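(* Let $0<\alpha<2$, $T>0$, and let $V:\mathbb{R}\to\mathbb{R}$ be smooth, bounded and $T$-periodic. Let $H=(-d^2/dx^2)^{\alpha/2}+V(x)$ act on $L^2_{\rm per}([0,T])$ with domain $H^\alpha_{\rm per}([0,T])$, and let $\lambda_1<\lambda_2\leq\lambda_3\leq\cdots\nearrow+\infty$ denote its eigenvalues. For each $n\in\mathbb{N}$, if $\phi_n\in H^{\alpha/2}_{\rm per}([0,T])\cap C^0([0,T])$ is a real eigenfunction of $H$ associated with the eigenvalue $\lambda_n$, then $\phi_n$ changes its sign at most $2(n-1)$ times in $[0,T)$.
   Context: $L^2_{\rm per}([0,T])$ is the space of locally square-integrable $T$-periodic functions on $\mathbb{R}$, and $H^s_{\rm per}([0,T])$ the corresponding periodic Sobolev space. The fractional Laplacian $(-d^2/dx^2)^{\alpha/2}$ acts on periodic functions as the Fourier multiplier with symbol $|\xi|^\alpha$ on Fourier frequencies $\xi\in\frac{2\pi}{T}\mathbb{Z}$. The spectrum of $H$ on $L^2_{\rm per}([0,T])$ consists of discrete eigenvalues of finite multiplicity accumulating only at $+\infty$; they are listed in increasing order and repeated according to multiplicity (an eigenfunction for a repeated eigenvalue is regarded as associated with its lowest index). For an integer $M\ge1$, $\phi$ changes its sign $M$ times in $[0,T)$ if there exist points $x_1<\dots<x_{M+1}$ in $[0,T)$ with $\phi(x_k)\ne0$ for all $k$ and $\operatorname{sgn}\phi(x_k)=-\operatorname{sgn}\phi(x_{k+1})$ for $k=1,\dots,M$; ''at most $M$ times'' means it does not change sign $M+1$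 times. *)

(* Defs.v *)
From HB Require Import structures.
From mathcomp Require Import all_boot all_order all_algebra.
From mathcomp Require Import all_classical all_reals all_analysis.
Set Implicit Arguments. Unset Strict Implicit. Unset Printing Implicit Defensive.
Import Order.TTheory GRing.Theory Num.Theory.
Import numFieldNormedType.Exports.
Local Open Scope classical_set_scope.
Local Open Scope ring_scope.

Section Defs.
Variable R : realType.
Notation mu := (@lebesgue_measure R).

(* A T-periodic function is identified with its restriction to [0,T]
   (values outside [0,T] are irrelevant for all notions below). *)

Definition per_int (T : R) : set R := `[0%R, T]%classic.

Definition L2per (T : R) (f : R -> R) : Prop :=
  measurable_fun (per_int T) f /\
  (\int[mu]_(x in per_int T) ((f x) ^+ 2)%:E < +oo)%E.

(* Fourier frequency xi_k = 2 pi k / T, k : nat (frequencies -k handled by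
   the real cos/sin coefficients). *)
Definition freq (T : R) (k : nat) : R := 2 * pi * k%:R / T.

Definition fcos (T : R) (f : R -> R) (k : nat) : R :=
  Rintegral mu (per_int T) (fun x => f x * cos (freq T k * x)).
Definition fsin (T : R) (f : R -> R) (k : nat) : R :=
  Rintegral mu (per_int T) (fun x => f x * sin (freq T k * x)).

Definition Hper (s T : R) (f : R -> R) : Prop :=
  L2per T f /\
  exists M : R, forall N : nat,
    \sum_(k < N) (1 + freq T k ^+ 2) `^ s * (fcos T f k ^+ 2 + fsin T f k ^+ 2)
      <= M.

(* f is an eigenfunction of H = (-d^2/dx^2)^(alpha/2) + V on L^2_per([0,T])
   with domain H^alpha_per, for the eigenvalue lam: f in the domain, f <> 0
   in L^2, and the Fourier coefficients of H f (the fractional Laplacian being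
   the Fourier multiplier |xi|^alpha) equal those of lam f. *)
Definition is_eigenfunction (alpha T : R) (V : R -> R) (lam : R)
    (f : R -> R) : Prop :=
  Hper alpha T f /\
  ~ {ae mu, forall x, per_int T x -> f x = 0} /\
  forall k : nat,
    `|freq T k| `^ alpha * fcos T f k + fcos T (fun x => V x * f x) k
      = lam * fcos T f k /\
    `|freq T k| `^ alpha * fsin T f k + fsin T (fun x => V x * f x) k
      = lam * fsin T f k.

Definition is_eigenvalue (alpha T : R) (V : R -> R) (lam : R) : Prop :=
  exists f, is_eigenfunction alpha T V lam f.

Definition indep_eigenfunctions (alpha T : R) (V : R -> R) (lam : R)
    (m : nat) : Prop :=
  exists fs : 'I_m -> R -> R,
    (forall i, is_eigenfunction alpha T V lam (fs i)) /\
    forall c : 'I_m -> R,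
      {ae mu, forall x, per_int T x -> \sum_(i < m) c i * fs i x = 0} ->
      forall i, c i = 0.

Definition eig_multiplicity (alpha T : R) (V : R -> R) (lam : R)
    (m : nat) : Prop :=
  indep_eigenfunctions alpha T V lam m /\
  ~ indep_eigenfunctions alpha T V lam m.+1.

Definition eigenvalue_enumeration (alpha T : R) (V : R -> R)
    (lam : nat -> R) : Prop :=
  (forall k, (1 <= k)%N -> lam k <= lam k.+1) /\
  (forall mu0, is_eigenvalue alpha T V mu0 <->
      exists2 k, (1 <= k)%N & lam k = mu0) /\
  (forall k, (1 <= k)%N -> exists m i,
      eig_multiplicity alpha T V (lam k) m /\
      forall j, (1 <= j)%N -> (lam j = lam k <-> (i <= j < i + m)%N)).

Definition changes_sign_times (T : R) (phi : R -> R) (M : nat) : Prop :=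
  exists x : nat -> R,
    (forall k, (k <= M)%N -> 0 <= x k /\ x k < T) /\
    (forall k, (k < M)%N -> x k < x k.+1) /\
    (forall k, (k <= M)%N -> phi (x k) != 0) /\
    (forall k, (k < M)%N -> Num.sg (phi (x k)) = - Num.sg (phi (x k.+1))).

Definition smooth (f : R -> R) : Prop :=
  forall (n : nat) (x : R), derivable (iter n (fun g : R -> R => derive1 g) f) x 1.

End Defs.

(* Main.v *)
Require Import Defs.
From HB Require Import structures.
From mathcomp Require Import all_boot all_order all_algebra.
From mathcomp Require Import all_classical all_reals all_analysis.
From mathcomp Require Import ring lra zify measurable_realfun.
Set Implicit Arguments. Unset Strict Implicit. Unset Printing Implicit Defensive.
Import Order.TTheory GRing.Theory Num.Theory.
Import numFieldNormedType.Exports.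
Local Open Scope classical_set_scope.
Local Open Scope ring_scope.

(** The operator [(-d^2/dx^2)^(alpha/2)] is replaced, on a grid of [N] points of the
    circle, by a Dirichlet-to-Neumann map: [m^(alpha/2)] is a limit of responses of
    finite ladders with positive conductances, so the discrete operator is the boundary
    response of a planar network.  Courant's argument applies in this network, and by
    planarity its nodal domains meet the circle in noncrossing sets; hence [2n]
    alternations of sign give at least [n+1] nodal domains.  A combination of [n] nodal
    pieces can be made orthogonal to the at most [n-1] eigenfunctions below [lam_n], while
    it vanishes on a further domain.  As [N] goes to infinity along an ultrafilter, these
    combinations tend to an eigenfunction for [lam_n] which is not zero but vanishes on
    an interval.  This contradicts unique continuation: on that interval all derivatives
    of the convolution with [|y|^(-1-alpha)] vanish, so all moments of the function
    against negative powers vanish. *)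

(** * Alternating noncrossing sequences *)

Section Noncrossing.
Local Open Scope nat_scope.

(** Courant's argument needs a local quadratic form: a function can be cut along its sign changes
    only if the energy sits on edges. On the circle alone the fractional Laplacian has no such form,
    so one dimension is added; as the network is finite, nodal domains are classes of vertices and
    planarity is pure combinatorics. Samples of eigenfunctions are not eigenvectors of the grid
    operator, so there is no discrete min-max principle to compare with. A rank-one penalty for each
    lower eigenfunction is added to the form instead, and one shows that the bottom of the penalized
    form has lower bounds tending to [lam_n]. Test functions orthogonal to the samples do not feel
    the penalty and become almost minimizers. The limit must be kept from vanishing: the largest
    coefficient of the combination is scaled to [1], so the limit agrees with the given
    eigenfunction on one interval and is zero on another. All limits are weak; regularity of the
    weak equation turns them into functions. The bound [n - 1] for the lower eigenfunctions comes
    from the enumeration. There the nodal bound for the lowest eigenvalue is used first, to show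
    that this eigenvalue is simple. *)

Definition label := (bool * nat)%type.

Definition between (b d x : nat) := minn b d < x < maxn b d.

(** Only classes of opposite colours are compared. Their points are distinct, so [between] is never
    evaluated at an end of the chord, and this is the property that the addition of a vertex
    preserves. *)
Definition noncrossing (N : nat) (l : 'I_N -> label) : Prop :=
  forall b d a c : 'I_N, l b = l d -> l a = l c -> (l a).1 != (l b).1 ->
    between b d a = between b d c.

Definition run_constant (N : nat) (l : 'I_N -> label) : Prop :=
  forall i : 'I_N, (l i).1 = (l (ordS i)).1 -> l i = l (ordS i).

(** The step from [i] to its successor passes no end of the chord; the wrap from [N - 1] to [0]
    stays outside every chord. *)
Lemma between_ordS (N : nat) (i : 'I_N) (b d : nat) :
  b < N -> d < N -> b != i -> d != i -> b != ordS i -> d != ordS i ->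
  between b d i = between b d (ordS i).
Proof.
move=> bN dN; rewrite /between /=; have iN := ltn_ord i.
have [E|iN'] := eqVneq i.+1 N; last by rewrite modn_small; lia.
have -> : i.+1 %% N = 0 by rewrite {1}E modnn.
lia.
Qed.

(** Separation of chords is a symmetric relation; with it [recolor_flip] deduces one of the two
    colour cases from the other. *)
Lemma between_sym (a b c d : nat) : a != b -> a != d -> c != b -> c != d ->
  between b d a = between b d c -> between a c b = between a c d.
Proof. rewrite /between; lia. Qed.

Section Recolor.
Variables (N : nat) (l : 'I_N -> label) (i : 'I_N) (col : bool).
Hypotheses (NCl : noncrossing l) (RCl : run_constant l).

(** The boundary vertex at [i] is replaced by one of colour [col], which joins the classes of those
    neighbours that have this colour. [hit] marks these classes; [target] is their common label,
    fresh if neither neighbour has colour [col]. *)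
Let hit (x : label) := (x.1 == col) && ((x == l (ord_pred i)) || (x == l (ordS i))).
Let target : label :=
  if (l (ord_pred i)).1 == col then l (ord_pred i)
  else if (l (ordS i)).1 == col then l (ordS i)
  else (col, (\max_(j < N) (l j).2).+1).
Let merge (x : label) := if hit x then target else x.
Let l' (j : 'I_N) := if j == i then target else merge (l j).

Let target_col : target.1 = col.
Proof. by rewrite /target; case: eqP => // _; case: eqP. Qed.

Let merge_col x : (merge x).1 = x.1.
Proof. by rewrite /merge /hit; case: (x.1 =P col) => //= e; case: ifP => // _; rewrite target_col e. Qed.

Let merge_other x : x.1 != col -> merge x = x.
Proof. by rewrite /merge /hit => /negbTE ->. Qed.

Let target_hit j : l j = target -> hit (l j).
Proof.
rewrite /hit => E; rewrite {1}E target_col eqxx /=; move: E; rewrite /target.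
case: ifP => [_ ->|_]; first by rewrite eqxx.
case: ifP => [_ ->|_ E]; first by rewrite eqxx orbT.
have : (l j).2 <= \max_(k < N) (l k).2 by apply: (@leq_bigmax 'I_N (fun k => (l k).2)).
by rewrite E /= ltnn.
Qed.

Let neq_of_col (x y : 'I_N) : (l x).1 != (l y).1 -> val x != val y.
Proof. by apply: contra => /eqP/val_inj ->. Qed.

(** A hit class contains a neighbour of [i]. The chord from [b] to [d] has the other colour, so it
    ends neither there nor at [i], and the neighbour lies on the side of [i]. *)
Let hit_between b d x : l b = l d -> (l b).1 != col -> b != i -> d != i ->
  hit (l x) -> between b d x = between b d i.
Proof.
move=> bd bc bi di /andP[/eqP xc /orP[]/eqP xe].
- rewrite (@NCl b d x (ord_pred i)) //; last by rewrite xc eq_sym.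
  have e := ord_predK i; have c1 : (l (ord_pred i)).1 = col by rewrite -xe.
  have := @between_ordS N (ord_pred i) b d (ltn_ord b) (ltn_ord d); rewrite e.
  by apply=> //; apply: neq_of_col; rewrite ?c1 -?bd.
- rewrite (@NCl b d x (ordS i)) //; last by rewrite xc eq_sym.
  have c1 : (l (ordS i)).1 = col by rewrite -xe.
  apply/esym/between_ordS => //; apply: neq_of_col; rewrite ?c1 -?bd //.
Qed.

Let l'_col j : j != i -> (l' j).1 = (l j).1.
Proof. by rewrite /l' => /negbTE ->; rewrite merge_col. Qed.

Let l'_i : l' i = target. Proof. by rewrite /l' eqxx. Qed.

Let NC_half b d a c : l' b = l' d -> l' a = l' c -> (l' b).1 != col ->
  (l' a).1 = col -> between b d a = between b d c.
Proof.
move=> bd ac bcol acol.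
have bi : b != i by apply: contra bcol => /eqP->; rewrite l'_i target_col.
have di : d != i by apply: contra bcol => /eqP E; rewrite bd E l'_i target_col.
have lb : (l b).1 != col by rewrite -l'_col.
have ld : (l d).1 != col by rewrite -l'_col // -bd.
have lbd : l b = l d.
  by move: bd; rewrite /l' (negbTE bi) (negbTE di) !merge_other.
(* The points that now carry [target]: all of them lie on the side of [i], and no other point has
   this label. *)
pose special x := (x == i) || hit (l x).
have sp x : special x -> between b d x = between b d i.
  by move=> /orP[/eqP->//|]; apply: hit_between.
have sp_t x : special x -> l' x = target.
  by rewrite /special /l' /merge; case: ifP => //= _ ->.
have nsp x : ~~ special x -> l' x = l x.
  by rewrite /special negb_or /l' /merge => /andP[/negbTE-> /negbTE->].
have mixed x y : special x -> ~~ special y -> l' x = l' y -> False.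
  move=> sx sy; rewrite (sp_t _ sx) (nsp _ sy) => /esym/target_hit h.
  by move: sy; rewrite /special h orbT.
case sa : (special a); case sc : (special c).
- by rewrite !sp.
- by case: (mixed a c) => //; rewrite sc.
- by case: (mixed c a) => //; rewrite sa.
- have ea : l' a = l a by rewrite nsp ?sa.
  have ec : l' c = l c by rewrite nsp ?sc.
  apply: NCl => //; first by rewrite -ea -ec.
  by rewrite -ea acol eq_sym.
Qed.

(** The merging is expressed by a map [m] on labels, so that it can be applied to the layers already
    built as well. *)
Lemma recolor_flip : exists (m : label -> label) (l2 : 'I_N -> label),
  [/\ forall x, (m x).1 = x.1, forall j, j != i -> l2 j = m (l j),
      (l2 i).1 = col, noncrossing l2 & run_constant l2].
Proof.
exists merge, l'; split=> //.
- by move=> j /negbTE ji; rewrite /l' ji.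
- by rewrite l'_i target_col.
- move=> b d a c bd ac acol.
  have [bc|bc] := eqVneq (l' b).1 col; last first.
    have ac' : (l' a).1 = col by move: acol bc; case: (l' a).1 (l' b).1 col => [][][].
    exact: NC_half bd ac bc ac'.
  have ne (x y : 'I_N) : (l' x).1 != (l' y).1 -> val x != val y.
    by apply: contra => /eqP/val_inj ->.
  have ac1 : (l' a).1 != col by rewrite -bc.
  have := NC_half ac bd ac1 bc.
  by apply: between_sym; apply: ne; rewrite ?bc -?bd -?ac ?bc // eq_sym.
- move=> j; have [->|ji] := eqVneq j i.
    have [->//|si] := eqVneq (ordS i) i.
    rewrite (l'_col si) l'_i target_col => e.
    by rewrite /l' (negbTE si) /merge /hit -e eqxx /= eqxx orbT.
  have [sj|sj] := eqVneq (ordS j) i.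
    rewrite (l'_col ji) sj l'_i target_col => e.
    have pj : ord_pred i = j by rewrite -sj ordSK.
    by rewrite /l' (negbTE ji) /merge /hit e pj !eqxx.
  rewrite !l'_col // => e.
  by rewrite /l' (negbTE ji) (negbTE sj) (RCl e).
Qed.

End Recolor.

(** If the colour does not change, the new vertex continues the class of the old one along the edge
    between them; otherwise this edge is bichromatic and imposes nothing. *)
Lemma recolor (N : nat) (l : 'I_N -> label) (i : 'I_N) (col : bool) :
  noncrossing l -> run_constant l ->
  exists (m : label -> label) (l2 : 'I_N -> label),
  [/\ forall x, (m x).1 = x.1, forall j, j != i -> l2 j = m (l j),
      (l2 i).1 = col /\ ((l i).1 = col -> l2 i = m (l i)),
      noncrossing l2 & run_constant l2].
Proof.
move=> NCl RCl; have [e|ne] := eqVneq (l i).1 col.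
  by exists id, l; split.
have [m [l2 [h1 h2 h3 h4 h5]]] := recolor_flip i col NCl RCl.
by exists m, l2; split=> //; split=> // e; rewrite e eqxx in ne.
Qed.

(** A merge at one position renames labels given at earlier positions, so the renamings are composed
    along the sweep. *)
Lemma recolor_layer (N : nat) (l : 'I_N -> label) (col : 'I_N -> bool) :
  noncrossing l -> run_constant l ->
  exists (m : label -> label) (l2 : 'I_N -> label),
  [/\ forall x, (m x).1 = x.1, forall j, (l2 j).1 = col j,
      forall j, (l j).1 = col j -> l2 j = m (l j), noncrossing l2 & run_constant l2].
Proof.
move=> NCl RCl.
suff /(_ N (leqnn N)) [m [l2 [h0 h1 h2 h3 h4]]] : forall t, t <= N ->
    exists (m : label -> label) (l2 : 'I_N -> label),
    [/\ forall x, (m x).1 = x.1,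
        forall j : 'I_N, j < t -> (l2 j).1 = col j /\ ((l j).1 = col j -> l2 j = m (l j)),
        forall j : 'I_N, t <= j -> l2 j = m (l j), noncrossing l2 & run_constant l2].
  by exists m, l2; split=> // j; have [] := h1 j (ltn_ord j).
elim=> [_|t IH tN]; first by exists id, l; split.
have [m [l2 [h0 h1 h2 h3 h4]]] := IH (ltnW tN).
pose i := Ordinal tN.
have [m' [l3 [g0 g1 [g2 g3] g4 g5]]] := recolor i (col i) h3 h4.
exists (m' \o m), l3; split=> //.
- by move=> x /=; rewrite g0 h0.
- move=> j; rewrite ltnS leq_eqVlt => /orP[/eqP jt|jt].
    have -> : j = i by apply: val_inj.
    split=> // e; have ei : l2 i = m (l i) by apply: h2.
    by rewrite /= -ei g3 // ei h0.
  have ji : j != i by apply/eqP => e; rewrite e /= ltnn in jt.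
  have [c1 c2] := h1 j jt; split; first by rewrite g1 // g0.
  by move=> e; rewrite g1 //= c2.
- move=> j tj; have ji : j != i by apply/eqP => e; rewrite e /= ltnn in tj.
  by rewrite g1 // h2 // ltnW.
Qed.

(* Layers are added one vertex at a time, so the boundary of the coloured region
   is always a closed curve met by the monochromatic components without crossings. *)
Lemma planar_labelling (N M : nat) (col : nat -> 'I_N -> bool) :
  exists L : nat -> 'I_N -> label,
  [/\ forall y i, y <= M -> (L y i).1 = col y i,
      forall y i, y < M -> col y i = col y.+1 i -> L y i = L y.+1 i,
      forall y i, y <= M -> col y i = col y (ordS i) -> L y i = L y (ordS i)
    & noncrossing (L 0)].
Proof.
elim: M col => [|M IH] col.
  (* The deepest layer is glued to a fictitious one of colour [false]. This may join more vertices
     than the network does, which is harmless: labels have to be constant along monochromatic edges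
     and noncrossing, no more. *)
  have NC0 : @noncrossing N (fun=> (false, 0)) by move=> *.
  have RC0 : @run_constant N (fun=> (false, 0)) by move=> *.
  have [m [l2 [_ h1 h2 h3 h4]]] := recolor_layer (col 0) NC0 RC0.
  exists (fun=> l2); split=> //.
  - by move=> y i; rewrite leqn0 => /eqP ->.
  - by move=> y i; rewrite leqn0 => /eqP -> e; apply: h4; rewrite !h1.
have [L [h1 h2 h3 h4]] := IH (fun y => col y.+1).
have RC0 : run_constant (L 0) by move=> i e; apply: h3 => //; rewrite -!h1.
have [m [l2 [g0 g1 g2 g3 g4]]] := recolor_layer (col 0) h4 RC0.
exists (fun y => if y is y'.+1 then (fun i => m (L y' i)) else l2); split=> //.
- by case=> [|y] i //= yM; rewrite g0 h1.
- move=> [|y] i yM e; last by rewrite (h2 y i).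
  by rewrite g2 // h1.
- move=> [|y] i yM e; last by rewrite (h3 y i).
  by apply: g4; rewrite !g1.
Qed.

Definition alternating (s : seq label) :=
  forall i, i.+1 < size s -> (nth (false, 0) s i).1 != (nth (false, 0) s i.+1).1.

Definition seq_noncrossing (s : seq label) := forall a b c d, a < b < c -> c < d < size s ->
  nth (false, 0) s a = nth (false, 0) s c -> nth (false, 0) s b = nth (false, 0) s d ->
  (nth (false, 0) s a).1 = (nth (false, 0) s b).1.

(** Take two equal labels at positions [i < j] with the least gap. The label at [i + 1] cannot recur
    before [j], by minimality, nor outside, since it would cross the pair [i], [j] in the other
    colour. *)
Lemma exists_isolated (s : seq label) : alternating s -> seq_noncrossing s -> ~~ uniq s ->
  exists2 i, i.+1 < size s & forall k, k < size s -> nth (false, 0) s k = nth (false, 0) s i.+1 -> k = i.+1.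
Proof.
move=> As NCs; set x0 : label := (false, 0) => nu.
have ex : exists g, [exists i : 'I_(size s), exists j : 'I_(size s),
    (i + g == j) && (0 < g) && (nth x0 s i == nth x0 s j)].
  case/(uniqPn x0): nu => i [j [ij js e]].
  exists (j - i); apply/existsP; exists (Ordinal (ltn_trans ij js)).
  apply/existsP; exists (Ordinal js); rewrite /= e eqxx andbT; lia.
case: (ex_minnP ex) => g /existsP[i /existsP[j /andP[/andP[/eqP ij g0] /eqP e]]] gmin.
have js := ltn_ord j.
have min' a b : a < b -> b < size s -> nth x0 s a = nth x0 s b -> g <= b - a.
  move=> ab bs eab; apply: gmin; apply/existsP; exists (Ordinal (ltn_trans ab bs)).
  apply/existsP; exists (Ordinal bs); rewrite /= eab eqxx andbT; lia.
have is1 : i.+1 < size s by lia.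
have ci := As i is1; rewrite -/x0 in ci.
exists (nat_of_ord i) => // k ks ek.
have [//|kn] := eqVneq k i.+1.
have ki : k <> i by move=> E; rewrite -ek E eqxx in ci.
have kj : k <> j by move=> E; rewrite -ek E -e eqxx in ci.
have sj : i.+1 <> j by move=> E; rewrite e -E eqxx in ci.
have [k1|k1] := ltnP k i.
  have := NCs k i i.+1 j; rewrite ek -/x0 => h.
  by case/eqP: ci; apply/esym/h => //; lia.
have [k2|k2] := ltnP j k.
  have := NCs i i.+1 j k; rewrite -/x0 => h.
  by case/eqP: ci; apply/h => //; lia.
have : g <= k - i.+1 by apply: min' => //; lia.
lia.
Qed.

Lemma half_lt (m : nat) : 0 < m -> m./2 < m.
Proof. lia. Qed.

Lemma half_key (m m' u u' : nat) : m' = m.-2 -> u' < u -> m'./2 < u' -> m./2 < u.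
Proof. lia. Qed.

(** Induction on the length: an isolated entry is deleted together with its left neighbour. This
    costs two entries and at least one class, and the remaining sequence is of the same kind. *)
Lemma count_classes (s : seq label) : alternating s -> seq_noncrossing s -> 0 < size s ->
  (size s)./2 < size (undup s).
Proof.
elim: {s}(size s) {-2}s (leqnn (size s)) => [s|n IH s sn As NCs s0]; first by case: s.
have [us|nus] := boolP (uniq s); first by rewrite undup_id //; apply: half_lt.
have [i is1 iso] := exists_isolated As NCs nus.
set x0 : label := (false, 0) in iso.
pose s' := take i s ++ drop i.+2 s.
have ss' : size s' = (size s).-2 by rewrite size_cat size_take size_drop; case: ifP; lia.
have nth_s' k : nth x0 s' k = nth x0 s (if k < i then k else k.+2).
  have is0 : i < size s by lia.
  rewrite nth_cat size_take is0 /=.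
  by case: ifP => ki; [rewrite nth_take|rewrite nth_drop; congr nth; lia].
have uniqx x : x \in s' -> x \in s.
  by rewrite mem_cat => /orP[/mem_take|/mem_drop].
have iin : nth x0 s i.+1 \notin s'.
  apply/negP => /(nthP x0)[k ks]; rewrite nth_s' => /iso.
  rewrite ss' in ks; case: ifP => ki h; have := h; lia.
have key : size (undup s') < size (undup s).
  have -> : (size (undup s')).+1 = size (nth x0 s i.+1 :: undup s') by [].
  apply: uniq_leq_size; first by rewrite /= mem_undup iin undup_uniq.
  move=> x; rewrite inE => /orP[/eqP ->|]; first by rewrite mem_undup mem_nth.
  by rewrite !mem_undup => /uniqx.
(* If nothing is left, there were two entries of different colours, hence two classes. *)
have [s'0|s'0] := posnP (size s').
  have : nth x0 s i.+1 \in undup s by rewrite mem_undup mem_nth.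
  have : nth x0 s i \in undup s by rewrite mem_undup mem_nth // ltnW.
  have := As i is1; rewrite -/x0.
  have -> : size s = 2 by move: s'0 is1; rewrite ss'; case: (size s) => [|[|[|]]].
  case: (undup s) => [|a [|b t]] //=.
  by rewrite !inE => h /eqP e1 /eqP e2; rewrite e1 e2 eqxx in h.
suff : (size s')./2 < size (undup s') by apply: half_key key; rewrite ss'.
apply: IH => //; first by lia.
- move=> k; rewrite ss' -/x0 !nth_s' => ks.
  case: ifP => k1; case: ifP => k2; last by apply: As; lia.
  + by apply: As; lia.
  (* The junction of the two remaining parts: three colour changes in a row amount to one. *)
  + have -> : k.+3 = i.+2 by lia.
    have -> : k = i.-1 by lia.
    have h1 := As i.-1; have h2 := As i is1; have h3 := As i.+1.
    rewrite -/x0 in h1 h2 h3.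
    have e : i.-1.+1 = i by lia.
    rewrite e in h1; move: (h1 ltac:(lia)) h2 (h3 ltac:(lia)).
    by case: (nth _ _ _).1; case: (nth _ _ _).1; case: (nth _ _ _).1; case: (nth _ _ _).1.
  + lia.
- move=> a b c d; rewrite ss' -/x0 !nth_s' => abc cd; apply: NCs; move: abc cd;
  by do !case: ifP; lia.
Qed.

Lemma seq_noncrossing_map (N : nat) (l : 'I_N -> label) (m : nat) (p : 'I_m -> 'I_N) :
  noncrossing l -> (forall i j : 'I_m, i < j -> p i < p j) ->
  seq_noncrossing [seq l (p i) | i <- enum 'I_m].
Proof.
move=> NC pmon a b c d abc; rewrite size_map size_enum_ord => cd.
have am : a < m by lia. have bm : b < m by lia.
have cm : c < m by lia. have dm : d < m by lia.
have nthE k (km : k < m) : nth (false, 0) [seq l (p i) | i <- enum 'I_m] k = l (p (Ordinal km)).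
  rewrite (nth_map (Ordinal km)) ?size_enum_ord //; congr (l (p _)).
  by apply: val_inj; rewrite /= nth_enum_ord.
rewrite (nthE _ am) (nthE _ bm) (nthE _ cm) (nthE _ dm) => eac ebd.
apply/eqP; apply: contraT => h.
have := NC _ _ _ _ ebd eac h.
have := pmon (Ordinal am) (Ordinal bm) ltac:(move=> /=; lia).
have := pmon (Ordinal bm) (Ordinal cm) ltac:(move=> /=; lia).
have := pmon (Ordinal cm) (Ordinal dm) ltac:(move=> /=; lia).
rewrite /between; lia.
Qed.

Lemma many_classes (N n : nat) (l : 'I_N -> label) (p : 'I_(n.*2) -> 'I_N) :
  0 < n -> noncrossing l -> (forall i j : 'I_(n.*2), i < j -> p i < p j) ->
  (forall i j : 'I_(n.*2), j = i.+1 :> nat -> (l (p i)).1 != (l (p j)).1) ->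
  exists r : 'I_n.+1 -> 'I_(n.*2), injective (fun j => l (p (r j))).
Proof.
move=> n0 NC pmon alt; set s := [seq l (p i) | i <- enum 'I_(n.*2)].
have ss : size s = n.*2 by rewrite size_map size_enum_ord.
have As : alternating s.
  move=> i; rewrite ss => i1.
  have nthE k (km : k < n.*2) : nth (false, 0) s k = l (p (Ordinal km)).
    rewrite (nth_map (Ordinal km)) ?size_enum_ord //; congr (l (p _)).
    by apply: val_inj; rewrite /= nth_enum_ord.
  by rewrite (nthE _ (ltnW i1)) (nthE _ i1); apply: alt.
have := count_classes As (seq_noncrossing_map NC pmon).
rewrite ss doubleK => /(_ ltac:(lia)) cnt.
have mem j : nth (false, 0) (undup s) j \in s \/ size (undup s) <= j.
  by case: (ltnP j (size (undup s))) => h; [left; rewrite -mem_undup mem_nth|right].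
have ex (j : 'I_n.+1) : exists i : 'I_(n.*2), l (p i) == nth (false, 0) (undup s) j.
  have := ltn_ord j; case: (mem j) => [/mapP[i _ e]|]; last by lia.
  by exists i; rewrite e.
exists (fun j => xchoose (ex j)) => j k /=.
rewrite (eqP (xchooseP (ex j))) (eqP (xchooseP (ex k))) => /eqP.
have := ltn_ord j; have := ltn_ord k => kn jn.
by rewrite nth_uniq ?undup_uniq //; [move=> /eqP/val_inj|lia|lia].
Qed.

End Noncrossing.

(** * Powers as responses of finite ladders *)

Section Chain.
Variable R : realType.
Implicit Types (l : seq (R * R)) (a m : R).

(* Boundary response of a ladder at the Laplacian eigenvalue [m]: each rung [(p.1, p.2)] has
   conductance [p.1] inside its layer and [p.2] towards the next; [a] belongs to the last layer. *)
Fixpoint response l a m : R :=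
  if l is p :: l' then p.1 * m + p.2 * response l' a m / (p.2 + response l' a m)
  else a * m.

Fixpoint positive_chain l a : Prop :=
  if l is p :: l' then [/\ 0 <= p.1, 0 < p.2 & positive_chain l' a] else 0 <= a.

Definition scale_chain (k : R) l := [seq (k * p.1, k * p.2) | p <- l].

Lemma positive_scale_chain k l a : 0 < k -> positive_chain l a ->
  positive_chain (scale_chain k l) (k * a).
Proof.
move=> k0; elim: l => [|p l IH] /=; first by move=> a0; rewrite mulr_ge0 // ltW.
by case=> p1 p2 pl; split; [rewrite mulr_ge0 // ltW|rewrite mulr_gt0|exact: IH].
Qed.

Lemma response_ge0 l a m : positive_chain l a -> 0 <= m -> 0 <= response l a m.
Proof.
move=> + m0; elim: l => [|p l IH] /=; first by move=> a0; rewrite mulr_ge0.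
case=> p1 p2 /IH r0; rewrite addr_ge0 ?mulr_ge0 // ?ltW // invr_gt0; lra.
Qed.

Lemma response_scale k l a m : 0 < k -> positive_chain l a -> 0 <= m ->
  response (scale_chain k l) (k * a) m = k * response l a m.
Proof.
move=> k0 + m0; elim: l => [|p l IH] /=; first by rewrite mulrA.
case=> p1 p2 pl; rewrite IH //; have r0 := response_ge0 pl m0.
field; apply/andP; split; first by rewrite gt_eqF //; lra.
by rewrite -mulrDr mulf_neq0 // gt_eqF //; lra.
Qed.

(** The conductance of [b] and [x] connected in series, that is, the parallel sum of the two
    numbers. *)
Definition parallel (b x : R) := b * x / (b + x).

(** The parallel sum is increasing and nonexpansive in [x], so a change deep in a ladder is not
    amplified on its way to the boundary. *)
Lemma parallel_lip b x y : 0 < b -> 0 <= x -> x <= y ->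
  0 <= parallel b y - parallel b x <= y - x.
Proof.
move=> b0 x0 xy; rewrite /parallel.
have -> : b * y / (b + y) - b * x / (b + x) = (y - x) * (b / (b + y) * (b / (b + x))).
  by field; rewrite !gt_eqF //; lra.
have h z : 0 <= z -> 0 <= b / (b + z) <= 1.
  move=> z0; rewrite divr_ge0 ?ler_pdivrMr /=; lra.
have /andP[h1 h2] := h x x0; have /andP[h3 h4] := h y (le_trans x0 xy).
have /andP[p1 p2] : 0 <= b / (b + y) * (b / (b + x)) <= 1.
  by rewrite mulr_ge0 // mulr_ile1.
by rewrite mulr_ge0 ?subr_ge0 // ler_piMr // subr_ge0.
Qed.

Lemma parallel_le b x : 0 < b -> 0 <= x -> parallel b x <= x /\ parallel b x <= b.
Proof.
move=> b0 x0; rewrite /parallel !ler_pdivrMr; try lra.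
by split; nra.
Qed.

Lemma parallel_defect b x : 0 < b -> 0 <= x -> x - parallel b x = x ^+ 2 / (b + x).
Proof. by move=> b0 x0; rewrite /parallel; field; rewrite gt_eqF //; lra. Qed.

Lemma parallel_ge0 b x : 0 < b -> 0 <= x -> 0 <= parallel b x.
Proof. by move=> b0 x0; rewrite /parallel divr_ge0 ?mulr_ge0 ?addr_ge0 // ltW. Qed.

Lemma response0 l a : response l a 0 = 0.
Proof. by elim: l => [|p l IH] /=; rewrite ?IH !(mulr0, mul0r, addr0). Qed.

Lemma response_mono l a m m' : positive_chain l a -> 0 <= m -> m <= m' ->
  response l a m <= response l a m'.
Proof.
move=> + m0 mm; elim: l => [|p l IH] /=; first by move=> a0; rewrite ler_wpM2l.
case=> p1 p2 pl; apply: lerD; first by rewrite ler_wpM2l.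
have /andP[+ _] := parallel_lip p2 (response_ge0 pl m0) (IH pl).
by rewrite subr_ge0.
Qed.

(** * Self-similar ladders *)

Section Geometric.
Variables (s t g : R).
Hypotheses (t0 : 0 < t) (t1 : t < 1) (s1 : 1 < s) (stg : s = t * g).

(** Conductances within the layers grow by [s > 1], those of the links decay by [t < 1]; the weak
    links make the far end of a long ladder negligible. *)
Fixpoint geom (A B : R) (n : nat) : seq (R * R) :=
  if n is n'.+1 then (A, B) :: geom (A * s) (B * t) n' else [::].

Definition gresp A B n m := response (geom A B n) (A * s ^+ n) m.

Lemma gresp0 A B m : gresp A B 0 m = A * m.
Proof. by rewrite /gresp /= expr0 mulr1. Qed.

Lemma grespS A B n m :
  gresp A B n.+1 m = A * m + parallel B (gresp (A * s) (B * t) n m).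
Proof. by rewrite /gresp /= exprS mulrA. Qed.

Lemma s_gt0 : 0 < s. Proof. by apply: lt_trans s1. Qed.

Lemma geom_positive A B n : 0 < A -> 0 < B -> positive_chain (geom A B n) (A * s ^+ n).
Proof.
elim: n A B => [|n IH] A B A0 B0 /=; first by rewrite expr0 mulr1 ltW.
by split; rewrite ?ltW // exprS mulrA; apply: IH; rewrite mulr_gt0 // s_gt0.
Qed.

Lemma gresp_ge0 A B n m : 0 < A -> 0 < B -> 0 <= m -> 0 <= gresp A B n m.
Proof. by move=> A0 B0 m0; apply: response_ge0 => //; apply: geom_positive. Qed.

(** Since [s = t * g], moving one rung into the ladder amounts to multiplying all conductances by
    [t] and [m] by [g]. *)
Lemma gresp_shift A B n m : 0 < A -> 0 < B -> 0 <= m ->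
  gresp (A * s) (B * t) n m = t * gresp A B n (g * m).
Proof.
have t0_ := t0; have t1_ := t1; have s1_ := s1.
have g0 : 0 < g by rewrite -(pmulr_rgt0 g t0) -stg s_gt0.
move=> + + m0; elim: n A B => [|n IH] A B A0 B0; first by rewrite !gresp0 stg; ring.
have As0 : 0 < A * s by rewrite mulr_gt0 // s_gt0.
have Bt0 : 0 < B * t by rewrite mulr_gt0.
rewrite !grespS IH // /parallel.
have := @gresp_ge0 (A * s) (B * t) n (g * m) As0 Bt0 (mulr_ge0 (ltW g0) m0).
move: (gresp _ _ _ _) => x x0; rewrite stg; field.
by rewrite !gt_eqF //; nra.
Qed.

(** The two ladders differ only at the far end, where the additional link lets through at most its
    conductance [B * t ^+ n]; [parallel_lip] carries this to the boundary. *)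
Lemma gresp_succ A B n m : 0 < A -> 0 < B -> 0 <= m ->
  0 <= gresp A B n.+1 m - gresp A B n m <= B * t ^+ n.
Proof.
have t0_ := t0; have t1_ := t1; have s1_ := s1.
move=> + + m0; elim: n A B => [|n IH] A B A0 B0; have As0 : 0 < A * s by rewrite mulr_gt0 // s_gt0.
  rewrite grespS !gresp0 expr0 mulr1 addrC addKr.
  have h : 0 <= A * s * m by rewrite mulr_ge0 // ltW.
  by have [_ ->] := parallel_le B0 h; rewrite parallel_ge0.
have Bt0 : 0 < B * t by rewrite mulr_gt0.
have /andP[h1 h2] := IH _ _ As0 Bt0.
rewrite grespS [gresp A B n.+1 m]grespS.
have := @parallel_lip B (gresp (A * s) (B * t) n m) (gresp (A * s) (B * t) n.+1 m) B0.
rewrite gresp_ge0 // => /(_ isT); rewrite -subr_ge0 => /(_ h1) /andP[h3 h4].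
by apply/andP; split; [lra|rewrite exprS mulrA; lra].
Qed.

(** Short-circuiting the first [n] links can only raise the response; the conductances within these
    layers then add up to a geometric sum. *)
Lemma gresp_upper A B n k m : 0 < A -> 0 < B -> 0 <= m ->
  gresp A B (n + k) m <= m * A * (s ^+ n - 1) / (s - 1) + gresp (A * s ^+ n) (B * t ^+ n) k m.
Proof.
have t0_ := t0; have t1_ := t1; have s1_ := s1.
move=> + + m0; elim: n A B => [|n IH] A B A0 B0.
  by rewrite !expr0 subrr mulr0 mul0r add0r !mulr1.
have As0 : 0 < A * s by rewrite mulr_gt0 // s_gt0.
have Bt0 : 0 < B * t by rewrite mulr_gt0.
rewrite addSn grespS !exprS !mulrA.
have [h _] := parallel_le B0 (gresp_ge0 (n + k) As0 Bt0 m0).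
have := IH _ _ As0 Bt0.
have -> : m * (A * s) * (s ^+ n - 1) / (s - 1) = m * A * (s * s ^+ n - 1) / (s - 1) - A * m.
  by field; rewrite subr_eq0 gt_eqF.
lra.
Qed.

Lemma gresp_gt0 A B n m : 0 < A -> 0 < B -> 0 < m -> 0 < gresp A B n m.
Proof.
move=> A0 B0 m0; case: n => [|n]; first by rewrite gresp0 mulr_gt0.
have As0 : 0 < A * s by rewrite mulr_gt0 // s_gt0.
have Bt0 : 0 < B * t by rewrite mulr_gt0.
rewrite grespS ltr_pwDl ?mulr_gt0 //.
by rewrite parallel_ge0 // gresp_ge0 // ltW.
Qed.

(** Deleting the conductances within the first [n] layers can only lower the response; the
    resistances of the links then add up in series. *)
Lemma gresp_lower A B n k m : 0 < A -> 0 < B -> 0 < m ->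
  (gresp A B (n + k) m)^-1 <=
  B^-1 * (t^-1 ^+ n - 1) / (t^-1 - 1) + (gresp (A * s ^+ n) (B * t ^+ n) k m)^-1.
Proof.
have t0_ := t0; have t1_ := t1; have s1_ := s1.
move=> + + m0; elim: n A B => [|n IH] A B A0 B0.
  by rewrite !expr0 subrr mulr0 mul0r add0r !mulr1.
have As0 : 0 < A * s by rewrite mulr_gt0 // s_gt0.
have Bt0 : 0 < B * t by rewrite mulr_gt0.
rewrite addSn grespS !exprS ![_ * (_ * _)]mulrA.
have x0 := gresp_gt0 (n + k) As0 Bt0 m0.
have := IH _ _ As0 Bt0; move: (gresp _ _ (n + k) m) x0 => x x0 IHx.
have h1 : (A * m + parallel B x)^-1 <= B^-1 + x^-1.
  have -> : B^-1 + x^-1 = (parallel B x)^-1 by rewrite /parallel; field; rewrite !gt_eqF //; lra.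
  have px : 0 < parallel B x by rewrite /parallel divr_gt0 ?mulr_gt0 //; lra.
  have Am := mulr_gt0 A0 m0.
  by rewrite lef_pV2 ?posrE //; lra.
have ti : 1 < t^-1 by rewrite invf_gt1.
have -> : B^-1 * (t^-1 * t^-1 ^+ n - 1) / (t^-1 - 1) =
  B^-1 + (B * t)^-1 * (t^-1 ^+ n - 1) / (t^-1 - 1).
  rewrite invfM; field; rewrite mulN1r subr_eq0 !gt_eqF //.
lra.
Qed.

(** A cut-off, at the scales from [-K] to [K], of a ladder infinite in both directions, for which
    multiplying [m] by [g] would multiply the response by [t^-1] exactly. The middle rung has
    conductances [1], whence bounds uniform in [K]. *)
Definition F K m := gresp (s ^- K) (t ^- K) (K + K) m.

Lemma sK_gt0 K : 0 < s ^- K. Proof. by rewrite invr_gt0 exprn_gt0 // s_gt0. Qed.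
Lemma tK_gt0 K : 0 < t ^- K. Proof. by rewrite invr_gt0 exprn_gt0. Qed.

Lemma gresp11_le K m : 0 <= m -> gresp 1 1 K m <= m + 1.
Proof.
have t0_ := t0; have t1_ := t1; have s1_ := s1.
move=> m0; case: K => [|K]; first by rewrite gresp0; lra.
rewrite grespS; have [] := @parallel_le 1 (gresp (1 * s) (1 * t) K m) ltr01; last by lra.
by apply: gresp_ge0; rewrite // mul1r // s_gt0.
Qed.

Lemma F_ge0 K m : 0 <= m -> 0 <= F K m.
Proof. by move=> m0; apply: gresp_ge0; rewrite ?sK_gt0 ?tK_gt0. Qed.

Lemma F_upper K m : 0 <= m -> F K m <= m / (s - 1) + (m + 1).
Proof.
have t0_ := t0; have t1_ := t1; have s1_ := s1.
move=> m0; apply: le_trans (gresp_upper _ _ (sK_gt0 K) (tK_gt0 K) m0) _.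
rewrite !mulVf ?expf_neq0 ?gt_eqF // ?s_gt0 //.
apply: lerD; last exact: gresp11_le.
rewrite -!mulrA ler_wpM2l // mulrA -[leRHS]mul1r ler_wpM2r ?invr_ge0 //; first by lra.
rewrite mulrBr mulVf ?expf_neq0 ?gt_eqF // ?s_gt0 //.
by have := sK_gt0 K; rewrite mulr1; lra.
Qed.

Lemma F_lower K m : 0 < m -> (t^-1 / (t^-1 - 1) + m^-1)^-1 <= F K m.
Proof.
have t0_ := t0; have t1_ := t1; have s1_ := s1.
move=> m0; have ti : 1 < t^-1 by rewrite invf_gt1.
have Fp : 0 < F K m by apply: gresp_gt0; rewrite ?sK_gt0 ?tK_gt0.
have := gresp_lower K K (sK_gt0 K) (tK_gt0 K) m0; rewrite -/(F K m).
rewrite !mulVf ?expf_neq0 ?gt_eqF // ?s_gt0 // => h.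
rewrite -[leRHS]invrK lef_pV2 ?posrE ?invr_gt0 //; last first.
  by rewrite addr_gt0 ?invr_gt0 // divr_gt0 //; lra.
apply: le_trans h _; apply: lerD.
  rewrite ler_wpM2r ?invr_ge0 //; first by lra.
  rewrite invrK mulrBr exprVn mulfV ?expf_neq0 ?gt_eqF // mulr1.
  by have : 0 <= t ^+ K := exprn_ge0 _ (ltW t0); lra.
case: K {Fp} => [|K]; first by rewrite gresp0 mul1r.
have t0' : 0 < 1 * t by rewrite mul1r.
have s0' : 0 < 1 * s by rewrite mul1r s_gt0.
rewrite lef_pV2 ?posrE ?gresp_gt0 // grespS mul1r.
have := gresp_gt0 K s0' t0' m0; move: (gresp _ _ _ _) => x x0.
by have : 0 <= parallel 1 x; [rewrite parallel_ge0 // ltW|lra].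
Qed.

Lemma F_mono K m m' : 0 <= m -> m <= m' -> F K m <= F K m'.
Proof. by move=> m0 mm; apply: response_mono => //; apply: geom_positive; rewrite ?sK_gt0 ?tK_gt0. Qed.

Lemma cvg_expr0 (x c : R) : 0 <= x -> x < 1 -> c * x ^+ K @[K --> \oo] --> 0.
Proof.
move=> x0 x1; rewrite -[X in _ --> X](mulr0 c); apply: cvgMl_tmp.
by apply: cvg_expr; rewrite ger0_norm.
Qed.

(** [t * F K (g * m)] is the response of the ladder shifted by one rung. It differs from [F K m] at
    the near end by the first rung, an error of orders [s ^- K] and [t ^+ K], and at the far end by
    at most [t ^+ K], by [gresp_succ]. *)
Lemma F_scaling m : 0 < m -> F K (g * m) - t^-1 * F K m @[K --> \oo] --> 0.
Proof.
have t0_ := t0; have t1_ := t1; have s1_ := s1.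
move=> m0; have g0 : 0 < g by rewrite -(pmulr_rgt0 g t0) -stg s_gt0.
have gm0 : 0 < g * m by rewrite mulr_gt0.
pose C := g * m / (s - 1) + (g * m + 1).
have C0 : 0 <= C by apply: le_trans (F_ge0 0 (ltW gm0)) (F_upper 0 (ltW gm0)).
have si : 0 <= s^-1 < 1 by rewrite invr_ge0 ltW ?s_gt0 //= invf_lt1 // s_gt0.
pose e K := t^-1 * (m * s^-1 ^+ K) + (t^-1 * (1 + (t * C) ^+ 2)) * t ^+ K.
have e0 : e K @[K --> \oo] --> 0.
  rewrite -[X in _ --> X]addr0; apply: cvgD; last by apply: cvg_expr0; rewrite ?ltW.
  under eq_fun do rewrite mulrA.
  by have /andP[? ?] := si; apply: cvg_expr0.
apply/norm_cvg0P; apply: (squeeze_cvgr _ (cvg_cst 0) e0); near=> K.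
rewrite normr_ge0 /=.
pose G := t * F K (g * m).
have G0 : 0 <= G by rewrite mulr_ge0 ?F_ge0 // ltW.
have GC : G <= t * C by rewrite ler_wpM2l ?F_upper // ltW.
have eG : G = gresp (s ^- K * s) (t ^- K * t) (K + K) m.
  by rewrite gresp_shift ?sK_gt0 ?tK_gt0 // ltW.
have := gresp_succ (K + K) (sK_gt0 K) (tK_gt0 K) (ltW m0).
rewrite grespS -eG -/(F K m).
have -> : t ^- K * t ^+ (K + K) = t ^+ K.
  by rewrite exprD mulrA mulVf ?mul1r // expf_neq0 // gt_eqF.
have [h1 _] := parallel_le (tK_gt0 K) G0.
have h2 : G - parallel (t ^- K) G <= (t * C) ^+ 2 * t ^+ K.
  have tk := tK_gt0 K.
  have -> : G - parallel (t ^- K) G = G ^+ 2 / (t ^- K + G).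
    exact: parallel_defect.
  apply: ler_pM; rewrite ?exprn_ge0 ?invr_ge0 //; first by lra.
    by rewrite lerXn2r ?nnegrE // (le_trans G0).
  by rewrite -[leRHS]invrK lef_pV2 ?posrE ?invr_gt0 ?exprn_gt0 //; lra.
move=> /andP[h3 h4].
have -> : F K (g * m) - t^-1 * F K m = t^-1 * (G - F K m).
  by rewrite mulrBr mulrA mulVf ?mul1r // gt_eqF.
have ti : 0 < t^-1 by rewrite invr_gt0.
have -> : e K = t^-1 * (s ^- K * m + (1 + (t * C) ^+ 2) * t ^+ K).
  by rewrite /e exprVn; ring.
rewrite normrM gtr0_norm // ler_wpM2l ?(ltW ti) // ler_norml.
have : 0 <= s ^- K * m by rewrite mulr_ge0 // ltW // sK_gt0.
by move=> h5; apply/andP; split; lra.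
Unshelve. all: by end_near.
Qed.

Lemma F_scalings m i : 0 < m ->
  F K (g ^+ i * m) - t^-1 ^+ i * F K m @[K --> \oo] --> 0.
Proof.
move=> m0; have g0 : 0 < g by rewrite -(pmulr_rgt0 g t0) -stg s_gt0.
elim: i => [|i IH].
  by under eq_fun do rewrite !expr0 !mul1r subrr; apply: cvg_cst.
have h := @F_scaling (g ^+ i * m) (mulr_gt0 (exprn_gt0 i g0) m0).
have h' : t^-1 * (F K (g ^+ i * m) - t^-1 ^+ i * F K m) @[K --> \oo] --> t^-1 * 0.
  exact: cvgMl_tmp.
rewrite (_ : (fun K => _) = (fun K => (F K (g * (g ^+ i * m)) - t^-1 * F K (g ^+ i * m))
    + t^-1 * (F K (g ^+ i * m) - t^-1 ^+ i * F K m))); last first.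
  by apply/funext => K; rewrite !exprS -!mulrA; ring.
by rewrite -[X in _ --> X](addr0 0) -{2}(mulr0 t^-1); apply: cvgD.
Qed.

End Geometric.

Lemma expr_unbounded (g x : R) : 1 < g -> exists n, x < g ^+ n.
Proof.
move=> g1; have bern n : n%:R * (g - 1) <= g ^+ n.
  elim: n => [|n IH]; first by rewrite mul0r expr0.
  have : 1 <= g ^+ n by apply: exprn_ege1; rewrite ltW.
  by rewrite exprS -natr1 => h; nra.
have [n xn] : exists n : nat, x / (g - 1) < n%:R.
  exists (Num.truncn (x / (g - 1))).+1; exact: truncnS_gt.
exists n; apply: lt_le_trans (bern n).
by rewrite -ltr_pdivrMr // subr_gt0.
Qed.

Lemma powR_exprn (x y : R) n : 0 <= x -> (x ^+ n) `^ y = (x `^ y) ^+ n.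
Proof.
move=> x0; elim: n => [|n IH]; first by rewrite !expr0 powR1.
by rewrite !exprS (powRM _ x0 (exprn_ge0 n x0)) IH.
Qed.

Lemma geometric_bracket (g m0 m : R) : 1 < g -> 0 < m0 -> m0 <= m ->
  exists i, g ^+ i * m0 <= m <= g ^+ i.+1 * m0.
Proof.
move=> g1 m00 mm.
have ex : exists i, m <= g ^+ i.+1 * m0.
  have [n] := expr_unbounded (m / m0) g1; rewrite ltr_pdivrMr // => h.
  exists n; apply: le_trans (ltW h) _; rewrite ler_wpM2r ?(ltW m00) // exprS.
  by rewrite ler_peMl ?exprn_ge0 ?ltW // (lt_trans ltr01).
case: (ex_minnP ex) => i hi imin; exists i; rewrite hi andbT.
case: i hi imin => [|i] hi imin; first by rewrite expr0 mul1r.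
by rewrite leNgt; apply/negP => /ltW /imin; rewrite ltnn.
Qed.

Lemma near_all (P : R -> nat -> Prop) (s : seq R) :
  (forall x, x \in s -> \forall K \near \oo, P x K) ->
  \forall K \near \oo, forall x, x \in s -> P x K.
Proof.
elim: s => [|x s IH] h; first by near=> K.
have h1 := h x (mem_head _ _).
have h2 : \forall K \near \oo, forall y, y \in s -> P y K.
  by apply: IH => y ys; apply: h; rewrite inE ys orbT.
near=> K; move=> y; rewrite inE => /orP[/eqP ->|]; first by near: K.
by move: y; near: K.
Unshelve. all: by end_near.
Qed.

(* A self-similar ladder has, in the limit, a monotone response [r] such that
   [r (g * m) = g ^ c * r m]; this determines [r] up to a factor which tends to [1] with [g]. *)
Lemma chain_approximates_power (c e : R) (ms : seq R) : 0 < c -> c < 1 -> 0 < e ->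
  (forall m, m \in ms -> 0 <= m) ->
  exists l a, positive_chain l a /\
    forall m, m \in ms -> `|response l a m - m `^ c| <= e.
Proof.
move=> c0 c1 e0 ms0.
pose M := \sum_(m <- ms) m + 1.
have msM m : m \in ms -> m <= M.
  move=> mms; rewrite /M (big_rem _ mms) /= -addrA lerDl addr_ge0 // big_seq.
  by apply: sumr_ge0 => x /mem_rem/ms0.
have M1 : 1 <= M.
  by rewrite /M lerDr big_seq; apply: sumr_ge0 => x /ms0.
pose m0 := \big[Order.min/1]_(m <- [seq m <- ms | 0 < m]) m.
have m00 : 0 < m0.
  rewrite /m0; elim: (ms) => [|x l IH] /=; first by rewrite big_nil.
  by case: ifP => // x0; rewrite big_cons lt_min x0.
have m0le m : m \in ms -> 0 < m -> m0 <= m.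
  rewrite /m0 => + mp; elim: (ms) => [|x l IH] //=; rewrite inE => /orP[/eqP <-|ml].
    by rewrite mp big_cons ge_min lexx.
  by case: ifP => x0; rewrite ?big_cons ?ge_min IH // orbT.
(* With this [d] the factor [w = 1 + d] changes a [c]-th power of a number up to [M] by at most
   [e / 2]. *)
pose d := e / (M `^ c *+ 2).
have Mc : 0 < M `^ c by rewrite powR_gt0 // (lt_le_trans ltr01).
have d0 : 0 < d by rewrite divr_gt0 // mulr2n addr_gt0.
pose w := 1 + d; have w1 : 1 < w by rewrite ltrDl.
have w0 : 0 < w by apply: lt_trans w1.
(* The response gains the factor [w], the [c]-th power of [g], when [m] gains the factor [g]. As
   [c < 1], one has [w < g], that is [1 < s]. *)
pose g := w `^ c^-1; pose t := w^-1; pose s := t * g.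
have ci : 1 < c^-1 by rewrite invf_gt1.
have gw : w < g.
  by rewrite /g /powR gt_eqF // -[ltLHS](lnK w0) ltr_expR ltr_pMl ?ln_gt0.
have gc : g `^ c = w by rewrite /g -powRrM mulVf ?gt_eqF // powRr1 // ltW.
have g1 : 1 < g by apply: lt_trans gw.
have g0 : 0 < g by apply: lt_trans g1.
have t0 : 0 < t by rewrite invr_gt0.
have t1 : t < 1 by rewrite invf_lt1.
have s1 : 1 < s by rewrite /s /t mulrC ltr_pdivlMr // mul1r.
have ti : t^-1 = w by rewrite /t invrK.
pose G K m := F s t K m.
(* A lower bound of the response at [m0] uniform in [K]; it bounds the normalizing factor [k] below,
   so that the tolerance [e'] can be fixed before [K]. *)
pose lo := (t^-1 / (t^-1 - 1) + m0^-1)^-1.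
have lo0 : 0 < lo.
  rewrite invr_gt0 addr_gt0 ?invr_gt0 // divr_gt0 ?invr_gt0 // ti subr_gt0 //.
have Glo K : lo <= G K m0 by apply: F_lower.
pose e' := e / 2 * lo / m0 `^ c.
have m0c : 0 < m0 `^ c by rewrite powR_gt0.
have e'0 : 0 < e' by rewrite divr_gt0 // mulr_gt0 // divr_gt0.
have near_scal i : \forall K \near \oo, `|G K (g ^+ i * m0) - w ^+ i * G K m0| <= e'.
  have := F_scalings t0 t1 s1 (erefl s) i m00.
  move/cvgr0_norm_le => /(_ e' e'0); rewrite ti; exact.
pose idx m := xget 0%N [set i | g ^+ i * m0 <= m <= g ^+ i.+1 * m0].
have nearK : \forall K \near \oo, forall m, m \in ms ->
    `|G K (g ^+ (idx m) * m0) - w ^+ (idx m) * G K m0| <= e' /\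
    `|G K (g ^+ (idx m).+1 * m0) - w ^+ (idx m).+1 * G K m0| <= e'.
  apply: near_all => m _; apply: filterI; exact: near_scal.
have [K hK] := filter_ex nearK.
pose k := m0 `^ c / G K m0.
have G0 : 0 < G K m0 := lt_le_trans lo0 (Glo K).
have k0 : 0 < k by rewrite divr_gt0.
have pos : positive_chain (geom s t (s ^- K) (t ^- K) (K + K)) (s ^- K * s ^+ (K + K)).
  by apply: geom_positive => //; [exact: sK_gt0|exact: tK_gt0].
exists (scale_chain k (geom s t (s ^- K) (t ^- K) (K + K))), (k * (s ^- K * s ^+ (K + K))).
split; first exact: positive_scale_chain.
move=> m mms; have := ms0 _ mms; rewrite le_eqVlt => /orP[/eqP <-|mp].
  rewrite powR0 ?gt_eqF // subr0 response_scale //.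
  suff -> : response (geom s t (s ^- K) (t ^- K) (K + K)) (s ^- K * s ^+ (K + K)) 0 = 0.
    by rewrite mulr0 normr0 ltW.
  exact: response0.
rewrite (response_scale k0 pos (ltW mp)) -/(gresp s t _ _ _ m) -/(F s t K m) -/(G K m).
have [h1 h2] := hK _ mms.
(* By monotonicity the response at [m] lies between its values at two consecutive points
   [g ^+ i * m0], which are known up to [e']. *)
have /= := xgetPex 0%N (geometric_bracket g1 m00 (m0le _ mms mp)); rewrite -/(idx m).
move: (idx m) h1 h2 => i h1 h2 /andP[b1 b2].
have gi0 : 0 < g ^+ i * m0 by rewrite mulr_gt0 // exprn_gt0.
have G1 : G K (g ^+ i * m0) <= G K m by apply: F_mono => //; exact: ltW.
have G2 : G K m <= G K (g ^+ i.+1 * m0) by apply: F_mono => //; exact: ltW.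
have pw j : (g ^+ j * m0) `^ c = w ^+ j * m0 `^ c.
  rewrite powRM ?exprn_ge0 ?ltW // -gc; congr (_ * _).
  exact/powR_exprn/ltW.
have c0' := ltW c0.
have p1 : w ^+ i * m0 `^ c <= m `^ c by rewrite -pw ge0_ler_powR // nnegrE ltW.
have p2 : m `^ c <= w * (w ^+ i * m0 `^ c).
  by rewrite mulrA -exprS -pw ge0_ler_powR // nnegrE ltW // mulr_gt0 ?exprn_gt0.
have p3 : m `^ c <= M `^ c.
  by apply: ge0_ler_powR; rewrite ?nnegrE ?(ltW mp) ?(le_trans ler01 M1) ?msM.
have kG : k * G K m0 = m0 `^ c by rewrite /k divfK // gt_eqF.
have ke : k * e' <= e / 2.
  have -> : k * e' = e / 2 * (lo / G K m0).
    by rewrite /k /e'; field; rewrite !gt_eqF.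
  by rewrite ler_piMr ?divr_ge0 ?(ltW e0) // ler_pdivrMr // mul1r.
have Md : M `^ c * d = e / 2 by rewrite /d -mulr_natr; field; rewrite gt_eqF.
move: h1 h2; rewrite !ler_norml => /andP[h1 _] /andP[_ h2].
have q1 : k * (w ^+ i * G K m0 - e') <= k * G K m.
  by rewrite ler_wpM2l ?(ltW k0) //; clear -h1 G1; lra.
have q2 : k * G K m <= k * (w * (w ^+ i * G K m0) + e').
  by rewrite ler_wpM2l ?(ltW k0) // mulrA -exprS; clear -h2 G2; lra.
have e1 : k * (w ^+ i * G K m0 - e') = w ^+ i * m0 `^ c - k * e' by rewrite -kG; ring.
have e2 : k * (w * (w ^+ i * G K m0) + e') = w * (w ^+ i * m0 `^ c) + k * e' by rewrite -kG; ring.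
have e3 : w * (w ^+ i * m0 `^ c) = w ^+ i * m0 `^ c + d * (w ^+ i * m0 `^ c) by rewrite /w; ring.
have e4 : d * (w ^+ i * m0 `^ c) <= e / 2.
  by rewrite -Md mulrC ler_wpM2r ?(ltW d0) //; exact: le_trans p1 p3.
rewrite e1 in q1; rewrite e2 e3 in q2; clear -p1 p2 q1 q2 e3 e4 ke.
by rewrite e3 in p2; apply/andP; split; lra.
Qed.

End Chain.

(** * Nodal pieces on the grid *)

Section Grid.
Variable R : realType.

Definition theta (N k : nat) : R := 2 * pi * k%:R / N%:R.

Lemma cosD2pin (x : R) (n : nat) : cos (x + 2 * pi * n%:R) = cos x.
Proof.
elim: n => [|n IH]; first by rewrite mulr0 addr0.
have -> : x + 2 * pi * n.+1%:R = x + 2 * pi * n%:R + pi *+ 2.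
  by rewrite -[n.+1%:R]natr1; ring.
by rewrite cosD2pi.
Qed.

Lemma cos_theta_modn (N k j : nat) (x : R) : (0 < N)%N ->
  cos (x + theta N (k %% N)%N * j%:R) = cos (x + theta N k * j%:R).
Proof.
move=> N0; have N0' : N%:R != 0 :> R by rewrite pnatr_eq0 -lt0n.
rewrite {2}/theta {2}(divn_eq k N) -(cosD2pin _ (k %/ N * j)%N); congr cos.
by rewrite /theta natrD !natrM; field.
Qed.

(** Multiplied by [2 * sin (t / 2)] the sum telescopes over a full period, and this factor is
    nonzero because [N] does not divide [p]. *)
Lemma sum_cos_theta (N p : nat) (x : R) : (0 < N)%N -> (p %% N != 0)%N ->
  \sum_(j < N) cos (x + theta N p * j%:R) = 0.
Proof.
move=> N0 pN; have N0' : N%:R != 0 :> R by rewrite pnatr_eq0 -lt0n.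
under eq_bigr do rewrite -cos_theta_modn //.
set r := (p %% N)%N; set t := theta N r.
have rN : (r < N)%N by rewrite ltn_mod.
have st : 0 < sin (t / 2).
  apply: sin_gt0_pi; have -> : t / 2 = pi * (r%:R / N%:R) by rewrite /t /theta; field.
  have Np : 0 < N%:R :> R by rewrite ltr0n.
  rewrite mulr_gt0 ?pi_gt0 //=; last by rewrite divr_gt0 // ltr0n lt0n.
  by rewrite -[ltRHS]mulr1 ltr_pM2l ?pi_gt0 // ltr_pdivrMr // mul1r ltr_nat.
pose F (j : nat) := sin (x + t * j%:R - t / 2).
have step j : cos (x + t * j%:R) * (2 * sin (t / 2)) = F j.+1 - F j.
  rewrite /F; have -> : x + t * j.+1%:R - t / 2 = (x + t * j%:R) + t / 2.
    by rewrite -[j.+1%:R]natr1; field.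
  by rewrite sinB sinD; ring.
have h : (\sum_(j < N) cos (x + t * j%:R)) * (2 * sin (t / 2)) = 0.
  rewrite mulr_suml; under eq_bigr do rewrite step.
  rewrite -(big_mkord xpredT (fun j => F j.+1 - F j)) telescope_sumr // /F.
  have -> : x + t * N%:R - t / 2 = (x + t * 0%:R - t / 2) + 2 * pi * r%:R.
    by rewrite /t /theta mulr0; field.
  rewrite -!cosBpihalf.
  have -> : x + t * 0%:R - t / 2 + 2 * pi * r%:R - pi / 2 =
    x + t * 0%:R - t / 2 - pi / 2 + 2 * pi * r%:R by ring.
  by rewrite cosD2pin subrr.
by move/eqP: h; rewrite mulf_eq0 => /orP[/eqP //|]; rewrite mulf_eq0 pnatr_eq0 /= gt_eqF.
Qed.

Lemma sum_cos_thetaN (N p : nat) (x : R) : (0 < N)%N -> (p %% N != 0)%N ->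
  \sum_(j < N) cos (x - theta N p * j%:R) = 0.
Proof.
move=> N0 pN; rewrite -[RHS](sum_cos_theta (- x) N0 pN); apply: eq_bigr => j _.
by rewrite -cosN opprB addrC.
Qed.

Definition mean (N : nat) (F : 'I_N -> R) : R := N%:R^-1 * \sum_(j < N) F j.

Definition ghat (N : nat) (F : 'I_N -> R) (m : nat) (x : R) : R :=
  mean (fun j : 'I_N => F j * cos (theta N m * j%:R - x)).

(** The symmetric circulant operator whose kernel is the sum of [cos (theta N m * (j - i))] with
    weights [s m / N]; cosines keep the discrete Fourier calculus real. *)
Definition mult (N : nat) (s : nat -> R) (F : 'I_N -> R) (i : 'I_N) : R :=
  \sum_(m < N) s m * ghat F m (theta N m * i%:R).

Lemma ghatE N (F : 'I_N -> R) m x :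
  ghat F m x = ghat F m 0 * cos x + ghat F m (pi / 2) * sin x.
Proof.
rewrite /ghat /mean -!mulrA -mulrDr; congr (_ * _); rewrite !mulr_suml -big_split /=.
by apply: eq_bigr => j _; rewrite subr0 cosBpihalf cosB; ring.
Qed.

Lemma mult1 N (F : 'I_N -> R) i : mult (fun=> 1) F i = F i.
Proof.
have N0 : (0 < N)%N by apply: leq_ltn_trans (ltn_ord i).
have N0' : N%:R != 0 :> R by rewrite pnatr_eq0 -lt0n.
rewrite /mult /ghat /mean; under eq_bigr do rewrite mul1r.
rewrite -mulr_sumr exchange_big /= (bigD1 i) //= [X in _ * (_ + X)]big1 ?addr0; last first.
  move=> j ji; rewrite -mulr_sumr; apply/eqP; rewrite mulf_eq0; apply/orP; right; apply/eqP.
  have jN := ltn_ord j; have iN := ltn_ord i.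
  have [lt|le] := ltnP i j.
    rewrite (eq_bigr (fun m : 'I_N => cos (0 + theta N (j - i)%N * m%:R))); last first.
      by move=> m _; congr cos; rewrite /theta (natrB _ (ltnW lt)); ring.
    apply: sum_cos_theta => //; rewrite modn_small ?subn_eq0 -?ltnNge //.
    exact: leq_ltn_trans (leq_subr _ _) _.
  rewrite (eq_bigr (fun m : 'I_N => cos (0 - theta N (i - j)%N * m%:R))); last first.
    by move=> m _; congr cos; rewrite /theta (natrB _ le); ring.
  apply: sum_cos_thetaN => //; rewrite modn_small ?subn_eq0 -?ltnNge //.
    by rewrite ltn_neqAle le andbT; apply: contra ji => /eqP/val_inj->.
  exact: leq_ltn_trans (leq_subr _ _) _.
rewrite -mulr_sumr; under eq_bigr do rewrite subrr cos0.
by rewrite sumr_const card_ord mulrA mulrAC mulVf ?mul1r.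
Qed.

(** The product formula for cosines leaves the residues [k] (in [S1]) and [N - k] (in [S2]); a
    symbol that is a function of [cos theta] takes the same value at both. *)
Lemma mult_cos N (rho : R -> R) (k : nat) (x : R) (i : 'I_N) :
  mult (fun m => rho (cos (theta N m))) (fun j : 'I_N => cos (theta N k * j%:R + x)) i
  = rho (cos (theta N k)) * cos (theta N k * i%:R + x).
Proof.
have N0 : (0 < N)%N by apply: leq_ltn_trans (ltn_ord i).
have N0' : N%:R != 0 :> R by rewrite pnatr_eq0 -lt0n.
wlog kN : k / (k < N)%N.
  move=> h; have := h (k %% N)%N; rewrite ltn_mod => /(_ N0).
  have e j : cos (theta N (k %% N) * j%:R + x) = cos (theta N k * j%:R + x).
    by rewrite [LHS](congr1 cos (addrC _ _)) cos_theta_modn // addrC.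
  have -> : cos (theta N (k %% N)) = cos (theta N k).
    by have := @cos_theta_modn N k 1 0 N0; rewrite !mulr1 !add0r.
  rewrite e => <-; congr (mult _ _ _); apply/funext => j; exact/esym/e.
pose S1 (m : nat) := \sum_(j < N) cos ((theta N m * i%:R + x) + (theta N k - theta N m) * j%:R).
pose S2 (m : nat) := \sum_(j < N) cos ((x - theta N m * i%:R) + theta N (k + m)%N * j%:R).
have gE m : ghat (fun j : 'I_N => cos (theta N k * j%:R + x)) m (theta N m * i%:R)
    = N%:R^-1 * (2^-1 * (S1 m + S2 m)).
  rewrite /ghat /mean; congr (_ * _); rewrite /S1 /S2 -big_split mulr_sumr /=.
  apply: eq_bigr => j _.
  have -> : theta N m * i%:R + x + (theta N k - theta N m) * j%:R =
    (theta N k * j%:R + x) - (theta N m * j%:R - theta N m * i%:R) by ring.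
  have -> : x - theta N m * i%:R + theta N (k + m)%N * j%:R =
    (theta N k * j%:R + x) + (theta N m * j%:R - theta N m * i%:R).
    by rewrite /theta natrD; ring.
  by move: (_ + x) (_ - theta N m * i%:R) => A B; rewrite cosB cosD; field.
have S1E (m : nat) : (m < N)%N -> S1 m = if m == k then N%:R * cos (theta N k * i%:R + x) else 0.
  move=> mN; rewrite /S1; case: eqP => [->|/eqP mk].
    under eq_bigr do rewrite subrr mul0r addr0.
    by rewrite sumr_const card_ord mulr_natl.
  set y := theta N m * i%:R + x.
  have [lt|le] := ltnP m k.
    rewrite (eq_bigr (fun j : 'I_N => cos (y + theta N (k - m)%N * j%:R))); last first.
      by move=> j _; congr cos; rewrite /theta (natrB _ (ltnW lt)); ring.
    apply: sum_cos_theta => //; rewrite modn_small ?subn_eq0 -?ltnNge //.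
    exact: leq_ltn_trans (leq_subr _ _) _.
  rewrite (eq_bigr (fun j : 'I_N => cos (y - theta N (m - k)%N * j%:R))); last first.
    by move=> j _; congr cos; rewrite /theta (natrB _ le); ring.
  apply: sum_cos_thetaN => //; rewrite modn_small ?subn_eq0 -?ltnNge //.
    by rewrite ltn_neqAle le andbT eq_sym.
  exact: leq_ltn_trans (leq_subr _ _) _.
pose k' := ((N - k) %% N)%N.
have k'N : (k' < N)%N by rewrite ltn_mod.
have kk' : ((k + k') %% N = 0)%N by rewrite modnDmr subnKC ?modnn // ltnW.
have S2E (m : nat) : (m < N)%N ->
    S2 m = if m == k' then N%:R * cos (theta N k * i%:R + x) else 0.
  move=> mN; rewrite /S2; case: eqP => [->|/eqP mk].
    under eq_bigr do rewrite -cos_theta_modn // kk' /theta mulr0 mul0r mul0r addr0 -!/(theta _ _).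
    rewrite sumr_const card_ord -[LHS]mulr_natl; congr (_ * _).
    rewrite addrC -(cosD2pin _ (((k + k') %/ N) * i)); congr cos.
    have := divn_eq (k + k') N; rewrite kk' addn0 => e.
    rewrite natrM; have -> : theta N k' = 2 * pi * ((k + k') %/ N)%N%:R - theta N k.
      have : (k%:R + k'%:R = ((k + k') %/ N)%N%:R * N%:R :> R) by rewrite -natrD {1}e natrM.
      move=> e'; rewrite /theta.
      have -> : k'%:R = ((k + k') %/ N)%N%:R * N%:R - k%:R :> R by lra.
      by field.
    ring.
  apply: sum_cos_theta => //.
  apply: contra mk => /eqP h; rewrite -(modn_small mN) -(modn_small k'N) -(eqn_modDl k).
  by rewrite h kk'.
rewrite /mult; under eq_bigr => m _ do rewrite gE.
set C := cos (theta N k * i%:R + x) in S1E S2E *.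
have -> : \sum_(m < N) rho (cos (theta N m)) * (N%:R^-1 * (2^-1 * (S1 m + S2 m)))
  = N%:R^-1 * 2^-1 * (\sum_(m < N) rho (cos (theta N m)) * S1 m + \sum_(m < N) rho (cos (theta N m)) * S2 m).
  by rewrite -big_split mulr_sumr; apply: eq_bigr => m _ /=; ring.
rewrite (bigD1 (Ordinal kN)) //= [X in _ * (_ + X + _)]big1 ?addr0; last first.
  move=> m mk; rewrite S1E // ifF ?mulr0 //; apply: contraNF mk => /eqP e.
  by apply/eqP/val_inj.
rewrite (bigD1 (Ordinal k'N)) //= [X in _ * (_ + (_ + X))]big1 ?addr0; last first.
  move=> m mk; rewrite S2E // ifF ?mulr0 //; apply: contraNF mk => /eqP e.
  by apply/eqP/val_inj.
rewrite S1E // S2E // !eqxx.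
have -> : cos (theta N k') = cos (theta N k).
  have -> : cos (theta N k') = cos (0 + theta N (N - k) * 1%:R).
    by rewrite -cos_theta_modn // add0r mulr1.
  rewrite add0r mulr1 -[RHS]cosN -[RHS](cosD2pin _ 1) mulr1; congr cos.
  by rewrite /theta natrB ?(ltnW kN) //; field.
by field.
Qed.

Lemma ghat_D2pin N (F : 'I_N -> R) m (x : R) (n : nat) : ghat F m (x + 2 * pi * n%:R) = ghat F m x.
Proof.
rewrite ghatE cosD2pin -!cosBpihalf addrAC cosD2pin cosBpihalf -ghatE //.
Qed.

Lemma ghat_modn N (F : 'I_N -> R) m (j : nat) : (0 < N)%N ->
  ghat F m (theta N m * (j %% N)%N%:R) = ghat F m (theta N m * j%:R).
Proof.
move=> N0; have N0' : N%:R != 0 :> R by rewrite pnatr_eq0 -lt0n.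
rewrite [in RHS](divn_eq j N) -(ghat_D2pin F m _ (j %/ N * m)%N); congr ghat.
by rewrite /theta natrD !natrM; field.
Qed.

Definition lap (N : nat) (F : 'I_N -> R) (i : 'I_N) : R :=
  2 * F i - F (ordS i) - F (ord_pred i).

Lemma lap_mult N s (F : 'I_N -> R) i :
  lap (mult s F) i = mult (fun m => s m * (2 - 2 * cos (theta N m))) F i.
Proof.
have N0 : (0 < N)%N by apply: leq_ltn_trans (ltn_ord i).
have N0' : N%:R != 0 :> R by rewrite pnatr_eq0 -lt0n.
rewrite /lap /mult mulr_sumr -!sumrB; apply: eq_bigr => m _ /=.
rewrite !ghat_modn //.
have -> : ghat F m (theta N m * i.+1%:R) = ghat F m (theta N m * i%:R + theta N m).
  by congr ghat; rewrite -[i.+1%:R]natr1; ring.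
have -> : ghat F m (theta N m * (i + N).-1%:R) = ghat F m (theta N m * i%:R - theta N m).
  rewrite -[RHS](ghat_D2pin _ _ _ m); congr ghat.
  rewrite -subn1 natrB ?addn_gt0 ?N0 ?orbT // natrD /theta; field.
  by [].
move: (theta N m * i%:R) => x; move: (theta N m) => t.
by rewrite (ghatE F m (x + t)) (ghatE F m (x - t)) (ghatE F m x) cosD cosB sinD sinB; ring.
Qed.

Lemma multD N s s' (F : 'I_N -> R) i : mult (fun m => s m + s' m) F i = mult s F i + mult s' F i.
Proof. by rewrite /mult -big_split; apply: eq_bigr => m _; rewrite mulrDl. Qed.

Lemma multZ N c s (F : 'I_N -> R) i : mult (fun m => c * s m) F i = c * mult s F i.
Proof. by rewrite /mult mulr_sumr; apply: eq_bigr => m _; rewrite mulrA. Qed.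

(** The operator is diagonal in the modes; the phases [0] and [pi / 2] stand for the real and
    imaginary parts of a Fourier coefficient. *)
Lemma mult_pair N s (F G : 'I_N -> R) :
  \sum_(i < N) mult s F i * G i =
  N%:R * \sum_(m < N) s m * (ghat F m 0 * ghat G m 0 + ghat F m (pi / 2) * ghat G m (pi / 2)).
Proof.
case: N F G => [|N] F G; first by rewrite !big_ord0 mulr0.
have N0' : N.+1%:R != 0 :> R by rewrite pnatr_eq0.
under eq_bigr do rewrite /mult mulr_suml.
rewrite exchange_big mulr_sumr /=; apply: eq_bigr => m _.
transitivity (s m * (ghat F m 0 * (\sum_(i < N.+1) G i * cos (theta N.+1 m * i%:R - 0)) +
  ghat F m (pi / 2) * (\sum_(i < N.+1) G i * cos (theta N.+1 m * i%:R - pi / 2)))).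
  rewrite !mulr_sumr -big_split mulr_sumr; apply: eq_bigr => i _ /=.
  by rewrite ghatE cosBpihalf subr0; ring.
by rewrite [ghat G m 0]/ghat [ghat G m (pi / 2)]/ghat /mean; field.
Qed.

Lemma mult_sym N s (F G : 'I_N -> R) :
  \sum_(i < N) mult s F i * G i = \sum_(i < N) F i * mult s G i.
Proof.
under [RHS]eq_bigr do rewrite mulrC.
by rewrite !mult_pair; congr (_ * _); apply: eq_bigr => m _; ring.
Qed.

Definition hform N (F G : 'I_N -> R) : R :=
  \sum_(i < N) (F i - F (ordS i)) * (G i - G (ordS i)).

Lemma hformE N (F G : 'I_N -> R) : hform F G = \sum_(i < N) lap F i * G i.
Proof.
have e : \sum_(i < N) (F i - F (ordS i)) * G (ordS i) =
    \sum_(i < N) (F (ord_pred i) - F i) * G i.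
  rewrite [RHS](reindex_inj (@ordS_inj N)) /=.
  by apply: eq_bigr => i _; rewrite ordSK.
rewrite /hform; under eq_bigr do rewrite mulrBr.
rewrite sumrB e -sumrB; apply: eq_bigr => i _; rewrite /lap; ring.
Qed.

(** The Dirichlet form of the network, which has one copy of the discrete circle for each rung and a
    last one for [a]. *)
Fixpoint energy N (l : seq (R * R)) (a : R) (F G : nat -> 'I_N -> R) : R :=
  if l is p :: l' then
    p.1 * hform (F 0%N) (G 0%N)
    + p.2 * (\sum_(i < N) (F 0%N i - F 1%N i) * (G 0%N i - G 1%N i))
    + energy l' a (fun y => F y.+1) (fun y => G y.+1)
  else a * hform (F 0%N) (G 0%N).

(* Multiplier giving layer [y] of the harmonic extension. *)
Fixpoint ext (l : seq (R * R)) (a : R) (mu : nat -> R) (s : nat -> R) (y : nat) : nat -> R :=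
  match l, y with
  | p :: l', y'.+1 => ext l' a mu (fun m => s m * (p.2 / (p.2 + response l' a (mu m)))) y'
  | _, _ => s
  end.

(* Symbol of [lap]. *)
Definition lat (N : nat) (m : nat) : R := 2 - 2 * cos (theta N m).

Lemma lat_ge0 N m : 0 <= lat N m.
Proof. rewrite /lat; have := cos_le1 (theta N m); lra. Qed.

(** Summation by parts, layer by layer: by the choice of [ext], the current that leaves a layer
    through its links equals the response of the remaining ladder, so only the boundary layer
    contributes. *)
Lemma green N l a (F : 'I_N -> R) (G : nat -> 'I_N -> R) s : positive_chain l a ->
  energy l a (fun y => mult (ext l a (lat N) s y) F) G =
  \sum_(i < N) mult (fun m => s m * response l a (lat N m)) F i * G 0%N i.
Proof.
elim: l s G => [|p l IH] s G /=.
  move=> _; rewrite hformE mulr_sumr; apply: eq_bigr => i _.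
  rewrite lap_mult mulrA -multZ; congr (_ * _); apply: eq_bigr => m _.
  by rewrite /lat; ring.
case=> p1 p2 pl; rewrite IH // hformE !mulr_sumr -!big_split; apply: eq_bigr => i _ /=.
have -> : ext l a (lat N) (fun m : nat => s m * (p.2 / (p.2 + response l a (lat N m)))) 0
    = (fun m : nat => s m * (p.2 / (p.2 + response l a (lat N m)))) by case: (l).
rewrite lap_mult.
set s' := fun m => s m * (p.2 / (p.2 + response l a (lat N m))).
set r := fun m => s' m * response l a (lat N m).
have e1 : p.2 * (mult s F i - mult s' F i) = mult r F i.
  rewrite -mulN1r -multZ -multD -multZ; apply: eq_bigr => m _; congr (_ * _).
  have r0 := response_ge0 pl (lat_ge0 N m).
  by rewrite /r /s'; field; rewrite gt_eqF //; lra.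
have e2 : mult (fun m => s m * (p.1 * lat N m + p.2 * response l a (lat N m) /
    (p.2 + response l a (lat N m)))) F i =
    p.1 * mult (fun m => s m * (2 - 2 * cos (theta N m))) F i + mult r F i.
  rewrite -multZ -multD; apply: eq_bigr => m _; congr (_ * _).
  have r0 := response_ge0 pl (lat_ge0 N m).
  by rewrite /r /s' /lat; field; rewrite gt_eqF //; move: r0; rewrite /lat; lra.
by rewrite e2 [p.2 * (_ * _)]mulrA e1; ring.
Qed.

Lemma energyDl N l a (F F' G : nat -> 'I_N -> R) :
  energy l a (fun y i => F y i + F' y i) G = energy l a F G + energy l a F' G.
Proof.
have h (A B C : 'I_N -> R) : hform (fun i => A i + B i) C = hform A C + hform B C.
  by rewrite /hform -big_split; apply: eq_bigr => i _ /=; ring.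
elim: l F F' G => [|p l IH] F F' G /=; first by rewrite h mulrDr.
rewrite IH h; under eq_bigr do rewrite opprD addrACA mulrDl.
by rewrite big_split /=; ring.
Qed.

Lemma energy_sym N l a (F G : nat -> 'I_N -> R) : energy l a F G = energy l a G F.
Proof.
elim: l F G => [|p l IH] F G /=.
  by congr (_ * _); apply: eq_bigr => i _; rewrite mulrC.
rewrite IH; congr (_ * _ + _ * _ + _); by apply: eq_bigr => i _; rewrite mulrC.
Qed.

Lemma energy_ge0 N l a (F : nat -> 'I_N -> R) : positive_chain l a -> 0 <= energy l a F F.
Proof.
have h (A : 'I_N -> R) : 0 <= hform A A by apply: sumr_ge0 => i _; rewrite -expr2 sqr_ge0.
elim: l F => [|p l IH] F /=; first by move=> a0; rewrite mulr_ge0.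
case=> p1 p2 pl; rewrite !addr_ge0 ?mulr_ge0 ?IH // ?(ltW p2) //.
by apply: sumr_ge0 => i _; rewrite -expr2 sqr_ge0.
Qed.

(** The right side exceeds the left by [- (c - c') ^+ 2 * (w * w')], so the multiplier may jump
    wherever the function does not keep its sign. *)
Lemma edge_ineq (c c' w w' : R) : c = c' \/ w * w' <= 0 ->
  (c * w - c' * w') * (c * w - c' * w') <= (w - w') * (c ^+ 2 * w - c' ^+ 2 * w').
Proof.
move=> h; rewrite -subr_ge0.
have -> : (w - w') * (c ^+ 2 * w - c' ^+ 2 * w') - (c * w - c' * w') * (c * w - c' * w')
  = - ((c - c') ^+ 2 * (w * w')) by ring.
rewrite oppr_ge0; case: h => [->|h]; first by rewrite subrr expr0n mul0r.
by rewrite mulr_ge0_le0 // sqr_ge0.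
Qed.

Lemma energy_cut N l a (w c : nat -> 'I_N -> R) : positive_chain l a ->
  (forall y i, (y <= size l)%N -> c y i = c y (ordS i) \/ w y i * w y (ordS i) <= 0) ->
  (forall y i, (y < size l)%N -> c y i = c y.+1 i \/ w y i * w y.+1 i <= 0) ->
  energy l a (fun y i => c y i * w y i) (fun y i => c y i * w y i)
  <= energy l a w (fun y i => c y i ^+ 2 * w y i).
Proof.
elim: l w c => [|p l IH] w c /=.
  by move=> a0 h _; rewrite ler_wpM2l //; apply: ler_sum => i _; apply: edge_ineq; apply: h.
case=> p1 p2 pl h1 h2; rewrite !lerD //.
- by rewrite ler_wpM2l //; apply: ler_sum => i _; apply: edge_ineq; apply: h1.
- by rewrite ler_wpM2l ?(ltW p2) //; apply: ler_sum => i _; apply: edge_ineq; apply: h2.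
- by apply: (IH (fun y => w y.+1) (fun y => c y.+1)) => // y i yl; [apply: h1|apply: h2].
Qed.

Definition dtn N l a : ('I_N -> R) -> 'I_N -> R := mult (fun m => response l a (lat N m)).

(** The harmonic extension [t] of the cut data has no more energy than any other extension, in
    particular than the cut [z] of the harmonic extension of [v]; the latter is bounded by
    [energy_cut] and evaluated by [green]. *)
Lemma dirichlet N l a (v c0 : 'I_N -> R) (c : nat -> 'I_N -> R) :
  let w y := mult (ext l a (lat N) (fun=> 1) y) v in
  let K := @dtn N l a in
  positive_chain l a ->
  (forall y i, (y <= size l)%N -> c y i = c y (ordS i) \/ w y i * w y (ordS i) <= 0) ->
  (forall y i, (y < size l)%N -> c y i = c y.+1 i \/ w y i * w y.+1 i <= 0) ->
  c0 = c 0%N ->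
  \sum_(i < N) K (fun i => c0 i * v i) i * (c0 i * v i)
  <= \sum_(i < N) K v i * (c0 i ^+ 2 * v i).
Proof.
move=> w K pl h1 h2 ->.
have ext0 s : ext l a (lat N) s 0 = s by case: (l).
have one : (fun m => 1 * response l a (lat N m)) = (fun m => response l a (lat N m)).
  by apply/funext => m; rewrite mul1r.
have w0 i : w 0%N i = v i by rewrite /w ext0 mult1.
pose f i := c 0%N i * v i.
pose z y i := c y i * w y i.
pose t y := mult (ext l a (lat N) (fun=> 1) y) f.
pose d y i := z y i - t y i.
have d0 i : d 0%N i = 0 by rewrite /d /z /t ext0 mult1 /f w0 subrr.
have z0 i : z 0%N i = f i by rewrite /z w0.
(* [t] is harmonic and [d] vanishes on the boundary layer, so the energy of [z = t + d] splits. *)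
have td : energy l a t d = 0.
  by rewrite /t green // one big1 // => i _; rewrite d0 mulr0.
have tt : energy l a t t = \sum_(i < N) K f i * f i.
  rewrite {1}/t green // one; apply: eq_bigr => i _.
  by rewrite /t ext0 mult1.
have zE : z = (fun y i => t y i + d y i).
  by apply/funext => y; apply/funext => i; rewrite /d addrC subrK.
have zz : energy l a z z = energy l a t t + energy l a d d.
  have a1 G : energy l a z G = energy l a t G + energy l a d G.
    by rewrite [in LHS]zE; apply: energyDl.
  rewrite a1 (energy_sym l a t z) (energy_sym l a d z) !a1 td.
  by rewrite (energy_sym l a d t) td addr0 add0r.
rewrite -/f -tt; apply: (@le_trans _ _ (energy l a z z)).
  by rewrite zz lerDl energy_ge0.
apply: le_trans (energy_cut pl h1 h2) _.
by rewrite /w green // one; apply: ler_sum => i _; rewrite /w ext0 mult1.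
Qed.

(* [L] gives the nodal domain, in the whole network, of the harmonic extension of [v]. *)
Lemma grid_courant N l a (v : 'I_N -> R) : positive_chain l a ->
  exists L : 'I_N -> label,
  [/\ forall i, (L i).1 = (0 < v i),
      forall i, (0 < v i) = (0 < v (ordS i)) -> L i = L (ordS i), noncrossing L &
      forall a' : label -> R,
        \sum_(i < N) dtn l a (fun i => a' (L i) * v i) i * (a' (L i) * v i)
        <= \sum_(i < N) dtn l a v i * (a' (L i) ^+ 2 * v i)].
Proof.
move=> pl; pose w y := mult (ext l a (lat N) (fun=> 1) y) v.
have [L [h1 h2 h3 h4]] := planar_labelling (size l) (fun y (i : 'I_N) => 0 < w y i).
have ext0 s : ext l a (lat N) s 0 = s by case: (l).
have w0 i : w 0%N i = v i by rewrite /w ext0 mult1.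
(* Zeros share the colour of the negative values, so a product across colours is only nonpositive,
   which [edge_ineq] admits. *)
have sgn (x y : R) : (0 < x) <> (0 < y) -> x * y <= 0.
  have [x0|x0] := ltP 0 x; have [y0|y0] := ltP 0 y => // _.
    by rewrite mulr_ge0_le0 // ltW.
  by rewrite mulr_le0_ge0 // ltW.
exists (L 0%N); split => //.
- by move=> i; rewrite h1 // w0.
- by move=> i e; apply: h3 => //; rewrite !w0.
move=> a'; apply: (dirichlet (c := fun y i => a' (L y i))) => //.
- move=> y i yl; have [e|/eqP ne] := eqVneq (0 < w y i) (0 < w y (ordS i)).
    by left; rewrite (h3 y i).
  by right; apply: sgn.
- move=> y i yl; have [e|/eqP ne] := eqVneq (0 < w y i) (0 < w y.+1 i).
    by left; rewrite (h2 y i).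
  by right; apply: sgn.
Qed.

End Grid.

(** * Trigonometric approximation *)

Section Fourier.
Variable R : realType.
Notation mu := (@lebesgue_measure R).

Lemma geometric_domination (r1 r2 c C : R) : 0 <= r2 -> r2 < r1 -> 0 < c ->
  exists m, C * r2 ^+ m < c * r1 ^+ m.
Proof.
move=> r20 r21 c0; have r10 : 0 < r1 by apply: le_lt_trans r21.
have [->|r2n] := eqVneq r2 0.
  by exists 1%N; rewrite !expr1 mulr0 mulr_gt0.
have r2p : 0 < r2 by rewrite lt_def r2n.
have q1 : 1 < r1 / r2 by rewrite ltr_pdivlMr // mul1r.
have [m hm] := expr_unbounded (C / c) q1.
exists m; move: hm; rewrite expr_div_n ltr_pdivrMr // mulrAC ltr_pdivlMr ?exprn_gt0 //.
by rewrite [X in _ < X]mulrC.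
Qed.

Section MeasureSpace.
Context (dsp : measure_display) (S : measurableType dsp) (nu : {measure set S -> \bar R}).

Lemma Rintegrable_scale (D : set S) (k : R) (f : S -> R) : measurable D ->
  nu.-integrable D (EFin \o f) -> nu.-integrable D (EFin \o (fun x => k * f x)).
Proof.
move=> mD h; by apply: (@eq_integrable _ _ _ _ _ mD _ _ _ (integrableZl mD k h)) => x _; rewrite /= EFinM.
Qed.

(** On [E] the weighted integrand grows at least at the rate [r1], while everything negative grows
    at most at the smaller rate [r2]. The constant [C] is free, so that errors known to be of rate
    [r2] can be beaten too. *)
Lemma peak (D E : set S) (g w c : S -> R) (B d r1 r2 C : R) :
  measurable D -> measurable E -> E `<=` D ->
  nu.-integrable D (EFin \o w) -> (forall x, D x -> 0 <= w x) ->
  (forall m, nu.-integrable D (EFin \o (fun x => g x * w x * c x ^+ m))) ->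
  (forall x, D x -> 0 <= c x) ->
  (forall x, E x -> d <= g x /\ r1 <= c x) ->
  (forall x, D x -> 0 <= g x \/ (`|g x| <= B /\ c x <= r2)) ->
  0 < d -> 0 <= r2 -> r2 < r1 -> 0 <= B -> 0 < \int[nu]_(x in E) w x ->
  exists m, C * r2 ^+ m < \int[nu]_(x in D) (g x * w x * c x ^+ m).
Proof.
move=> mD mE ED iw w0 igc c0 hE hD d0 r20 r21 B0 wE.
have r10 : 0 <= r1 by apply: le_trans (ltW r21).
have iwE : nu.-integrable E (EFin \o w) by apply: integrableS iw.
have mDE : measurable (D `\` E) by exact: measurableD.
have sDE : D `\` E `<=` D by move=> x [].
have iwDE : nu.-integrable (D `\` E) (EFin \o w) by apply: integrableS iw.
have dwE : 0 < d * \int[nu]_(x in E) w x by rewrite mulr_gt0.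
(* The part on [E] has to beat both the prescribed [C] and the possible negative part outside
   [E]. *)
have [m hm] := geometric_domination (C + B * \int[nu]_(x in D `\` E) w x) r20 r21 dwE.
exists m; have iE : nu.-integrable E (EFin \o (fun x => g x * w x * c x ^+ m)) by apply: integrableS (igc m).
have iDE : nu.-integrable (D `\` E) (EFin \o (fun x => g x * w x * c x ^+ m)) by apply: integrableS (igc m).
have -> : \int[nu]_(x in D) (g x * w x * c x ^+ m) =
  \int[nu]_(x in E) (g x * w x * c x ^+ m) + \int[nu]_(x in D `\` E) (g x * w x * c x ^+ m).
  have {1}-> : D = E `|` (D `\` E) by rewrite setDUK.
  rewrite Rintegral_setU //; first by rewrite setDUK.
  by apply/disj_setPS => x [Ex []].
have h1 : d * r1 ^+ m * \int[nu]_(x in E) w x <= \int[nu]_(x in E) (g x * w x * c x ^+ m).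
  rewrite -RintegralZl //; apply: le_Rintegral => //.
    exact: Rintegrable_scale.
  move=> x Ex; have [h1 h2] := hE _ Ex; have wx := w0 _ (ED _ Ex).
  have -> : d * r1 ^+ m * w x = d * w x * r1 ^+ m by ring.
  apply: ler_pM; rewrite ?mulr_ge0 ?exprn_ge0 ?(ltW d0) //; first by rewrite ler_wpM2r.
  by rewrite lerXn2r // nnegrE // (le_trans r10).
have h2 : - (B * r2 ^+ m) * \int[nu]_(x in D `\` E) w x <= \int[nu]_(x in D `\` E) (g x * w x * c x ^+ m).
  rewrite -RintegralZl //; apply: le_Rintegral => //.
    exact: Rintegrable_scale.
  move=> x [Dx _]; have wx := w0 _ Dx; have cx := c0 _ Dx.
  have Br : 0 <= B * r2 ^+ m * w x by rewrite !mulr_ge0 // exprn_ge0.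
  case: (hD _ Dx) => [gx|[gB cr]].
    by rewrite mulNr (@le_trans _ _ 0) ?oppr_le0 // !mulr_ge0 // exprn_ge0.
  rewrite mulNr lerNl; apply: le_trans (ler_norm _) _.
  rewrite normrN !normrM (ger0_norm wx) normrX (ger0_norm cx) [leRHS]mulrAC.
  apply: ler_pM; rewrite ?mulr_ge0 ?exprn_ge0 //; first by rewrite ler_wpM2r.
  by rewrite lerXn2r // nnegrE.
apply: lt_le_trans (lerD h1 h2); move: hm; lra.
Qed.

End MeasureSpace.

Implicit Types T : R.

(** The phase puts cosines ([p = 0]) and sines ([p = pi / 2]) into one family closed under
    shifts. *)
Definition wave (T : R) (k : nat) (p : R) (x : R) : R := cos (freq T k * x - p).

Inductive trig (T : R) : (R -> R) -> Prop :=
| trig0 : trig T (fun=> 0)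
| trigS f c k p : trig T f -> trig T (fun x => f x + c * wave T k p x).

Definition itg (T : R) (f : R -> R) : R := T^-1 * \int[mu]_(x in per_int T) f x.

Lemma continuous_wave T k p : continuous (wave T k p).
Proof.
move=> x; apply: continuous_comp; last exact: continuous_cos.
apply: cvgB; last exact: cvg_cst.
by apply: cvgM; [exact: cvg_cst|exact: cvg_id].
Qed.

Lemma trig_continuous T f : trig T f -> continuous f.
Proof.
elim=> [|g c k p _ gc] x; first exact: cvg_cst.
apply: cvgD; first exact: gc.
by apply: cvgM; [exact: cvg_cst|exact: continuous_wave].
Qed.

Lemma wave_le1 T k p x : `|wave T k p x| <= 1.
Proof. exact: cos_max. Qed.

Lemma trig_ext T f g : trig T f -> f =1 g -> trig T g.
Proof. by move=> h /funext <-. Qed.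

Lemma trigD T f g : trig T f -> trig T g -> trig T (fun x => f x + g x).
Proof.
move=> tf; elim=> [|h c k p _ IH]; first by apply: trig_ext tf _ => x; rewrite addr0.
by apply: trig_ext (trigS c k p IH) _ => x; rewrite addrA.
Qed.

Lemma trigZ T f a : trig T f -> trig T (fun x => a * f x).
Proof.
elim=> [|h c k p _ IH]; first by apply: trig_ext (trig0 T) _ => x; rewrite mulr0.
by apply: trig_ext (trigS (a * c) k p IH) _ => x; rewrite mulrDr mulrA.
Qed.

Lemma trig_wave T k p : trig T (wave T k p).
Proof. by apply: trig_ext (trigS 1 k p (trig0 T)) _ => x; rewrite add0r mul1r. Qed.

Lemma trig_cst T c : trig T (fun=> c).
Proof.
apply: trig_ext (trigZ c (trig_wave T 0 0)) _ => x.
by rewrite /wave /freq !(mulr0, mul0r) subr0 cos0 mulr1.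
Qed.

Lemma wave_prod T k p l q x : (l <= k)%N ->
  wave T k p x * wave T l q x = 2^-1 * (wave T (k - l) (p - q) x + wave T (k + l) (p + q) x).
Proof.
move=> lk; rewrite /wave.
have -> : freq T (k - l) * x - (p - q) = (freq T k * x - p) - (freq T l * x - q).
  by rewrite /freq natrB //; ring.
have -> : freq T (k + l) * x - (p + q) = (freq T k * x - p) + (freq T l * x - q).
  by rewrite /freq natrD; ring.
by move: (_ - p) (_ - q) => A B; rewrite cosB cosD; field.
Qed.

Lemma trig_wave_prod T k p l q : trig T (fun x => wave T k p x * wave T l q x).
Proof.
wlog lk : k p l q / (l <= k)%N.
  move=> h; have [lk|kl] := leqP l k; first exact: h.
  by apply: trig_ext (h l q k p (ltnW kl)) _ => x; rewrite mulrC.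
apply: trig_ext (trigZ 2^-1 (trigD (trig_wave T (k - l) (p - q)) (trig_wave T (k + l) (p + q)))) _.
by move=> x; rewrite wave_prod.
Qed.

Lemma trigM T f g : trig T f -> trig T g -> trig T (fun x => f x * g x).
Proof.
move=> tf; elim=> [|h c k p _ IH]; first by apply: trig_ext (trig0 T) _ => x; rewrite mulr0.
suff tw : trig T (fun x => f x * wave T k p x).
  by apply: trig_ext (trigD IH (trigZ c tw)) _ => x; ring.
elim: tf => [|f' c' k' p' _ IH']; first by apply: trig_ext (trig0 T) _ => x; rewrite mul0r.
apply: trig_ext (trigD IH' (trigZ c' (trig_wave_prod T k' p' k p))) _ => x; ring.
Qed.

Lemma trigX T f m : trig T f -> trig T (fun x => f x ^+ m).
Proof.
move=> tf; elim: m => [|m IH]; first by apply: trig_ext (trig_cst T 1) _ => x; rewrite expr0.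
by apply: trig_ext (trigM tf IH) _ => x; rewrite exprS.
Qed.

Lemma per_int_measurable (T : R) : measurable (per_int T).
Proof. exact: measurable_itv. Qed.

Lemma within_integrable (a b : R) f : {within `[a, b], continuous f} ->
  mu.-integrable `[a, b] (EFin \o f).
Proof. by move=> cf; apply: continuous_compact_integrable => //; exact: segment_compact. Qed.

Lemma withinM (A : set R) (f g : R -> R) : {within A, continuous f} -> {within A, continuous g} ->
  {within A, continuous (fun x => f x * g x)}.
Proof. by move=> cf cg x; apply: (@continuousM _ (subspace A) f g x); [exact: cf|exact: cg]. Qed.

Lemma continuous_within (A : set R) (f : R -> R) : continuous f -> {within A, continuous f}.
Proof. by move=> cf; apply: continuous_subspaceT. Qed.

Definition wc (T : R) (f : R -> R) : Prop := {within per_int T, continuous f}.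

Lemma wc_integrable T f : wc T f -> mu.-integrable (per_int T) (EFin \o f).
Proof. exact: within_integrable. Qed.

Lemma wcM T f g : wc T f -> wc T g -> wc T (fun x => f x * g x).
Proof. exact: withinM. Qed.

Lemma wcD T f g : wc T f -> wc T g -> wc T (fun x => f x + g x).
Proof. by move=> cf cg x; apply: (@continuousD _ _ (subspace (per_int T)) f g x); [exact: cf|exact: cg]. Qed.

Lemma wcZ T c f : wc T f -> wc T (fun x => c * f x).
Proof. by move=> cf; apply: wcM => //; apply: continuous_within => x; exact: cvg_cst. Qed.

Lemma wc_cont T f : continuous f -> wc T f.
Proof. exact: continuous_within. Qed.

Lemma per_measure T : 0 < T -> fine (mu (per_int T)) = T.
Proof. by move=> T0; rewrite lebesgue_measure_itv /= lte_fin T0 -EFinB subr0. Qed.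

Lemma itgD T f g : wc T f -> wc T g -> itg T (fun x => f x + g x) = itg T f + itg T g.
Proof.
move=> cf cg; rewrite /itg RintegralD ?mulrDr //; first exact: measurable_itv.
- exact: wc_integrable.
- exact: wc_integrable.
Qed.

Lemma itgZ T c f : wc T f -> itg T (fun x => c * f x) = c * itg T f.
Proof.
move=> cf; rewrite /itg RintegralZl; [exact: mulrCA|exact: measurable_itv|exact: wc_integrable].
Qed.

Lemma itg_le T f g : 0 < T -> wc T f -> wc T g -> (forall x, per_int T x -> f x <= g x) ->
  itg T f <= itg T g.
Proof.
move=> T0 cf cg fg; rewrite /itg ler_wpM2l ?invr_ge0 ?(ltW T0) //.
apply: le_Rintegral => //; first exact: measurable_itv.
- exact: wc_integrable.
- exact: wc_integrable.
Qed.

Lemma itg_cst T c : 0 < T -> itg T (fun=> c) = c.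
Proof.
move=> T0; rewrite /itg Rintegral_cst; last exact: measurable_itv.
by rewrite per_measure // mulrCA mulVf ?mulr1 // gt_eqF.
Qed.

Lemma itg_bound T f M : 0 < T -> wc T f -> (forall x, per_int T x -> `|f x| <= M) -> `|itg T f| <= M.
Proof.
move=> T0 cf fM; have cM c : wc T (fun=> c) by apply: wc_cont => x; exact: cvg_cst.
rewrite ler_norml -(itg_cst M T0) -mulN1r -itgZ //; apply/andP; split;
  apply: itg_le => //; try exact: wcZ; move=> x /fM; rewrite ler_norml => /andP[h1 h2] //.
by rewrite mulN1r.
Qed.

Lemma eq_itg T f g : (forall x, per_int T x -> f x = g x) -> itg T f = itg T g.
Proof. by move=> h; rewrite /itg; congr (_ * _); apply: eq_Rintegral => x /[!inE]; exact: h. Qed.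

Lemma FTC_global (f F : R -> R) (a b : R) : a < b -> continuous f ->
  (forall x : R, is_derive x 1 F (f x)) -> \int[mu]_(x in `[a, b]) f x = F b - F a.
Proof.
move=> ab cf dF; have cF : continuous F.
  by move=> x; apply: differentiable_continuous; apply/derivable1_diffP; case: (dF x).
rewrite /Rintegral (@continuous_FTC2 R f F) //.
- exact: continuous_within.
- by split=> [x _||]; [case: (dF x)|apply: cvg_at_right_filter; exact: cF|apply: cvg_at_left_filter; exact: cF].
- by move=> x _; rewrite derive1E; case: (dF x).
Qed.

Lemma is_derive_wave T k p (x : R) :
  is_derive x 1 (wave T k p) (- freq T k * sin (freq T k * x - p)).
Proof.
have h : is_derive x 1 (fun y : R => freq T k * y - p) (freq T k).
  have -> : (fun y : R => freq T k * y - p) = (freq T k *: @id R) - cst p by apply/funext.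
  apply: is_derive_eq; rewrite subr0; exact: mulr1.
rewrite /wave; apply: is_derive_eq; by rewrite !mulNr mulrC.
Qed.

Lemma freq_gt0 T k : 0 < T -> (0 < k)%N -> 0 < freq T k.
Proof.
by move=> T0 k0; rewrite /freq divr_gt0 // !mulr_gt0 ?pi_gt0 // ltr0n.
Qed.

Lemma freqT T k : 0 < T -> freq T k * T = 2 * pi * k%:R.
Proof. by move=> T0; rewrite /freq divfK // gt_eqF. Qed.

Lemma wave_periodic T k p x : 0 < T -> wave T k p (x + T) = wave T k p x.
Proof.
move=> T0; rewrite /wave mulrDr freqT // addrAC; exact: cosD2pin.
Qed.

Lemma itg_wave T k p : 0 < T -> itg T (wave T k p) = if k == 0%N then cos p else 0.
Proof.
move=> T0; case: eqP => [->|/eqP k0].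
  rewrite -[RHS](itg_cst (cos p) T0); apply: eq_itg => x _.
  by rewrite /wave /freq mulr0 mul0r mul0r sub0r cosN.
have f0 : freq T k != 0 by rewrite gt_eqF // freq_gt0 // lt0n.
pose F := (freq T k)^-1 *: wave T k (p + pi / 2).
have dF (x : R) : is_derive x 1 F (wave T k p x).
  have h := is_derive_wave T k (p + pi / 2) x.
  apply: is_derive_eq; rewrite /wave opprD addrA sinBpihalf.
  by rewrite -[LHS]/(_ * _) mulrNN mulrA mulVf ?mul1r.
rewrite /itg (FTC_global T0 (@continuous_wave T k p) dF).
have := @wave_periodic T k (p + pi / 2) 0 T0; rewrite add0r => e.
by rewrite /F -[X in X - _]/(_ * _) e subrr mulr0.
Qed.

Lemma trig_itg0 T g f : wc T g -> (forall k p, itg T (fun x => g x * wave T k p x) = 0) ->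
  trig T f -> itg T (fun x => g x * f x) = 0.
Proof.
move=> cg h tf; elim: tf => [|f' c k p tf' IH].
  transitivity (itg T (fun x => 0 * g x)); first by apply: eq_itg => x _; rewrite mulr0 mul0r.
  by rewrite itgZ // mul0r.
have cw : wc T (fun x => g x * wave T k p x).
  by apply: wcM => //; apply: wc_cont; exact: continuous_wave.
have cf' : wc T (fun x => g x * f' x).
  by apply: wcM => //; apply: wc_cont; exact: trig_continuous tf'.
transitivity (itg T (fun x => g x * f' x + c * (g x * wave T k p x))).
  by apply: eq_itg => x _; ring.
by rewrite itgD ?itgZ ?h ?IH ?mulr0 ?addr0 //; exact: wcZ.
Qed.

(** The squared cosine of half the angle to [x0]: a trigonometric polynomial with values between [0]
    and [1] and peak [1] at [x0], whose powers concentrate there. [bump_at] below is its value at a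
    given distance from the peak. *)
Definition bump (T x0 : R) (x : R) : R := (1 + wave T 1 (freq T 1 * x0) x) / 2.

Lemma trig_bump T x0 : trig T (bump T x0).
Proof.
have := trigD (trig_cst T 2^-1) (trigZ 2^-1 (trig_wave T 1 (freq T 1 * x0))).
by move/trig_ext; apply => x; rewrite /bump; field.
Qed.

Lemma bump01 T x0 x : 0 <= bump T x0 x <= 1.
Proof. by have := wave_le1 T 1 (freq T 1 * x0) x; rewrite ler_norml /bump => /andP[h1 h2]; apply/andP; split; lra. Qed.

Lemma freq1T T : 0 < T -> freq T 1 = 2 * pi / T.
Proof. by rewrite /freq mulr1. Qed.

Lemma cos_decr (x y : R) : 0 <= x -> x < y -> y <= pi -> cos y < cos x.
Proof. by move=> x0 xy yp; rewrite ltr_cos // in_itv /=; apply/andP; split; lra. Qed.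

Definition bump_at (T e : R) : R := (1 + cos (freq T 1 * e)) / 2.

Lemma bump_at_decr T d e : 0 < T -> 0 <= d -> d < e -> e <= T / 2 -> bump_at T e < bump_at T d.
Proof.
move=> T0 d0 de eT; rewrite /bump_at ltr_pM2r // ltrD2l.
have w0 : 0 < freq T 1 by apply: freq_gt0.
apply: cos_decr; [exact: mulr_ge0 (ltW w0) d0|by rewrite ltr_pM2l|].
apply: (@le_trans _ _ (freq T 1 * (T / 2))); first by rewrite ler_pM2l.
by rewrite freq1T // le_eqVlt; apply/orP; left; apply/eqP; field; rewrite gt_eqF.
Qed.

Lemma bump_at_ge0 T e : 0 <= bump_at T e.
Proof. rewrite /bump_at; have := cos_geN1 (freq T 1 * e); lra. Qed.

Lemma bump_near T x0 x e : 0 < T -> e <= T / 2 -> `|x - x0| <= e -> bump_at T e <= bump T x0 x.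
Proof.
move=> T0 eT; rewrite le_eqVlt => /orP[/eqP <-|xe].
  rewrite /bump /bump_at /wave -mulrBr -(cos_norm (_ * (x - x0))) normrM (gtr0_norm (freq_gt0 T0 _)) //.
have := bump_at_decr T0 (normr_ge0 (x - x0)) xe eT.
by rewrite {2}/bump_at /bump /wave -mulrBr -(cos_norm (_ * (x - x0))) normrM (gtr0_norm (freq_gt0 T0 _)) // => /ltW.
Qed.

Lemma bump_far T x0 x e : 0 < T -> 0 <= e -> e <= x0 -> x0 <= T - e -> per_int T x -> e <= `|x - x0| ->
  bump T x0 x <= bump_at T e.
Proof.
move=> T0 e0 ex xT; rewrite /per_int /= in_itv /= => /andP[x1 x2] xe.
have E : bump T x0 x = bump_at T `|x - x0|.
  by rewrite /bump_at /bump /wave -mulrBr -(cos_norm (_ * (x - x0))) normrM (gtr0_norm (freq_gt0 T0 _)).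
have Te : e <= T / 2 by lra.
have [h|h] := leP `|x - x0| (T / 2).
  rewrite E; move: xe; rewrite le_eqVlt => /orP[/eqP <- //|xe].
  by apply: ltW; apply: bump_at_decr.
(* Beyond half a period the distance is measured the other way round; as [e <= x0 <= T - e], it is
   still at least [e]. *)
have -> : bump T x0 x = bump_at T (T - `|x - x0|).
  rewrite E /bump_at; congr ((1 + _) / _); rewrite mulrBr freqT // mulr1.
  rewrite -[LHS]cosN -[LHS](cosD2pin _ 1) mulr1; congr cos; ring.
have [h1 h2] : 0 <= T - `|x - x0| /\ e <= T - `|x - x0|.
  by have [h3|h3] := leP 0 (x - x0); [rewrite ger0_norm //|rewrite ltr0_norm //]; split; lra.
move: h2; rewrite le_eqVlt => /orP[/eqP <- //|h2].
by apply: ltW; apply: bump_at_decr => //; lra.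
Qed.

Lemma wc_bounded T f : wc T f -> exists B, 0 <= B /\ forall x, per_int T x -> `|f x| <= B.
Proof.
move=> cf; have /compact_bounded[M [_ mrt]] := continuous_compact cf (@segment_compact R 0 T).
exists (`|M| + 1); split; first by rewrite addr_ge0.
move=> x xT; apply: (mrt (`|M| + 1)); last by exists x.
by apply: (le_lt_trans (ler_norm M)); rewrite ltrDl.
Qed.

Lemma wc_near T f x0 d : 0 < x0 < T -> wc T f -> f x0 > d ->
  exists e, [/\ 0 < e, e <= x0, x0 <= T - e & forall x, `|x - x0| <= e -> d < f x].
Proof.
move=> /andP[x00 x0T] cf fd.
have cx : {for x0, continuous f}.
  have /continuous_within_itvP[//|h _ _] := cf; first exact: lt_trans x0T.
  by apply: h; rewrite in_itv /= x00 x0T.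
have : \forall x \near x0, d < f x by apply: (cvgr_gt _ cx).
move=> /nbhs_ballP[e /= e0 he].
pose e' := Num.min (e / 2) (Num.min x0 (T - x0)).
exists e'; split.
- by rewrite !lt_min divr_gt0 //= x00 subr_gt0.
- by rewrite /e' !ge_min lexx /= orbT.
- by rewrite lerBrDl -lerBrDr /e' !ge_min lexx !orbT.
- move=> x xe; apply: he; rewrite /ball /= distrC (le_lt_trans xe) //.
  by rewrite /e' gt_min ltr_pdivrMr // ltr_pMr // ltr1n.
Qed.

Lemma Rint_pos_interval (a b : R) : a < b -> 0 < \int[mu]_(x in `[a, b]) (1 : R).
Proof.
move=> ab; rewrite Rintegral_cst; last exact: measurable_itv.
rewrite mul1r; have e : fine (mu `[a, b]) = b - a.
  by rewrite lebesgue_measure_itv /= lte_fin ab -EFinB.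
by rewrite [X in _ < X]e subr_gt0.
Qed.

(* If [g] is nonzero at [x0], testing against powers of a peaked trigonometric
   polynomial beats any geometric rate attached to the outside of a neighbourhood. *)
Lemma itg_peak T g x0 e0 C : 0 < x0 < T -> wc T g -> 0 < g x0 -> 0 < e0 ->
  exists e m, [/\ 0 < e <= e0, e <= x0, x0 <= T - e & C * bump_at T e ^+ m < itg T (fun x => g x * bump T x0 x ^+ m)].
Proof.
move=> xT cg g0 e00; have T0 : 0 < T by case/andP: xT => a b; exact: lt_trans b.
have gd : g x0 / 2 < g x0 by lra.
have [e1 [e10 ex xe h]] := wc_near xT cg gd.
pose e := Num.min e0 e1.
have e_0 : 0 < e by rewrite lt_min e00.
have ee1 : e <= e1 by rewrite ge_min lexx orbT.
have [B [B0 hB]] := wc_bounded cg.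
have eT : e <= T / 2 by lra.
have cb m : wc T (fun x => g x * bump T x0 x ^+ m).
  apply: wcM => //; apply: wc_cont; apply: trig_continuous; apply: trigX; exact: trig_bump.
(* The set [E] has half the radius, so that on it the bump is strictly larger than at distance
   [e]. *)
have [] := @peak _ _ mu (per_int T) `[x0 - e / 2, x0 + e / 2] g (fun=> 1) (bump T x0) B (g x0 / 2)
  (bump_at T (e / 2)) (bump_at T e) (C * T).
- exact: measurable_itv.
- exact: measurable_itv.
- move=> x /=; rewrite /per_int /= !in_itv /= => /andP[h1 h2]; apply/andP; split; lra.
- by apply: wc_integrable; apply: wc_cont => x; exact: cvg_cst.
- by [].
- by move=> m; under eq_fun do rewrite mulr1; apply: wc_integrable.
- by move=> x _; case/andP: (bump01 T x0 x).
- move=> x /=; rewrite in_itv /= => /andP[h1 h2].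
  have xx : `|x - x0| <= e / 2 by rewrite ler_norml; apply/andP; split; lra.
  split; first by apply/ltW/h; lra.
  by apply: bump_near => //; lra.
- move=> x xT'; have [xx|xx] := leP `|x - x0| e.
    by left; have := h x (le_trans xx ee1); lra.
  right; split; first exact: hB.
  by apply: bump_far => //; lra.
- lra.
- exact: bump_at_ge0.
- by apply: bump_at_decr => //; lra.
- by [].
- by apply: Rint_pos_interval; lra.
move=> m hm; exists e, m; split; [by rewrite e_0 ge_min lexx|lra|lra|].
rewrite /itg; under eq_Rintegral do rewrite -[g _]mulr1.
by rewrite [ltRHS]mulrC ltr_pdivlMr // mulrAC.
Qed.

(** Powers of [bump] are trigonometric polynomials, so a positive or negative value inside would
    give a nonzero integral; the end points follow by continuity. *)
Lemma wave_unique T g : 0 < T -> wc T g -> (forall k p, itg T (fun x => g x * wave T k p x) = 0) ->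
  forall x, per_int T x -> g x = 0.
Proof.
move=> T0.
have half h : wc T h -> (forall k p, itg T (fun x => h x * wave T k p x) = 0) ->
    forall x, 0 < x < T -> h x <= 0.
  move=> ch hh x xT; rewrite leNgt; apply/negP => hx.
  have [e [m [_ _ _]]] := itg_peak 0 xT ch hx ltr01.
  by rewrite mul0r (trig_itg0 ch hh (trigX m (trig_bump T x))) ltxx.
move=> cg hg; have int0 x : 0 < x < T -> g x = 0.
  move=> xT; apply/eqP; rewrite eq_le half //=.
  have := half (fun x => -1 * g x) (wcZ (c := -1) cg) _ x xT.
  rewrite mulN1r oppr_le0; apply => k p.
  have cw : wc T (fun x => g x * wave T k p x).
    by apply: wcM => //; apply: wc_cont; exact: continuous_wave.
  transitivity (itg T (fun x => -1 * (g x * wave T k p x))).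
    by apply: eq_itg => y _; rewrite mulrA.
  by rewrite itgZ // hg mulr0.
have /continuous_within_itvP[//|_ c0 cT] := cg.
move=> x; rewrite /per_int /= in_itv /= => /andP[x0 xT].
move: x0; rewrite le_eqVlt => /orP[/eqP <-|x0].
  apply: (@cvg_unique _ _ (g x @[x --> 0^'+])) => //.
  apply: cvg_near_cst; near=> y; apply: int0; apply/andP; split=> //.
move: xT; rewrite le_eqVlt => /orP[/eqP ->|xT]; last by apply: int0; rewrite x0.
apply: (@cvg_unique _ _ (g x @[x --> T^'-])) => //.
by apply: cvg_near_cst; near=> y; apply: int0; apply/andP; split.
Unshelve. all: by end_near.
Qed.

End Fourier.

(** * Uniform approximation, and functionals given by their Fourier coefficients *)

Section Functionals.
Variable R : realType.
Notation mu := (@lebesgue_measure R).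
Implicit Types (T : R) (f g : R -> R) (Phi : (R -> R) -> R).

(* Continuous and [T]-periodic, in the form of uniform approximability. *)
Definition UA T f : Prop :=
  forall e, 0 < e -> exists2 g, trig T g & forall x, `|f x - g x| <= e.

Lemma UA_ext T f g : UA T f -> f =1 g -> UA T g.
Proof. by move=> h /funext <-. Qed.

Lemma UA_trig T f : trig T f -> UA T f.
Proof. by move=> tf e e0; exists f => // x; rewrite subrr normr0 ltW. Qed.

Lemma UA_wave T k p : UA T (wave T k p).
Proof. exact/UA_trig/trig_wave. Qed.

Lemma UA_cst T c : UA T (fun=> c).
Proof. exact/UA_trig/trig_cst. Qed.

Lemma trig_bounded T f : trig T f -> exists B, 0 <= B /\ forall x, `|f x| <= B.
Proof.
elim=> [|g c k p _ [B [B0 h]]]; first by exists 0; split=> // x; rewrite normr0.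
exists (B + `|c|); split=> [|x]; first by rewrite addr_ge0.
apply: le_trans (ler_normD _ _) _; rewrite lerD // normrM ler_piMr //; exact: wave_le1.
Qed.

Lemma UA_bounded T f : UA T f -> exists B, 0 <= B /\ forall x, `|f x| <= B.
Proof.
move=> /(_ 1 ltr01)[g /trig_bounded[B [B0 hB]] fg].
exists (B + 1); split=> [|x]; first by rewrite addr_ge0.
by rewrite -(subrK (g x) (f x)) (le_trans (ler_normD _ _)) // addrC lerD.
Qed.

Lemma UAD T f g : UA T f -> UA T g -> UA T (fun x => f x + g x).
Proof.
move=> hf hg e e0; have e20 : 0 < e / 2 by rewrite divr_gt0.
have [f' tf hf'] := hf _ e20; have [g' tg hg'] := hg _ e20.
exists (fun x => f' x + g' x); first exact: trigD.
move=> x; rewrite opprD addrACA (le_trans (ler_normD _ _)) //.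
by rewrite [leRHS](splitr e) lerD.
Qed.

Lemma UAM T f g : UA T f -> UA T g -> UA T (fun x => f x * g x).
Proof.
move=> hf hg e e0; have [A [A0 hA]] := UA_bounded hf.
have e1 : 0 < e / (2 * (A + 1)) by rewrite divr_gt0 // mulr_gt0 // ltr_wpDl.
have [g' tg hg'] := hg _ e1; have [B [B0 hB]] := trig_bounded tg.
have e2 : 0 < e / (2 * (B + 1)) by rewrite divr_gt0 // mulr_gt0 // ltr_wpDl.
have [f' tf hf'] := hf _ e2.
exists (fun x => f' x * g' x); first exact: trigM.
move=> x; have -> : f x * g x - f' x * g' x = f x * (g x - g' x) + (f x - f' x) * g' x by ring.
apply: le_trans (ler_normD _ _) _; rewrite !normrM [leRHS](splitr e).
have aux (y z C : R) : 0 <= y -> 0 <= z -> 0 <= C -> y <= C -> z <= e / (2 * (C + 1)) -> y * z <= e / 2.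
  move=> y0 z0 C0 yC zC; apply: (@le_trans _ _ (C * (e / (2 * (C + 1))))); first exact: ler_pM.
  have -> : C * (e / (2 * (C + 1))) = (e / 2) * (C / (C + 1)) by field; rewrite gt_eqF // ltr_wpDl.
  by rewrite ler_piMr ?divr_ge0 ?(ltW e0) // ler_pdivrMr ?ltr_wpDl // mul1r lerDl.
by apply: lerD; [apply: aux (hA x) (hg' x)|rewrite mulrC; apply: aux (hB x) (hf' x)].
Qed.

Lemma UAZ T c f : UA T f -> UA T (fun x => c * f x).
Proof. by move=> hf; apply: UAM => //; exact: UA_cst. Qed.

Lemma UA_sum T (n : nat) (F : nat -> R -> R) : (forall i, (i < n)%N -> UA T (F i)) ->
  UA T (fun x => \sum_(i < n) F i x).
Proof.
elim: n => [|n IH] h; first by apply: UA_ext (UA_cst T 0) _ => x; rewrite big_ord0.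
apply: UA_ext (UAD (IH (fun i ni => h i (ltnW ni))) (h n (ltnSn n))) _ => x.
by rewrite big_ord_recr.
Qed.

Lemma UA_lim T f : (forall e, 0 < e -> exists2 g, UA T g & forall x, `|f x - g x| <= e) -> UA T f.
Proof.
move=> h e e0; have e20 : 0 < e / 2 by rewrite divr_gt0.
have [g hg fg] := h _ e20; have [g' tg gg'] := hg _ e20.
exists g' => // x; rewrite -(subrKA (g x)) (le_trans (ler_normD _ _)) //.
by rewrite [leRHS](splitr e) lerD.
Qed.

Lemma UA_continuous T f : UA T f -> continuous f.
Proof.
move=> h x; apply/cvgrPdist_le => e e0.
have e3 : 0 < e / 3 by rewrite divr_gt0.
have [g /trig_continuous cg fg] := h _ e3.
have := cg x; move/cvgrPdist_le => /(_ _ e3) gx.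
near=> y; have gxy : `|g x - g y| <= e / 3 by near: y.
have -> : f x - f y = (f x - g x) + (g x - g y) - (f y - g y) by ring.
apply: le_trans (ler_normB _ _) _; apply: le_trans (lerD (ler_normD _ _) (lexx _)) _.
by have := fg x; have := fg y; lra.
Unshelve. all: by end_near.
Qed.

Lemma UA_wc T f : UA T f -> wc T f.
Proof. by move=> /UA_continuous h; exact: wc_cont. Qed.

Lemma trig_periodic T f : 0 < T -> trig T f -> forall x, f (x + T) = f x.
Proof. by move=> T0; elim=> [|g c k p _ IH] x //; rewrite IH wave_periodic. Qed.

Lemma le_all_eps (x : R) : (forall e, 0 < e -> x <= e) -> x <= 0.
Proof. by move=> h; apply/ler_addgt0Pr => e e0; rewrite add0r h. Qed.

Lemma UA_periodic T f : 0 < T -> UA T f -> forall x, f (x + T) = f x.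
Proof.
move=> T0 h x; apply/eqP; rewrite -subr_eq0 -normr_eq0 eq_le normr_ge0 andbT.
apply: le_all_eps => e e0; have e20 : 0 < e / 2 by rewrite divr_gt0.
have [g tg fg] := h _ e20.
have -> : f (x + T) - f x = (f (x + T) - g (x + T)) - (f x - g x).
  by rewrite (trig_periodic T0 tg); ring.
by apply: le_trans (ler_normB _ _) _; rewrite [leRHS](splitr e) lerD.
Qed.

Lemma le_all_harmonic (x C : R) (d0 : nat) : (forall d, (d0 <= d)%N -> x <= C / d.+1%:R) -> x <= 0.
Proof.
move=> h; apply: le_all_eps => e e0.
pose d := (d0 + (Num.truncn (`|C| / e)).+1)%N.
apply: le_trans (h d (leq_addr _ _)) _; apply: (le_trans (ler_norm _)).
rewrite normrM (ger0_norm (_ : 0 <= d.+1%:R^-1)) ?invr_ge0 // ler_pdivrMr ?ltr0Sn //.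
rewrite mulrC -ler_pdivrMr //; apply: (le_trans (ltW (truncnS_gt _))).
by rewrite ler_nat ltnS /d addnS leqW // leq_addl.
Qed.

(** Of the [j + 2] factors, [j] are bounded by their value at [d], and the last two telescope: an
    inverse square is at most twice the difference of consecutive inverses. Hence the constant
    [4]. *)
Lemma series_tail (F : nat -> R) (j : nat) C : (forall k, `|F k| <= 2 * (C / k.+1%:R ^+ (j + 2))) ->
  forall d d', (d <= d')%N -> `|\sum_(k < d') F k - \sum_(k < d) F k| <= 4 * C / d.+1%:R ^+ j.+1.
Proof.
move=> hC d d' /subnKC <-.
have C0 : 0 <= C by have := le_trans (normr_ge0 _) (hC 0%N); rewrite expr1n divr1 pmulr_rge0.
have E0 : 0 <= C / d.+1%:R ^+ j by rewrite divr_ge0 // exprn_ge0.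
suff h e : `|\sum_(k < d + e) F k - \sum_(k < d) F k| <=
    4 * (C / d.+1%:R ^+ j) * (d.+1%:R^-1 - (d + e).+1%:R^-1).
  apply: le_trans (h _) _; rewrite exprS invfM.
  have p0 : 0 <= (d + (d' - d)).+1%:R^-1 :> R by rewrite invr_ge0.
  rewrite [leRHS](_ : _ = 4 * (C / d.+1%:R ^+ j) * d.+1%:R^-1); last by ring.
  by apply: ler_wpM2l; [exact: mulr_ge0|rewrite lerBlDr lerDl].
elim: e => [|e IH]; first by rewrite addn0 !subrr normr0 mulr0.
rewrite addnS big_ord_recr /= addrAC.
apply: le_trans (ler_normD _ _) _; apply: le_trans (lerD IH (hC _)) _.
set k := (d + e)%N.
have k1 : 0 < k.+1%:R :> R by rewrite ltr0Sn.
have d1 : 0 < d.+1%:R :> R by rewrite ltr0Sn.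
have k2 : k.+2%:R = k.+1%:R + 1 :> R by rewrite -natr1.
have dk : d.+1%:R <= k.+1%:R :> R by rewrite ler_nat ltnS leq_addr.
have h1 : C / k.+1%:R ^+ (j + 2) <= C / d.+1%:R ^+ j * k.+1%:R ^- 2.
  rewrite exprD invfM mulrA ler_wpM2r ?invr_ge0 ?exprn_ge0 //.
  rewrite ler_wpM2l // lef_pV2 ?posrE ?exprn_gt0 //.
  by rewrite lerXn2r // nnegrE ltW.
have h2 : k.+1%:R ^- 2 <= 2 * (k.+1%:R^-1 - k.+2%:R^-1) :> R.
  rewrite k2; have -> : 2 * (k.+1%:R^-1 - (k.+1%:R + 1)^-1) = (2 * k.+1%:R / (k.+1%:R + 1)) * k.+1%:R ^- 2 :> R.
    by field; rewrite !gt_eqF //; lra.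
  rewrite ler_peMl ?invr_ge0 ?exprn_ge0 // ler_pdivlMr; last by lra.
  by have : 1 <= k.+1%:R :> R; [rewrite ler1n|lra].
have h3 : C / d.+1%:R ^+ j * k.+1%:R ^- 2 <= C / d.+1%:R ^+ j * (2 * (k.+1%:R^-1 - k.+2%:R^-1)).
  by rewrite ler_wpM2l.
have h4 : 2 * (C / k.+1%:R ^+ (j + 2)) <= 2 * (C / d.+1%:R ^+ j * (2 * (k.+1%:R^-1 - k.+2%:R^-1))).
  by rewrite ler_pM2l //; exact: le_trans h1 h3.
apply: le_trans (lerD (lexx _) h4) _; rewrite le_eqVlt; apply/orP; left; apply/eqP; ring.
Qed.

(** Integration against a continuous function and weak limits of grid functions are both of this
    kind, so regularity is proved once for both. *)
Record functional T Phi (B : R) : Prop := Functional {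
  functionalD : forall f g, UA T f -> UA T g -> Phi (fun x => f x + g x) = Phi f + Phi g;
  functionalZ : forall c f, UA T f -> Phi (fun x => c * f x) = c * Phi f;
  functional_bound : forall f M, UA T f -> (forall x, `|f x| <= M) -> `|Phi f| <= B * M;
  functional_B0 : 0 <= B }.

Section OneFunctional.
Variables (T : R) (Phi : (R -> R) -> R) (B : R).
Hypothesis (hPhi : functional T Phi B).

Lemma eq_functional f g : f =1 g -> Phi f = Phi g.
Proof. by move=> /funext ->. Qed.

Lemma functionalB f g : UA T f -> UA T g -> Phi (fun x => f x - g x) = Phi f - Phi g.
Proof.
move=> uf ug; rewrite -mulN1r -(functionalZ hPhi) // -(functionalD hPhi) //; last exact: UAZ.
by apply: eq_functional => x; rewrite mulN1r.
Qed.

Lemma functional0 : Phi (fun=> 0) = 0.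
Proof.
transitivity (Phi (fun=> 0 * 0)); first by apply: eq_functional => x; rewrite mul0r.
by rewrite (functionalZ hPhi 0 (UA_cst T 0)) mul0r.
Qed.

Lemma functional_sum (n : nat) (F : nat -> R -> R) : (forall i, (i < n)%N -> UA T (F i)) ->
  Phi (fun x => \sum_(i < n) F i x) = \sum_(i < n) Phi (F i).
Proof.
elim: n => [|n IH] h.
  transitivity (Phi (fun=> 0)); first by apply: eq_functional => x; rewrite big_ord0.
  by rewrite functional0 big_ord0.
have h' i : (i < n)%N -> UA T (F i) by move=> /ltnW; exact: h.
rewrite big_ord_recr /= -IH // -(functionalD hPhi); [|exact: UA_sum|exact: h].
by apply: eq_functional => x; rewrite big_ord_recr.
Qed.

Definition amp (k : nat) : R := `|Phi (wave T k 0)| + `|Phi (wave T k (pi / 2))|.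

Lemma amp_ge0 k : 0 <= amp k. Proof. by rewrite addr_ge0. Qed.

Lemma functional_wave k p :
  Phi (wave T k p) = cos p * Phi (wave T k 0) + sin p * Phi (wave T k (pi / 2)).
Proof.
rewrite -!(functionalZ hPhi); try exact: UA_wave.
rewrite -(functionalD hPhi); try exact: (UAZ _ (UA_wave _ _ _)).
by apply: eq_functional => x; rewrite /wave subr0 cosBpihalf cosB; ring.
Qed.

Lemma functional_wave_le k p : `|Phi (wave T k p)| <= amp k.
Proof.
rewrite functional_wave; apply: le_trans (ler_normD _ _) _; rewrite !normrM.
by apply: lerD; rewrite ler_piMl ?cos_max ?sin_max.
Qed.

Lemma amp_le k : amp k <= 2 * B.
Proof.
have h p : `|Phi (wave T k p)| <= B * 1.
  by apply: (functional_bound hPhi); [exact: UA_wave|exact: wave_le1].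
by rewrite mulr2n mulrDl mul1r lerD // (le_trans (h _)) // mulr1.
Qed.

Lemma functional_wave_prod k p l q : (l <= k)%N ->
  `|Phi (fun x => wave T k p x * wave T l q x)| <= 2^-1 * (amp (k - l) + amp (k + l)).
Proof.
move=> lk; rewrite (eq_functional (fun x => wave_prod T p q x lk)).
rewrite (functionalZ hPhi); last by apply: UAD; exact: UA_wave.
rewrite (functionalD hPhi); try exact: UA_wave.
rewrite normrM ger0_norm ?invr_ge0 // ler_wpM2l ?invr_ge0 //.
by apply: le_trans (ler_normD _ _) _; apply: lerD; exact: functional_wave_le.
Qed.

(** The normalization of the real Fourier series: the mean of a squared wave is [1 / 2], except at
    [k = 0]. *)
Definition wt (k : nat) : R := if k == 0%N then 1 else 2.

Definition tterm (k : nat) (x : R) : R :=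
  wt k * (Phi (wave T k 0) * wave T k 0 x + Phi (wave T k (pi / 2)) * wave T k (pi / 2) x).

Definition tsum (d : nat) (x : R) : R := \sum_(k < d) tterm k x.

Lemma wt_bound k : 0 <= wt k <= 2.
Proof. by rewrite /wt; case: eqP => _; apply/andP; split; lra. Qed.

Lemma tterm_le k x : `|tterm k x| <= 2 * amp k.
Proof.
have /andP[w0 w2] := wt_bound k.
rewrite normrM (ger0_norm w0); apply: ler_pM => //.
apply: le_trans (ler_normD _ _) _; rewrite !normrM.
by apply: lerD; rewrite ler_piMr // wave_le1.
Qed.

Lemma UA_tterm k : UA T (tterm k).
Proof. by apply: UAZ; apply: UAD; apply: UAZ; exact: UA_wave. Qed.

Lemma UA_tsum d : UA T (tsum d).
Proof. by apply: (@UA_sum T d tterm) => i _; exact: UA_tterm. Qed.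

Lemma tsum_cauchy (j : nat) C : (forall k, amp k <= C / k.+1%:R ^+ (j + 2)) ->
  forall d d' x, (d <= d')%N -> `|tsum d' x - tsum d x| <= 4 * C / d.+1%:R ^+ j.+1.
Proof.
move=> hC d d' x; apply: (@series_tail (tterm^~ x) j C) => k; apply: le_trans (tterm_le _ _) _.
by rewrite ler_pM2l.
Qed.

End OneFunctional.

Lemma functional_eq T Phi Psi B B' : functional T Phi B -> functional T Psi B' ->
  (forall k p, Phi (wave T k p) = Psi (wave T k p)) -> forall f, UA T f -> Phi f = Psi f.
Proof.
move=> hP hQ hw; have ht f : trig T f -> Phi f = Psi f.
  elim=> [|g c k p tg IH]; first by rewrite (functional0 hP) (functional0 hQ).
  have ug := UA_trig tg; have uw := UAZ c (UA_wave T k p).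
  rewrite (functionalD hP) // (functionalD hQ) //.
  by rewrite (functionalZ hP) ?(functionalZ hQ) ?hw ?IH //; exact: UA_wave.
move=> f uf; apply/eqP; rewrite -subr_eq0 -normr_eq0 eq_le normr_ge0 andbT.
have BB0 : 0 <= B + B' by rewrite addr_ge0 ?(functional_B0 hP) ?(functional_B0 hQ).
apply: le_all_eps => e e0; have e1 : 0 < e / (B + B' + 1) by rewrite divr_gt0 // ltr_wpDl.
have [g tg fg] := uf _ e1; have ug := UA_trig tg.
have ud : UA T (fun x => f x - g x).
  by apply: UA_ext (UAD uf (UAZ (-1) ug)) _ => x; rewrite mulN1r.
have -> : Phi f - Psi f = Phi (fun x => f x - g x) - Psi (fun x => f x - g x).
  by rewrite (functionalB hP) // (functionalB hQ) // (ht g tg); ring.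
apply: le_trans (ler_normB _ _) _.
apply: le_trans (lerD (functional_bound hP ud fg) (functional_bound hQ ud fg)) _.
rewrite -mulrDl mulrA ler_pdivrMr ?ltr_wpDl // mulrC ler_wpM2l ?(ltW e0) //; lra.
Qed.

Lemma itg_functional T phi B : 0 < T -> wc T phi -> (forall x, per_int T x -> `|phi x| <= B) ->
  functional T (fun g => itg T (fun x => phi x * g x)) B.
Proof.
move=> T0 cp hB; have wcg g : UA T g -> wc T (fun x => phi x * g x).
  by move=> /UA_wc; exact: wcM.
split.
- move=> f g uf ug; rewrite -itgD; [|exact: wcg|exact: wcg].
  by apply: eq_itg => x _; rewrite mulrDr.
- move=> c f uf; rewrite -itgZ; last exact: wcg.
  by apply: eq_itg => x _; rewrite mulrCA.
- move=> f M uf fM; apply: itg_bound => //; first exact: wcg.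
  by move=> x xT; rewrite normrM ler_pM // hB.
- apply: le_trans (normr_ge0 (phi 0)) (hB _ _).
  by rewrite /per_int /= in_itv /= lexx ltW.
Qed.

Lemma itg_wave_prod T k p l q : 0 < T ->
  itg T (fun x => wave T k p x * wave T l q x) =
  if k == l then (if k == 0%N then cos p * cos q else 2^-1 * cos (p - q)) else 0.
Proof.
move=> T0; wlog lk : k p l q / (l <= k)%N.
  move=> h; have [lk|kl] := leqP l k; first exact: h.
  rewrite (@eq_itg _ T _ (fun x => wave T l q x * wave T k p x)); last by move=> x _; rewrite mulrC.
  rewrite h ?(ltnW kl) // eq_sym; case: eqP => // ->; case: eqP => _; first by rewrite mulrC.
  by rewrite -cosN opprB.
have w n r : wc T (wave T n r) by apply: UA_wc; exact: UA_wave.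
rewrite (@eq_itg _ T _ (fun x => 2^-1 * (wave T (k - l) (p - q) x + wave T (k + l) (p + q) x))); last first.
  by move=> x _; rewrite wave_prod.
rewrite itgZ; last exact: wcD. rewrite itgD // !itg_wave // subn_eq0.
have [->|kl] := eqVneq k l.
  rewrite leqnn addn_eq0 andbb; case: eqP => _; last by rewrite addr0.
  by rewrite cosB cosD; field.
rewrite leqNgt ltn_neqAle lk eq_sym kl /= addn_eq0 ifF ?addr0 ?mulr0 //.
by apply: contraNF kl => /andP[/eqP -> /eqP ->].
Qed.

(** The Fourier series of [Phi] converges uniformly at this rate of decay; its sum has the
    coefficients of [Phi] and therefore represents it. This is how a weak limit becomes a
    function. *)
Lemma represent T Phi B (j : nat) C : 0 < T -> functional T Phi B ->
  (forall k, amp T Phi k <= C / k.+1%:R ^+ (j + 2)) ->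
  exists f, [/\ UA T f, forall d x, `|f x - tsum T Phi d x| <= 4 * C / d.+1%:R ^+ j.+1 &
    forall g, UA T g -> itg T (fun x => f x * g x) = Phi g].
Proof.
move=> T0 hP hC; have cau := tsum_cauchy hC.
have C0 : 0 <= C by have := le_trans (amp_ge0 T Phi 0) (hC 0%N); rewrite expr1n divr1.
have hd (d : nat) : 4 * C / d.+1%:R ^+ j.+1 <= 4 * C / d.+1%:R.
  rewrite ler_wpM2l ?mulr_ge0 // lef_pV2 ?posrE ?exprn_gt0 ?ltr0Sn //.
  by rewrite exprS ler_peMr // exprn_ege1 // ler1n.
have small e : 0 < e -> exists d0, forall d, (d0 <= d)%N -> 4 * C / d.+1%:R <= e.
  move=> e0; exists (Num.truncn (4 * C / e)).+1 => d d0d.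
  rewrite ler_pdivrMr ?ltr0Sn // [leRHS]mulrC -ler_pdivrMr //.
  by apply: (le_trans (ltW (truncnS_gt _))); rewrite ler_nat ltnW.
have cv x : cvgn (fun d => tsum T Phi d x).
  apply/cauchy_cvgP/cauchy_exP => _/posnumP[e].
  have [d0 hd0] := small (e%:num / 2) ltac:(by []).
  exists (tsum T Phi d0 x); exists d0 => // d /= d0d.
  rewrite /ball /= distrC; apply: le_lt_trans (cau _ _ _ d0d) _.
  apply: le_lt_trans (hd _) _; apply: le_lt_trans (hd0 _ (leqnn _)) _.
  by rewrite ltr_pdivrMr // ltr_pMr // ltr1n.
pose f x := lim ((fun d => tsum T Phi d x) @ \oo).
have fd d x : `|f x - tsum T Phi d x| <= 4 * C / d.+1%:R ^+ j.+1.
  have cv' : (fun d' => `|tsum T Phi d' x - tsum T Phi d x|) @ \oo --> `|f x - tsum T Phi d x|.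
    by apply: cvg_norm; apply: cvgB; [exact: cv|exact: cvg_cst].
  rewrite -(cvg_lim _ cv') //; apply: limr_le; first by apply/cvg_ex; eexists; exact: cv'.
  by exists d => // d' /= dd'; exact: cau.
have uf : UA T f.
  apply: UA_lim => e e0; have [d hd'] := small _ e0.
  exists (tsum T Phi d); first exact: UA_tsum.
  by move=> x; apply: le_trans (fd _ _) _; apply: le_trans (hd _) _; exact: hd'.
exists f; split=> //.
have [Bf [Bf0 hBf]] := UA_bounded uf.
have hF : functional T (fun g => itg T (fun x => f x * g x)) Bf.
  by apply: itg_functional => //; exact: UA_wc.
apply: (functional_eq hF hP) => l q.
apply/eqP; rewrite -subr_eq0 -normr_eq0 eq_le normr_ge0 andbT.
apply: (@le_all_harmonic _ (4 * C) l.+1) => d ld.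
(* For [d > l] the partial sum already has the exact coefficient of index [l]. *)
have -> : Phi (wave T l q) = itg T (fun x => tsum T Phi d x * wave T l q x).
  have [Bd [Bd0 hBd]] := UA_bounded (UA_tsum T Phi d).
  have hl : functional T (fun g => itg T (fun x => wave T l q x * g x)) 1.
    by apply: itg_functional => //; [exact/UA_wc/UA_wave|move=> x _; exact: wave_le1].
  rewrite (@eq_itg _ T _ (fun x => wave T l q x * \sum_(k < d) tterm T Phi k x)); last first.
    by move=> x _; rewrite mulrC.
  rewrite (functional_sum hl); last by move=> i _; exact: UA_tterm.
  have tE k : itg T (fun x => wave T l q x * tterm T Phi k x) =
      if l == k then Phi (wave T l q) else 0.
    have uw n r := UA_wave T n r.
    rewrite (functionalZ hl); last by apply: UAD; exact: UAZ.
    rewrite (functionalD hl); [|exact: UAZ|exact: UAZ].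
    rewrite !(functionalZ hl) // !itg_wave_prod //; case: eqP => [<-|_]; last by rewrite !mulr0 addr0 mulr0.
    rewrite [RHS](functional_wave hP) /wt; case: eqP => [->|_].
      rewrite cos0 cos_pihalf.
      have -> : Phi (wave T 0 (pi / 2)) = 0.
        rewrite -(functional0 hP); apply: eq_functional => x.
        by rewrite /wave /freq mulr0 mul0r mul0r sub0r cosN cos_pihalf.
      ring.
    by rewrite subr0 cosBpihalf; field.
  rewrite (eq_bigr (fun k : 'I_d => if l == k then Phi (wave T l q) else 0)) //.
  rewrite (bigD1 (Ordinal ld)) //= eqxx big1 ?addr0 // => i.
  by move=> il; rewrite ifF //; apply: contraNF il => /eqP e; apply/eqP/val_inj.
have ut := UA_tsum T Phi d.
have -> : itg T (fun x => f x * wave T l q x) - itg T (fun x => tsum T Phi d x * wave T l q x) =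
    itg T (fun x => (f x - tsum T Phi d x) * wave T l q x).
  have w1 : wc T (fun x => f x * wave T l q x) by apply/UA_wc/UAM => //; exact: UA_wave.
  have w2 : wc T (fun x => tsum T Phi d x * wave T l q x) by apply/UA_wc/UAM => //; exact: UA_wave.
  rewrite -[X in _ - X]mul1r -mulNr -itgZ // -itgD //; last exact: wcZ.
  by apply: eq_itg => x _; ring.
apply: itg_bound => //.
  apply/UA_wc/UAM; last exact: UA_wave.
  by apply: UA_ext (UAD uf (UAZ (-1) ut)) _ => x; rewrite mulN1r.
move=> x _; rewrite normrM -[leRHS]mulr1 ler_pM // ?wave_le1 //.
exact: le_trans (fd _ _) (hd _).
Qed.

End Functionals.

(** * Regularity of eigenfunctions *)

Section Regularity.
Variable R : realType.
Notation mu := (@lebesgue_measure R).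
Implicit Types (T : R) (f g : R -> R) (Phi : (R -> R) -> R).

Lemma derive1_periodic T f : (forall x, f (x + T) = f x) -> forall x, derive1 f (x + T) = derive1 f x.
Proof.
move=> fT x; rewrite /derive1.
have -> // : (fun h => h^-1 *: (f (h + (x + T)) - f (x + T))) = (fun h => h^-1 *: (f (h + x) - f x)).
by apply/funext => h; rewrite addrA !fT.
Qed.

(** Integration by parts: periodicity cancels the boundary terms, and the shift of the phase by
    [pi / 2] turns the sine back into a [wave]. *)
Lemma itg_wave_derive T g k p : 0 < T -> (0 < k)%N -> (forall x, derivable g x 1) ->
  continuous (derive1 g) -> (forall x, g (x + T) = g x) ->
  itg T (fun x => g x * wave T k p x) =
  - (freq T k)^-1 * itg T (fun x => derive1 g x * wave T k (p + pi / 2) x).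
Proof.
move=> T0 k0 dg cg' gT; have f0 : freq T k != 0 by rewrite gt_eqF // freq_gt0.
have cg : continuous g by move=> x; apply: differentiable_continuous; apply/derivable1_diffP.
set q := p + pi / 2.
have cw n r := @continuous_wave R T n r.
have c1 : continuous (fun x => derive1 g x * wave T k q x).
  by move=> x; apply: cvgM; [exact: cg'|exact: cw].
have c2 : continuous (fun x => g x * wave T k p x).
  by move=> x; apply: cvgM; [exact: cg|exact: cw].
pose F : R -> R := g * wave T k q.
have dF (x : R) : is_derive x 1 F (derive1 g x * wave T k q x + freq T k * (g x * wave T k p x)).
  have h1 := is_derive_wave T k q x.
  have h2 : is_derive x 1 g (derive1 g x) by rewrite derive1E; apply: DeriveDef.
  apply: is_derive_eq; rewrite /q opprD addrA sinBpihalf -/(wave T k p x).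
  rewrite -[X in X + _]/(_ * _) -[X in _ + X]/(_ * _) mulrNN addrC; congr (_ + _); ring.
have cs : continuous (fun x => derive1 g x * wave T k q x + freq T k * (g x * wave T k p x)).
  by move=> x; apply: cvgD; [exact: c1|apply: cvgM; [exact: cvg_cst|exact: c2]].
have key : itg T (fun x => derive1 g x * wave T k q x + freq T k * (g x * wave T k p x)) = 0.
  rewrite /itg (FTC_global T0 cs dF) /F -[X in X - _]/(_ * _) -[X in _ - X]/(_ * _).
  have := @wave_periodic R T k q 0 T0; have := gT 0; rewrite !add0r => -> ->.
  by rewrite subrr mulr0.
move: key; rewrite itgD ?itgZ; try exact: wc_cont; last by apply: wcZ; exact: wc_cont.
move=> key; apply: (mulfI f0).
rewrite [RHS](_ : _ = - itg T (fun x => derive1 g x * wave T k q x)); last by field.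
by apply/eqP; rewrite -addr_eq0 addrC key.
Qed.

Lemma smooth_coefficients T V (n : nat) : 0 < T -> smooth V -> (forall x, V (x + T) = V x) ->
  exists2 M, 0 <= M & forall k p, (0 < k)%N ->
    `|itg T (fun x => V x * wave T k p x)| <= M / freq T k ^+ n.
Proof.
move=> T0 sV VT; pose W m := iter m (fun g : R -> R => derive1 g) V.
have dW m x : derivable (W m) x 1 by exact: sV.
have cW m : continuous (W m) by move=> x; apply: differentiable_continuous; apply/derivable1_diffP.
have WT m : forall x, W m (x + T) = W m x.
  by elim: m => [|m IH] //; apply: derive1_periodic.
have [M [M0 hM]] := wc_bounded (wc_cont (T := T) (cW n)).
exists M => // k p k0; have f0 := freq_gt0 T0 k0.
have st m q : `|itg T (fun x => W m x * wave T k q x)| =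
    (freq T k)^-1 * `|itg T (fun x => W m.+1 x * wave T k (q + pi / 2) x)|.
  rewrite (@itg_wave_derive T (W m) k q T0 k0 (dW m) (cW m.+1) (WT m)).
  by rewrite normrM normrN (gtr0_norm (_ : 0 < (freq T k)^-1)) ?invr_gt0.
have it m : exists q, `|itg T (fun x => V x * wave T k p x)| =
    (freq T k)^-1 ^+ m * `|itg T (fun x => W m x * wave T k q x)|.
  elim: m => [|m [q ->]]; first by exists p; rewrite mul1r.
  by exists (q + pi / 2); rewrite st exprSr mulrA.
have [q ->] := it n; rewrite exprVn mulrC ler_wpM2r ?invr_ge0 ?exprn_ge0 ?(ltW f0) //.
apply: itg_bound => //.
  by apply: wcM; apply: wc_cont => //; exact: continuous_wave.
move=> x xT; rewrite normrM -[leRHS]mulr1; apply: ler_pM => //; first exact: hM.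
exact: wave_le1.
Qed.

Lemma periodic_nat T f (n : nat) : (forall x, f (x + T) = f x) -> forall x, f (x + n%:R * T) = f x.
Proof.
move=> fT x; elim: n => [|n IH]; first by rewrite mul0r addr0.
by rewrite -[n.+1%:R]natr1 mulrDl mul1r addrA fT.
Qed.

Lemma periodic_zero T f : 0 < T -> (forall x, f (x + T) = f x) ->
  (forall x, per_int T x -> f x = 0) -> forall x, f x = 0.
Proof.
move=> T0 fT f0 x.
pose n := (Num.truncn (`|x| / T)).+1.
have xn : 0 <= x + n%:R * T.
  have : `|x| < n%:R * T by rewrite -ltr_pdivrMr // truncnS_gt.
  by move=> h; have := ler_norm (- x); rewrite normrN; lra.
rewrite -(periodic_nat n fT x); set y := x + n%:R * T in xn *.
pose m := Num.truncn (y / T).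
have yT : 0 <= y / T by rewrite divr_ge0 // ltW.
have /andP[h1 h2] := truncn_itv yT.
have -> : y = (y - m%:R * T) + m%:R * T by rewrite subrK.
rewrite (periodic_nat m fT) f0 // /per_int /= in_itv /=.
move: h1 h2; rewrite -/m ler_pdivlMr // ltr_pdivrMr // -[m.+1%:R]natr1 => h1 h2.
by apply/andP; split; lra.
Qed.

Lemma periodic_eq T f g : 0 < T -> (forall x, f (x + T) = f x) -> (forall x, g (x + T) = g x) ->
  (forall x, per_int T x -> f x = g x) -> f =1 g.
Proof.
move=> T0 fT gT fg x; apply/eqP; rewrite -subr_eq0; apply/eqP.
apply: (@periodic_zero T (fun x => f x - g x)) => // [y|y yT]; first by rewrite fT gT.
by rewrite fg // subrr.
Qed.

Definition density T V : (R -> R) -> R := fun g => itg T (fun x => V x * g x).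

(** Six integrations by parts leave a tail of order five, enough for the order four that
    [regularity] asks of [V]. The Fourier sum is identified with [V] by [wave_unique] and
    periodicity. *)
Lemma smooth_tail T V : 0 < T -> smooth V -> (forall x, V (x + T) = V x) ->
  exists C, [/\ UA T V, 0 <= C, forall k, amp T (density T V) k <= C / k.+1%:R ^+ 6 &
    forall d x, `|V x - tsum T (density T V) d x| <= 4 * C / d.+1%:R ^+ 5].
Proof.
move=> T0 sV VT; have [M M0 hM] := smooth_coefficients 6 T0 sV VT.
have cV : continuous V.
  by move=> x; apply: differentiable_continuous; apply/derivable1_diffP; exact: (sV 0%N).
have [B [B0 hB]] := wc_bounded (wc_cont (T := T) cV).
have hP : functional T (density T V) B by apply: itg_functional => //; exact: wc_cont.
pose K := 2 * M * (T / pi) ^+ 6.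
have K0 : 0 <= K.
  by apply: mulr_ge0; [exact: mulr_ge0|apply: exprn_ge0; rewrite divr_ge0 ?pi_ge0 // ltW].
pose C := K + 2 * B.
have C0 : 0 <= C by rewrite addr_ge0 // mulr_ge0.
have ampC k : amp T (density T V) k <= C / k.+1%:R ^+ 6.
  have [->|k0] := posnP k.
    by rewrite expr1n divr1; apply: le_trans (amp_le hP 0) _; rewrite lerDr.
  have f0 := freq_gt0 T0 k0.
  have h : freq T k ^- 6 <= (T / pi) ^+ 6 / k.+1%:R ^+ 6.
    rewrite -expr_div_n -exprVn lerXn2r ?nnegrE ?invr_ge0 ?(ltW f0) //.
      by rewrite !divr_ge0 ?pi_ge0 // ltW.
    have -> : T / pi / k.+1%:R = (pi / T * k.+1%:R)^-1.
      by move: (k.+1%:R) (ltr0Sn R k) (pi) (pi_gt0 R) => z z0 p p0; field; rewrite !gt_eqF.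
    have pT : 0 < pi / T by rewrite divr_gt0 ?pi_gt0.
    rewrite lef_pV2 ?posrE //; last by rewrite mulr_gt0.
    have -> : freq T k = pi / T * (2 * k%:R) by rewrite /freq; field; rewrite gt_eqF.
    by rewrite ler_pM2l // -natrM ler_nat; lia.
  have hp p : `|itg T (fun x => V x * wave T k p x)| <= M * (T / pi) ^+ 6 / k.+1%:R ^+ 6.
    by apply: le_trans (hM k p k0) _; rewrite -[leRHS]mulrA ler_wpM2l //; exact: h.
  apply: le_trans (lerD (hp 0) (hp (pi / 2))) _.
  rewrite -mulrDl ler_wpM2r ?invr_ge0 ?exprn_ge0 // /C /K; lra.
have [f [uf ft fg]] := represent T0 hP ampC (j := 4).
have fV : f =1 V.
  apply: (periodic_eq T0) => //; first exact: UA_periodic.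
  move=> x xT; apply/eqP; rewrite -subr_eq0 -mulN1r; apply/eqP.
  have cw k p : wc T (wave T k p) by apply/UA_wc/UA_wave.
  have cf := UA_wc uf; have cV' := wc_cont (T := T) cV.
  apply: (@wave_unique _ T (fun x => f x + -1 * V x)) => //; first by apply: wcD => //; exact: wcZ.
  move=> k p; transitivity (itg T (fun x => f x * wave T k p x + -1 * (V x * wave T k p x))).
    by apply: eq_itg => y _; ring.
  rewrite itgD; [|exact: wcM|by apply: wcZ; exact: wcM].
  rewrite itgZ; last exact: wcM.
  by rewrite fg ?mulN1r ?subrr //; exact: UA_wave.
exists C; split=> //; first exact: UA_ext uf fV.
by move=> d x; rewrite -fV.
Qed.

Lemma powR_dec (x p q : R) : 1 <= x -> p <= q -> x `^ (- q) <= x `^ (- p).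
Proof. by move=> x1 pq; rewrite ler_powR // lerN2. Qed.

Fact half_leq k : (k./2 <= k)%N. Proof. lia. Qed.
Fact leq_double_half k : (k <= (k./2).*2.+1)%N. Proof. lia. Qed.
Fact leq_double_sub k l : (l < k./2)%N -> (k <= (k - l).*2.+1)%N. Proof. lia. Qed.
Fact leq_succ_double k m : (k <= m.*2.+1)%N -> (k.+1 <= m.+1 * 2)%N. Proof. lia. Qed.

(** Each pass through the inequality gains the exponent [al] of the operator, up to the cap [4] set
    by the last term; so [e j] is the decay known after [j] passes. *)
Lemma bootstrap (al c C0 B0 W : R) (F w D : nat -> R) : 0 < al -> 0 <= c -> 0 <= C0 -> 0 <= W ->
  (forall k, 0 <= F k <= B0) -> (forall l, 0 <= w l) -> (forall d, \sum_(l < d) w l <= W) ->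
  (forall k, k.+1%:R `^ al <= c * (1 + D k)) ->
  (forall k d, (d <= k)%N -> D k * F k <= C0 * F k
     + \sum_(l < d) w l * (F (k - l)%N + F (k + l)%N) + C0 / d.+1%:R ^+ 4) ->
  exists2 C, 0 <= C & forall k, F k <= C / k.+1%:R ^+ 4.
Proof.
move=> al0 c0 C00 W0 hF w0 hW hD hE.
have B00 : 0 <= B0 by have /andP[h1 h2] := hF 0%N; exact: le_trans h2.
pose e (j : nat) := Num.min (j%:R * al) 4.
have e0 j : 0 <= e j by rewrite le_min mulr_ge0 ?ler0n // ltW.
have e4 j : e j <= 4 by rewrite ge_min lexx orbT.
have k1 k : 1 <= k.+1%:R :> R by rewrite ler1n.
have step j : exists2 C, 0 <= C & forall k, F k <= C * k.+1%:R `^ (- e j).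
  elim: j => [|j [C C1 hC]].
    exists B0 => // k; have -> : e 0%N = 0 by rewrite /e mul0r min_l.
    by rewrite oppr0 powRr0 mulr1; case/andP: (hF k).
  pose C' := c * (C + C0 * C + 17 * C * W + 16 * C0).
  have C'0 : 0 <= C'.
    by rewrite mulr_ge0 // !addr_ge0 // !mulr_ge0.
  exists C' => // k; set x : R := k.+1%:R; set y := x `^ (- e j).
  have x1 : 1 <= x := k1 k; have x0 : 0 < x := lt_le_trans ltr01 x1.
  have y0 : 0 <= y by exact: powR_ge0.
  (* Frequencies [l] below half of [k] keep [k - l] comparable to [k]; as the exponent is at most
     [4], this costs a factor [16]. *)
  pose d := (k./2)%N; have dk : (d <= k)%N := half_leq k.
  have half (m : nat) : (k <= m.*2.+1)%N -> m.+1%:R `^ (- e j) <= 16 * y.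
    move=> km; have xm : x / 2 <= m.+1%:R.
      by rewrite ler_pdivrMr // -natrM ler_nat leq_succ_double.
    have x20 : 0 < x / 2 by rewrite divr_gt0.
    apply: (@le_trans _ _ ((x / 2) `^ (- e j))).
      rewrite !powRN lef_pV2 ?posrE ?powR_gt0 ?ltr0Sn //.
      by rewrite ge0_ler_powR ?nnegrE // ltW.
    rewrite powRM ?invr_ge0 ?(ltW x0) // mulrC ler_wpM2r //.
    rewrite -powR_inv1 // -powRrM mulN1r opprK.
    have -> : 16 = 2 `^ 4 :> R by rewrite -[4]/(4%:R) powR_mulrn //; ring.
    by rewrite ler_powR // ler1n.
  have h4 : C0 / d.+1%:R ^+ 4 <= 16 * C0 * y.
    rewrite -mulrA mulrCA ler_wpM2l //.
    apply: le_trans (half d (leq_double_half k)).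
    by rewrite -powR_mulrn // -powRN powR_dec.
  have hs : \sum_(l < d) w l * (F (k - l)%N + F (k + l)%N) <= 17 * C * W * y.
    apply: (@le_trans _ _ (\sum_(l < d) w l * (17 * C * y))).
      apply: ler_sum => l _; rewrite ler_wpM2l //.
      have ld := ltn_ord l.
      have a1 : F (k - l)%N <= C * (16 * y).
        by apply: le_trans (hC _) _; rewrite ler_wpM2l // half // leq_double_sub.
      have a2 : F (k + l)%N <= C * y.
        apply: le_trans (hC _) _; rewrite ler_wpM2l // /y !powRN lef_pV2 ?posrE ?powR_gt0 ?ltr0Sn //.
        by rewrite ge0_ler_powR ?nnegrE ?ler0n // ler_nat ltnS leq_addr.
      by have -> : 17 * C * y = C * (16 * y) + C * y by [ring|]; apply: lerD.
    rewrite -mulr_suml mulrC [leRHS](_ : _ = 17 * C * y * W); last by ring.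
    by rewrite ler_wpM2l // !mulr_ge0.
  have DF : D k * F k <= (C0 * C + 17 * C * W + 16 * C0) * y.
    apply: le_trans (hE k d dk) _.
    rewrite [leRHS](_ : _ = C0 * C * y + 17 * C * W * y + 16 * C0 * y); last by ring.
    apply: lerD; last exact: h4.
    by apply: lerD; [rewrite -mulrA ler_wpM2l //; exact: hC|exact: hs].
  have main : x `^ al * F k <= C' * y.
    have /andP[F0 _] := hF k.
    apply: (@le_trans _ _ (c * (1 + D k) * F k)); first by rewrite ler_wpM2r //; exact: hD.
    rewrite [leRHS](_ : _ = c * (C * y + (C0 * C + 17 * C * W + 16 * C0) * y)); last by rewrite /C'; ring.
    rewrite -mulrA ler_wpM2l // mulrDl mul1r.
    by apply: lerD; first exact: hC.
  have xal : 0 < x `^ al by rewrite powR_gt0.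
  rewrite -(ler_pM2l xal); apply: le_trans main _; rewrite mulrCA ler_wpM2l //.
  rewrite /y -powRD; last by rewrite (gt_eqF x0) implybT.
  rewrite ler_powR // lerBrDr addrC -lerBrDr opprK /e -[j.+1%:R]natr1 mulrDl mul1r.
  rewrite /Num.min; case: ifP => h1; case: ifP => h2; lra.
pose j := (Num.truncn (4 / al)).+1.
have ej : e j = 4.
  by rewrite /e min_r // -ler_pdivrMr // ltW // truncnS_gt.
have [C C1 hC] := step j; exists C => // k; apply: le_trans (hC k) _.
by rewrite ej powRN -[4]/(4%:R) powR_mulrn.
Qed.

Lemma freq_growth T al k : 0 < T -> 0 < al ->
  k.+1%:R `^ al <= (1 + (T / pi) `^ al) * (1 + `|freq T k| `^ al) :> R.
Proof.
move=> T0 al0; have [->|k0] := posnP k.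
  rewrite powR1; apply: (@le_trans _ _ (1 * 1)); first by rewrite mulr1.
  by apply: ler_pM => //; rewrite lerDl powR_ge0.
rewrite mulrDl mul1r [leRHS]addrC mulrDr mulr1 -addrA.
have f0 := freq_gt0 T0 k0; have Tp : 0 <= T / pi by rewrite divr_ge0 ?pi_ge0 // ltW.
apply: (@le_trans _ _ ((T / pi) `^ al * `|freq T k| `^ al)).
  rewrite -powRM //; apply: ge0_ler_powR; [exact: ltW|by rewrite nnegrE|by rewrite nnegrE mulr_ge0|].
  rewrite gtr0_norm // /freq.
  have -> : T / pi * (2 * pi * k%:R / T) = 2 * k%:R.
    by move: (pi) (pi_gt0 R) => p p0; field; rewrite !gt_eqF.
  by rewrite -natrM ler_nat mul2n -addnn -addn1 leq_add2l.
by rewrite addrC -!addrA lerDl !addr_ge0 ?powR_ge0.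
Qed.

(** Elliptic regularity on the level of coefficients: multiplication by [V] is a convolution with
    rapidly decaying weights, so [bootstrap] applies. The term [gam] makes room for the penalty of
    the perturbed form. *)
Lemma regularity T al V Phi B nu (gam : nat -> R -> R) Cg :
  0 < T -> 0 < al -> smooth V -> (forall x, V (x + T) = V x) -> functional T Phi B ->
  (forall k p, `|gam k p| <= Cg / k.+1%:R ^+ 4) ->
  (forall k p, `|freq T k| `^ al * Phi (wave T k p) + Phi (fun x => V x * wave T k p x) + gam k p
      = nu * Phi (wave T k p)) ->
  exists2 C, 0 <= C & forall k, amp T Phi k <= C / k.+1%:R ^+ 4.
Proof.
move=> T0 al0 sV VT hP hg eqn.
have [Cv [uV Cv0 ampV tailV]] := smooth_tail T0 sV VT.
have B0 := functional_B0 hP.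
have Cg0 : 0 <= Cg by have := le_trans (normr_ge0 _) (hg 0%N 0); rewrite expr1n divr1.
pose W := 8 * Cv; pose C0 := 2 * `|nu| + 8 * B * Cv + 2 * Cg.
have W0 : 0 <= W by rewrite mulr_ge0.
have C00 : 0 <= C0 by rewrite !addr_ge0 // !mulr_ge0.
pose w l := 2 * amp T (density T V) l.
have hw d : \sum_(l < d) w l <= W.
  suff : \sum_(l < d) w l <= 4 * Cv * (2 - d.+1%:R^-1).
    move=> h; apply: le_trans h _; rewrite /W (_ : 8 * Cv = 4 * Cv * 2); last by ring.
    by apply: ler_wpM2l; [exact: mulr_ge0|rewrite lerBlDr lerDl invr_ge0].
  elim: d => [|d IH]; first by rewrite big_ord0 invr1 mulr_ge0 //; lra.
  rewrite big_ord_recr /=; apply: le_trans (lerD IH (lexx _)) _.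
  have d1 : 1 <= d.+1%:R :> R by rewrite ler1n.
  have a1 : w d <= 4 * Cv * (d.+1%:R^-1 - d.+2%:R^-1).
    rewrite /w; have -> : 4 * Cv * (d.+1%:R^-1 - d.+2%:R^-1) = 2 * (Cv * (2 * (d.+1%:R^-1 - d.+2%:R^-1))) by ring.
    rewrite ler_pM2l //; apply: le_trans (ampV d) _; rewrite ler_wpM2l //.
    have -> : d.+2%:R = d.+1%:R + 1 :> R by rewrite -[d.+2%:R]natr1.
    have -> : 2 * (d.+1%:R^-1 - (d.+1%:R + 1)^-1) = (2 * d.+1%:R / (d.+1%:R + 1)) * d.+1%:R ^- 2 :> R.
      by field; rewrite !gt_eqF //; lra.
    apply: (@le_trans _ _ (1 * d.+1%:R ^- 2)).
      by rewrite mul1r lef_pV2 ?posrE ?exprn_gt0 ?ltr0Sn // ler_weXn2l.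
    rewrite ler_wpM2r ?invr_ge0 ?exprn_ge0 // ler_pdivlMr; lra.
  have -> : 4 * Cv * (2 - d.+2%:R^-1) = 4 * Cv * (2 - d.+1%:R^-1) + 4 * Cv * (d.+1%:R^-1 - d.+2%:R^-1) by ring.
  by rewrite lerD.
apply: (@bootstrap al (1 + (T / pi) `^ al) C0 (2 * B) W (amp T Phi) w (fun k => `|freq T k| `^ al)) => //.
- by rewrite addr_ge0 // powR_ge0.
- by move=> k; rewrite amp_ge0 (amp_le hP).
- by move=> l; rewrite mulr_ge0 // amp_ge0.
- by move=> k; exact: freq_growth.
move=> k d dk; pose Dk := `|freq T k| `^ al.
have Dk0 : 0 <= Dk by exact: powR_ge0.
have uVw p : UA T (fun x => V x * wave T k p x) by apply: UAM => //; exact: UA_wave.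
(* [V] is replaced by its Fourier sum below [d], whose products with the wave split into the
   frequencies [k - l] and [k + l]; the tail is absorbed by the bound of [Phi]. *)
have PV p : `|Phi (fun x => V x * wave T k p x)| <=
    B * (4 * Cv / d.+1%:R ^+ 5) + 2^-1 * \sum_(l < d) w l * (amp T Phi (k - l) + amp T Phi (k + l)).
  pose tt l x := tterm T (density T V) l x * wave T k p x.
  have utt l : UA T (tt l) by apply: UAM; [exact: UA_tterm|exact: UA_wave].
  have ud : UA T (fun x => (V x - tsum T (density T V) d x) * wave T k p x).
    apply: UAM; last exact: UA_wave.
    by apply: UA_ext (UAD uV (UAZ (-1) (UA_tsum T (density T V) d))) _ => x; rewrite mulN1r.
  have us : UA T (fun x => \sum_(l < d) tt l x) by apply: UA_sum.
  have -> : Phi (fun x => V x * wave T k p x) =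
      Phi (fun x => (V x - tsum T (density T V) d x) * wave T k p x) + \sum_(l < d) Phi (tt l).
    rewrite -(functional_sum hP) // -(functionalD hP) //; congr Phi; apply/funext => x.
    by rewrite /tt -mulr_suml -mulrDl subrK.
  apply: le_trans (ler_normD _ _) _; apply: lerD.
    apply: (functional_bound hP) => // x; rewrite normrM -[leRHS]mulr1 ler_pM //.
    exact: wave_le1.
  apply: le_trans (ler_norm_sum _ _ _) _; rewrite mulr_sumr; apply: ler_sum => l _.
  have lk : (l <= k)%N by rewrite ltnW // (leq_trans (ltn_ord l)).
  have ww q : `|Phi (fun x => wave T l q x * wave T k p x)| <= 2^-1 * (amp T Phi (k - l) + amp T Phi (k + l)).
    rewrite (_ : (fun x => _) = (fun x => wave T k p x * wave T l q x)).
      exact: (functional_wave_prod hP).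
    by apply/funext => x; rewrite mulrC.
  have uww q : UA T (fun x => wave T l q x * wave T k p x) by apply: UAM; exact: UA_wave.
  have -> : Phi (tt l) = wt R l * (density T V (wave T l 0) * Phi (fun x => wave T l 0 x * wave T k p x)
      + density T V (wave T l (pi / 2)) * Phi (fun x => wave T l (pi / 2) x * wave T k p x)).
    rewrite -!(functionalZ hP) // -(functionalD hP); try exact: UAZ.
    rewrite -(functionalZ hP); last by apply: UAD; exact: UAZ.
    by congr Phi; apply/funext => x; rewrite /tt /tterm; ring.
  have /andP[wt0 wt2] := wt_bound R l.
  set S := amp T Phi (k - l) + amp T Phi (k + l) in ww *.
  have S0 : 0 <= S by rewrite addr_ge0 // amp_ge0.
  rewrite normrM (ger0_norm wt0) /w.
  have -> : 2^-1 * (2 * amp T (density T V) l * S) = 2 * (amp T (density T V) l * (2^-1 * S)) by field.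
  apply: ler_pM => //; apply: le_trans (ler_normD _ _) _.
  rewrite (normrM (density T V (wave T l 0))) (normrM (density T V (wave T l (pi / 2)))).
  rewrite [leRHS](_ : _ = `|density T V (wave T l 0)| * (2^-1 * S) + `|density T V (wave T l (pi / 2))| * (2^-1 * S)).
    by apply: lerD; rewrite ler_wpM2l.
  exact: mulrDl.
have hp p : Dk * `|Phi (wave T k p)| <= `|nu| * `|Phi (wave T k p)| +
    (B * (4 * Cv / d.+1%:R ^+ 5) + 2^-1 * \sum_(l < d) w l * (amp T Phi (k - l) + amp T Phi (k + l)))
    + Cg / d.+1%:R ^+ 4.
  have -> : Dk * `|Phi (wave T k p)| = `|Dk * Phi (wave T k p)| by rewrite normrM (ger0_norm Dk0).
  have -> : Dk * Phi (wave T k p) = nu * Phi (wave T k p) - Phi (fun x => V x * wave T k p x) - gam k p.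
    by rewrite -eqn /Dk; ring.
  apply: le_trans (ler_normB _ _) _; apply: lerD; last first.
    apply: le_trans (hg k p) _; rewrite ler_wpM2l // lef_pV2 ?posrE ?exprn_gt0 ?ltr0Sn //.
    by rewrite lerXn2r ?nnegrE ?ler0n // ler_nat.
  by apply: le_trans (ler_normB _ _) _; rewrite normrM lerD.
have h5 : 4 * Cv / d.+1%:R ^+ 5 <= 4 * Cv / d.+1%:R ^+ 4.
  rewrite ler_wpM2l ?mulr_ge0 // lef_pV2 ?posrE ?exprn_gt0 ?ltr0Sn //.
  by rewrite ler_weXn2l // ler1n.
have h6 : B * (4 * Cv / d.+1%:R ^+ 5) <= B * (4 * Cv / d.+1%:R ^+ 4) by rewrite ler_wpM2l.
have := lerD (hp 0) (hp (pi / 2)).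
rewrite -mulrDr -/(amp T Phi k) -/Dk => h; apply: le_trans h _.
have a0 := amp_ge0 T Phi k.
set S := \sum_(l < d) _.
have -> : C0 / d.+1%:R ^+ 4 = 2 * (B * (4 * Cv / d.+1%:R ^+ 4)) + 2 * (Cg / d.+1%:R ^+ 4) + 2 * `|nu| / d.+1%:R ^+ 4.
  by rewrite /C0; ring.
have n0 : 0 <= 2 * `|nu| / d.+1%:R ^+ 4 by rewrite divr_ge0 ?mulr_ge0 ?exprn_ge0.
have n1 : `|nu| * `|Phi (wave T k 0)| + `|nu| * `|Phi (wave T k (pi / 2))| <= C0 * amp T Phi k.
  rewrite -mulrDr -/(amp T Phi k) ler_wpM2r // /C0.
  have : 0 <= 8 * B * Cv by rewrite !mulr_ge0.
  by have := normr_ge0 nu; lra.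
have lin (X Y Z N P0 P1 Q S' : R) : X <= Y -> 0 <= N -> P0 + P1 <= Q ->
    P0 + (X + 2^-1 * S') + Z + (P1 + (X + 2^-1 * S') + Z) <= Q + S' + (2 * Y + 2 * Z + N) by lra.
exact: lin h6 n0 n1.
Qed.

End Regularity.

(** * Unique continuation *)

Section UniqueContinuation.
Variable R : realType.
Notation mu := (@lebesgue_measure R).
Implicit Types (T a b s t c M xi : R) (f g : R -> R).

Lemma norm_sin_le (x : R) : `|sin x| <= `|x|.
Proof.
wlog x0 : x / 0 <= x.
  move=> h; have [/h//|x0] := leP 0 x.
  by rewrite -normrN -sinN -[leRHS]normrN h // oppr_ge0 ltW.
move: x0; rewrite le_eqVlt => /orP[/eqP <-|x0]; first by rewrite sin0.
have [c _] := @MVT_segment R sin cos 0 x (ltW x0) (fun y _ => is_derive_sin y)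
  (continuous_within (@continuous_sin R)).
rewrite sin0 !subr0 => ->; rewrite normrM ler_piMl //; exact: cos_max.
Qed.

Lemma one_sub_cos (x : R) : 1 - cos x = 2 * sin (x / 2) ^+ 2.
Proof.
have := cos_mulr2n (x / 2); rewrite (_ : x / 2 *+ 2 = x); last by field.
by move=> ->; rewrite cos2sin2; ring.
Qed.

Lemma one_sub_cos_ge0 (x : R) : 0 <= 1 - cos x.
Proof. by rewrite subr_ge0 cos_le1. Qed.

Lemma one_sub_cos_le (x : R) : 1 - cos x <= x ^+ 2 / 2.
Proof.
rewrite one_sub_cos; have h := norm_sin_le (x / 2).
have : sin (x / 2) ^+ 2 <= (x / 2) ^+ 2.
  by rewrite -[leLHS]real_normK ?num_real // -[leRHS]real_normK ?num_real // lerXn2r ?nnegrE.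
by rewrite expr_div_n; lra.
Qed.

Definition pw s (y : R) : R := y `^ (- s).

Lemma pw_ge0 s y : 0 <= pw s y. Proof. exact: powR_ge0. Qed.

Lemma is_derive_pw s (y : R) : 0 < y -> is_derive y 1 (pw s) (- s * pw (s + 1) y).
Proof. by move=> y0; have h := is_derive1_powR (- s) y0; apply: is_derive_eq; rewrite /pw opprD. Qed.

Lemma continuous_pw s (y : R) : 0 < y -> {for y, continuous (pw s)}.
Proof.
move=> y0; have h := is_derive_pw s y0; apply: differentiable_continuous.
by apply/derivable1_diffP.
Qed.

Lemma half_line_within a g : (forall y, a <= y -> {for y, continuous g}) ->
  {within `[a, +oo[, continuous g}.
Proof.
move=> h; apply: continuous_in_subspaceT => y; rewrite inE /= in_itv /= andbT => ay.
exact: h.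
Qed.

Lemma pw_within a s : 0 < a -> {within `[a, +oo[, continuous (pw s)}.
Proof. by move=> a0; apply: half_line_within => y ay; apply: continuous_pw; exact: lt_le_trans ay. Qed.

Lemma pw_decr s x y : 0 <= s -> 0 < x -> x <= y -> pw s y <= pw s x.
Proof.
move=> s0 x0 xy; rewrite /pw !powRN lef_pV2 ?posrE ?powR_gt0 ?(lt_le_trans x0) //.
by rewrite ge0_ler_powR // nnegrE ltW // (lt_le_trans x0).
Qed.

Lemma pw_cvg0 s : 0 < s -> pw s y @[y --> +oo] --> 0.
Proof.
move=> s0; apply/cvgr0Pnorm_le => e e0.
near=> y.
have y0 : 0 < y by near: y; exact: nbhs_pinfty_gt.
have ye : e `^ (- s^-1) <= y by near: y; apply: nbhs_pinfty_ge.
rewrite ger0_norm ?pw_ge0 //.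
have e' : 0 < e `^ (- s^-1) by rewrite powR_gt0.
apply: le_trans (pw_decr (ltW s0) e' ye) _.
by rewrite /pw -powRrM mulrNN mulVf ?gt_eqF // powRr1 // ltW.
Unshelve. all: by end_near.
Qed.

Lemma pw_integral a s : 0 < a -> 1 < s ->
  (\int[mu]_(y in `[a, +oo[) (pw s y)%:E = (pw (s - 1) a / (s - 1))%:E)%E.
Proof.
move=> a0 s1; have s10 : 0 < s - 1 by rewrite subr_gt0.
have s1n : s - 1 != 0 by rewrite gt_eqF.
pose F : R -> R := (- (s - 1)^-1) *: pw (s - 1).
have dF (y : R) : 0 < y -> is_derive y 1 F (pw s y).
  move=> y0; have h := is_derive_pw (s - 1) y0.
  apply: is_derive_eq; rewrite subrK -[LHS]/(_ * _) mulrA mulrNN mulVf ?mul1r //.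
rewrite (@ge0_continuous_FTC2y R (pw s) F a 0).
- by rewrite sub0e -EFinN /F; congr EFin; rewrite -[X in - X]/(_ * _); ring.
- by move=> y _; exact: pw_ge0.
- exact: pw_within.
- rewrite /F -[X in _ --> X](mulr0 (- (s - 1)^-1)).
  by apply: (@cvgMl_tmp _ _ _ _ (pw (s - 1))); exact: pw_cvg0.
- by move=> y ay; case: (dF y (lt_trans a0 ay)).
- apply: cvg_at_right_filter; apply: differentiable_continuous; apply/derivable1_diffP.
  by case: (dF a a0).
- move=> y; rewrite in_itv /= andbT => ay; rewrite derive1E.
  by case: (dF y (lt_trans a0 ay)).
Qed.

Lemma pw_integrable a s : 0 < a -> 1 < s -> mu.-integrable `[a, +oo[ (EFin \o pw s).
Proof.
move=> a0 s1; apply/integrableP; split.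
  apply/measurable_EFinP; apply: subspace_continuous_measurable_fun => //; exact: pw_within.
under eq_integral do rewrite /= ger0_norm ?pw_ge0 //.
by rewrite pw_integral // ltry.
Qed.

(** A class closed under sums and products and integrable against every power [pw s] with [s > 1],
    as long as the half line starts to the right of [0]. *)
Definition tame a g : Prop :=
  {within `[a, +oo[, continuous g} /\ exists M, forall y, a <= y -> `|g y| <= M.

Lemma tame_cont a g M : continuous g -> (forall y, `|g y| <= M) -> tame a g.
Proof. by move=> cg gM; split; [exact: continuous_within|exists M]. Qed.

Lemma tame_cst a c : tame a (fun=> c).
Proof. by apply: (@tame_cont _ _ `|c|) => // x; apply: cvg_cst. Qed.

Lemma tame_bound a g : tame a g -> exists2 M, 0 <= M & forall y, a <= y -> `|g y| <= M.
Proof. by move=> [_ [M h]]; exists M => //; apply: le_trans (h a _). Qed.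

Lemma tameM a f g : tame a f -> tame a g -> tame a (fun y => f y * g y).
Proof.
move=> tf tg; have [M M0 fM] := tame_bound tf; have [M' M'0 gM] := tame_bound tg.
split; first exact: withinM tf.1 tg.1.
by exists (M * M') => y ay; rewrite normrM ler_pM ?fM ?gM.
Qed.

Lemma tameD a f g : tame a f -> tame a g -> tame a (fun y => f y + g y).
Proof.
move=> tf tg; have [M M0 fM] := tame_bound tf; have [M' M'0 gM] := tame_bound tg; split.
  move=> x; apply: (@continuousD _ _ (subspace `[a, +oo[) f g x); [exact: tf.1|exact: tg.1].
by exists (M + M') => y ay; apply: le_trans (ler_normD _ _) _; rewrite lerD ?fM ?gM.
Qed.

Lemma tameZ a c f : tame a f -> tame a (fun y => c * f y).
Proof. by move=> tf; apply: tameM => //; exact: tame_cst. Qed.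

Lemma tame_pw a s : 0 < a -> 0 <= s -> tame a (pw s).
Proof.
move=> a0 s0; split; first exact: pw_within.
by exists (pw s a) => y ay; rewrite ger0_norm ?pw_ge0 // pw_decr.
Qed.

Lemma tame_integrable a s g : 0 < a -> 1 < s -> tame a g ->
  mu.-integrable `[a, +oo[ (EFin \o (fun y => g y * pw s y)).
Proof.
move=> a0 s1 tg; have [M M0 gM] := tame_bound tg; have cg := tg.1.
have mI : measurable (`[a, +oo[%classic : set (measurableTypeR R)) by exact: measurable_itv.
have h := Rintegrable_scale (nu := mu) M mI (pw_integrable a0 s1).
apply: (le_integrable mI _ _ h).
  apply/measurable_EFinP; apply: subspace_continuous_measurable_fun => // y.
  by apply: (@continuousM _ (subspace `[a, +oo[) g (pw s) y); [exact: cg|exact: pw_within].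
move=> y /=; rewrite in_itv /= andbT => ay; rewrite lee_fin !normrM (ger0_norm M0).
by rewrite ler_wpM2r // gM.
Qed.

Definition tail a s g : R := \int[mu]_(y in `[a, +oo[) (g y * pw s y).

Lemma eq_tail a s f g : (forall y, a <= y -> f y = g y) -> tail a s f = tail a s g.
Proof.
move=> h; apply: eq_Rintegral => y; rewrite inE /= in_itv /= andbT => ay.
by rewrite h.
Qed.

Lemma tailD a s f g : 0 < a -> 1 < s -> tame a f -> tame a g ->
  tail a s (fun y => f y + g y) = tail a s f + tail a s g.
Proof.
move=> a0 s1 tf tg; rewrite /tail.
under eq_Rintegral do rewrite mulrDl.
by apply: RintegralD; [exact: measurable_itv|exact: tame_integrable|exact: tame_integrable].
Qed.

Lemma tailZ a s c f : 0 < a -> 1 < s -> tame a f -> tail a s (fun y => c * f y) = c * tail a s f.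
Proof.
move=> a0 s1 tf; rewrite /tail.
under eq_Rintegral do rewrite -mulrA.
by apply: RintegralZl; [exact: measurable_itv|exact: tame_integrable].
Qed.

Lemma tail_cst a s c : 0 < a -> 1 < s -> tail a s (fun=> c) = c * (pw (s - 1) a / (s - 1)).
Proof.
move=> a0 s1; rewrite /tail RintegralZl; [|exact: measurable_itv|exact: pw_integrable].
by rewrite /Rintegral pw_integral.
Qed.

Lemma tail_le a s f g : 0 < a -> 1 < s -> tame a f -> tame a g ->
  (forall y, a <= y -> f y <= g y) -> tail a s f <= tail a s g.
Proof.
move=> a0 s1 tf tg fg; rewrite /tail; apply: le_Rintegral; first exact: measurable_itv.
- exact: tame_integrable.
- exact: tame_integrable.
- by move=> y /=; rewrite in_itv /= andbT => ay; rewrite ler_wpM2r ?pw_ge0 // fg.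
Qed.

Lemma tail_bound a s f M : 0 < a -> 1 < s -> tame a f -> (forall y, a <= y -> `|f y| <= M) ->
  `|tail a s f| <= M * (pw (s - 1) a / (s - 1)).
Proof.
move=> a0 s1 tf fM; rewrite ler_norml -mulNr -!tail_cst //.
by apply/andP; split; apply: tail_le => // [|y]; try exact: tame_cst;
  move=> /fM; rewrite ler_norml => /andP[].
Qed.

Lemma Rint_endpoint a b (F : R -> R) : a <= b -> (forall y, a <= y < b -> F y = 0) ->
  \int[mu]_(y in `[a, +oo[) F y = \int[mu]_(y in `[b, +oo[) F y.
Proof.
move=> ab h; rewrite Rintegral_mkcond [RHS]Rintegral_mkcond; apply: eq_Rintegral => y _.
rewrite /patch !mem_setE !in_itv /= !andbT.
case: (leP b y) => by_; first by rewrite (le_trans ab by_).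
by case: (leP a y) => ay //; rewrite h // ay.
Qed.

Lemma tail_shift_ge0 a s g t : 0 < a -> 0 < a + t -> continuous g -> (forall y, 0 <= g y) ->
  \int[mu]_(v in `[a + t, +oo[) (g v * pw s (v - t)) = tail a s (fun y => g (y + t)).
Proof.
move=> a0 at0 cg g0; rewrite /tail /Rintegral; apply: (congr1 fine).
pose G y := g (y + t) * pw s y.
have e1 : (a + t) - t = a by rewrite addrK.
have d1 : derive1 (fun v : R => v - t) = (fun=> 1).
  by apply/funext => v; rewrite derive1E deriveB // derive_id derive_cst subr0.
rewrite -[in RHS]e1 (@increasing_ge0_integration_by_substitutiony R (fun v => v - t) G (a + t)).
- apply: eq_integral => v _; congr EFin; rewrite -[RHS]/(_ * _) /G /= subrK.
  by rewrite d1 mulr1.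
- by move=> x y _ _ xy; rewrite ltrD2r.
- by move=> x _; rewrite d1; apply: cvg_cst.
- by rewrite d1; apply/cvg_ex; exists 1; apply: cvg_cst.
- by rewrite d1; apply/cvg_ex; exists 1; apply: cvg_cst.
- split; first by move=> x _; exact: derivableB.
  by apply: cvg_at_right_filter; apply: cvgB; [exact: cvg_id|exact: cvg_cst].
- apply/cvgryPge => A; near=> x; rewrite lerBrDr; near: x; apply: nbhs_pinfty_ge; exact: num_real.
- rewrite e1; apply: half_line_within => y ay.
  apply: (@continuousM _ _ (fun y => g (y + t)) (pw s)); last first.
    by apply: continuous_pw; exact: lt_le_trans ay.
  apply: (@continuous_comp _ _ _ (fun y => y + t) g); last exact: cg.
  by apply: cvgD; [exact: cvg_id|exact: cvg_cst].
- by move=> y _; rewrite mulr_ge0 ?pw_ge0.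
Unshelve. all: by end_near.
Qed.

Lemma tail_scale_ge0 a s g xi M : 0 < a -> 1 < s -> 0 < xi -> continuous g ->
  (forall y, 0 <= g y) -> (forall y, `|g y| <= M) ->
  tail a s (fun y => g (xi * y)) = xi `^ (s - 1) * tail (xi * a) s g.
Proof.
move=> a0 s1 xi0 cg g0 gM.
have d1 : derive1 (fun v : R => xi * v) = (fun=> xi).
  apply/funext => v; rewrite derive1E (_ : (fun v : R => xi * v) = xi *: @id R); last by apply/funext.
  by rewrite deriveZ // derive_id; exact: mulr1.
have h : \int[mu]_(y in `[xi * a, +oo[) (g y * pw s y) =
    \int[mu]_(y in `[a, +oo[) (xi `^ (1 - s) * (g (xi * y) * pw s y)).
  rewrite /Rintegral; congr fine.
  rewrite (@increasing_ge0_integration_by_substitutiony R (fun v => xi * v) (fun y => g y * pw s y) a).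
  - apply: eq_integral => v; rewrite inE /= in_itv /= andbT => av; congr EFin.
    have v0 : 0 <= v by apply: ltW; exact: lt_le_trans av.
    have e : xi `^ (1 - s) = xi * xi `^ (- s).
      by rewrite powRD ?powRr1 ?(ltW xi0) //; apply/implyP => _; rewrite gt_eqF.
    by rewrite -[LHS]/(_ * _) d1 /= /pw powRM ?(ltW xi0) // e; ring.
  - by move=> x y _ _ xy; rewrite ltr_pM2l.
  - by move=> x _; rewrite d1; apply: cvg_cst.
  - by rewrite d1; apply/cvg_ex; exists xi; apply: cvg_cst.
  - by rewrite d1; apply/cvg_ex; exists xi; apply: cvg_cst.
  - split; first by move=> x _; exact: derivableM.
    by apply: cvg_at_right_filter; apply: cvgM; [apply: cvg_cst|exact: cvg_id].
  - apply/cvgryPge => A; near=> x; rewrite mulrC -ler_pdivrMr //; near: x; apply: nbhs_pinfty_ge; exact: num_real.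
  - apply: half_line_within => y ay; apply: (@continuousM _ _ g (pw s)); first exact: cg.
    by apply: continuous_pw; apply: lt_le_trans ay; rewrite mulr_gt0.
  - by move=> y _; rewrite mulr_ge0 ?pw_ge0.
have cgx : continuous (fun y => g (xi * y)).
  move=> y; apply: (@continuous_comp _ _ _ (fun y => xi * y) g); last exact: cg.
  by apply: cvgM; [apply: cvg_cst|exact: cvg_id].
rewrite [tail (xi * a) s g]h RintegralZl; last 2 first.
- exact: measurable_itv.
- by apply: tame_integrable => //; apply: (tame_cont _ cgx (M := M)).
rewrite mulrA -powRD; last by apply/implyP => _; rewrite gt_eqF.
by rewrite (_ : s - 1 + (1 - s) = 0) ?powRr0 ?mul1r //; ring.
Unshelve. all: by end_near.
Qed.

End UniqueContinuation.

(** * The truncated singular kernel and its symbol *)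

Section Kernel.
Variable R : realType.
Notation mu := (@lebesgue_measure R).
Implicit Types (T a b s t c M xi : R) (f g h : R -> R).

Lemma tail_split a b s g : 0 < a -> a <= b -> 1 < s -> tame a g ->
  tail a s g = \int[mu]_(y in `[a, b]) (g y * pw s y) + tail b s g.
Proof.
move=> a0 ab s1 tg; have ig := tame_integrable a0 s1 tg.
have := @Rintegral_itvB R (fun y => g y * pw s y) (BLeft a) +oo%O b ig.
rewrite bnd_simp => /(_ ab isT) /eqP; rewrite subr_eq addrC /tail => /eqP ->; congr (_ + _).
rewrite -Rintegral_itv_obnd_cbnd //.
apply: integrableS ig; [exact: measurable_itv|exact: measurable_itv|].
by move=> y /=; rewrite !in_itv /= !andbT; move=> /ltW; apply: le_trans.
Qed.

(** [represent] yields a function with the coefficients of [f] and the stated tails; uniqueness of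
    coefficients identifies it with [f]. *)
Lemma UA_tail T f C j : 0 < T -> UA T f ->
  (forall k, amp T (density T f) k <= C / k.+1%:R ^+ (j + 2)) ->
  forall d x, `|f x - tsum T (density T f) d x| <= 4 * C / d.+1%:R ^+ j.+1.
Proof.
move=> T0 uf hC; have [B [B0 hB]] := UA_bounded uf.
have hP : functional T (density T f) B by apply: itg_functional => //; exact: UA_wc.
have [f' [uf' tl eqf]] := represent T0 hP hC.
suff e : f' =1 f by move=> d x; rewrite -e.
apply: (periodic_eq T0 (UA_periodic T0 uf') (UA_periodic T0 uf)) => x hx.
apply/eqP; rewrite -subr_eq0; apply/eqP.
have wd : wc T (fun x => f' x - f x).
  apply: UA_wc; apply: UA_ext (UAD uf' (UAZ (-1) uf)) _ => y; by rewrite mulN1r.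
apply: (wave_unique T0 wd _ hx) => k p.
have uw := UA_wave T k p.
rewrite (@eq_itg _ T _ (fun x => f' x * wave T k p x + (-1) * (f x * wave T k p x))); last first.
  by move=> y _; ring.
have w1 := UA_wc (UAM uf' uw); have w2 := UA_wc (UAM uf uw).
rewrite itgD; [|exact: w1|exact: wcZ]. rewrite itgZ; last exact: w2.
by rewrite eqf // mulN1r subrr.
Qed.

Lemma freq_ge0 T k : 0 < T -> 0 <= freq T k.
Proof.
move=> T0; apply: divr_ge0; last exact: ltW.
by apply: mulr_ge0 => //; apply: mulr_ge0 => //; exact: pi_ge0.
Qed.

Lemma freq_power_le T al k : 0 < T -> 0 <= al <= 2 ->
  `|freq T k| `^ al <= (1 + 2 * pi / T) ^+ 2 * k.+1%:R ^+ 2.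
Proof.
move=> T0 /andP[al0 al2]; have f0 := freq_ge0 k T0.
have c0 : 0 <= 2 * pi / T :> R by rewrite divr_ge0 ?mulr_ge0 ?pi_ge0 ?ltW.
have k1 : 1 <= k.+1%:R :> R by rewrite ler1n.
rewrite ger0_norm // -exprMn.
have h1 : freq T k `^ al <= (1 + freq T k) `^ al by rewrite ge0_ler_powR ?nnegrE //; lra.
have h2 : (1 + freq T k) `^ al <= (1 + freq T k) ^+ 2.
  by rewrite -powR_mulrn; [apply: ler_powR; lra|lra].
apply: le_trans h1 (le_trans h2 _); rewrite lerXn2r ?nnegrE; [|lra|by rewrite mulr_ge0 ?addr_ge0|].
  by [].
have -> : freq T k = 2 * pi / T * k%:R by rewrite /freq; ring.
by rewrite -[k.+1%:R]natr1; have : 0 <= k%:R :> R by []; nra.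
Qed.

(** Both multipliers grow at most quadratically and the coefficients of [f] decay with order four,
    so the frequencies from [d] on contribute [O(1 / d)], uniformly in the multipliers. Below [d]
    only the difference of the symbols counts. Used for the truncated kernel and for the grid
    operator. *)
Lemma multiplier_approx T al f h C A s Theta B (kap : nat -> R) x :
  0 < T -> 0 <= al <= 2 -> UA T f -> UA T h ->
  (forall k, amp T (density T f) k <= C / k.+1%:R ^+ 4) ->
  (forall k p, itg T (fun x => h x * wave T k p x) =
     `|freq T k| `^ al * itg T (fun x => f x * wave T k p x)) ->
  functional T Theta B -> (forall k p, Theta (wave T k p) = kap k * wave T k p x) ->
  0 <= A -> 0 <= s -> (forall k, `|kap k| <= A * k.+1%:R ^+ 2) ->
  (forall k, s * `|freq T k| `^ al <= A * k.+1%:R ^+ 2) ->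
  forall d, `|Theta f - s * h x| <= 8 * (A * C) / d.+1%:R
    + \sum_(k < d) `|kap k - s * `|freq T k| `^ al| * (2 * C).
Proof.
move=> T0 hal uf uh hC hfh fT hkap A0 s0 kapA sA d.
pose C3 := (1 + 2 * pi / T) ^+ 2.
have C30 : 0 <= C3 by exact: sqr_ge0.
pose sg k := `|freq T k| `^ al.
have sg0 k : 0 <= sg k by exact: powR_ge0.
have hsg k : sg k <= C3 * k.+1%:R ^+ 2 by exact: freq_power_le.
pose t k := tterm T (density T f) k x.
have C0 : 0 <= C by have := le_trans (amp_ge0 T (density T f) 0) (hC 0%N); rewrite expr1n divr1.
have p0 n k : 0 <= C / k.+1%:R ^+ n by rewrite divr_ge0 // exprn_ge0.
have tb k : `|t k| <= 2 * (C / k.+1%:R ^+ 4).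
  by apply: le_trans (tterm_le _ _ _ _) _; rewrite ler_pM2l.
have weight (E z y : R) k : `|z| <= E * k.+1%:R ^+ 2 -> `|y| <= 2 * (C / k.+1%:R ^+ 4) ->
    `|z * y| <= 2 * (E * C / k.+1%:R ^+ (0 + 2)).
  move=> hz hy; rewrite normrM.
  apply: le_trans (ler_pM (normr_ge0 _) (normr_ge0 _) hz hy) _.
  rewrite le_eqVlt; apply/orP; left; apply/eqP; field.
  by rewrite gt_eqF // addrC natr1 ltr0Sn.
have nsg k : `|sg k| <= C3 * k.+1%:R ^+ 2 by rewrite ger0_norm.
have ampE k p : density T h (wave T k p) = sg k * density T f (wave T k p) by exact: hfh.
have hampl k : amp T (density T h) k <= C3 * C / k.+1%:R ^+ (0 + 2).
  have -> : amp T (density T h) k = sg k * amp T (density T f) k.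
    by rewrite /amp !ampE ![`|sg k * _|]normrM (ger0_norm (sg0 k)) -mulrDr.
  apply: le_trans (ler_pM (sg0 k) (amp_ge0 _ _ _) (hsg k) (hC k)) _.
  rewrite le_eqVlt; apply/orP; left; apply/eqP; field.
  by rewrite gt_eqF // addrC natr1 ltr0Sn.
have tsumh n : tsum T (density T h) n x = \sum_(k < n) sg k * t k.
  by apply: eq_bigr => k _; rewrite /t /tterm !ampE; ring.
have hcj k : amp T (density T f) k <= C / k.+1%:R ^+ (2 + 2) by exact: hC.
have tlf := UA_tail T0 uf hcj; have tlh := UA_tail T0 uh hampl.
have E0 : 0 <= 4 * (A * C) / d.+1%:R by rewrite divr_ge0 // mulr_ge0 // mulr_ge0.
have split3 (u v w : R) : `|u - w| <= `|u - v| + `|v - w|.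
  by rewrite -(subrKA v); exact: ler_normD.
have step1 : `|Theta f - \sum_(k < d) kap k * t k| <= 4 * (A * C) / d.+1%:R.
  rewrite -subr_le0; apply: (@le_all_harmonic _ _ (B * (4 * C)) d) => d' dd'.
  have kt n : Theta (tsum T (density T f) n) = \sum_(k < n) kap k * t k.
    rewrite (functional_sum fT (F := tterm T (density T f))); last by move=> i _; exact: UA_tterm.
    apply: eq_bigr => k _; rewrite /t /tterm (functionalZ fT); last first.
      by apply: UAD; apply: UAZ; exact: UA_wave.
    rewrite (functionalD fT); try by apply: UAZ; exact: UA_wave.
    by rewrite !(functionalZ fT) ?hkap //; try exact: UA_wave; ring.
  have h1 : `|Theta f - \sum_(k < d') kap k * t k| <= B * (4 * C / d'.+1%:R ^+ 3).
    rewrite -kt -(functionalB fT) //; last exact: UA_tsum.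
    apply: (functional_bound fT) => [|y]; last exact: tlf.
    apply: UA_ext (UAD uf (UAZ (-1) (UA_tsum T (density T f) d'))) _ => y; by rewrite mulN1r.
  have h2 := series_tail (fun k => weight _ _ _ _ (kapA k) (tb k)) dd'.
  rewrite expr1 in h2.
  have h3 : B * (4 * C / d'.+1%:R ^+ 3) <= B * (4 * C) / d'.+1%:R.
    rewrite mulrA ler_wpM2l //; first by rewrite mulr_ge0 ?(functional_B0 fT) ?mulr_ge0.
    have d1 : 1 <= d'.+1%:R :> R by rewrite ler1n.
    have d3 : 0 < d'.+1%:R ^+ 3 :> R by rewrite exprn_gt0.
    rewrite lef_pV2 ?posrE // exprS ler_peMr //; exact: exprn_ege1.
  rewrite lerBlDr; apply: le_trans (lerD h3 h2).
  exact: le_trans (split3 _ _ _) (lerD h1 (lexx _)).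
have step2 : `|s * h x - \sum_(k < d) s * sg k * t k| <= 4 * (A * C) / d.+1%:R.
  rewrite -subr_le0; apply: (@le_all_harmonic _ _ (s * (4 * (C3 * C))) d) => d' dd'.
  have h1 : `|s * h x - \sum_(k < d') s * sg k * t k| <= s * (4 * (C3 * C)) / d'.+1%:R.
    have -> : \sum_(k < d') s * sg k * t k = s * tsum T (density T h) d' x.
      by rewrite tsumh mulr_sumr; apply: eq_bigr => k _; rewrite mulrA.
    by rewrite -mulrBr normrM (ger0_norm s0) -mulrA ler_wpM2l // tlh.
  have sn k : `|s * sg k| <= A * k.+1%:R ^+ 2 by rewrite ger0_norm ?mulr_ge0 // sA.
  have h2 := series_tail (fun k => weight _ _ _ _ (sn k) (tb k)) dd'.
  rewrite expr1 in h2.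
  rewrite lerBlDr; apply: le_trans (lerD h1 h2); exact: split3.
have step3 : `|\sum_(k < d) kap k * t k - \sum_(k < d) s * sg k * t k| <=
    \sum_(k < d) `|kap k - s * sg k| * (2 * C).
  rewrite -sumrB; apply: le_trans (ler_norm_sum _ _ _) _; apply: ler_sum => k _.
  rewrite -mulrBl normrM ler_wpM2l //; apply: le_trans (tb k) _; rewrite ler_pM2l //.
  by rewrite ler_pdivrMr ?exprn_gt0 // ler_peMr // exprn_ege1 // ler1n.
apply: le_trans (split3 _ (\sum_(k < d) kap k * t k) _) _.
apply: le_trans (lerD step1 (split3 _ (\sum_(k < d) s * sg k * t k) _)) _.
rewrite [X in _ + (_ + X)]distrC.
have -> : 8 * (A * C) / d.+1%:R = 4 * (A * C) / d.+1%:R + 4 * (A * C) / d.+1%:R by ring.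
by rewrite -addrA lerD2l addrC lerD.
Qed.

Variable alpha : R.
Hypotheses (al0 : 0 < alpha) (al2 : alpha < 2).
Let be1 : 1 < 1 + alpha. Proof. by rewrite ltrDl. Qed.

(* Truncating the kernel to [y >= a] avoids the singularity; [kappa a] is its symbol. *)
Definition kappa a xi : R := tail a (1 + alpha) (fun y => 1 - cos (xi * y)).

Lemma continuous_one_sub_cos xi : continuous (fun y => 1 - cos (xi * y)).
Proof.
move=> y; apply: cvgB; first exact: cvg_cst.
apply: (@continuous_comp _ _ _ (fun y => xi * y) cos); last exact: continuous_cos.
by apply: cvgM; [exact: cvg_cst|exact: cvg_id].
Qed.

Lemma tame_kappa a xi : tame a (fun y => 1 - cos (xi * y)).
Proof.
apply: (@tame_cont _ _ _ 2) => [|y]; first exact: continuous_one_sub_cos.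
rewrite ger0_norm ?one_sub_cos_ge0 //.
by have := cos_geN1 (xi * y); lra.
Qed.

(** The substitution of [xi * y] for [y] shows that, as [a] tends to [0], all symbols are governed
    by the single limit of [kappa d 1] as [d] tends to [0]. *)
Lemma kappa_scale a xi : 0 < a -> 0 < xi -> kappa a xi = xi `^ alpha * kappa (xi * a) 1.
Proof.
move=> a0 xi0; pose g y : R := 1 - cos y.
have -> : kappa (xi * a) 1 = tail (xi * a) (1 + alpha) g.
  by apply: eq_tail => y _; rewrite mul1r.
have {1}-> : alpha = 1 + alpha - 1 by ring.
apply: (@tail_scale_ge0 _ _ _ g xi 2) => //.
- by move=> y; apply: cvgB; [exact: cvg_cst|exact: continuous_cos].
- by move=> y; exact: one_sub_cos_ge0.
- by move=> y; rewrite ger0_norm ?one_sub_cos_ge0 // /g; have := cos_geN1 y; lra.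
Qed.

Lemma kappa0 a : kappa a 0 = 0.
Proof.
rewrite /kappa /tail.
under eq_Rintegral do rewrite mul0r cos0 subrr mul0r.
by rewrite /Rintegral integral0.
Qed.

Lemma kappa_ge0 a xi : 0 <= kappa a xi.
Proof. by apply: Rintegral_ge0 => y _; rewrite mulr_ge0 ?pw_ge0 ?one_sub_cos_ge0. Qed.

Lemma kappa_decr a b xi : 0 < a -> a <= b -> kappa b xi <= kappa a xi.
Proof.
move=> a0 ab; rewrite /kappa (tail_split a0 ab be1); last exact: tame_kappa.
by rewrite lerDr; apply: Rintegral_ge0 => y _; rewrite mulr_ge0 ?pw_ge0 ?one_sub_cos_ge0.
Qed.

(** Near [0] the integrand is at most [y] to the power [1 - alpha], integrable because [alpha < 2],
    with integral [(2 - alpha)^-1] over the unit interval. *)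
Lemma kappa_bounded a : 0 < a -> a <= 1 -> kappa a 1 <= (2 - alpha)^-1 + kappa 1 1.
Proof.
move=> a0 a1; rewrite /kappa (tail_split a0 a1 be1) ?lerD2r; last exact: tame_kappa.
have c0 : 0 <= (2 - alpha)^-1 by rewrite invr_ge0; have := al2; lra.
move: a1; rewrite le_eqVlt => /orP[/eqP ->|a1].
  by rewrite set_itv1 Rintegral_set1.
have pc : {within `[a, 1], continuous (pw (alpha - 1) : R -> R)}.
  apply: continuous_in_subspaceT => y; rewrite inE /= in_itv /= => /andP[ay _].
  by apply: continuous_pw; exact: lt_le_trans ay.
have i1 : mu.-integrable `[a, 1] (EFin \o (fun y => (1 - cos (1 * y)) * pw (1 + alpha) y)).
  apply: within_integrable; apply: withinM; apply: continuous_in_subspaceT => y.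
    move=> _; exact: continuous_one_sub_cos.
  rewrite inE /= in_itv /= => /andP[ay _].
  by apply: continuous_pw; exact: lt_le_trans ay.
have mI : measurable (`[a, 1%R]%classic : set (measurableTypeR R)) by exact: measurable_itv.
have i2 := within_integrable pc.
apply: (@le_trans _ _ (\int[mu]_(y in `[a, 1]) pw (alpha - 1) y)).
  apply: le_Rintegral => // y /=; rewrite in_itv /= => /andP[ay _].
  have y0 : 0 < y by exact: lt_le_trans ay.
  have -> : pw (alpha - 1) y = y ^+ 2 * pw (1 + alpha) y.
    rewrite /pw -powR_mulrn ?(ltW y0) // -powRD; last by apply/implyP => _; rewrite gt_eqF.
    by congr (_ `^ _); ring.
  rewrite ler_wpM2r ?pw_ge0 // mul1r; apply: le_trans (one_sub_cos_le y) _.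
  by have := sqr_ge0 y; lra.
pose F : R -> R := (2 - alpha)^-1 *: pw (alpha - 2).
have n2 : 2 - alpha != 0 by rewrite gt_eqF // subr_gt0.
have dF (y : R) : 0 < y -> is_derive y 1 F (pw (alpha - 1) y).
  move=> y0; have h := is_derive_pw (alpha - 2) y0.
  apply: is_derive_eq; rewrite -[LHS]/(_ * _) mulrA opprB mulVf // mul1r.
  by congr pw; ring.
have cF (y : R) : 0 < y -> {for y, continuous F}.
  move=> y0; apply: differentiable_continuous; apply/derivable1_diffP.
  by case: (dF y y0).
rewrite /Rintegral (@continuous_FTC2 R _ F a 1 a1 pc); last 2 first.
- split.
  + move=> y; rewrite in_itv /= => /andP[ay _]; by case: (dF y (lt_trans a0 ay)).
  + by apply: cvg_at_right_filter; exact: cF.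
  + by apply: cvg_at_left_filter; apply: cF.
- move=> y; rewrite in_itv /= => /andP[ay _]; rewrite derive1E.
  by case: (dF y (lt_trans a0 ay)).
rewrite -EFinB /= /F -[X in X - _]/(_ * _) -[X in _ - X]/(_ * _).
rewrite -mulrBr ler_piMr // /pw powR1 lerBlDr lerDl powR_ge0 //.
Qed.

(** The symbol increases as the truncation is lowered, so its supremum is its limit. *)
Lemma kappa_limit : exists2 K, forall d, 0 < d -> 0 <= kappa d 1 <= K &
  forall e, 0 < e -> exists2 d0, 0 < d0 & forall d, 0 < d -> d <= d0 -> K - e <= kappa d 1.
Proof.
pose A := [set kappa d 1 | d in [set d | 0 < d <= 1]].
have hA : has_sup A.
  split; first by exists (kappa 1 1); exists 1 => //=; rewrite ltr01 lexx.
  by exists ((2 - alpha)^-1 + kappa 1 1) => _ [d /andP[d0 d1] <-]; exact: kappa_bounded.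
exists (sup A).
  move=> d d0; rewrite kappa_ge0 /=; have [d1|/ltW d1] := leP d 1.
    by apply: sup_upper_bound => //; exists d => //=; rewrite d0.
  apply: le_trans (kappa_decr _ ltr01 d1) _.
  by apply: sup_upper_bound => //; exists 1 => //=; rewrite ltr01 lexx.
move=> e e0; have [_ [d0 /andP[d00 d01] <-] h] := sup_adherent e0 hA.
exists d0 => // d d1 dd0; apply: le_trans (ltW h) _; exact: kappa_decr.
Qed.

(** The singular integral of the fractional Laplacian, up to a constant factor, truncated at [a] and
    written with symmetric second differences. *)
Definition kernel a f x : R := tail a (1 + alpha) (fun y => f x - 2^-1 * (f (x + y) + f (x - y))).

Lemma tame_shift T f a x b : UA T f -> tame a (fun y => f (x + b * y)).
Proof.
move=> uf; have [B [B0 hB]] := UA_bounded uf; apply: (@tame_cont _ _ _ B) => // y.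
apply: (@continuous_comp _ _ _ (fun y => x + b * y) f); last exact: UA_continuous uf _.
by apply: cvgD; [exact: cvg_cst|apply: cvgM; [exact: cvg_cst|exact: cvg_id]].
Qed.

Lemma tame_kernel T f a x : UA T f -> tame a (fun y => f x - 2^-1 * (f (x + y) + f (x - y))).
Proof.
move=> uf; rewrite (_ : (fun y => _) =
    (fun y => f x + (- 2^-1) * (f (x + 1 * y) + f (x + (-1) * y)))); last first.
  by apply/funext => y; rewrite mul1r mulN1r mulNr.
apply: tameD; first exact: tame_cst.
by apply: tameZ; apply: tameD; exact: tame_shift uf.
Qed.

Lemma kernel_functional T a x : 0 < a ->
  functional T (fun f => kernel a f x) (2 * (pw (1 + alpha - 1) a / (1 + alpha - 1))).
Proof.
move=> a0; split.
- move=> f g uf ug; rewrite /kernel -tailD //; try exact: tame_kernel uf; try exact: tame_kernel ug.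
  by apply: eq_tail => y _; ring.
- move=> c f uf; rewrite /kernel -tailZ //; try exact: tame_kernel uf.
  by apply: eq_tail => y _; ring.
- move=> f M uf hM; rewrite mulrAC; apply: tail_bound => //; first exact: tame_kernel uf.
  move=> y _; have := hM x; have := hM (x + y); have := hM (x - y).
  rewrite !ler_norml => /andP[? ?] /andP[? ?] /andP[? ?]; apply/andP; split; lra.
- by rewrite mulr_ge0 // divr_ge0 ?pw_ge0 //; have := al0; lra.
Qed.

Lemma kernel_wave T a k p x : 0 < a ->
  kernel a (wave T k p) x = kappa a (freq T k) * wave T k p x.
Proof.
move=> a0; rewrite mulrC /kappa -tailZ //; last exact: tame_kappa.
apply: eq_tail => y _; rewrite /wave.
have -> : freq T k * (x + y) - p = (freq T k * x - p) + freq T k * y by ring.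
have -> : freq T k * (x - y) - p = (freq T k * x - p) - freq T k * y by ring.
by move: (freq T k * x - p) => u; rewrite cosD cosB; field.
Qed.

(** The truncated integrals tend to [K * h x] as the truncation is removed; if they are eventually
    constant, the constant is this limit. *)
Lemma kernel_zero T f h C x c e0 : 0 < T -> UA T f -> UA T h ->
  (forall k, amp T (density T f) k <= C / k.+1%:R ^+ 4) ->
  (forall k p, itg T (fun x => h x * wave T k p x) =
     `|freq T k| `^ alpha * itg T (fun x => f x * wave T k p x)) ->
  0 < e0 -> (forall e, 0 < e -> e <= e0 -> kernel e f x = c) -> h x = 0 -> c = 0.
Proof.
move=> T0 uf uh hC hfh e00 hc hx0.
have [K hK limK] := kappa_limit.
have K0 : 0 <= K by have /andP[h1] := hK 1 ltr01; exact: le_trans.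
pose C3 := (1 + 2 * pi / T) ^+ 2.
have hal : 0 <= alpha <= 2 by rewrite !ltW.
have C30 : 0 <= C3 by exact: sqr_ge0.
pose sg k := `|freq T k| `^ alpha.
have sg0 k : 0 <= sg k by exact: powR_ge0.
have Ksg k : K * sg k <= K * C3 * k.+1%:R ^+ 2.
  by rewrite -mulrA ler_wpM2l //; exact: freq_power_le.
have C0 : 0 <= C by have := le_trans (amp_ge0 T (density T f) 0) (hC 0%N); rewrite expr1n divr1.
have KC0 : 0 <= K * C3 by rewrite mulr_ge0.
have kk e k : 0 < e -> kappa e (freq T k) <= K * sg k.
  move=> ep; case: k => [|k].
    by rewrite /freq mulr0 mul0r kappa0 mulr_ge0.
  have f0 : 0 < freq T k.+1 by exact: freq_gt0.
  rewrite kappa_scale // mulrC /sg (gtr0_norm f0) ler_wpM2r ?powR_ge0 //.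
  by have /andP[] := hK (freq T k.+1 * e) (mulr_gt0 f0 ep).
have main e d : 0 < e -> e <= e0 -> `|c| <= 8 * (K * C3 * C) / d.+1%:R
    + \sum_(k < d) `|kappa e (freq T k) - K * sg k| * (2 * C).
  move=> ep ee0.
  have kb k : `|kappa e (freq T k)| <= K * C3 * k.+1%:R ^+ 2.
    by rewrite (ger0_norm (kappa_ge0 _ _)); exact: le_trans (kk e k ep) (Ksg k).
  have := multiplier_approx T0 hal uf uh hC hfh (kernel_functional T x ep)
    (fun k p => kernel_wave T k p x ep) KC0 K0 kb Ksg d.
  by rewrite hx0 mulr0 subr0 hc.
suff : `|c| <= 0 by rewrite normr_le0 => /eqP.
apply: (@le_all_harmonic _ _ (8 * (K * C3 * C)) 0) => d _.
rewrite -subr_le0; apply: le_all_eps => eta eta0; rewrite lerBlDr.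
pose S := \sum_(k < d) sg k * (2 * C).
have S0 : 0 <= S by apply: sumr_ge0 => k _; rewrite mulr_ge0 ?mulr_ge0.
have S1 : 0 < S + 1 by rewrite ltr_wpDl.
have [d0 d00 hd0] := limK (eta / (S + 1)) (divr_gt0 eta0 S1).
(* Dividing [d0] by a bound of all frequencies below [d] makes each [freq T k * e] small enough for
   [hd0] at once. *)
pose F := 1 + freq T d.
have F0 : 0 < F by rewrite ltr_pwDl // freq_ge0.
pose e := Num.min e0 (d0 / F).
have ep : 0 < e by rewrite lt_min e00 divr_gt0.
have ee0 : e <= e0 by rewrite ge_min lexx.
have kd k : (k < d)%N -> `|kappa e (freq T k) - K * sg k| <= eta / (S + 1) * sg k.
  case: k => [|k] kd.
    rewrite /sg /freq mulr0 mul0r kappa0 normr0 powR0 ?gt_eqF //.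
    by rewrite !mulr0 subrr normr0.
  have f0 : 0 < freq T k.+1 by exact: freq_gt0.
  rewrite kappa_scale // mulrC /sg (gtr0_norm f0) -mulrBl normrM (ger0_norm (powR_ge0 _ _)).
  rewrite ler_wpM2r ?powR_ge0 //.
  have fe : freq T k.+1 * e <= d0.
    have : e <= d0 / F by rewrite ge_min lexx orbT.
    rewrite ler_pdivlMr // mulrC; apply: le_trans; rewrite ler_wpM2r ?(ltW ep) //.
    rewrite /F /freq; apply: ler_wpDl => //.
    rewrite ler_wpM2r ?invr_ge0 ?(ltW T0) // ler_wpM2l ?mulr_ge0 ?pi_ge0 //.
    by rewrite ler_nat ltnW.
  have fe0 : 0 < freq T k.+1 * e by exact: mulr_gt0.
  have /andP[_ h2] := hK _ fe0; have h3 := hd0 _ fe0 fe.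
  by rewrite ler_norml; apply/andP; split; lra.
apply: le_trans (main e d ep ee0) _; rewrite addrC lerD2r.
apply: (@le_trans _ _ (\sum_(k < d) eta / (S + 1) * (sg k * (2 * C)))).
  apply: ler_sum => k _; rewrite [leRHS]mulrA ler_wpM2r ?mulr_ge0 //; exact: kd.
rewrite -mulr_sumr -/S -mulrA ler_piMr ?(ltW eta0) // mulrC ler_pdivrMr // mul1r lerDl //.
Qed.

End Kernel.

(** * Vanishing moments on a half line *)

Section Moments.
Variable R : realType.
Notation mu := (@lebesgue_measure R).
Implicit Types (T a b s t c M xi r z v : R) (f g h G : R -> R).

Lemma pw_scale s (k v : R) : 0 < k -> 0 <= v -> pw s (k * v) = pw s k * pw s v.
Proof. by move=> k0 v0; rewrite /pw powRM // ltW. Qed.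

(** For [v >= b] the quotient [(v - t) / v] is least at [v = b] if [t > 0], and at least [1]
    otherwise. *)
Lemma pw_shift_le b s t v : 0 < b -> t < b -> 0 <= s -> b <= v ->
  pw s (v - t) <= pw s (Num.min 1 ((b - t) / b)) * pw s v.
Proof.
move=> b0 tb s0 bv; have v0 : 0 < v by exact: lt_le_trans bv.
set k := Num.min _ _; have k0 : 0 < k by rewrite lt_min ltr01 divr_gt0 // subr_gt0.
rewrite -pw_scale ?(ltW v0) //; apply: pw_decr => //; first exact: mulr_gt0.
have [t0|t0] := leP t 0.
  apply: (@le_trans _ _ (1 * v)); last by rewrite mul1r lerDl oppr_ge0.
  by rewrite ler_wpM2r ?(ltW v0) // ge_min lexx.
apply: (@le_trans _ _ ((b - t) / b * v)).
  by rewrite ler_wpM2r ?(ltW v0) // ge_min lexx orbT.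
rewrite mulrAC ler_pdivrMr //; nra.
Qed.

Lemma pw_shift_within b s t : t < b -> {within `[b, +oo[, continuous (fun v => pw s (v - t))}.
Proof.
move=> tb; apply: half_line_within => v bv.
apply: (@continuous_comp _ _ _ (fun v => v - t) (pw s)).
  by apply: cvgB; [exact: cvg_id|exact: cvg_cst].
by apply: continuous_pw; rewrite subr_gt0; exact: lt_le_trans bv.
Qed.

Lemma shift_integrable b s t g : 0 < b -> t < b -> 1 < s -> tame b g ->
  mu.-integrable `[b, +oo[ (EFin \o (fun v => g v * pw s (v - t))).
Proof.
move=> b0 tb s1 tg; have [M M0 gM] := tame_bound tg.
have s0 : 0 <= s by apply: ltW; exact: lt_trans s1.
have mI : measurable (`[b, +oo[%classic : set (measurableTypeR R)) by exact: measurable_itv.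
set k := pw s (Num.min 1 ((b - t) / b)).
have h := Rintegrable_scale (nu := mu) (M * k) mI (pw_integrable b0 s1).
apply: (le_integrable mI _ _ h).
  apply/measurable_EFinP; apply: subspace_continuous_measurable_fun => //.
  by apply: withinM; [exact: tg.1|exact: pw_shift_within].
move=> v /=; rewrite in_itv /= andbT => bv; rewrite lee_fin !normrM (ger0_norm M0).
rewrite !(ger0_norm (pw_ge0 _ _)) -mulrA ler_pM ?pw_ge0 // ?gM //.
exact: pw_shift_le.
Qed.

(** Both sides are linear in [g]; adding the constant [M] makes [g] nonnegative and reduces the
    claim to [tail_shift_ge0]. *)
Lemma tail_shift a s g t M : 0 < a -> 0 < a + t -> 1 < s -> continuous g -> (forall y, `|g y| <= M) ->
  \int[mu]_(v in `[a + t, +oo[) (g v * pw s (v - t)) = tail a s (fun y => g (y + t)).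
Proof.
move=> a0 at0 s1 cg gM; have M0 : 0 <= M by exact: le_trans (gM 0).
have tat : t < a + t by rewrite ltrDr.
have cM : continuous ((fun=> M) : R -> R) by move=> x; apply: cvg_cst.
pose g' y := g y + M.
have g'0 y : 0 <= g' y by have := gM y; rewrite ler_norml /g' => /andP[? _]; lra.
have cg' : continuous g' by move=> y; apply: cvgD; [exact: cg|exact: cM].
have h1 := @tail_shift_ge0 R a s g' t a0 at0 cg' g'0.
have h2 := @tail_shift_ge0 R a s (fun=> M) t a0 at0 cM (fun=> M0).
have cgt : continuous (fun y => g (y + t)).
  move=> y; apply: (@continuous_comp _ _ _ (fun y => y + t) g); last exact: cg.
  by apply: cvgD; [exact: cvg_id|exact: cvg_cst].
have tgt : tame a (fun y => g (y + t)) by apply: (tame_cont _ cgt (M := M)).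
rewrite (tailD a0 s1 tgt (tame_cst a M)) in h1.
have i1 := shift_integrable at0 tat s1 (tame_cont (a + t) cg gM).
have i2 := shift_integrable at0 tat s1 (tame_cst (a + t) M).
have e : \int[mu]_(v in `[a + t, +oo[) (g' v * pw s (v - t)) =
   \int[mu]_(v in `[a + t, +oo[) (g v * pw s (v - t)) +
   \int[mu]_(v in `[a + t, +oo[) (M * pw s (v - t)).
  rewrite -(RintegralD _ i1 i2); last exact: measurable_itv.
  by apply: eq_Rintegral => v _; rewrite mulrDl.
by move: h1; rewrite e h2 => /addIr.
Qed.

Definition smoment r s g t : R := \int[mu]_(v in `[r, +oo[) (g v * pw s (v - t)).

(** For [v >= r] and shifts below [r / 2] one has [v - t >= v / 2]; this dominates the derivative
    uniformly, and differentiation under the integral applies. *)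
Lemma is_derive_smoment r s g t : 0 < r -> 1 < s -> tame r g -> `|t| < r / 2 ->
  is_derive t 1 (smoment r s g) (s * smoment r (s + 1) g t).
Proof.
move=> r0 s1 tg tr; have [M M0 gM] := tame_bound tg.
have s0 : 0 <= s by apply: ltW; exact: lt_trans s1.
have mI : measurable (`[r, +oo[%classic : set (measurableTypeR R)) by exact: measurable_itv.
pose F t v := g v * pw s (v - t).
have dF (x v : R) : x < v -> is_derive x 1 (F ^~ v) (g v * (s * pw (s + 1) (v - x))).
  move=> xv; have vx : 0 < v - x by rewrite subr_gt0.
  have h := is_derive_pw s vx.
  have h' : is_derive x 1 (fun t => v - t) (-1).
    by have := is_deriveB (is_derive_cst v x 1) (is_derive_id x 1); rewrite sub0r.
  have h2 := @is_derive1_comp _ (pw s) (fun t => v - t) x _ _ h h'.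
  rewrite (_ : F ^~ v = g v *: (pw s \o (fun t => v - t))); last by apply/funext => y.
  apply: is_derive_eq; rewrite -[LHS]/(_ * _) mulNr mulrN1 opprK //.
have Ia : `]- (r / 2), r / 2[%classic t by rewrite /= in_itv /= -ltr_norml.
have Ir x : `]- (r / 2), r / 2[%classic x -> x < r /\ - (r / 2) < x < r / 2.
  by rewrite /= in_itv /= => /andP[h1 h2]; split; [lra|apply/andP].
pose Gd v := (M * s * pw (s + 1) 2^-1) * pw (s + 1) v.
have iF x : `]- (r / 2), r / 2[%classic x -> mu.-integrable `[r, +oo[ (EFin \o F x).
  by move=> /Ir[xr _]; exact: shift_integrable.
have dF1 x v : `]- (r / 2), r / 2[%classic x -> `[r, +oo[%classic v -> derivable (F ^~ v) x 1.
  move=> /Ir[xr _]; rewrite /= in_itv /= andbT => rv.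
  by case: (dF x v (lt_le_trans xr rv)).
have G0 v : 0 <= Gd v by rewrite mulr_ge0 ?pw_ge0 // mulr_ge0 ?pw_ge0 // mulr_ge0.
have iG : mu.-integrable `[r, +oo[ (EFin \o Gd).
  by apply: Rintegrable_scale => //; apply: pw_integrable => //; lra.
have d1E x v : `]- (r / 2), r / 2[%classic x -> `[r, +oo[%classic v ->
    partial1of2 F x v = g v * (s * pw (s + 1) (v - x)).
  move=> /Ir[xr _]; rewrite /= in_itv /= andbT => rv; rewrite partial1of2E.
  by case: (dF x v (lt_le_trans xr rv)).
have Gub x v : `]- (r / 2), r / 2[%classic x -> `[r, +oo[%classic v -> `|partial1of2 F x v| <= Gd v.
  move=> hx hv; rewrite d1E //; have [xr /andP[x1 x2]] := Ir _ hx.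
  move: hv; rewrite /= in_itv /= andbT => rv.
  rewrite !normrM (ger0_norm s0) (ger0_norm (pw_ge0 _ _)) /Gd -!mulrA.
  apply: ler_pM; rewrite ?normr_ge0 ?mulr_ge0 ?pw_ge0 // ?gM //.
  rewrite ler_wpM2l // -pw_scale //; [|lra].
  by apply: pw_decr; lra.
have D := derivable_under_integral mI Ia iF dF1 G0 iG Gub.
have E := differentiation_under_integral mI Ia iF dF1 G0 iG Gub.
apply: DeriveDef; first exact: D.
rewrite -derive1E; apply: etrans E _.
rewrite /smoment -RintegralZl //; last by apply: shift_integrable => //; have [] := Ir _ Ia; lra.
by apply: eq_Rintegral => v; rewrite inE => hv; rewrite d1E //; ring.
Qed.

(** Each differentiation in [t] raises the exponent by one, up to a nonzero factor, and the
    reflected argument contributes a sign. *)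
Lemma smoment_zero r s g1 g2 : 0 < r -> 1 < s -> tame r g1 -> tame r g2 ->
  (forall t, `|t| < r / 2 -> smoment r s g1 t + smoment r s g2 (- t) = 0) ->
  forall (n : nat) t, `|t| < r / 2 ->
    smoment r (s + n%:R) g1 t + (-1) ^+ n * smoment r (s + n%:R) g2 (- t) = 0.
Proof.
move=> r0 s1 tg1 tg2 h; elim=> [|n IH] t tr; first by rewrite addr0 expr0 mul1r h.
set sn := s + n%:R in IH; have sn1 : 1 < sn by rewrite ltr_wpDr.
have -> : s + n.+1%:R = sn + 1 by rewrite -[n.+1%:R]natr1 addrA.
have d1 := is_derive_smoment r0 sn1 tg1 tr.
have tr' : `|- t| < r / 2 by rewrite normrN.
have d2 := is_derive_smoment r0 sn1 tg2 tr'.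
have d3 : is_derive t 1 (fun t => - t) (-1) by apply: is_derive_eq.
have d4 := @is_derive1_comp _ (smoment r sn g2) (fun t => - t) t _ _ d2 d3.
pose D : R -> R := smoment r sn g1 \+ (-1) ^+ n *: (smoment r sn g2 \o (fun t => - t)).
have dD : is_derive t 1 D (sn * smoment r (sn + 1) g1 t +
    (-1) ^+ n *: (sn * smoment r (sn + 1) g2 (- t) * (-1))).
  by apply: is_deriveD.
have D0 : {near t, D =1 (fun=> 0)}.
  have : t \in `]- (r / 2), r / 2[ by rewrite in_itv /= -ltr_norml.
  move=> /near_in_itvoo; apply: filterS => u; rewrite in_itv /= -ltr_norml => ur.
  by rewrite -(IH u ur).
have E := @near_eq_derive R R R D (fun=> 0) t 1 D0.
rewrite (@derive_val _ _ _ _ _ _ _ dD) derive_cst in E.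
have {E} : sn * (smoment r (sn + 1) g1 t + (-1) ^+ n.+1 * smoment r (sn + 1) g2 (- t)) = 0.
  move: E; rewrite -[_ *: _]/(_ * _) exprS.
  move: (smoment _ _ _ _) (smoment _ _ _ _) => A B E; rewrite -[RHS]E; ring.
by move=> /eqP; rewrite mulf_eq0 gt_eqF ?(lt_trans ltr01) //= => /eqP.
Qed.

(* The weights [1 - (u - u0)^2] with [u = (r / v)^2] peak at [v0]. *)
Lemma moments_zero r s G M : 0 < r -> 1 < s -> continuous G -> (forall y, `|G y| <= M) ->
  (forall k : nat, tail r (s + 2 * k%:R) G = 0) -> forall v0, r <= v0 -> G v0 <= 0.
Proof.
move=> r0 s1 cG GM hk v0 rv0; rewrite leNgt; apply/negP => Gv0.
have v00 : 0 < v0 by exact: lt_le_trans rv0.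
have M0 : 0 <= M by exact: le_trans (GM 0).
have mI a b : measurable (`[a, b]%classic : set (measurableTypeR R)) by exact: measurable_itv.
have mD : measurable (`[r, +oo[%classic : set (measurableTypeR R)) by exact: measurable_itv.
pose u v : R := r ^+ 2 * pw 2 v.
have uE v : 0 < v -> u v = (r / v) ^+ 2.
  by move=> v_0; rewrite /u /pw powRN powR_mulrn ?(ltW v_0) // -exprVn -exprMn.
have u_le v w : 0 < v -> v <= w -> u w <= u v.
  by move=> v_0 vw; rewrite /u ler_wpM2l ?sqr_ge0 // pw_decr.
have u_lt v w : 0 < v -> v < w -> u w < u v.
  move=> v_0 vw; have w0 := lt_trans v_0 vw; rewrite !uE // ltrXn2r ?nnegrE ?divr_ge0 ?(ltW r0) ?ltW //.
  by rewrite ltr_pM2l // ltf_pV2.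
have u01 v : r <= v -> 0 <= u v <= 1.
  move=> rv; have v_0 := lt_le_trans r0 rv; rewrite mulr_ge0 ?sqr_ge0 ?pw_ge0 //=.
  apply: le_trans (u_le _ _ r0 rv) _; by rewrite uE // divff ?expr1n ?gt_eqF.
pose c v := 1 - (u v - u v0) ^+ 2.
have tG : tame r G by exact: (tame_cont _ cG GM).
have tu : tame r u by apply: tameZ; apply: tame_pw.
have tX g n : tame r g -> tame r (fun v => g v ^+ n).
  move=> tg; elim: n => [|n IH].
    rewrite (_ : (fun v => _) = (fun=> 1)); first exact: tame_cst.
    by apply/funext => v; rewrite expr0.
  rewrite (_ : (fun v => _) = (fun v => g v * g v ^+ n)); first exact: tameM.
  by apply/funext => v; rewrite exprS.
have tc : tame r c.
  rewrite (_ : c = (fun v => 1 + (-1) * (u v + - u v0) ^+ 2)); last first.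
    by apply/funext => v; rewrite mulN1r.
  apply: tameD; first exact: tame_cst. apply: tameZ; apply: tX.
  by apply: tameD => //; exact: tame_cst.
(* [c] is a polynomial in [u], and powers of [u] only raise the exponent of [pw] by even numbers, so
   all these integrals are combinations of the vanishing moments. *)
have poly m : forall k, tail r s (fun v => G v * u v ^+ k * c v ^+ m) = 0.
  elim: m => [|m IH] k.
    have s2 : 1 < s + 2 * k%:R by rewrite ltr_wpDr // mulr_ge0.
    rewrite -[RHS](mulr0 (r ^+ (2 * k))) -(hk k) -(tailZ _ r0 s2 tG).
    apply: eq_Rintegral => v; rewrite inE /= in_itv /= andbT => rv.
    have v_0 := lt_le_trans r0 rv.
    have e1 : pw 2 v ^+ k = v `^ (- 2 * k%:R) by rewrite /pw -powR_mulrn ?powR_ge0 // -powRrM.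
    have e2 : pw (s + 2 * k%:R) v = v `^ (- 2 * k%:R) * pw s v.
      rewrite /pw -powRD; last by apply/implyP => _; rewrite gt_eqF.
      by congr (_ `^ _); ring.
    by rewrite expr0 mulr1 /u exprMn -exprM e1 e2; ring.
  have t0 j : tame r (fun v => G v * u v ^+ j * c v ^+ m).
    by apply: tameM; [apply: tameM => //; exact: tX|exact: tX].
  have e : tail r s (fun v => G v * u v ^+ k * c v ^+ m.+1) =
     tail r s (fun v => ((1 - u v0 ^+ 2) * (G v * u v ^+ k * c v ^+ m) +
       2 * u v0 * (G v * u v ^+ k.+1 * c v ^+ m)) + (-1) * (G v * u v ^+ k.+2 * c v ^+ m)).
    by apply: eq_tail => v _; rewrite !exprS /c; ring.
  rewrite e tailD //; [|by apply: tameD; exact: tameZ|exact: tameZ].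
  rewrite tailD //; [|exact: tameZ|exact: tameZ].
  by rewrite !tailZ // !IH !mulr0 !addr0.
have [eta [eta0 etav]] : exists eta, [/\ 0 < eta, eta < v0 &
    forall v, `|v - v0| < eta -> G v0 / 2 < G v].
  have /cvgrPdist_lt/(_ (G v0 / 2)) : G x @[x --> v0] --> G v0 by exact: cG.
  rewrite divr_gt0 // => /(_ isT) [d /= d0 hd].
  exists (Num.min d (v0 / 2)); split.
  - by rewrite lt_min d0 divr_gt0.
  - by rewrite gt_min; apply/orP; right; lra.
  - move=> v; rewrite lt_min => /andP[vd _].
    have := hd v; rewrite /ball_ /= distrC => /(_ vd).
    by rewrite ltr_norml => /andP[_ ?]; lra.
move=> hG.
have vm : 0 < v0 - eta by rewrite subr_gt0.
(* [u] is strictly monotone: outside the [eta]-neighbourhood of [v0] it differs from [u v0] by at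
   least [q], and close to [v0] by at most [q / 2]. These give the two rates for [peak]. *)
pose q := Num.min (u v0 - u (v0 + eta)) (u (v0 - eta) - u v0).
have q0 : 0 < q.
  by rewrite lt_min !subr_gt0 !u_lt //; [rewrite ltrBlDr ltrDl|rewrite ltrDl].
have q1 : q <= 1.
  have /andP[_ h1] := u01 _ rv0.
  have /andP[h2 _] : 0 <= u (v0 + eta) <= 1 by apply: u01; lra.
  by apply: (@le_trans _ _ (u v0 - u (v0 + eta))); [rewrite ge_min lexx|lra].
have qfar v : r <= v -> eta <= `|v - v0| -> q <= `|u v - u v0|.
  move=> rv; have v_0 := lt_le_trans r0 rv; rewrite ler_normr => /orP[] h.
    have h1 : u v <= u (v0 + eta) by apply: u_le; [exact: addr_gt0|lra].
    have h2 : q <= u v0 - u (v0 + eta) by rewrite ge_min lexx.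
    by rewrite ler_normr; apply/orP; right; lra.
  have h1 : u (v0 - eta) <= u v by apply: u_le => //; lra.
  have h2 : q <= u (v0 - eta) - u v0 by rewrite ge_min lexx orbT.
  by rewrite ler_normr; apply/orP; left; lra.
have [e1 [e10 e1eta e1q]] : exists e1, [/\ 0 < e1, e1 < eta &
    forall v, `|v - v0| <= e1 -> `|u v - u v0| <= q / 2].
  have cu : {for v0, continuous u}.
    by apply: cvgM; [exact: cvg_cst|exact: continuous_pw].
  have /cvgrPdist_lt/(_ (q / 2)) : u x @[x --> v0] --> u v0 by exact: cu.
  rewrite divr_gt0 // => /(_ isT) [d /= d0 hd].
  exists (Num.min (d / 2) (eta / 2)); split.
  - by rewrite lt_min !divr_gt0.
  - by rewrite gt_min; apply/orP; right; lra.
  - move=> v; rewrite le_min => /andP[vd _].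
    have := hd v; rewrite /ball_ /= distrC => h; apply: ltW; rewrite distrC; apply: h.
    lra.
have iw : mu.-integrable `[r, +oo[ (EFin \o pw s) by exact: pw_integrable.
(* One-sided, since [v0] may be the left end point [r]. *)
have sub : `[v0, v0 + e1] `<=` `[r, +oo[.
  by move=> v /=; rewrite !in_itv /= andbT => /andP[h _]; exact: le_trans h.
have igm m : mu.-integrable `[r, +oo[ (EFin \o (fun v => G v * pw s v * c v ^+ m)).
  have := @tame_integrable _ r s (fun v => G v * c v ^+ m) r0 s1 (tameM tG (tX c m tc)).
  by apply: eq_integrable => // v _; rewrite /= mulrAC.
have c0 v : `[r, +oo[%classic v -> 0 <= c v.
  rewrite /= in_itv /= andbT => rv; have /andP[h1 h2] := u01 v rv; have /andP[h3 h4] := u01 v0 rv0.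
  rewrite /c subr_ge0 -[leLHS]real_normK ?num_real // exprn_ile1 //.
  by rewrite ler_norml; apply/andP; split; lra.
have hE v : `[v0, v0 + e1]%classic v -> G v0 / 2 <= G v /\ 1 - (q / 2) ^+ 2 <= c v.
  rewrite /= in_itv /= => /andP[h1 h2].
  have h3 : `|v - v0| <= e1 by rewrite ger0_norm; lra.
  split; first by apply/ltW/hG; exact: le_lt_trans e1eta.
  rewrite /c lerD2l lerN2 -[leLHS]real_normK ?num_real // lerXn2r ?nnegrE ?divr_ge0 ?(ltW q0) //.
  exact: e1q.
have hD v : `[r, +oo[%classic v -> 0 <= G v \/ (`|G v| <= M /\ c v <= 1 - q ^+ 2).
  rewrite /= in_itv /= andbT => rv; have [h|h] := ltP `|v - v0| eta.
    by left; apply/ltW; apply: lt_trans (hG v h); rewrite divr_gt0.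
  right; split => //; rewrite /c lerD2l lerN2 -[leRHS]real_normK ?num_real //.
  by rewrite lerXn2r ?nnegrE ?(ltW q0) // qfar.
have w0 : 0 < \int[mu]_(x in `[v0, v0 + e1]) pw s x.
  apply: (@lt_le_trans _ _ (\int[mu]_(x in `[v0, v0 + e1]) (pw s (v0 + e1) * 1))).
    rewrite RintegralZl //; last by apply: within_integrable; apply: continuous_within => x; exact: cvg_cst.
    rewrite mulr_gt0 ?powR_gt0 ?addr_gt0 // Rint_pos_interval // ltrDl //.
  apply: le_Rintegral => //.
  - by apply: within_integrable; apply: continuous_within => x; exact: cvg_cst.
  - by apply: integrableS iw.
  - move=> v /=; rewrite in_itv /= => /andP[h1 h2]; rewrite mulr1.
    by apply: pw_decr; [lra|exact: lt_le_trans h1|].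
have r12 : 1 - q ^+ 2 < 1 - (q / 2) ^+ 2.
  by rewrite ltrD2l ltrN2 ltrXn2r ?nnegrE ?divr_ge0 ?(ltW q0) // ltr_pdivrMr //; lra.
have r20 : 0 <= 1 - q ^+ 2 by rewrite subr_ge0 exprn_ile1 // ltW.
have [m] := @peak _ _ _ mu _ _ G (pw s) c M (G v0 / 2) (1 - (q / 2) ^+ 2) (1 - q ^+ 2) 0
  mD (mI _ _) sub iw (fun x _ => pw_ge0 s x) igm c0 hE hD (divr_gt0 Gv0 (ltr0Sn _ 1))
  r20 r12 M0 w0.
rewrite mul0r => h; have := poly m 0%N.
rewrite /tail (_ : \int[mu]_(y in `[r, +oo[) _ = \int[mu]_(x in `[r, +oo[) (G x * pw s x * c x ^+ m)); last first.
  by apply: eq_Rintegral => v _; rewrite expr0 mulr1 mulrAC.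
by move=> e; rewrite e ltxx in h.
Qed.

(** With the centre moved to [z + t], the vanishing of [h] becomes an identity in [t] between
    inverse-power integrals of the right half [g1] and the left half [g2]. Its derivatives of even
    order at [0] give moments of [g1 + g2], those of odd order moments of [g1 - g2]. *)
Lemma unique_continuation alpha T f h C z r : 0 < alpha -> alpha < 2 -> 0 < T -> UA T f -> UA T h ->
  (forall k, amp T (density T f) k <= C / k.+1%:R ^+ 4) ->
  (forall k p, itg T (fun x => h x * wave T k p x) =
     `|freq T k| `^ alpha * itg T (fun x => f x * wave T k p x)) ->
  0 < r -> (forall x, `|x - z| < r -> f x = 0 /\ h x = 0) -> forall x, f x = 0.
Proof.
move=> al0 al2 T0 uf uh hC hfh r0 hz.
have be1 : 1 < 1 + alpha by rewrite ltrDl.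
have r20 : 0 < r / 2 by rewrite divr_gt0.
have [M [M0 fM]] := UA_bounded uf.
have cf (b : R) : continuous (fun y => f (z + b * y)).
  move=> y; apply: (@continuous_comp _ _ _ (fun y => z + b * y) f); last exact: UA_continuous uf _.
  by apply: cvgD; [exact: cvg_cst|apply: cvgM; [exact: cvg_cst|exact: cvg_id]].
pose g1 v := f (z + 1 * v); pose g2 v := f (z + (-1) * v).
have t1 : tame r g1 by exact: tame_shift uf.
have t2 : tame r g2 by exact: tame_shift uf.
have h0 t : `|t| < r / 2 -> smoment r (1 + alpha) g1 t + smoment r (1 + alpha) g2 (- t) = 0.
  move=> tr; move: (tr); rewrite ltr_norml => /andP[tr1 tr2].
  have nearz y : - (r / 2) < y -> y < r / 2 -> f (z + t + y) = 0.
    by move=> y1 y2; apply: (hz _ _).1; rewrite ltr_norml; apply/andP; split; lra.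
  have [fx hx] : f (z + t) = 0 /\ h (z + t) = 0.
    by apply: hz; rewrite ltr_norml; apply/andP; split; lra.
  (* [f] vanishes within [r / 2] of [z + t], so truncating the kernel below [r / 2] changes
     nothing. *)
  have kc e : 0 < e -> e <= r / 2 -> kernel alpha e f (z + t) = kernel alpha (r / 2) f (z + t).
    move=> e0 er; apply: Rint_endpoint => // y /andP[y1 y2].
    have n1 : f (z + t + y) = 0 by apply: nearz; [lra|].
    have n2 : f (z + t - y) = 0 by apply: nearz; clear -e0 y1 y2; lra.
    by rewrite fx n1 n2 addr0 mulr0 subr0 mul0r.
  have := kernel_zero al0 al2 T0 uf uh hC hfh r20 kc hx.
  have s1 := tame_shift (r / 2) (z + t) 1 uf; have s2 := tame_shift (r / 2) (z + t) (-1) uf.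
  have -> : kernel alpha (r / 2) f (z + t) = tail (r / 2) (1 + alpha)
      (fun y => (- 2^-1) * (f (z + t + 1 * y) + f (z + t + (-1) * y))).
    by apply: eq_tail => y _; rewrite fx sub0r mul1r mulN1r mulNr.
  rewrite (tailZ _ r20 be1 (tameD s1 s2)).
  have a1 : 0 < r / 2 + t by lra.
  have a2 : 0 < r / 2 + - t by lra.
  have E1 : tail (r / 2) (1 + alpha) (fun y => f (z + t + 1 * y)) = smoment r (1 + alpha) g1 t.
    transitivity (tail (r / 2) (1 + alpha) (fun y => g1 (y + t))).
      by apply: eq_tail => y _; rewrite /g1; congr f; ring.
    rewrite -(tail_shift r20 a1 be1 (cf 1) (fun y => fM _)) /smoment.
    apply: Rint_endpoint => [|v /andP[v1 v2]]; first lra.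
    have fv : f (z + 1 * v) = 0.
      by apply: (hz _ _).1; rewrite ltr_norml; clear -v1 v2 tr1 tr2 r20; apply/andP; split; lra.
    by rewrite /g1 fv mul0r.
  have E2 : tail (r / 2) (1 + alpha) (fun y => f (z + t + (-1) * y)) = smoment r (1 + alpha) g2 (- t).
    transitivity (tail (r / 2) (1 + alpha) (fun y => g2 (y + - t))).
      by apply: eq_tail => y _; rewrite /g2; congr f; ring.
    rewrite -(tail_shift r20 a2 be1 (cf (-1)) (fun y => fM _)) /smoment.
    apply: Rint_endpoint => [|v /andP[v1 v2]]; first lra.
    have fv : f (z + (-1) * v) = 0.
      by apply: (hz _ _).1; rewrite ltr_norml; clear -v1 v2 tr1 tr2 r20; apply/andP; split; lra.
    by rewrite /g2 fv mul0r.
  rewrite (tailD r20 be1 s1 s2) E1 E2.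
  by move=> /eqP; rewrite mulf_eq0 oppr_eq0 invr_eq0 pnatr_eq0 /= => /eqP.
have mom := smoment_zero r0 be1 t1 t2 h0.
have zr : `|0 : R| < r / 2 by rewrite normr0.
have moE s g : smoment r s g 0 = tail r s g.
  by apply: eq_Rintegral => v _; rewrite subr0.
(* [b] selects the parity; within one parity the exponents advance by two, as [moments_zero]
   requires. The factor [e] takes both signs and turns the inequality into an equality. *)
have hzero (b : bool) (e : R) v : r <= v -> e * (g1 v + (-1) ^+ b * g2 v) <= 0.
  move=> rv.
  apply: (@moments_zero r (1 + alpha + b%:R) (fun v => e * (g1 v + (-1) ^+ b * g2 v)) (`|e| * (M + M))) => //.
  - by rewrite ltr_wpDr.
  - move=> y; apply: cvgM; first exact: cvg_cst.
    apply: cvgD; first exact: (cf 1).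
    by apply: cvgM; [exact: cvg_cst|exact: (cf (-1))].
  - move=> y; rewrite normrM ler_wpM2l //; apply: le_trans (ler_normD _ _) _; apply: lerD; first exact: fM.
    by rewrite normrMsign; exact: fM.
  - move=> k; have := mom (b + k.*2)%N 0 zr; rewrite oppr0 !moE => h1.
    have s1 : 1 < 1 + alpha + b%:R + 2 * k%:R by rewrite -addrA ltr_wpDr // addr_ge0 ?mulr_ge0.
    have e2 : 1 + alpha + (b + k.*2)%:R = 1 + alpha + b%:R + 2 * k%:R.
      by rewrite natrD -mul2n natrM addrA.
    have tz := tameZ ((-1) ^+ b) t2.
    rewrite e2 exprD -mul2n exprM sqrrN expr1n expr1n mulr1 in h1.
    by rewrite (tailZ _ r0 s1 (tameD t1 tz)) (tailD r0 s1 t1 tz) (tailZ _ r0 s1 t2) h1 mulr0.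
have g12 v : r <= v -> g1 v = 0 /\ g2 v = 0.
  move=> rv.
  have a1 := hzero false 1 v rv; have a2 := hzero false (-1) v rv.
  have a3 := hzero true 1 v rv; have a4 := hzero true (-1) v rv.
  rewrite expr0 !mul1r mulN1r in a1 a2; rewrite expr1 !mul1r !mulN1r in a3 a4.
  by split; lra.
move=> x; have [xz|xz] := ltP `|x - z| r; first by have [] := hz x xz.
move: xz; rewrite ler_normr => /orP[xz|xz].
  have [<- _] := g12 (x - z) xz; by rewrite /g1; congr f; ring.
have [_ <-] := g12 (- (x - z)) xz; by rewrite /g2; congr f; ring.
Qed.

End Moments.

(** * The discrete symbol *)

Section Mean.

Fact leq_mirror K m N : (K <= m)%N -> (m <= N - K)%N -> (m < N)%N -> (K <= N - m)%N.
Proof. lia. Qed.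

Variable R : realType.
Implicit Types (c M : R).

Section FixedSize.
Variable N : nat.
Implicit Types F G : 'I_N -> R.

Lemma meanD F G : mean (fun i => F i + G i) = mean F + mean G.
Proof. by rewrite /mean big_split mulrDr. Qed.

Lemma meanZ c F : mean (fun i => c * F i) = c * mean F.
Proof. by rewrite /mean -mulr_sumr mulrCA. Qed.

Lemma eq_mean F G : F =1 G -> mean F = mean G.
Proof. by move=> h; rewrite /mean; congr (_ * _); apply: eq_bigr => i _. Qed.

Lemma mean_le F G : (forall i, F i <= G i) -> mean F <= mean G.
Proof. by move=> h; rewrite /mean ler_wpM2l ?invr_ge0 // ler_sum. Qed.

Lemma mean_ge0 F : (forall i, 0 <= F i) -> 0 <= mean F.
Proof. by move=> h; rewrite /mean mulr_ge0 ?invr_ge0 // sumr_ge0. Qed.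

Lemma mean_cst c : (0 < N)%N -> mean (fun _ : 'I_N => c) = c.
Proof.
move=> N0; rewrite /mean sumr_const card_ord -[c *+ N]mulr_natl mulrA mulVf ?mul1r //.
by rewrite pnatr_eq0 -lt0n.
Qed.

Lemma mean_bound F M : (0 < N)%N -> (forall i, `|F i| <= M) -> `|mean F| <= M.
Proof.
move=> N0 h; rewrite -[leRHS](mean_cst _ N0) /mean normrM ger0_norm ?invr_ge0 //.
rewrite ler_wpM2l ?invr_ge0 //; apply: le_trans (ler_norm_sum _ _ _) _.
by apply: ler_sum => i _.
Qed.

Lemma multDr s F G i : mult s (fun i => F i + G i) i = mult s F i + mult s G i.
Proof.
rewrite /mult -big_split; apply: eq_bigr => m _ /=; rewrite -mulrDr /ghat -meanD.
by congr (_ * _); apply: eq_mean => j; rewrite mulrDl.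
Qed.

Lemma multZr s c F i : mult s (fun i => c * F i) i = c * mult s F i.
Proof.
rewrite /mult mulr_sumr; apply: eq_bigr => m _; rewrite [RHS]mulrCA; congr (_ * _).
by rewrite /ghat -meanZ; apply: eq_mean => j; rewrite mulrA.
Qed.

Lemma eq_multr s F G i : F =1 G -> mult s F i = mult s G i.
Proof.
move=> h; rewrite /mult; apply: eq_bigr => m _; congr (_ * _).
by apply: eq_mean => j; rewrite h.
Qed.

Lemma eq_mults s s' F i : s =1 s' -> mult s F i = mult s' F i.
Proof. by move=> h; rewrite /mult; apply: eq_bigr => m _; rewrite h. Qed.

Lemma mult_bound s F M i : (0 < N)%N -> (forall j, `|F j| <= M) ->
  `|mult s F i| <= (\sum_(m < N) `|s m|) * M.
Proof.
move=> N0 h; rewrite /mult mulr_suml; apply: le_trans (ler_norm_sum _ _ _) _.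
apply: ler_sum => m _; rewrite normrM ler_wpM2l //; apply: mean_bound => // j.
by rewrite normrM; apply: le_trans (ler_piMr _ (cos_max _)) (h j).
Qed.

End FixedSize.

Variable T : R.
Hypothesis T0 : 0 < T.

Definition gpt (N i : nat) : R := T * i%:R / N%:R.

Definition smp (N : nat) (g : R -> R) : 'I_N -> R := fun i => g (gpt N i).

Lemma gpt_per N (i : 'I_N) : per_int T (gpt N i).
Proof.
have N0 : (0 < N)%N by case: N i => // [[]].
rewrite /per_int /= in_itv /= /gpt; apply/andP; split.
  by rewrite divr_ge0 // mulr_ge0 // ltW.
by rewrite ler_pdivrMr ?ltr0n // ler_wpM2l ?(ltW T0) // ler_nat ltnW.
Qed.

Lemma smp_wave N k p (i : 'I_N) : smp (wave T k p) i = cos (theta R N k * i%:R - p).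
Proof.
rewrite /smp /wave /freq /gpt /theta; congr (cos (_ - _)).
have Tn : T != 0 by rewrite gt_eqF.
by rewrite [RHS]mulrAC; move: (pi) => q; rewrite !mulrA; congr (_ / _); field.
Qed.

Lemma ghat_wave N (F : 'I_N -> R) k p : ghat F k p = mean (fun i => F i * smp (wave T k p) i).
Proof. by apply: eq_mean => i; rewrite smp_wave. Qed.

Lemma mean_wave N k p : (k < N)%N -> mean (@smp N (wave T k p)) = itg T (wave T k p).
Proof.
move=> kN; have N0 : (0 < N)%N by exact: leq_ltn_trans kN.
rewrite itg_wave //; case: eqP => [->|/eqP k0].
  rewrite (@eq_mean _ _ (fun=> cos p)) ?mean_cst // => i.
  by rewrite smp_wave /theta mulr0 mul0r mul0r sub0r cosN.
rewrite /mean; under eq_bigr do rewrite smp_wave addrC.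
by rewrite sum_cos_theta ?mulr0 // modn_small.
Qed.

(** Grid means of trigonometric polynomials are exact as soon as the grid resolves their
    frequencies; uniform approximation does the rest. *)
Lemma riemann g : UA T g -> mean (@smp t.+1 g) @[t --> \oo] --> itg T g.
Proof.
move=> ug; apply/cvgrPdist_le => e e0.
have e3 : 0 < e / 2 by rewrite divr_gt0.
have [g' tg' gg'] := ug _ e3.
have h : \forall t \near \oo, mean (@smp t.+1 g') = itg T g'.
  elim: tg' {gg'} => [|f c k p tf IH].
    near=> t; rewrite itg_cst // /smp; exact: mean_cst.
  near=> t.
  have kt : (k < t.+1)%N by near: t; exists k.
  have IHt : mean (@smp t.+1 f) = itg T f by near: t.
  have uf := UA_trig tf; have uw := UA_wave T k p.
  rewrite itgD; [|exact: UA_wc|exact: UA_wc (UAZ c uw)].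
  rewrite itgZ; last exact: UA_wc.
  by rewrite -IHt -(mean_wave p kt) -meanZ -meanD.
near=> t.
have ht : mean (@smp t.+1 g') = itg T g' by near: t.
have -> : itg T g - mean (@smp t.+1 g) = (itg T g - itg T g') + (mean (@smp t.+1 g') - mean (@smp t.+1 g)).
  by rewrite ht; ring.
apply: le_trans (ler_normD _ _) _; rewrite [leRHS](splitr e); apply: lerD.
- have w : wc T (fun x => g x + (-1) * g' x) by apply: UA_wc; apply: UAD ug (UAZ _ (UA_trig tg')).
  have -> : itg T g - itg T g' = itg T (fun x => g x + (-1) * g' x).
    have w' := UA_wc (UA_trig tg').
    by rewrite itgD; [rewrite itgZ // mulN1r|exact: UA_wc|exact: (wcZ (c := -1))].
  by apply: itg_bound => // x _; rewrite mulN1r.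
- have -> : mean (@smp t.+1 g') - mean (@smp t.+1 g) = mean (fun i => smp g' i + (-1) * @smp t.+1 g i).
    by rewrite meanD meanZ mulN1r.
  by apply: mean_bound => // i; rewrite /smp mulN1r distrC; exact: gg'.
Unshelve. all: by end_near.
Qed.

Section Symbol.
Variable alpha : R.
Hypotheses (al0 : 0 < alpha) (al2 : alpha < 2).

Lemma sin_ge_cubic (x : R) : 0 <= x -> x * (1 - x ^+ 2 / 2) <= sin x.
Proof.
rewrite le_eqVlt => /orP[/eqP <-|x0]; first by rewrite mul0r sin0.
have [c] := @MVT R sin cos 0 x x0 (fun y _ => is_derive_sin y)
  (continuous_within (@continuous_sin R)).
rewrite in_itv /= => /andP[c0 cx]; rewrite sin0 !subr0 => ->; rewrite mulrC ler_wpM2r ?(ltW x0) //.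
have := one_sub_cos_le c; have : c ^+ 2 <= x ^+ 2 by rewrite lerXn2r ?nnegrE ?ltW // (lt_trans c0).
lra.
Qed.

Lemma sin_ge_quarter (x : R) : 0 <= x -> x <= 2 -> x / 4 <= sin x.
Proof.
move=> x0 x2.
have -> : sin x = 2 * (sin (x / 2) * cos (x / 2)).
  rewrite [in LHS](_ : x = x / 2 *+ 2); last by field.
  by rewrite sin_mulr2n; ring.
have h1 := @sin_ge_cubic (x / 2) ltac:(lra).
have h2 := one_sub_cos_le (x / 2).
have h3 : (x / 2) ^+ 2 <= 1 by rewrite exprn_ile1 //; lra.
have h4 : x / 4 <= sin (x / 2).
  apply: le_trans h1; have : (1 - (x / 2) ^+ 2 / 2) >= 2^-1 by lra.
  move=> h; have : x / 2 * 2^-1 <= x / 2 * (1 - (x / 2) ^+ 2 / 2) by rewrite ler_wpM2l //; lra.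
  by lra.
have h5 : 2^-1 <= cos (x / 2) by lra.
have h6 : x / 4 * 2^-1 <= sin (x / 2) * cos (x / 2) by apply: ler_pM => //; lra.
by lra.
Qed.

(* Square root of the symbol of the discrete Laplacian at mesh [T / N]. *)
Definition bfreq (N k : nat) : R := 2 * N%:R / T * `|sin (pi * k%:R / N%:R)|.

Lemma bfreq_ge0 N k : 0 <= bfreq N k.
Proof. by rewrite /bfreq mulr_ge0 // divr_ge0 ?mulr_ge0 // ltW. Qed.

Lemma latE N k : lat R N k = (2 * sin (pi * k%:R / N%:R)) ^+ 2.
Proof.
rewrite /lat; have := one_sub_cos (theta R N k).
rewrite (_ : theta R N k / 2 = pi * k%:R / N%:R); last first.
  rewrite /theta; move: (pi) => q; rewrite [LHS](_ : _ = 2 / 2 * (q * k%:R / N%:R)); last by ring.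
  by rewrite divff // mul1r.
by move=> h; rewrite exprMn; lra.
Qed.

Lemma bfreq_le t k : bfreq t.+1 k <= freq T k.
Proof.
have N0 : 0 < t.+1%:R :> R by rewrite ltr0n.
have := @norm_sin_le R (pi * k%:R / t.+1%:R).
rewrite [leRHS]ger0_norm; last by rewrite divr_ge0 // mulr_ge0 // pi_ge0.
move=> h; have c0 : 0 <= 2 * t.+1%:R / T :> R by rewrite divr_ge0 ?mulr_ge0 ?ltW.
apply: le_trans (ler_wpM2l c0 h) _.
rewrite le_eqVlt; apply/orP; left; apply/eqP; rewrite /freq; move: (pi) => q.
by field; rewrite !gt_eqF //.
Qed.

Lemma bfreq_ge t k : freq T k * (1 - (pi * k%:R / t.+1%:R) ^+ 2 / 2) <= bfreq t.+1 k.
Proof.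
have N0 : 0 < t.+1%:R :> R by rewrite ltr0n.
have x0 : 0 <= pi * k%:R / t.+1%:R :> R by rewrite divr_ge0 // mulr_ge0 // pi_ge0.
have h := le_trans (sin_ge_cubic x0) (ler_norm _).
have c0 : 0 <= 2 * t.+1%:R / T :> R by rewrite divr_ge0 ?mulr_ge0 ?ltW.
apply: le_trans _ (ler_wpM2l c0 h); rewrite mulrA.
rewrite le_eqVlt; apply/orP; left; apply/eqP; congr (_ * _); rewrite /freq; move: (pi) => q.
by field; rewrite !gt_eqF //.
Qed.

Lemma bfreq_cvg k : bfreq t.+1 k @[t --> \oo] --> freq T k.
Proof.
apply: (@squeeze_cvgr _ _ _ _ (fun t => freq T k * (1 - (pi * k%:R / t.+1%:R) ^+ 2 / 2)) (fun=> freq T k)).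
- by near=> t; rewrite bfreq_ge bfreq_le.
- rewrite -[X in _ --> X]mulr1; apply: cvgM; first exact: cvg_cst.
  rewrite -[X in _ --> X]subr0; apply: cvgB; first exact: cvg_cst.
  rewrite -(mul0r 2^-1); apply: cvgM; last exact: cvg_cst.
  have h : pi * k%:R / t.+1%:R @[t --> \oo] --> (0 : R).
    rewrite -(mulr0 (pi * k%:R)); apply: cvgM; first exact: cvg_cst.
    exact: cvg_harmonic.
  have h2 := cvgM h h; rewrite mulr0 in h2; exact: h2.
- exact: cvg_cst.
Unshelve. all: by end_near.
Qed.

(** The modes [m] and [N - m] have the same symbol, so one may assume [2 * m <= N]; there the
    argument of the sine is at most [pi / 2], and [sin x >= x / 4]. *)
Lemma bfreq_high N K m : (K <= m)%N -> (m <= N - K)%N -> (m < N)%N -> pi * K%:R / (2 * T) <= bfreq N m.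
Proof.
move=> Km mK mN; have N0 : 0 < N%:R :> R by rewrite ltr0n (leq_ltn_trans _ mN).
have key j : (K <= j)%N -> (j.*2 <= N)%N -> pi * K%:R / (2 * T) <= 2 * N%:R / T * sin (pi * j%:R / N%:R).
  move=> Kj jN.
  have x0 : 0 <= pi * j%:R / N%:R :> R.
    by apply: divr_ge0; [apply: mulr_ge0 => //; exact: pi_ge0|exact: ltW].
  have x2 : pi * j%:R / N%:R <= 2 :> R.
    have h1 : j%:R / N%:R <= 2^-1 :> R.
      by rewrite ler_pdivrMr // mulrC ler_pdivlMr // -natrM ler_nat muln2.
    have /andP[_ h2] := @pihalf_02 R.
    have := pi_ge0 R; rewrite -mulrA => p0.
    have := ler_wpM2l p0 h1; lra.
  have h := sin_ge_quarter x0 x2.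
  have c0 : 0 <= 2 * N%:R / T :> R by rewrite divr_ge0 ?mulr_ge0 ?ltW.
  apply: le_trans _ (ler_wpM2l c0 h).
  have -> : 2 * N%:R / T * (pi * j%:R / N%:R / 4) = pi * j%:R / (2 * T) :> R.
    by move: (pi) => q; field; rewrite !gt_eqF.
  rewrite ler_wpM2r ?invr_ge0 ?mulr_ge0 ?(ltW T0) // ler_wpM2l ?pi_ge0 // ler_nat //.
rewrite /bfreq; have [h|h] := leqP m.*2 N.
  have := key m Km h; set c := 2 * N%:R / T => hk; apply: le_trans hk _.
  by rewrite ler_wpM2l ?ler_norm // divr_ge0 ?mulr_ge0 ?ltW.
have h2 : ((N - m).*2 <= N)%N by rewrite doubleB leq_subLR -addnn leq_add2r ltnW.
have h3 : (K <= N - m)%N by exact: leq_mirror.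
have := key _ h3 h2; set c := 2 * N%:R / T => hk; apply: le_trans hk _.
have -> : pi * (N - m)%:R / N%:R = pi - pi * m%:R / N%:R :> R.
  rewrite natrB ?(ltnW mN) //; move: (pi) => q; field; by rewrite gt_eqF.
have -> : sin (pi - pi * m%:R / N%:R) = sin (pi * m%:R / N%:R) :> R.
  by rewrite sinB sinpi cospi mul0r mulN1r sub0r opprK.
by rewrite ler_wpM2l ?ler_norm // divr_ge0 ?mulr_ge0 ?ltW.
Qed.

Variable la : nat -> seq (R * R) * R.

(** The factor [(N / T) ^ alpha] restores the scale of the mesh: [lat] is the square of [bfreq]
    times [(T / N) ^ 2]. *)
Definition tau t k : R :=
  (t.+1%:R / T) `^ alpha * response (la t).1 (la t).2 (lat R t.+1 k).

Definition approximating : Prop :=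
  forall t, positive_chain (la t).1 (la t).2 /\
    forall k, `|tau t k - bfreq t.+1 k `^ alpha| <= t.+1%:R^-1.

Hypothesis hla : approximating.

Lemma tau_ge0 t k : 0 <= tau t k.
Proof. by rewrite /tau mulr_ge0 ?powR_ge0 // response_ge0 ?lat_ge0 //; case: (hla t). Qed.

Lemma inv_succ_le1 t : t.+1%:R^-1 <= 1 :> R.
Proof. by rewrite invf_le1 ?ltr0n // ler1n. Qed.

Lemma tau_le t k : tau t k <= `|freq T k| `^ alpha + 1.
Proof.
have [_ h] := hla t; have := h k; rewrite ler_norml => /andP[_ h1].
have h2 : bfreq t.+1 k `^ alpha <= `|freq T k| `^ alpha.
  rewrite (ger0_norm (freq_ge0 k T0)) ge0_ler_powR ?nnegrE ?bfreq_ge0 ?freq_ge0 ?(ltW al0) //.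
  exact: bfreq_le.
rewrite lerBlDl in h1; apply: le_trans h1 (lerD h2 (inv_succ_le1 t)).
Qed.

Lemma tau_cvg k : tau t k @[t --> \oo] --> `|freq T k| `^ alpha.
Proof.
have h0 : bfreq t.+1 k `^ alpha @[t --> \oo] --> `|freq T k| `^ alpha.
  rewrite (ger0_norm (freq_ge0 k T0)); case: k => [|k].
    rewrite (_ : (fun t => _) = (fun=> freq T 0 `^ alpha)); first exact: cvg_cst.
    apply/funext => t; congr (_ `^ _).
    by rewrite /bfreq /freq !mulr0 !mul0r sin0 normr0 mulr0.
  have h := is_derive1_powR alpha (freq_gt0 T0 (ltn0Sn k)).
  have : {for freq T k.+1, continuous (fun x : R => x `^ alpha)}.
    by apply: differentiable_continuous; apply/derivable1_diffP; case: h.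
  apply: (@cvg_comp _ _ _ (fun t => bfreq t.+1 k.+1) (fun x : R => x `^ alpha)); exact: bfreq_cvg.
have h1 : tau t k - bfreq t.+1 k `^ alpha @[t --> \oo] --> (0 : R).
  apply: norm_cvg0.
  apply: (@squeeze_cvgr _ _ _ _ (fun=> 0) (fun t => t.+1%:R^-1)).
  - by near=> t; rewrite normr_ge0; case: (hla t) => _ ->.
  - exact: cvg_cst.
  - exact: cvg_harmonic.
rewrite (_ : (fun t => tau t k) = (fun t => (tau t k - bfreq t.+1 k `^ alpha) + bfreq t.+1 k `^ alpha)).
  by rewrite -[X in _ --> X]add0r; exact: cvgD.
by apply/funext => t; rewrite subrK.
Unshelve. all: by end_near.
Qed.

Lemma tau_high t K m : (K <= m)%N -> (m <= t.+1 - K)%N -> (m < t.+1)%N ->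
  (pi * K%:R / (2 * T)) `^ alpha - 1 <= tau t m.
Proof.
move=> h1 h2 h3; have [_ h] := hla t; have := h m; rewrite ler_norml => /andP[h4 _].
have h5 : (pi * K%:R / (2 * T)) `^ alpha <= bfreq t.+1 m `^ alpha.
  rewrite ge0_ler_powR ?nnegrE ?bfreq_ge0 ?(ltW al0) //; last exact: bfreq_high.
  by apply: divr_ge0; [apply: mulr_ge0 => //; exact: pi_ge0|apply: mulr_ge0 => //; exact: ltW].
rewrite lerBlDr; apply: le_trans h5 _; rewrite -lerBlDl; apply: le_trans (inv_succ_le1 t).
by rewrite -[leRHS]opprK lerNr opprB.
Qed.

Lemma mult_tau_wave t k p (i : 'I_t.+1) :
  mult (tau t) (smp (wave T k p)) i = tau t k * smp (wave T k p) i.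
Proof.
pose rho (c : R) := (t.+1%:R / T) `^ alpha * response (la t).1 (la t).2 (2 - 2 * c).
rewrite smp_wave -[RHS](mult_cos rho k (- p) i).
by apply: eq_multr => j; rewrite smp_wave.
Qed.

Lemma mult_tau_functional t (i : 'I_t.+1) :
  functional T (fun g => mult (tau t) (smp g) i) (\sum_(m < t.+1) `|tau t m|).
Proof.
split=> [f g _ _|c f _|f M _ h|].
- exact: multDr.
- exact: multZr.
- by apply: mult_bound => // j; exact: h.
- exact: sumr_ge0.
Qed.

(** [multiplier_approx] with the grid operator at a single grid point as functional: [tau] converges
    mode by mode and grows at most quadratically, with bounds independent of the point. *)
Lemma consistency f h C e : UA T f -> UA T h ->
  (forall k, amp T (density T f) k <= C / k.+1%:R ^+ 4) ->
  (forall k p, itg T (fun x => h x * wave T k p x) =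
     `|freq T k| `^ alpha * itg T (fun x => f x * wave T k p x)) ->
  0 < e -> \forall t \near \oo, forall i : 'I_t.+1, `|mult (tau t) (smp f) i - smp h i| <= e.
Proof.
move=> uf uh hC hfh e0.
have C0 : 0 <= C by have := le_trans (amp_ge0 T (density T f) 0) (hC 0%N); rewrite expr1n divr1.
pose A := (1 + 2 * pi / T) ^+ 2 + 1.
have A0 : 0 <= A by rewrite addr_ge0 ?sqr_ge0.
have hal : 0 <= alpha <= 2 by rewrite !ltW.
have hA k : `|freq T k| `^ alpha + 1 <= A * k.+1%:R ^+ 2.
  by rewrite mulrDl mul1r lerD ?freq_power_le ?exprn_ege1 ?ler1n.
have sA k : 1 * `|freq T k| `^ alpha <= A * k.+1%:R ^+ 2 by rewrite mul1r; apply: le_trans (hA k); rewrite lerDl.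
have tA t k : `|tau t k| <= A * k.+1%:R ^+ 2.
  by rewrite ger0_norm ?tau_ge0 //; exact: le_trans (tau_le t k) (hA k).
have [d hd] : exists d, 8 * (A * C) / d.+1%:R <= e / 2.
  exists (Num.truncn (8 * (A * C) / (e / 2))).
  have x0 : 0 <= 8 * (A * C) / (e / 2).
    by apply: divr_ge0; [apply: mulr_ge0 => //; exact: mulr_ge0|apply: ltW; exact: divr_gt0].
  have /andP[_ hx] := truncn_itv x0.
  rewrite ler_pdivrMr ?ltr0n // [leRHS]mulrC -ler_pdivrMr ?divr_gt0 //; exact: ltW.
have hs n : \sum_(k < n) `|tau t k - 1 * `|freq T k| `^ alpha| * (2 * C) @[t --> \oo] --> (0 : R).
  elim: n => [|k IH].
    by rewrite (_ : (fun t => _) = (fun=> 0)); [exact: cvg_cst|apply/funext => t; rewrite big_ord0].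
  have h1 : tau t k - 1 * `|freq T k| `^ alpha @[t --> \oo] --> (0 : R).
    rewrite mul1r -[X in _ --> X](subrr (`|freq T k| `^ alpha)).
    by apply: cvgB; [exact: tau_cvg|exact: cvg_cst].
  have h2 : `|tau t k - 1 * `|freq T k| `^ alpha| @[t --> \oo] --> `|0 : R| by apply: cvg_norm.
  rewrite normr0 in h2.
  have h3 := cvgD IH (cvgM h2 (cvg_cst (2 * C))); rewrite mul0r addr0 in h3.
  rewrite (_ : (fun t => _) = (fun t => \sum_(i < k) `|tau t i - 1 * `|freq T i| `^ alpha| * (2 * C) +
     `|tau t k - 1 * `|freq T k| `^ alpha| * (2 * C))); first exact: h3.
  by apply/funext => t; rewrite big_ord_recr.
have e2 : 0 < e / 2 by rewrite divr_gt0.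
have /cvgr0Pnorm_le/(_ _ e2) hs' := hs d.
near=> t => i.
have ht : `|\sum_(k < d) `|tau t k - 1 * `|freq T k| `^ alpha| * (2 * C)| <= e / 2 by near: t.
have := @multiplier_approx _ T alpha f h C A 1 _ _ (tau t) (gpt t.+1 i) T0 hal uf uh hC hfh
  (mult_tau_functional i) (fun k p => mult_tau_wave k p i) A0 ler01 (tA t) sA d.
rewrite mul1r => hm; apply: le_trans hm _; rewrite [leRHS](splitr e) lerD //.
exact: le_trans (ler_norm _) ht.
Unshelve. all: by end_near.
Qed.

End Symbol.

Lemma approximating_exists alpha : 0 < alpha -> alpha < 2 -> exists la, approximating alpha la.
Proof.
move=> al0 al2.
have h t : exists p : seq (R * R) * R, positive_chain p.1 p.2 /\
    forall k, `|(t.+1%:R / T) `^ alpha * response p.1 p.2 (lat R t.+1 k) - bfreq t.+1 k `^ alpha| <= t.+1%:R^-1.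
  have N0 : 0 < t.+1%:R :> R by rewrite ltr0n.
  have s0 : 0 < (t.+1%:R / T) `^ alpha by rewrite powR_gt0 // divr_gt0.
  pose e := t.+1%:R^-1 / (t.+1%:R / T) `^ alpha.
  have e0 : 0 < e by rewrite divr_gt0 // invr_gt0.
  have c0 : 0 < alpha / 2 by rewrite divr_gt0.
  have c1 : alpha / 2 < 1 by lra.
  have [l [a [pl hl]]] := @chain_approximates_power R (alpha / 2) e
    [seq lat R t.+1 m | m <- iota 0 t.+1] c0 c1 e0
    ltac:(by move=> m /mapP[k _ ->]; exact: lat_ge0).
  exists (l, a); split => // k /=.
  (* Periodicity in [k] reduces the infinitely many requirements to a finite list of values, as the
     ladder lemma demands. *)
  have latm : lat R t.+1 k = lat R t.+1 (k %% t.+1)%N.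
    rewrite /lat; congr (2 - 2 * _).
    have := @cos_theta_modn R t.+1 k 1 0 (ltn0Sn t); rewrite !mulr1 !add0r; exact: esym.
  rewrite latm.
  have kin : lat R t.+1 (k %% t.+1)%N \in [seq lat R t.+1 m | m <- iota 0 t.+1].
    by apply/mapP; exists (k %% t.+1)%N => //; rewrite mem_iota /= add0n ltn_mod.
  have -> : bfreq t.+1 k `^ alpha = (t.+1%:R / T) `^ alpha * lat R t.+1 (k %% t.+1)%N `^ (alpha / 2).
    rewrite -latm latE -[_ ^+ 2]real_normK ?num_real // powR_exprn //.
    rewrite -powR_mulrn ?powR_ge0 // -powRrM divfK // -powRM //; last by rewrite divr_ge0 // ltW.
    by rewrite /bfreq normrM ger0_norm //; congr (_ `^ _); ring.
  rewrite -mulrBr normrM (ger0_norm (powR_ge0 _ _)) mulrC -ler_pdivlMr //.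
  exact: hl.
have [la hla] := choice h; by exists la.
Qed.

End Mean.

(** * Eigenfunctions with decaying Fourier coefficients *)

Section Nice.
Variables (R : realType) (T alpha : R) (V : R -> R).
Hypotheses (T0 : 0 < T) (al0 : 0 < alpha) (al2 : alpha < 2) (uV : UA T V).
Implicit Types (f g h u v : R -> R) (nu lam : R).

Definition ip f g : R := itg T (fun x => f x * g x).

Lemma ipC f g : ip f g = ip g f.
Proof. by apply: eq_itg => x _; rewrite mulrC. Qed.

Lemma eq_ip f f' g g' : f =1 f' -> g =1 g' -> ip f g = ip f' g'.
Proof. by move=> h1 h2; apply: eq_itg => x _; rewrite h1 h2. Qed.

Lemma UA_functional f : UA T f -> exists B, functional T (ip f) B.
Proof.
move=> uf; have [B [B0 hB]] := UA_bounded uf; exists B.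
by apply: itg_functional => //; exact: UA_wc.
Qed.

Lemma ipDl f g h : UA T f -> UA T g -> UA T h -> ip (fun x => f x + g x) h = ip f h + ip g h.
Proof.
move=> uf ug uh; have [B fB] := UA_functional uh.
by rewrite ipC (functionalD fB) // ipC [ip h g]ipC.
Qed.

Lemma ipZl c f h : UA T f -> UA T h -> ip (fun x => c * f x) h = c * ip f h.
Proof.
move=> uf uh; have [B fB] := UA_functional uh.
by rewrite ipC (functionalZ fB) // ipC.
Qed.

Lemma ip_suml (n : nat) (F : 'I_n -> R -> R) h : (forall i, UA T (F i)) -> UA T h ->
  ip (fun x => \sum_(i < n) F i x) h = \sum_(i < n) ip (F i) h.
Proof.
move=> uF uh; elim: n F uF => [|n IH] F uF.
  rewrite big_ord0; transitivity (ip (fun x => 0 * h x) h).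
    by apply: eq_ip => // x; rewrite big_ord0 mul0r.
  by rewrite ipZl // mul0r.
have uS (m : nat) (G : 'I_m -> R -> R) : (forall i, UA T (G i)) -> UA T (fun x => \sum_(i < m) G i x).
  elim: m G => [|m IHm] G uG; first by apply: UA_ext (UA_cst T 0) _ => x; rewrite big_ord0.
  apply: UA_ext (UAD (IHm (fun i => G (widen_ord (leqnSn m) i)) (fun i => uG _)) (uG ord_max)) _ => x.
  by rewrite big_ord_recr.
rewrite big_ord_recr /= -IH // -ipDl //; last exact: uS.
by apply: eq_ip => // x; rewrite big_ord_recr.
Qed.

Lemma UA_sum_ord (n : nat) (F : 'I_n -> R -> R) : (forall i, UA T (F i)) ->
  UA T (fun x => \sum_(i < n) F i x).
Proof.
elim: n F => [|n IH] F uF; first by apply: UA_ext (UA_cst T 0) _ => x; rewrite big_ord0.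
apply: UA_ext (UAD (IH (fun i => F (widen_ord (leqnSn n) i)) (fun i => uF _)) (uF ord_max)) _ => x.
by rewrite big_ord_recr.
Qed.

Definition decaying f : Prop := exists C, forall k, amp T (density T f) k <= C / k.+1%:R ^+ 4.

(* [h] is the fractional Laplacian of [f], in the weak sense. *)
Definition image f h : Prop :=
  forall k p, ip h (wave T k p) = `|freq T k| `^ alpha * ip f (wave T k p).

Lemma image_decay f h C : image f h -> (forall k, amp T (density T f) k <= C / k.+1%:R ^+ 4) ->
  forall k, amp T (density T h) k <= (1 + 2 * pi / T) ^+ 2 * C / k.+1%:R ^+ (0 + 2).
Proof.
move=> hfh hC k.
have -> : amp T (density T h) k = `|freq T k| `^ alpha * amp T (density T f) k.
  have e p : density T h (wave T k p) = `|freq T k| `^ alpha * density T f (wave T k p) by exact: hfh.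
  have s0 : 0 <= `|freq T k| `^ alpha by exact: powR_ge0.
  move: (`|freq T k| `^ alpha) s0 e => s s0 e.
  by rewrite /amp !e ![`|s * _|]normrM -mulrDr (ger0_norm s0).
have hal : 0 <= alpha <= 2 by rewrite !ltW.
apply: le_trans (ler_pM (powR_ge0 _ _) (amp_ge0 _ _ _) (freq_power_le k T0 hal) (hC k)) _.
rewrite le_eqVlt; apply/orP; left; apply/eqP; field.
by rewrite !gt_eqF // addrC natr1 ltr0Sn.
Qed.

(** Pairing [hu] with the partial sums of [v] and [u] with those of [hv] gives the same result mode
    by mode; the decay of [v] makes both partial sums converge uniformly. *)
Lemma image_sym u hu v hv : UA T u -> UA T hu -> UA T v -> UA T hv ->
  decaying v -> image u hu -> image v hv -> ip hu v = ip u hv.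
Proof.
move=> uu uhu uv uhv [C hC] iu iv.
have [Bu fu] := UA_functional uu; have [Bh fh] := UA_functional uhu.
have tv := @UA_tail R T v C 2 T0 uv hC.
have th := UA_tail T0 uhv (image_decay iv hC).
set C' := _ * C in th.
have sums d : ip hu (tsum T (density T v) d) = ip u (tsum T (density T hv) d).
  rewrite (functional_sum fh (F := tterm T (density T v))); last by move=> i _; exact: UA_tterm.
  rewrite (functional_sum fu (F := tterm T (density T hv))); last by move=> i _; exact: UA_tterm.
  apply: eq_bigr => k _; rewrite /tterm.
  have w p : UA T (wave T k p) by exact: UA_wave.
  have wz c p : UA T (fun x => c * wave T k p x) by exact: UAZ.
  rewrite (functionalZ fh); last exact: UAD. rewrite (functionalZ fu); last exact: UAD.
  rewrite (functionalD fh (wz _ _) (wz _ _)) (functionalD fu (wz _ _) (wz _ _)).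
  rewrite !(functionalZ fh _ (w _)) !(functionalZ fu _ (w _)).
  have e p : density T hv (wave T k p) = `|freq T k| `^ alpha * density T v (wave T k p) by exact: iv.
  by rewrite !e !iu; ring.
apply/eqP; rewrite -subr_eq0 -normr_le0; apply/eqP/eqP.
apply: (@le_all_harmonic _ _ (Bh * (4 * C) + Bu * (4 * C')) 0) => d _.
have C0 : 0 <= C by have := le_trans (amp_ge0 T (density T v) 0) (hC 0%N); rewrite expr1n divr1.
have h1 : `|ip hu v - ip hu (tsum T (density T v) d)| <= Bh * (4 * C / d.+1%:R ^+ 3).
  rewrite -(functionalB fh) //; last exact: UA_tsum.
  apply: (functional_bound fh) => [|y]; last exact: tv.
  by apply: UA_ext (UAD uv (UAZ (-1) (UA_tsum T (density T v) d))) _ => y; rewrite mulN1r.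
have h2 : `|ip u (tsum T (density T hv) d) - ip u hv| <= Bu * (4 * C' / d.+1%:R ^+ 1).
  rewrite distrC -(functionalB fu) //; last exact: UA_tsum.
  apply: (functional_bound fu) => [|y]; last exact: th.
  by apply: UA_ext (UAD uhv (UAZ (-1) (UA_tsum T (density T hv) d))) _ => y; rewrite mulN1r.
have h3 : Bh * (4 * C / d.+1%:R ^+ 3) <= Bh * (4 * C) / d.+1%:R.
  rewrite mulrA ler_wpM2l //; first by rewrite mulr_ge0 ?(functional_B0 fh) ?mulr_ge0.
  have d1 : 1 <= d.+1%:R :> R by rewrite ler1n.
  have d3 : 0 < d.+1%:R ^+ 3 :> R by rewrite exprn_gt0.
  rewrite lef_pV2 ?posrE // exprS ler_peMr //; exact: exprn_ege1.
have h4 := ler_normD (ip hu v - ip hu (tsum T (density T v) d)) (ip u (tsum T (density T hv) d) - ip u hv).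
rewrite -sums subrKA in h4; rewrite -sums expr1 mulrA in h2.
apply: le_trans h4 _; rewrite mulrDl; apply: lerD h2.
exact: le_trans h1 h3.
Qed.

Record nice nu f : Prop := Nice {
  nice_UA : UA T f;
  nice_decay : decaying f;
  nice_eq : forall k p, `|freq T k| `^ alpha * ip f (wave T k p)
     + ip (fun x => V x * f x) (wave T k p) = nu * ip f (wave T k p) }.

(** For an eigenfunction this is its fractional Laplacian, obtained without differentiating. *)
Definition residual nu f : R -> R := fun x => nu * f x - V x * f x.

Lemma UA_residual nu f : UA T f -> UA T (residual nu f).
Proof.
move=> uf; apply: UA_ext (UAD (UAZ nu uf) (UAZ (-1) (UAM uV uf))) _ => x.
by rewrite mulN1r.
Qed.

Lemma ip_residual nu f g : UA T f -> UA T g ->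
  ip (residual nu f) g = nu * ip f g - ip (fun x => V x * f x) g.
Proof.
move=> uf ug; rewrite -mulN1r -ipZl // -?ipZl //; last exact: UAM.
rewrite -ipDl //; [|exact: UAZ|by apply: UAZ; exact: UAM].
by apply: eq_ip => // x; rewrite mulN1r.
Qed.

Lemma nice_image nu f : nice nu f -> image f (residual nu f).
Proof.
move=> [uf _ e] k p; rewrite ip_residual //; last exact: UA_wave.
by rewrite -e addrK.
Qed.

Lemma decaying_lin c f g : UA T f -> UA T g -> decaying f -> decaying g ->
  decaying (fun x => f x + c * g x).
Proof.
move=> uf ug [C hC] [D hD]; exists (C + `|c| * D) => k.
have e p : density T (fun x => f x + c * g x) (wave T k p) =
    density T f (wave T k p) + c * density T g (wave T k p).
  have uw := UA_wave T k p.
  by rewrite -[LHS]/(ip _ _) ipDl ?ipZl //; exact: UAZ.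
rewrite /amp !e [leRHS]mulrDl -[`|c| * D / _]mulrA; apply: le_trans (lerD (ler_normD _ _) (ler_normD _ _)) _.
rewrite addrACA; apply: lerD; first exact: hC.
by rewrite ![`|c * _|]normrM -mulrDr ler_wpM2l //; exact: hD.
Qed.

Lemma nice_lin nu c f g : nice nu f -> nice nu g -> nice nu (fun x => f x + c * g x).
Proof.
move=> nf ng; have [uf df ef] := nf; have [ug dg eg] := ng.
have ucg := UAZ c ug; have uVg := UAM uV ug; have uVf := UAM uV uf.
split; [exact: UAD|exact: decaying_lin|move=> k p].
have uw := UA_wave T k p.
rewrite ipDl // ipZl // (@eq_ip (fun x => V x * (f x + c * g x)) (fun x => V x * f x + c * (V x * g x)) _ (wave T k p)) //; last first.
  by move=> x; ring.
rewrite ipDl //; last exact: UAZ. rewrite ipZl //.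
transitivity (`|freq T k| `^ alpha * ip f (wave T k p) + ip (fun x => V x * f x) (wave T k p)
  + c * (`|freq T k| `^ alpha * ip g (wave T k p) + ip (fun x => V x * g x) (wave T k p))); first by ring.
by rewrite ef eg; ring.
Qed.

Lemma nice_scale nu c f : nice nu f -> nice nu (fun x => c * f x).
Proof.
move=> nf; have [uf df ef] := nf.
have h := nice_lin (c - 1) nf nf; have [uh dh eh] := h.
have e : (fun x => f x + (c - 1) * f x) = (fun x => c * f x) by apply/funext => x; ring.
by rewrite e in h.
Qed.

(** Testing the equation with [v l] shows that [nu - (nl l + ip T (v l) (v l))] times [ip T (v l) u]
    is zero. The first factor is negative since [nu < lam], so [u] is orthogonal to the family and
    the penalty disappears. *)
Lemma perturbed_eigen (j : nat) (v : 'I_j -> R -> R) (nl : 'I_j -> R) u nu lam :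
  (forall l, nice (nl l) (v l)) -> (forall l l', l != l' -> ip (v l) (v l') = 0) ->
  (forall l, lam <= nl l + ip (v l) (v l)) -> nu < lam -> UA T u -> decaying u ->
  (forall k p, `|freq T k| `^ alpha * ip u (wave T k p) + ip (fun x => V x * u x) (wave T k p)
     + \sum_(l < j) ip (v l) u * ip (v l) (wave T k p) = nu * ip u (wave T k p)) ->
  nice nu u /\ forall l, ip (v l) u = 0.
Proof.
move=> nv ov lv nulam uu du eu.
have uv l := nice_UA (nv l).
pose c l := - ip (v l) u.
have uS : UA T (fun x => \sum_(l < j) c l * v l x) by apply: UA_sum_ord => l; exact: UAZ.
pose h x := residual nu u x + \sum_(l < j) c l * v l x.
have ur := UA_residual nu uu.
have uh : UA T h by exact: UAD.
have ih g : UA T g -> ip h g = nu * ip u g - ip (fun x => V x * u x) g - \sum_(l < j) ip (v l) u * ip (v l) g.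
  move=> ug; rewrite ipDl // ip_residual // (@ip_suml _ (fun l x => c l * v l x)) //; last first.
    by move=> l; exact: UAZ.
  by congr (_ + _); rewrite -sumrN; apply: eq_bigr => l _; rewrite ipZl // mulNr.
have imh : image u h.
  move=> k p; rewrite ih; last exact: UA_wave. by rewrite -eu; ring.
have orth l : ip (v l) u = 0.
  have := image_sym uu uh (uv l) (UA_residual (nl l) (uv l)) (nice_decay (nv l)) imh (nice_image (nv l)).
  rewrite ih // (bigD1 l) //= big1 ?addr0; last by move=> l' /ov ->; rewrite mulr0.
  rewrite [ip u (residual _ _)]ipC ip_residual //.
  have -> : ip (fun x => V x * v l x) u = ip (fun x => V x * u x) (v l).
    by apply: eq_itg => x _; ring.
  rewrite [ip u (v l)]ipC => e.
  have e2 : (nu - (nl l + ip (v l) (v l))) * ip (v l) u = 0.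
    transitivity ((nu * ip (v l) u - ip (fun x => V x * u x) (v l) - ip (v l) u * ip (v l) (v l))
      - (nl l * ip (v l) u - ip (fun x => V x * u x) (v l))); first by ring.
    by rewrite e subrr.
  move/eqP: e2; rewrite mulf_eq0 => /orP[|/eqP //].
  rewrite subr_eq0 => /eqP h1; have h2 := lv l; move: nulam; rewrite h1 => h3.
  by have := le_lt_trans h2 h3; rewrite ltxx.
split => //; split => // k p; rewrite -eu big1 ?addr0 // => l _.
by rewrite orth mul0r.
Qed.

End Nice.

(** * Limits along an ultrafilter *)

Section Ultra.
Variables (R : realType) (U : set_system nat).
Context {hU : UltraFilter U}.
Hypothesis Uoo : \oo `<=` U.

(** By compactness the image of [U] has a cluster point, and a cluster point of an ultrafilter is a
    limit; no subsequences have to be extracted. *)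
Lemma ultra_cvg (a : nat -> R) (M : R) : (forall t, `|a t| <= M) -> exists x : R, a t @[t --> U] --> x.
Proof.
move=> aM.
have : compact `[- M, M]%classic by exact: segment_compact.
move=> /(_ (a @ U) _) [|x [_ hx]].
  have h t : `[- M, M]%classic (a t) by rewrite /= in_itv /= -ler_norml aM.
  exact: (@filterS _ U _ setT (a @^-1` `[- M, M]) (fun t _ => h t) filterT).
exists x; apply/cvgrPdist_lt => e e0.
have [//|Un] := in_ultra_setVsetC [set t | `|x - a t| < e] hU.
have ball : nbhs x [set y | `|x - y| < e] by exists e.
have [y [h1 h2]] := hx _ _ (Un : (a @ U) [set y | ~ `|x - y| < e]) ball.
by case: (h1 h2).
Qed.

Definition ulim (a : nat -> R) : R := lim (a t @[t --> U]).

Lemma ulimP (a : nat -> R) (M : R) : (forall t, `|a t| <= M) -> a t @[t --> U] --> ulim a.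
Proof. by move=> /ultra_cvg [x hx]; rewrite /ulim; apply/cvg_ex; exists x. Qed.

Lemma cvg_ultra (a : nat -> R) (x : R) : a t @[t --> \oo] --> x -> a t @[t --> U] --> x.
Proof. by move=> h A /h; exact: Uoo. Qed.

Lemma ulimE (a : nat -> R) (x : R) : a t @[t --> U] --> x -> ulim a = x.
Proof. by move=> h; apply: cvg_lim. Qed.

Lemma cvg_ultra_sum (n : nat) (F : 'I_n -> nat -> R) (l : 'I_n -> R) :
  (forall i, F i t @[t --> U] --> l i) -> \sum_(i < n) F i t @[t --> U] --> \sum_(i < n) l i.
Proof.
elim: n F l => [|n IH] F l h.
  rewrite big_ord0 (_ : (fun t => _) = (fun=> 0)); first exact: cvg_cst.
  by apply/funext => t; rewrite big_ord0.
rewrite big_ord_recr (_ : (fun t => _) = (fun t => \sum_(i < n) F (widen_ord (leqnSn n) i) t + F ord_max t)).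
  by apply: cvgD => //; exact: IH.
by apply/funext => t; rewrite big_ord_recr.
Qed.

End Ultra.

(** * Minimizers on the grid *)

Section GridForm.

Fact mirror_cond t K m : (K <= t.+1)%N -> (m < t.+1)%N ->
  (t.+1 - K < t.+1 - m.+1)%N = (m < K.-1)%N.
Proof. lia. Qed.

Fact mirror_lt m K : (m < K.-1)%N -> (m.+1 < K)%N.
Proof. lia. Qed.

Variables (R : realType) (T alpha : R) (V : R -> R) (la : nat -> seq (R * R) * R).
Hypotheses (T0 : 0 < T) (al0 : 0 < alpha) (al2 : alpha < 2).
Hypotheses (sV : smooth V) (pV : forall x, V (x + T) = V x).
Hypothesis hla : approximating T alpha la.

Section Bilinear.
Variable t : nat.
Implicit Types (F G H : 'I_t.+1 -> R) (s : R).

Definition gip F G : R := mean (fun i => F i * G i).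

Lemma gipC F G : gip F G = gip G F.
Proof. by apply: eq_mean => i; rewrite mulrC. Qed.

Lemma gip_lin F H s G : gip (fun i => F i + s * H i) G = gip F G + s * gip H G.
Proof. by rewrite /gip -meanZ -meanD; apply: eq_mean => i; ring. Qed.

Lemma eq_gip F F' G G' : F =1 F' -> G =1 G' -> gip F G = gip F' G'.
Proof. by move=> h1 h2; apply: eq_mean => i; rewrite h1 h2. Qed.

Lemma gip_ge0 F : 0 <= gip F F.
Proof. by apply: mean_ge0 => i; rewrite -expr2 sqr_ge0. Qed.

(** The inequality between [2 * |F|] and [1 + F ^+ 2] is enough here, as only boundedness in terms
    of [B] is wanted. *)
Lemma gip_bound F G (B M : R) : gip F F <= B -> (forall i, `|G i| <= M) ->
  `|gip F G| <= (1 + B) / 2 * M.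
Proof.
move=> hB hM; have M0 : 0 <= M by exact: le_trans (hM ord0).
apply: (@le_trans _ _ (mean (fun i => (1 + F i * F i) / 2 * M))).
  rewrite ler_norml /gip -[X in X <= _]mulN1r -meanZ; apply/andP.
  have h i : `|F i * G i| <= (1 + F i * F i) / 2 * M.
    have e : `|F i| * `|F i| = F i * F i by rewrite -expr2 real_normK ?num_real // expr2.
    rewrite normrM ler_pM // -e; have := sqr_ge0 (`|F i| - 1).
    by move: (`|F i|) => y; lra.
  by split; apply: mean_le => i; have := h i; rewrite ler_norml => /andP[]; rewrite ?mulN1r.
have -> : mean (fun i => (1 + F i * F i) / 2 * M) = (1 + gip F F) / 2 * M.
  transitivity (mean (fun i => 2^-1 * M * 1 + 2^-1 * M * (F i * F i))).
    by apply: eq_mean => i; ring.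
  by rewrite meanD !meanZ mean_cst // /gip; ring.
by rewrite ler_wpM2r // ler_wpM2r ?invr_ge0 // lerD2l.
Qed.

Definition kinetic F G : R := mean (fun i => mult (tau T alpha la t) F i * G i).

Lemma kineticC F G : kinetic F G = kinetic G F.
Proof.
rewrite /kinetic /mean mult_sym; congr (_ * _).
by apply: eq_bigr => i _; rewrite mulrC.
Qed.

Lemma kinetic_lin F H s G : kinetic (fun i => F i + s * H i) G = kinetic F G + s * kinetic H G.
Proof.
rewrite /kinetic -meanZ -meanD; apply: eq_mean => i.
by rewrite (multDr _ _ (fun i => s * H i)) multZr; ring.
Qed.

Lemma kinetic_wave F k p :
  kinetic F (smp T (wave T k p)) = tau T alpha la t k * gip F (smp T (wave T k p)).
Proof.
rewrite kineticC /kinetic /gip -meanZ; apply: eq_mean => i.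
by rewrite mult_tau_wave //; ring.
Qed.

(* Square of the modulus of the discrete Fourier coefficient. *)
Definition mass F m : R := gip F (smp T (wave T m 0)) ^+ 2 + gip F (smp T (wave T m (pi / 2))) ^+ 2.

Lemma mass_ge0 F m : 0 <= mass F m.
Proof. by rewrite addr_ge0 ?sqr_ge0. Qed.

Lemma mean_multE (s : nat -> R) F : mean (fun i => mult s F i * F i) = \sum_(m < t.+1) s m * mass F m.
Proof.
rewrite /mean mult_pair mulrA mulVf ?mul1r ?pnatr_eq0 //.
by apply: eq_bigr => m _; rewrite !(ghat_wave T0) -!expr2.
Qed.

Lemma kineticE F : kinetic F F = \sum_(m < t.+1) tau T alpha la t m * mass F m.
Proof. exact: mean_multE. Qed.

Lemma parseval F : gip F F = \sum_(m < t.+1) mass F m.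
Proof.
rewrite /gip -[LHS](_ : mean (fun i => mult (fun=> 1) F i * F i) = _); last first.
  by apply: eq_mean => i; rewrite mult1.
by rewrite mean_multE; apply: eq_bigr => m _; rewrite mul1r.
Qed.

Lemma kinetic_ge0 F : 0 <= kinetic F F.
Proof. by rewrite kineticE sumr_ge0 // => m _; rewrite mulr_ge0 ?mass_ge0 ?tau_ge0. Qed.

(** For a real function the coefficients at [m] and [N - m] are complex conjugates. *)
Lemma mass_mirror F (m : nat) : (m < t.+1)%N -> mass F (t.+1 - m)%N = mass F m.
Proof.
move=> mt; rewrite /mass /gip -!(ghat_wave T0).
have c (x : R) (i : nat) : cos (theta R t.+1 (t.+1 - m)%N * i%:R - x) = cos (theta R t.+1 m * i%:R + x).
  rewrite -cosN opprB -[RHS](cosD2pin _ 0) mulr0n mulr0 addr0.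
  have -> : theta R t.+1 (t.+1 - m)%N = 2 * pi - theta R t.+1 m.
    rewrite /theta natrB ?(ltnW mt) //; move: (pi) => q; field.
    by rewrite addrC natr1 pnatr_eq0.
  have -> : x - (2 * pi - theta R t.+1 m) * i%:R = (theta R t.+1 m * i%:R + x) - 2 * pi * i%:R by ring.
  by rewrite -[in RHS](subrK (2 * pi * i%:R) (_ + x)) cosD2pin.
have g (x : R) : ghat F (t.+1 - m)%N x = ghat F m (- x).
  by apply: eq_mean => i; rewrite c opprK.
by rewrite !g oppr0 [ghat F m (- _)]ghatE cosN sinN cos_pihalf sin_pihalf mulr0 add0r mulrN1 sqrrN.
Qed.

End Bilinear.

Section Perturbed.
Variables (j : nat) (v : 'I_j -> R -> R).
Hypothesis uv : forall l, UA T (v l).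
Hypothesis dv : forall l, decaying T (v l).

(* The penalty on the [v l] lifts the lower eigenvalues above the level of interest. *)
Definition form t (F G : 'I_t.+1 -> R) : R :=
  kinetic F G + gip (fun i => smp T V i * F i) G
  + \sum_(l < j) gip (smp T (v l)) F * gip (smp T (v l)) G.

Lemma formC t (F G : 'I_t.+1 -> R) : form F G = form G F.
Proof.
rewrite /form kineticC; congr (_ + _ + _); first by apply: eq_mean => i; ring.
by apply: eq_bigr => l _; rewrite mulrC.
Qed.

Lemma form_lin t (F H G : 'I_t.+1 -> R) s :
  form (fun i => F i + s * H i) G = form F G + s * form H G.
Proof.
rewrite /form kinetic_lin.
have -> : gip (fun i => smp T V i * (F i + s * H i)) G =
    gip (fun i => smp T V i * F i) G + s * gip (fun i => smp T V i * H i) G.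
  by rewrite -gip_lin; apply: eq_gip => // i; ring.
have -> : \sum_(l < j) gip (smp T (v l)) (fun i => F i + s * H i) * gip (smp T (v l)) G =
   \sum_(l < j) gip (smp T (v l)) F * gip (smp T (v l)) G
   + s * \sum_(l < j) gip (smp T (v l)) H * gip (smp T (v l)) G.
  rewrite mulr_sumr -big_split; apply: eq_bigr => l _ /=.
  by rewrite gipC gip_lin [gip F _]gipC [gip H _]gipC; ring.
by ring.
Qed.

(** The discriminant inequality, read off at the minimizer [s = - b / c]; it serves as
    Cauchy-Schwarz for nonnegative forms. *)
Lemma quadratic_bound (a b c : R) : 0 < c -> (forall s, 0 <= a + 2 * s * b + s ^+ 2 * c) -> b ^+ 2 <= a * c.
Proof.
move=> c0 /(_ (- b / c)) h; rewrite -ler_pdivrMr //.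
have e : a + 2 * (- b / c) * b + (- b / c) ^+ 2 * c = a - b ^+ 2 / c by field; rewrite gt_eqF.
by rewrite e in h; lra.
Qed.

Variable U : set_system nat.
Context {hU : UltraFilter U}.
Hypothesis Uoo : \oo `<=` U.

Lemma uV : UA T V. Proof. by have [C [h _ _ _]] := smooth_tail T0 sV pV. Qed.

Lemma riemann_ultra g : UA T g -> mean (@smp R T t.+1 g) @[t --> U] --> itg T g.
Proof. by move=> ug; apply: cvg_ultra => //; exact: riemann. Qed.

(** The weak limit of grid functions, as a functional of the test function [g]. *)
Definition ulimit (F : forall t, 'I_t.+1 -> R) g : R := ulim U (fun t => gip (F t) (smp T g)).

Lemma ulimit_cvg (F : forall t, 'I_t.+1 -> R) B g : (forall t, gip (F t) (F t) <= B) -> UA T g ->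
  gip (F t) (smp T g) @[t --> U] --> ulimit F g.
Proof.
move=> FB ug; have [M [M0 gM]] := UA_bounded ug.
by apply: (@ulimP R U hU _ ((1 + B) / 2 * M)) => t; apply: gip_bound => // i; exact: gM.
Qed.

Lemma ulimit_functional (F : forall t, 'I_t.+1 -> R) B : (forall t, gip (F t) (F t) <= B) ->
  functional T (ulimit F) ((1 + B) / 2).
Proof.
move=> FB; have B0 : 0 <= B by exact: le_trans (gip_ge0 (F 0%N)) (FB 0%N).
split=> [f g uf ug|c f uf|f M uf hM|]; last by rewrite divr_ge0 ?addr_ge0.
- apply: ulimE; rewrite (_ : (fun t => _) = (fun t => gip (F t) (smp T f) + gip (F t) (smp T g))).
    by apply: cvgD; exact: ulimit_cvg.
  by apply/funext => t; rewrite /gip -meanD; apply: eq_mean => i; rewrite mulrDr.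
- apply: ulimE; rewrite (_ : (fun t => _) = (fun t => c * gip (F t) (smp T f))).
    by apply: cvgM; [exact: cvg_cst|exact: ulimit_cvg].
  by apply/funext => t; rewrite /gip -meanZ; apply: eq_mean => i; rewrite mulrCA.
- have h := ulimit_cvg FB uf.
  have hb t : `|gip (F t) (smp T f)| <= (1 + B) / 2 * M by apply: gip_bound => // i; exact: hM.
  rewrite ler_norml; apply/andP; split.
    by apply: (cvgr_to_ge h); apply: nearW => t; have := hb t; rewrite ler_norml => /andP[].
  by apply: (cvgr_to_le h); apply: nearW => t; have := hb t; rewrite ler_norml => /andP[].
Qed.

Lemma gip_wave_le1 (t k : nat) p : gip (@smp R T t.+1 (wave T k p)) (smp T (wave T k p)) <= 1.
Proof.
rewrite /gip; have := @mean_bound R t.+1 (fun i => @smp R T t.+1 (wave T k p) i * smp T (wave T k p) i) 1 isT.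
move=> h; apply: le_trans (ler_norm _) (h _) => i.
by rewrite normrM -[leRHS](mulr1 1) ler_pM // wave_le1.
Qed.

Lemma form_wave_le k p : exists2 M, 0 < M & forall t,
  @form t (smp T (wave T k p)) (smp T (wave T k p)) <= M.
Proof.
have [BV [BV0 hV]] := UA_bounded uV.
have /choice[Bl hBl] l : exists B, 0 <= B /\ forall x, `|v l x| <= B by exact: UA_bounded (uv l).
exists (`|freq T k| `^ alpha + 1 + BV + \sum_(l < j) Bl l * Bl l + 1).
  rewrite ltr_wpDl // addr_ge0 //.
    by rewrite addr_ge0 // addr_ge0 // powR_ge0.
  by apply: sumr_ge0 => l _; have [h _] := hBl l; exact: mulr_ge0.
move=> t; set W := smp T (wave T k p).
have W1 i : `|W i| <= 1 by exact: wave_le1.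
have h1 : kinetic W W <= `|freq T k| `^ alpha + 1.
  rewrite kinetic_wave; have h := tau_le T0 al0 hla t k.
  have t0 := tau_ge0 hla t k.
  apply: le_trans h; rewrite ler_piMr //; exact: gip_wave_le1.
have h2 : gip (fun i => smp T V i * W i) W <= BV.
  apply: le_trans (ler_norm _) _; apply: mean_bound => // i.
  rewrite !normrM -[leRHS]mulr1 ler_pM // ?mulr_ge0 // -[leRHS]mulr1 ler_pM //; exact: hV.
have h3 : \sum_(l < j) gip (smp T (v l)) W * gip (smp T (v l)) W <= \sum_(l < j) Bl l * Bl l.
  apply: ler_sum => l _; apply: le_trans (ler_norm _) _; have [_ h] := hBl l.
  have h4 : `|gip (smp T (v l)) W| <= Bl l.
    apply: mean_bound => // i; rewrite normrM -[leRHS]mulr1 ler_pM //; exact: h.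
  by rewrite normrM ler_pM.
have := lerD (lerD h1 h2) h3; rewrite /form => h4; apply: le_trans h4 _; by rewrite lerDl.
Qed.

(** The form minus [nuN] times the inner product is nonnegative and tends to zero on [F t]. By
    Cauchy-Schwarz its pairing with every wave tends to zero, which is the weak equation for the
    limit functional; [regularity] and [represent] make this functional a function. *)
Lemma limit_equation (F : forall t, 'I_t.+1 -> R) B Bn (nuN : nat -> R) (nu : R) :
  (forall t, gip (F t) (F t) <= B) -> (forall t, `|nuN t| <= Bn) -> nuN t @[t --> U] --> nu ->
  (forall t (G : 'I_t.+1 -> R), nuN t * gip G G <= form G G) ->
  form (F t) (F t) - nuN t * gip (F t) (F t) @[t --> U] --> (0 : R) ->
  exists f, [/\ UA T f, decaying T f,
    forall g, UA T g -> gip (F t) (smp T g) @[t --> U] --> ip T f g &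
    forall k p, `|freq T k| `^ alpha * ip T f (wave T k p) + ip T (fun x => V x * f x) (wave T k p)
      + \sum_(l < j) ip T (v l) f * ip T (v l) (wave T k p) = nu * ip T f (wave T k p)].
Proof.
move=> FB nB cnu low a0; have uV' := uV.
pose Phi := ulimit F; have fP := ulimit_functional FB.
have cP g : UA T g -> gip (F t) (smp T g) @[t --> U] --> Phi g by exact: ulimit_cvg.
have Bn0 : 0 <= Bn by exact: le_trans (nB 0%N).
pose gam k p := \sum_(l < j) Phi (v l) * ip T (v l) (wave T k p).
have eqPhi k p : `|freq T k| `^ alpha * Phi (wave T k p) + Phi (fun x => V x * wave T k p x) + gam k p
    = nu * Phi (wave T k p).
  have uw := UA_wave T k p.
  pose W t := @smp R T t.+1 (wave T k p).
  pose b t := form (F t) (W t) - nuN t * gip (F t) (W t).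
  have [M M0 hM] := form_wave_le k p.
  have MB : 0 < M + Bn by rewrite ltr_wpDr.
  (* On a wave the nonnegative form is at most [M + Bn], uniformly in the grid. *)
  have bsq t : b t ^+ 2 <= (form (F t) (F t) - nuN t * gip (F t) (F t)) * (M + Bn).
    apply: quadratic_bound => // s.
    have h1 := low t (fun i => F t i + s * W t i).
    have e1 : form (fun i => F t i + s * W t i) (fun i => F t i + s * W t i) =
        form (F t) (F t) + 2 * s * form (F t) (W t) + s ^+ 2 * form (W t) (W t).
      by rewrite form_lin ![form _ (fun i => F t i + s * W t i)]formC !form_lin [form (W t) (F t)]formC; ring.
    have e2 : gip (fun i => F t i + s * W t i) (fun i => F t i + s * W t i) =
        gip (F t) (F t) + 2 * s * gip (F t) (W t) + s ^+ 2 * gip (W t) (W t).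
      by rewrite gip_lin ![gip _ (fun i => F t i + s * W t i)]gipC !gip_lin [gip (W t) (F t)]gipC; ring.
    rewrite e1 e2 in h1.
    have h2 : s ^+ 2 * form (W t) (W t) <= s ^+ 2 * M by rewrite ler_wpM2l ?sqr_ge0.
    have h3 : - (nuN t * gip (W t) (W t)) <= Bn.
      apply: le_trans (ler_norm _) _; rewrite normrN normrM -[leRHS]mulr1 ler_pM //.
      by rewrite ger0_norm ?gip_ge0 //; exact: gip_wave_le1.
    have h4 : s ^+ 2 * - (nuN t * gip (W t) (W t)) <= s ^+ 2 * Bn by rewrite ler_wpM2l ?sqr_ge0.
    rewrite -subr_ge0 in h1; apply: le_trans h1 _; rewrite -subr_ge0.
    rewrite -subr_ge0 in h2; rewrite -subr_ge0 in h4.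
    by apply: le_trans (addr_ge0 h2 h4) _; rewrite le_eqVlt; apply/orP; left; apply/eqP; rewrite /b; ring.
  have cb0 : b t @[t --> U] --> (0 : R).
    apply/cvgr0Pnorm_le => e e0.
    have e2 : 0 < e ^+ 2 / (M + Bn) by rewrite divr_gt0 // exprn_gt0.
    move/cvgr0Pnorm_le: a0 => /(_ _ e2); apply: filterS => t h.
    have h1 := le_trans (bsq t) (ler_wpM2r (ltW MB) (le_trans (ler_norm _) h)).
    rewrite divfK ?gt_eqF // -[leLHS]real_normK ?num_real // in h1.
    by rewrite -ler_sqr ?nnegrE ?(ltW e0).
  have cb1 : b t @[t --> U] --> `|freq T k| `^ alpha * Phi (wave T k p)
      + Phi (fun x => V x * wave T k p x) + gam k p - nu * Phi (wave T k p).
    have -> : b = (fun t => tau T alpha la t k * gip (F t) (W t)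
        + gip (F t) (smp T (fun x => V x * wave T k p x))
        + \sum_(l < j) gip (F t) (smp T (v l)) * mean (@smp R T t.+1 (fun x => v l x * wave T k p x))
        - nuN t * gip (F t) (W t)).
      apply/funext => t; rewrite /b /form kinetic_wave; congr (_ + _ + _ - _).
        by apply: eq_mean => i; rewrite /W /smp; ring.
      by apply: eq_bigr => l _; rewrite [gip _ (F t)]gipC.
    have cW : gip (F t) (W t) @[t --> U] --> Phi (wave T k p) by exact: cP.
    apply: cvgB; last exact: cvgM.
    apply: cvgD.
      apply: cvgD; last by apply: cP; exact: UAM.
      apply: cvgM => //; apply: cvg_ultra => //; exact: tau_cvg.
    apply: (cvg_ultra_sum (F := fun l t => _)) => l; apply: cvgM; first exact: cP.
    by apply: riemann_ultra; exact: UAM.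
  by apply/eqP; rewrite -subr_eq0 -(ulimE cb1) (ulimE cb0).
have /choice[Cl hCl] l : exists C, forall k, amp T (density T (v l)) k <= C / k.+1%:R ^+ 4 by exact: dv l.
have gamB k p : `|gam k p| <= (\sum_(l < j) `|Phi (v l)| * Cl l) / k.+1%:R ^+ 4.
  rewrite mulr_suml; apply: le_trans (ler_norm_sum _ _ _) _; apply: ler_sum => l _.
  rewrite normrM -mulrA ler_wpM2l //.
  have [Bv fv] := UA_functional T0 (uv l).
  exact: le_trans (functional_wave_le fv k p) (hCl l k).
have [C C0 hC] := regularity T0 al0 sV pV fP gamB eqPhi.
have hC' k : amp T Phi k <= C / k.+1%:R ^+ (2 + 2) by exact: hC.
have [f [uf _ ef]] := represent T0 fP hC'.
have ef' g : UA T g -> ip T f g = Phi g by exact: ef.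
exists f; split => //.
- exists C => k; apply: le_trans (hC k); rewrite le_eqVlt; apply/orP; left; apply/eqP.
  have e p : density T f (wave T k p) = Phi (wave T k p) by apply: ef; exact: UA_wave.
  by rewrite /amp !e.
- by move=> g ug; rewrite ef' //; exact: cP.
- move=> k p; have uw := UA_wave T k p.
  have eV : ip T (fun x => V x * f x) (wave T k p) = Phi (fun x => V x * wave T k p x).
    by rewrite -ef'; [apply: eq_itg => x _; ring|exact: UAM].
  rewrite eV !ef' // -eqPhi; congr (_ + _); apply: eq_bigr => l _.
  by rewrite ipC ef'.
Qed.

(** Modes between [K] and [N - K] have symbol at least [2 * C], so they carry at most half of the
    mass. The rest sits in the modes below [K] and their mirror images, hence at least a quarter
    below [K]. This keeps weak limits from vanishing. *)
Lemma low_mass t (F : 'I_t.+1 -> R) K C L : gip F F = 1 -> kinetic F F <= C -> (K.*2 <= t.+1)%N ->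
  (0 < K)%N -> 0 < L -> 2 * C <= L -> L <= (pi * K%:R / (2 * T)) `^ alpha - 1 ->
  4^-1 <= \sum_(m < K) mass F m.
Proof.
move=> F1 FC K2 K0 L0 CL LK; have KN : (K <= t.+1)%N by rewrite (leq_trans _ K2) // -addnn leq_addr.
have pointwise (m : 'I_t.+1) : mass F m <= tau T alpha la t m * mass F m / L
    + (if (m < K)%N then mass F m else 0) + (if (t.+1 - K < m)%N then mass F m else 0).
  have m0 := mass_ge0 F m; have t0 := tau_ge0 hla t m.
  have q0 : 0 <= tau T alpha la t m * mass F m / L.
    by apply: divr_ge0; [exact: mulr_ge0|exact: ltW].
  case: ltnP => mK; first by case: ifP => _; lra.
  case: ltnP => mN; first by lra.
  rewrite !addr0 ler_pdivlMr // mulrC ler_wpM2r //.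
  exact: le_trans LK (tau_high T0 al0 hla mK mN (ltn_ord m)).
have : \sum_(m < t.+1) mass F m <= \sum_(m < t.+1) (tau T alpha la t m * mass F m / L
    + (if (m < K)%N then mass F m else 0) + (if (t.+1 - K < m)%N then mass F m else 0)).
  by apply: ler_sum => m _; exact: pointwise.
rewrite -parseval F1 big_split big_split /= -mulr_suml -kineticE.
rewrite -!big_mkcond /=.
have s1 : \sum_(m < t.+1 | (m < K)%N) mass F m = \sum_(m < K) mass F m.
  by rewrite (big_ord_widen t.+1 (fun m => mass F m) KN).
have s2 : \sum_(m < t.+1 | (t.+1 - K < m)%N) mass F m <= \sum_(m < K) mass F m.
  rewrite (reindex_inj rev_ord_inj) /=.
  rewrite (eq_bigl (fun m : 'I_t.+1 => (m < K.-1)%N)); last by move=> m /=; exact: mirror_cond.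
  have e (m : 'I_t.+1) : (m < K.-1)%N -> mass F (t.+1 - m.+1)%N = mass F m.+1.
    by move=> mK; apply: mass_mirror; exact: leq_trans (mirror_lt mK) KN.
  rewrite (eq_bigr (fun m : 'I_t.+1 => mass F m.+1)) //.
  rewrite -(big_ord_widen t.+1 (fun m => mass F m.+1)); last exact: leq_trans (leq_pred _) KN.
  by rewrite -[in leRHS](prednK K0) big_ord_recl lerDr mass_ge0.
rewrite s1 => h.
have h2 : kinetic F F / L <= 2^-1 by rewrite ler_pdivrMr //; lra.
lra.
Qed.

Lemma high_symbol (C : R) : 0 <= C -> exists2 K, (0 < K)%N & C <= (pi * K%:R / (2 * T)) `^ alpha - 1.
Proof.
move=> C0; pose y := (C + 1) `^ alpha^-1.
have y0 : 0 <= y by exact: powR_ge0.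
have p0 := pi_gt0 R.
have z0 : 0 <= y * (2 * T) / pi.
  by apply: divr_ge0; [apply: mulr_ge0 => //; apply: mulr_ge0 => //; exact: ltW|exact: ltW].
exists (Num.truncn (y * (2 * T) / pi)).+1 => //.
have /andP[_] := truncn_itv z0; move: (Num.truncn _).+1 => K h.
have h1 : y <= pi * K%:R / (2 * T).
  rewrite ler_pdivlMr ?mulr_gt0 // mulrC [leRHS]mulrC -ler_pdivrMr // mulrC; exact: ltW h.
have h2 : y `^ alpha <= (pi * K%:R / (2 * T)) `^ alpha.
  by rewrite ge0_ler_powR ?nnegrE ?(ltW al0) //; exact: le_trans h1.
rewrite /y -powRrM mulVf ?gt_eqF // powRr1 in h2; last by lra.
lra.
Qed.

Lemma form_scale t c (G : 'I_t.+1 -> R) : form (fun i => c * G i) (fun i => c * G i) = c ^+ 2 * form G G.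
Proof.
have e : (fun i => c * G i) = (fun i => G i + (c - 1) * G i) by apply/funext => i; ring.
by rewrite e form_lin ![form _ (fun i => G i + (c - 1) * G i)]formC !form_lin; ring.
Qed.

Lemma form_lower : exists2 M, 0 <= M & forall t (G : 'I_t.+1 -> R),
  kinetic G G - M * gip G G <= form G G.
Proof.
have [M [M0 hV]] := UA_bounded uV; exists M => // t G.
rewrite /form -addrA lerD2l -[leLHS]addr0; apply: lerD; last first.
  by apply: sumr_ge0 => l _; rewrite -expr2 sqr_ge0.
rewrite -mulNr /gip -meanZ; apply: mean_le => i.
rewrite -[leRHS]mulrA ler_wpM2r // -?expr2 ?sqr_ge0 //.
by have := hV (gpt T t.+1 i); rewrite ler_norml => /andP[].
Qed.

Lemma gip_scale t c (G : 'I_t.+1 -> R) : gip (fun i => c * G i) (fun i => c * G i) = c ^+ 2 * gip G G.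
Proof. by rewrite /gip -meanZ; apply: eq_mean => i; ring. Qed.

(* Any grid function almost minimizing the form below the level [lam] would converge to a
   further eigenfunction. *)
Lemma lower_bound (nl : 'I_j -> R) (lam : R) :
  (forall l, nice T alpha V (nl l) (v l)) -> (forall l l', l != l' -> ip T (v l) (v l') = 0) ->
  (forall l, lam <= nl l + ip T (v l) (v l)) ->
  (forall u nu, nice T alpha V nu u -> nu < lam -> (forall l, ip T (v l) u = 0) -> forall x, u x = 0) ->
  exists nuN Bn, [/\ forall t, `|nuN t| <= Bn, forall t, nuN t <= lam, nuN t @[t --> U] --> lam &
    forall t (G : 'I_t.+1 -> R), nuN t * gip G G <= form G G].
Proof.
move=> nv ov lv hmax; have [M M0 hM] := form_lower.
have [M1 M10 hM1] := form_wave_le 0 0.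
pose Q t := [set form G G / gip G G | G in [set G : 'I_t.+1 -> R | 0 < gip G G]].
have lowM t (G : 'I_t.+1 -> R) : - M * gip G G <= form G G.
  by apply: le_trans (hM t G); rewrite mulNr lerDr; exact: kinetic_ge0.
have W1 t : @gip t (smp T (wave T 0 0)) (smp T (wave T 0 0)) = 1.
  rewrite /gip (@eq_mean _ _ _ (fun=> 1)) ?mean_cst // => i.
  by rewrite /smp /wave /freq mulr0 mul0r mul0r subr0 cos0 mulr1.
have Qinf t : has_inf (Q t).
  split; first by exists (form (@smp R T t.+1 (wave T 0 0)) (smp T (wave T 0 0)) / 1), (smp T (wave T 0 0)); rewrite /= W1.
  by exists (- M) => _ [G /= G0 <-]; rewrite ler_pdivlMr.
pose r t := inf (Q t).
have rM t : - M <= r t.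
  by apply: lb_le_inf; [case: (Qinf t)|move=> _ [G /= G0 <-]; rewrite ler_pdivlMr].
have rM1 t : r t <= M1.
  apply: le_trans (hM1 t); apply: ge_inf; first by case: (Qinf t).
  by exists (smp T (wave T 0 0)); rewrite /= W1 // divr1.
(* The infimum of the Rayleigh quotients is capped at [lam], so that only a limit strictly below
   [lam] has to be excluded. *)
pose nuN t := Num.min (r t) lam.
have nr t : nuN t <= r t by rewrite ge_min lexx.
have nlam t : nuN t <= lam by rewrite ge_min lexx orbT.
pose Bn := M + M1 + `|lam|.
have nB t : `|nuN t| <= Bn.
  have h1 := rM t; have h2 := rM1 t; have h3 := ler_norm lam; have h4 := ler_norm (- lam).
  rewrite normrN in h4; rewrite ler_norml /Bn; apply/andP; split; last by have := nlam t; lra.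
  by rewrite le_min; apply/andP; split; lra.
have low t (G : 'I_t.+1 -> R) : nuN t * gip G G <= form G G.
  have := gip_ge0 G; rewrite le_eqVlt => /orP[/eqP G0|G0].
    by rewrite -G0 mulr0; have := lowM t G; rewrite -G0 mulr0.
  rewrite -ler_pdivlMr //; apply: le_trans (nr t) _; apply: ge_inf; first by case: (Qinf t).
  by exists G.
have cn : nuN t @[t --> U] --> ulim U nuN by exact: ulimP nB.
exists nuN, Bn; split => //.
have : ulim U nuN <= lam by apply: (cvgr_to_le cn); apply: nearW.
rewrite le_eqVlt => /orP[/eqP <- //|nulam]; exfalso.
(* If the cap is inactive, a normalized grid function close to the infimum is taken; the default [0]
   is met for no [t] close to [U] (see [evlam]). *)
have near_min t : exists F : 'I_t.+1 -> R, gip F F <= 1 /\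
    (nuN t < lam -> gip F F = 1 /\ form F F <= nuN t + t.+1%:R^-1).
  have [h|h] := leP lam (nuN t).
    exists (fun=> 0); split => //.
    by rewrite /gip (@eq_mean _ _ _ (fun=> 0)) ?mean_cst // => i; rewrite mulr0.
  have e0 : 0 < t.+1%:R^-1 :> R by rewrite invr_gt0.
  have rn : r t = nuN t by move: h; rewrite /nuN minEle; case: ifP => // _; rewrite ltxx.
  have [_ [G /= G0 <-] hG] := inf_adherent e0 (Qinf t).
  pose c := (Num.sqrt (gip G G))^-1.
  have c2 : c ^+ 2 = (gip G G)^-1 by rewrite exprVn sqr_sqrtr // ltW.
  exists (fun i => c * G i); rewrite gip_scale form_scale c2 mulVf ?gt_eqF //; split => // _; split => //.
  by rewrite mulrC -rn; exact: ltW.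
pose F t := projT1 (cid (near_min t)).
have F1 t : gip (F t) (F t) <= 1 by rewrite /F; case: cid => /= ? [].
have F2 t : nuN t < lam -> gip (F t) (F t) = 1 /\ form (F t) (F t) <= nuN t + t.+1%:R^-1.
  by rewrite /F; case: cid => /= ? [].
have evlam : \forall t \near U, nuN t < lam by apply: (cvgr_lt _ cn).
have ch : t.+1%:R^-1 @[t --> U] --> (0 : R) by apply: cvg_ultra => //; exact: cvg_harmonic.
have a0 : form (F t) (F t) - nuN t * gip (F t) (F t) @[t --> U] --> (0 : R).
  apply: (@squeeze_cvgr _ _ _ _ (fun=> 0) (fun t => t.+1%:R^-1)) => //; last exact: cvg_cst.
  apply: filterS evlam => t h; have [h1 h2] := F2 t h.
  have h3 := low t (F t); rewrite h1 mulr1 in h3 *.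
  by rewrite subr_ge0 h3 lerBlDl.
have [f [uf df cf ef]] := limit_equation F1 nB cn low a0.
have [nf of_] := perturbed_eigen T0 al0 al2 uV nv ov lv nulam uf df ef.
(* The limit has eigenvalue below [lam] and is orthogonal to the family, so it is zero and each of
   the first [K] coefficients of [F t] tends to zero; [low_mass] forbids this. *)
have f0 := hmax f _ nf nulam of_.
pose C := lam + 1 + M; have C0 : 0 <= `|C| by [].
have [K K0 hK] := high_symbol (mulr_ge0 (ler0n R 2) (addr_ge0 C0 ler01)).
have mass0 m : mass (F t) m @[t --> U] --> (0 : R).
  have ip0 g : UA T g -> gip (F t) (smp T g) @[t --> U] --> (0 : R).
    move=> ug; have := cf g ug; rewrite (_ : ip T f g = 0) //.
    by rewrite /ip (@eq_itg _ _ _ (fun=> 0)) ?itg_cst // => x _; rewrite f0 mul0r.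
  have h1 := ip0 _ (UA_wave T m 0); have h2 := ip0 _ (UA_wave T m (pi / 2)).
  rewrite (_ : 0 = 0 * 0 + 0 * 0 :> R); last by ring.
  apply: cvgD; [exact: (cvgM h1 h1)|exact: (cvgM h2 h2)].
have sum0 : \sum_(m < K) mass (F t) m @[t --> U] --> (0 : R).
  have h := @cvg_ultra_sum R U hU K (fun m t => mass (F t) m) (fun=> 0) (fun m => mass0 m).
  by rewrite big1 in h.
have ev : \forall t \near U, 4^-1 <= \sum_(m < K) mass (F t) m.
  have big : \forall t \near U, (K.*2 <= t.+1)%N.
    by apply: Uoo; exists K.*2 => // t /= h; exact: leqW.
  apply: filterS2 evlam big => t h hKt; have [h1 h2] := F2 t h.
  have L0 : 0 < 2 * (`|C| + 1) by rewrite mulr_gt0 // ltr_wpDl.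
  apply: (low_mass h1 _ hKt K0 L0 (lexx _) hK).
  have h3 := hM t (F t); rewrite h1 mulr1 in h3.
  have h4 := inv_succ_le1 R t; have h6 := nlam t; have h5 := ler_norm C; rewrite /C in h5 *.
  move: h2 h4; move: (t.+1%:R^-1) => y h2 h4; lra.
have h : (4^-1 : R) <= 0 by exact: (cvgr_to_ge sum0 ev).
by move: h; apply/negP; rewrite -ltNge invr_gt0; exact: ltr0Sn.
Qed.

End Perturbed.
End GridForm.

(** * From eigenfunctions to decaying coefficients and back *)

Section Eigenfunctions.
Variables (R : realType) (T alpha : R) (V : R -> R).
Notation mu := (@lebesgue_measure R).
Hypotheses (T0 : 0 < T) (al0 : 0 < alpha) (al2 : alpha < 2).
Hypotheses (sV : smooth V) (pV : forall x, V (x + T) = V x).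

Let UV : UA T V. Proof. by have [C [h _ _ _]] := smooth_tail T0 sV pV. Qed.

Lemma ip_ge0 f : UA T f -> 0 <= ip T f f.
Proof.
move=> uf; rewrite -(itg_cst 0 T0); apply: itg_le => //.
- by apply: wc_cont => x; exact: cvg_cst.
- by apply: UA_wc; exact: UAM.
- by move=> x _; rewrite -expr2 sqr_ge0.
Qed.

(** If the norm vanished, Cauchy-Schwarz would make all Fourier coefficients zero, hence [f] itself
    by [wave_unique]. The added [1] only keeps the quadratic coefficient positive. *)
Lemma ip_pos f x : UA T f -> f x != 0 -> 0 < ip T f f.
Proof.
move=> uf fx; rewrite lt_neqAle ip_ge0 // andbT; apply/negP => /eqP f0.
have w k p : itg T (fun x => f x * wave T k p x) = 0.
  have uw := UA_wave T k p; have uz s := UAZ s uw.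
  apply/eqP; rewrite -sqrf_eq0 eq_le sqr_ge0 andbT -(mul0r (ip T (wave T k p) (wave T k p) + 1)).
  apply: quadratic_bound => [|s]; first by rewrite ltr_wpDl ?ip_ge0.
  have := ip_ge0 (UAD uf (uz s)).
  rewrite (ipDl T0 uf (uz s) (UAD uf (uz s))) [ip T f _]ipC (ipDl T0 uf (uz s) uf).
  rewrite [ip T (fun x => s * _) (fun x => _ + _)]ipC (ipDl T0 uf (uz s) (uz s)).
  rewrite [ip T f (fun x => s * _)]ipC !(ipZl T0 s uw) // [ip T (wave T k p) (fun x => s * _)]ipC !(ipZl T0 s uw) //.
  rewrite -f0 [ip T (wave T k p) f]ipC => h; apply: le_trans h _.
  have := sqr_ge0 s; rewrite /ip; move: (itg T _) (itg T _) => A B h; nra.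
have z := wave_unique T0 (UA_wc uf) w.
by move: fx; rewrite (periodic_zero T0 (UA_periodic T0 uf) z) eqxx.
Qed.

(** Powers of [bump] are at most [1], so weighting with them cannot increase the integral of a
    nonnegative function; a positive value would make a weighted integral positive. *)
Lemma product_zero g : wc T g -> (forall x, per_int T x -> 0 <= g x) -> itg T g = 0 ->
  forall x, 0 < x < T -> g x = 0.
Proof.
move=> wg g0 ig x xT; apply/eqP; rewrite eq_le g0; last first.
  by rewrite /per_int /= in_itv /=; move: xT => /andP[/ltW -> /ltW ->].
rewrite andbT leNgt; apply/negP => gx.
have [e [m [_ _ _]]] := itg_peak 0 xT wg gx ltr01.
rewrite mul0r ltNge => /negP; apply; rewrite -ig; apply: itg_le => //.
- by apply: wcM => //; apply: UA_wc; apply: UA_trig; apply: trigX; exact: trig_bump.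
- move=> y hy; have /andP[b0 b1] := bump01 T x y.
  by rewrite ler_piMr ?g0 // exprn_ile1.
Qed.

Lemma fcosE f k : fcos T f k = T * itg T (fun x => f x * wave T k 0 x).
Proof.
rewrite /itg mulrA divff ?gt_eqF // mul1r; apply: eq_Rintegral => x _.
by rewrite /wave subr0.
Qed.

Lemma fsinE f k : fsin T f k = T * itg T (fun x => f x * wave T k (pi / 2) x).
Proof.
rewrite /itg mulrA divff ?gt_eqF // mul1r; apply: eq_Rintegral => x _.
by rewrite /wave cosB cos_pihalf sin_pihalf mulr0 add0r mulr1.
Qed.

Lemma UA_ae_zero f : UA T f -> {ae mu, forall x, per_int T x -> f x = 0} -> forall x, f x = 0.
Proof.
move=> uf fae; have wf := UA_wc uf.
have w k p : itg T (fun x => f x * wave T k p x) = 0.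
  rewrite /itg /Rintegral (ae_eq_integral (fun=> 0%E)) ?integral0 ?mulr0 //.
  - exact: per_int_measurable.
  - by apply/measurable_EFinP; apply: subspace_continuous_measurable_fun;
      [exact: per_int_measurable|exact: (wcM wf (UA_wc (UA_wave T k p)))].
  - move: fae; apply: filterS; first exact: (ae_filter_ringOfSetsType mu).
    by move=> x h hx; rewrite h // mul0r.
exact: (periodic_zero T0 (UA_periodic T0 uf) (wave_unique T0 wf w)).
Qed.

(** Squared coefficients decay with order eight and the weight of [Hper] grows at most with order
    four because [alpha < 2], so the partial sums stay bounded. *)
Lemma nice_eigenfunction nu f x0 : nice T alpha V nu f -> f x0 != 0 -> is_eigenfunction alpha T V nu f.
Proof.
move=> nf fx0; have [uf [C hC] ef] := nf.
have wf := UA_wc uf.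
split; last split.
- split; first split.
  + apply: subspace_continuous_measurable_fun; [exact: per_int_measurable|exact: wf].
  + have /integrableP[_] := wc_integrable (wcM wf wf).
    apply: le_lt_trans; rewrite le_eqVlt; apply/orP; left; apply/eqP.
    by apply: eq_integral => x _; rewrite /= ger0_norm -expr2 // sqr_ge0.
  + have C0 : 0 <= C by have := le_trans (amp_ge0 T (density T f) 0) (hC 0%N); rewrite expr1n divr1.
    pose c := 1 + 2 * pi / T; pose D := (c ^+ 2) ^+ 2 * (T ^+ 2 * C ^+ 2).
    have D0 : 0 <= D by apply: mulr_ge0; [exact: sqr_ge0|apply: mulr_ge0; exact: sqr_ge0].
    exists (4 * D) => N.
    pose F k := (1 + freq T k ^+ 2) `^ alpha * (fcos T f k ^+ 2 + fsin T f k ^+ 2).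
    have FD k : `|F k| <= 2 * (D / k.+1%:R ^+ (0 + 2)).
      have k1 : 1 <= k.+1%:R :> R by rewrite ler1n.
      have k0 : 0 < k.+1%:R :> R by rewrite ltr0n.
      have h1 : 1 <= 1 + freq T k ^+ 2 by rewrite lerDl sqr_ge0.
      have c0 : 0 <= 2 * pi / T :> R by rewrite divr_ge0 ?mulr_ge0 ?pi_ge0 ?ltW.
      have h2 : 1 + freq T k ^+ 2 <= c ^+ 2 * k.+1%:R ^+ 2.
        have -> : freq T k = 2 * pi / T * k%:R by rewrite /freq; ring.
        rewrite -[k.+1%:R]natr1 /c -exprMn.
        have : 0 <= k%:R :> R by []; move: (2 * pi / T) c0 (k%:R) => y y0 z z0; nra.
      have h3 : (1 + freq T k ^+ 2) `^ alpha <= (c ^+ 2 * k.+1%:R ^+ 2) ^+ 2.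
        apply: (@le_trans _ _ ((1 + freq T k ^+ 2) `^ 2%:R)); first by apply: ler_powR => //; exact: ltW.
        have n1 : 0 <= 1 + freq T k ^+ 2 by exact: le_trans ler01 h1.
        have n2 : 0 <= c ^+ 2 * k.+1%:R ^+ 2 by apply: mulr_ge0; exact: sqr_ge0.
        by rewrite powR_mulrn //; apply: lerXn2r; rewrite ?nnegrE.
      have h4 : fcos T f k ^+ 2 + fsin T f k ^+ 2 <= T ^+ 2 * (C / k.+1%:R ^+ 4) ^+ 2.
        have hk := hC k; rewrite /amp /density in hk; rewrite fcosE fsinE.
        move: (itg T (fun x => f x * wave T k 0 x)) (itg T (fun x => f x * wave T k (pi / 2) x)) hk => a b hk.
        have -> : (T * a) ^+ 2 + (T * b) ^+ 2 = T ^+ 2 * (a ^+ 2 + b ^+ 2) by ring.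
        rewrite ler_wpM2l ?sqr_ge0 //.
        have h5 : (`|a| + `|b|) ^+ 2 <= (C / k.+1%:R ^+ 4) ^+ 2.
          by rewrite lerXn2r ?nnegrE ?addr_ge0 // (le_trans _ hk) ?addr_ge0.
        apply: le_trans h5; rewrite -[a ^+ 2]real_normK ?num_real // -[b ^+ 2]real_normK ?num_real //.
        by have := normr_ge0 a; have := normr_ge0 b; nra.
      rewrite ger0_norm; last by rewrite mulr_ge0 ?powR_ge0 ?addr_ge0 ?sqr_ge0.
      have h6 : 0 <= fcos T f k ^+ 2 + fsin T f k ^+ 2 by rewrite addr_ge0 ?sqr_ge0.
      apply: le_trans (ler_pM (powR_ge0 _ _) h6 h3 h4) _.
      have -> : (c ^+ 2 * k.+1%:R ^+ 2) ^+ 2 * (T ^+ 2 * (C / k.+1%:R ^+ 4) ^+ 2) =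
         D / k.+1%:R ^+ (0 + 2) * k.+1%:R ^- 2.
        by rewrite /D; move: (k.+1%:R) k0 => y y0; field; rewrite gt_eqF.
      have h7 : 0 <= D / k.+1%:R ^+ (0 + 2) by rewrite divr_ge0 // exprn_ge0.
      apply: (@le_trans _ _ (D / k.+1%:R ^+ (0 + 2))); last by rewrite mulr_natl mulr2n lerDl.
      by rewrite ler_piMr // invf_le1 ?exprn_gt0 // exprn_ege1.
    have := series_tail FD (leq0n N); rewrite big_ord0 subr0 expr1 divr1.
    exact: le_trans (ler_norm _).
- by move=> fae; move: fx0; rewrite (UA_ae_zero uf fae) eqxx.
- move=> k.
  have eV p : itg T (fun x => V x * f x * wave T k p x) = ip T (fun x => V x * f x) (wave T k p) by [].
  have e p := ef k p; rewrite !fcosE !fsinE !eV.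
  split; rewrite -/(ip T f _) ![_ `^ alpha * (T * _)]mulrCA -mulrDr e; ring.
Qed.

(** [regularity] without penalty applies to integration against [phi]. The function that represents
    it is periodic on the whole line, whereas [phi] is described on [[0, T]] only; thus they are
    compared there. *)
Lemma eigenfunction_nice nu phi : wc T phi -> is_eigenfunction alpha T V nu phi ->
  exists2 f, nice T alpha V nu f & forall x, per_int T x -> phi x = f x.
Proof.
move=> wphi [_ [_ heq]].
have [B [B0 hB]] := wc_bounded wphi.
have fP := itg_functional T0 wphi hB; set Phi := fun g => _ in fP.
have wV := UA_wc UV; have wVp := wcM wV wphi.
have [B' [B'0 hB']] := wc_bounded wVp.
have fQ := itg_functional T0 wVp hB'; set Psi := fun g => _ in fQ.
have ePsi g : Phi (fun x => V x * g x) = Psi g by apply: eq_itg => x _; ring.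
have Tn : T != 0 by rewrite gt_eqF.
have eqw k p : `|freq T k| `^ alpha * Phi (wave T k p) + Phi (fun x => V x * wave T k p x) + 0 = nu * Phi (wave T k p).
  rewrite addr0 ePsi (functional_wave fP k p) (functional_wave fQ k p).
  have [h1 h2] := heq k; rewrite !fcosE -/(Phi (wave T k 0)) -/(Psi (wave T k 0)) in h1.
  rewrite !fsinE -/(Phi (wave T k (pi / 2))) -/(Psi (wave T k (pi / 2))) in h2.
  have {}h1 : `|freq T k| `^ alpha * Phi (wave T k 0) + Psi (wave T k 0) = nu * Phi (wave T k 0).
    by apply: (mulfI Tn); rewrite mulrDr mulrCA h1; ring.
  have {}h2 : `|freq T k| `^ alpha * Phi (wave T k (pi / 2)) + Psi (wave T k (pi / 2)) = nu * Phi (wave T k (pi / 2)).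
    by apply: (mulfI Tn); rewrite mulrDr mulrCA h2; ring.
  transitivity (cos p * (`|freq T k| `^ alpha * Phi (wave T k 0) + Psi (wave T k 0)) +
    sin p * (`|freq T k| `^ alpha * Phi (wave T k (pi / 2)) + Psi (wave T k (pi / 2)))); first by ring.
  by rewrite h1 h2; ring.
have gam0 k (p : R) : `|0 : R| <= 0 / k.+1%:R ^+ 4 by rewrite normr0 mul0r.
have [C C0 hC] := regularity T0 al0 sV pV fP gam0 eqw.
have hC' k : amp T Phi k <= C / k.+1%:R ^+ (2 + 2) by exact: hC.
have [f [uf _ ef]] := represent T0 fP hC'.
have efw k p : ip T f (wave T k p) = Phi (wave T k p) by apply: ef; exact: UA_wave.
exists f.
  split => //.
    exists C => k; have := hC k; rewrite /amp -!efw; exact.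
  move=> k p; rewrite efw -eqw addr0; congr (_ + _).
  rewrite -[RHS]ef; last by apply: UAM => //; exact: UA_wave.
  by apply: eq_itg => x _; ring.
move=> x hx; apply/eqP; rewrite -subr_eq0 -mulN1r; apply/eqP.
have wf := UA_wc uf; have wfm := wcZ (c := -1) wf.
apply: (wave_unique T0 (wcD wphi wfm) _ hx) => k p.
have ww := UA_wc (UA_wave T k p).
rewrite (@eq_itg _ T _ (fun x => phi x * wave T k p x + (-1) * (f x * wave T k p x))); last first.
  by move=> y _; ring.
have wfw := wcM wf ww.
rewrite itgD; [|exact: wcM|exact: wcZ]. rewrite itgZ //.
by rewrite -[itg T (fun x => f x * _)]/(ip T f (wave T k p)) efw /Phi mulN1r subrr.
Qed.

End Eigenfunctions.

(** * Local information on weak limits *)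

Section Localize.
Variables (R : realType) (T : R) (U : set_system nat).
Context {hU : UltraFilter U}.
Hypothesis T0 : 0 < T.

(** Weak convergence tested with powers of [bump]: where the grid functions vanish near [x], the
    pairing is at most [M * bump_at T e ^+ m], and [itg_peak] with [C = M] beats this if the limit
    is nonzero at [x]. *)
Lemma localize (F : forall t, 'I_t.+1 -> R) f (M a b : R) : UA T f ->
  (forall g, UA T g -> gip (F t) (smp T g) @[t --> U] --> ip T f g) ->
  (forall t i, `|F t i| <= M) -> 0 <= a -> b <= T ->
  (\forall t \near U, forall i : 'I_t.+1, a < gpt T t.+1 i -> gpt T t.+1 i < b -> F t i = 0) ->
  forall x, a < x -> x < b -> f x = 0.
Proof.
move=> uf cf FM a0 bT Fz x ax xb; have M0 : 0 <= M by exact: le_trans (FM 0%N ord0).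
have xT : 0 < x < T by rewrite (le_lt_trans a0) //= (lt_le_trans xb).
suff key s : `|s| = 1 -> s * f x <= 0.
  have := key 1 (normr1 _); have := key (-1); rewrite normrN1 => /(_ erefl) h1 h2; lra.
move=> s1; rewrite leNgt; apply/negP => fx.
have e00 : 0 < Num.min (x - a) (b - x) by rewrite lt_min !subr_gt0 ax.
have usf := UAZ s uf.
have [e [m [/andP[e0 ee] ex xe h]]] := itg_peak M xT (UA_wc usf) fx e00.
pose w y := bump T x y ^+ m.
have uw : UA T w by apply: UA_trig; apply: trigX; exact: trig_bump.
have hb : \forall t \near U, `|gip (F t) (smp T w)| <= M * bump_at T e ^+ m.
  apply: filterS Fz => t Fz; apply: mean_bound => // i; rewrite normrM.
  have w0 : 0 <= @smp R T t.+1 w i by rewrite exprn_ge0 //; case/andP: (bump01 T x (gpt T t.+1 i)).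
  rewrite (ger0_norm w0); have [hi|hi] := ltP `|gpt T t.+1 i - x| e.
    rewrite Fz ?normr0 ?mul0r ?mulr_ge0 ?exprn_ge0 ?bump_at_ge0 //.
      have : e <= x - a by apply: le_trans ee _; rewrite ge_min lexx.
      by move: hi; rewrite ltr_norml => /andP[? ?] ?; lra.
    have : e <= b - x by apply: le_trans ee _; rewrite ge_min lexx orbT.
    by move: hi; rewrite ltr_norml => /andP[? ?] ?; lra.
  rewrite ler_pM //; apply: lerXn2r; rewrite ?nnegrE ?bump_at_ge0 //.
    by case/andP: (bump01 T x (gpt T t.+1 i)).
  by apply: bump_far => //; [exact: ltW|exact: gpt_per].
have h2 : `|ip T f w| <= M * bump_at T e ^+ m.
  rewrite ler_norml; apply/andP; split.
    by apply: (cvgr_to_ge (cf w uw)); apply: filterS hb => t; rewrite ler_norml => /andP[].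
  by apply: (cvgr_to_le (cf w uw)); apply: filterS hb => t; rewrite ler_norml => /andP[].
have : `|s * ip T f w| <= M * bump_at T e ^+ m by rewrite normrM s1 mul1r.
rewrite -(ipZl T0 s uf uw) => h3; have := lt_le_trans h (le_trans (ler_norm _) h3).
by rewrite ltxx.
Qed.

(** The pigeonhole principle for an ultrafilter: one of finitely many values is taken on a set of
    [U]. *)
Lemma ultra_const (X : finType) (k : nat -> X) : exists x, \forall t \near U, k t = x.
Proof.
have : \forall t \near U, k t \in enum X by apply: nearW => t; rewrite mem_enum.
elim: (enum X) => [|x s IH] h; first by have [t] := filter_ex h.
have [hx|hx] := in_ultra_setVsetC [set t | k t = x] hU; first by exists x.
apply: IH; apply: filterS2 h hx => t; rewrite inE => /orP[/eqP kx nk|//]; by case: nk.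
Qed.

End Localize.

(** * Sign changes and the Courant argument *)

Section GridTest.
Variable R : realType.

(** A kernel vector divided by its entry of largest modulus. The entry [1] keeps the test function
    from degenerating in the limit, and the bound [1] keeps it below the eigenfunction. *)
Lemma null_combination (m n : nat) (A : 'M[R]_(m, n)) : (n < m)%N ->
  exists a : 'I_m -> R, [/\ exists s, a s = 1, forall s, `|a s| <= 1 &
    forall l, \sum_(s < m) a s * A s l = 0].
Proof.
move=> nm.
have : kermx A != 0.
  rewrite -mxrank_eq0 mxrank_ker -lt0n subn_gt0; exact: leq_ltn_trans (rank_leq_col A) nm.
case: (pickP (fun i => [exists s, kermx A i s != 0])) => [i /existsP[s0 h0] _|h]; last first.
  case/eqP; apply/matrixP => i s; rewrite [RHS]mxE; apply/eqP/negPn/negP => his.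
  by have /negP := negbT (h i); apply; apply/existsP; exists s.
pose b s := kermx A i s.
have bA l : \sum_(s < m) b s * A s l = 0.
  transitivity ((kermx A *m A) i l); first by rewrite [RHS]mxE.
  by rewrite mulmx_ker [LHS]mxE.
have [s1 _ hs1] := @arg_maxP _ _ _ s0 xpredT (fun s => `|b s|) isT.
have b1 : b s1 != 0.
  rewrite -normr_gt0; apply: lt_le_trans (hs1 s0 isT); by rewrite normr_gt0.
exists (fun s => b s / b s1); split.
- by exists s1; rewrite divff.
- by move=> s; rewrite normrM normfV ler_pdivrMr ?normr_gt0 // mul1r; exact: (hs1 s isT).
- move=> l; transitivity ((\sum_(s < m) b s * A s l) / b s1); last by rewrite bA mul0r.
  by rewrite mulr_suml; apply: eq_bigr => s _; rewrite mulrAC.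
Qed.

Lemma same_sign (a b : R) : 0 < a * b -> (0 < a) = (0 < b).
Proof.
move=> h; apply/idP/idP => h0; first by rewrite -(pmulr_rgt0 _ h0).
by rewrite -(pmulr_lgt0 _ h0).
Qed.

Lemma opposite_sign (a b : R) : a * b < 0 -> (0 < a) != (0 < b).
Proof.
move=> h; apply/eqP => e; move: h; case: (ltP 0 a) e => a0 /esym b0; apply/negP; rewrite -leNgt.
  by rewrite ltW // mulr_gt0.
by rewrite mulr_le0 // leNgt b0.
Qed.

Variables (T alpha : R) (la : nat -> seq (R * R) * R).
Hypotheses (T0 : 0 < T) (hla : approximating T alpha la).

Lemma kinetic_courant t (v : 'I_t.+1 -> R) : exists L : 'I_t.+1 -> label,
  [/\ forall i, (L i).1 = (0 < v i), forall i, (0 < v i) = (0 < v (ordS i)) -> L i = L (ordS i),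
      noncrossing L & forall a : label -> R,
      kinetic T alpha la (fun i => a (L i) * v i) (fun i => a (L i) * v i)
      <= mean (fun i => mult (tau T alpha la t) v i * (a (L i) ^+ 2 * v i))].
Proof.
have [pc _] := hla t; have [L [h1 h2 h3 h4]] := grid_courant v pc.
exists L; split => // a; rewrite /kinetic /mean ler_wpM2l ?invr_ge0 //.
have e (F : 'I_t.+1 -> R) i : mult (tau T alpha la t) F i = (t.+1%:R / T) `^ alpha * dtn (la t).1 (la t).2 F i.
  by rewrite /dtn -multZ; exact: eq_mults.
under eq_bigr do rewrite e -mulrA; under [leRHS]eq_bigr do rewrite e -mulrA.
by rewrite -!mulr_sumr ler_wpM2l ?powR_ge0.
Qed.

Variables (q : nat) (y : nat -> R) (eta : R) (f0 : R -> R).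
Let n2 := q.+1.*2.
Hypotheses (hy0 : forall k, (k < n2)%N -> 0 <= y k) (hyT : forall k, (k < n2)%N -> y k + eta <= T).
Hypothesis hyS : forall k, (k.+1 < n2)%N -> y k + eta <= y k.+1.
Hypothesis hyc : forall k x, (k < n2)%N -> y k <= x -> x < y k + eta -> 0 < f0 x * f0 (y k).
Hypothesis hya : forall k, (k.+1 < n2)%N -> f0 (y k) * f0 (y k.+1) < 0.
Hypothesis eta0 : 0 < eta.

(** The [2 * (q + 1)] alternating intervals give [q + 2] classes. Orthogonality imposes [j <= q]
    conditions and one class gets the coefficient [0], so a nonzero choice remains. [b] is the
    square of the multiplier, as in Courant's inequality. *)
Lemma grid_test t (j : nat) (w : 'I_j -> 'I_t.+1 -> R) : T / t.+1%:R < eta -> (j <= q)%N ->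
  exists (F b : 'I_t.+1 -> R) (k0 k1 : 'I_n2),
  [/\ forall i, [/\ 0 <= b i, b i <= 1, F i * F i = b i * (f0 (gpt T t.+1 i) * f0 (gpt T t.+1 i)) &
        `|F i| <= `|f0 (gpt T t.+1 i)|],
      kinetic T alpha la F F <= mean (fun i => mult (tau T alpha la t) (smp T f0) i * (b i * smp T f0 i)),
      forall l, gip (w l) F = 0,
      forall i : 'I_t.+1, y k0 < gpt T t.+1 i -> gpt T t.+1 i < y k0 + eta -> F i = 0 &
      forall i : 'I_t.+1, y k1 < gpt T t.+1 i -> gpt T t.+1 i < y k1 + eta -> F i = f0 (gpt T t.+1 i)].
Proof.
move=> te jq; have N0 : 0 < t.+1%:R :> R by rewrite ltr0n.
(* The first grid index strictly to the right of [y k]; the mesh is smaller than [eta], so it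
   belongs to the interval that starts at [y k]. *)
pose pk k := (Num.truncn (y k * t.+1%:R / T)).+1.
have z0 k : (k < n2)%N -> 0 <= y k * t.+1%:R / T.
  by move=> kn; rewrite divr_ge0 ?(ltW T0) // mulr_ge0 ?hy0.
have pk1 k : (k < n2)%N -> y k < gpt T t.+1 (pk k).
  move=> kn; have /andP[_ h] := truncn_itv (z0 k kn).
  by rewrite /gpt ltr_pdivlMr // [ltRHS]mulrC -ltr_pdivrMr.
have pk2 k : (k < n2)%N -> gpt T t.+1 (pk k) < y k + eta.
  move=> kn; have /andP[h _] := truncn_itv (z0 k kn).
  have h1 : gpt T t.+1 (Num.truncn (y k * t.+1%:R / T)) <= y k.
    by rewrite /gpt ler_pdivrMr // mulrC -ler_pdivlMr.
  have -> : gpt T t.+1 (pk k) = gpt T t.+1 (Num.truncn (y k * t.+1%:R / T)) + T / t.+1%:R.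
    by rewrite /gpt /pk -[(_).+1%:R]natr1 mulrDr mulr1 mulrDl.
  exact: ler_ltD.
have gle (a b : nat) : (gpt T t.+1 a < gpt T t.+1 b) = (a < b)%N.
  by rewrite /gpt ltr_pM2r ?invr_gt0 // ltr_pM2l // ltr_nat.
have gltT (a : nat) : (gpt T t.+1 a < T) = (a < t.+1)%N.
  by rewrite -gle /gpt mulfK ?gt_eqF.
have pkN k : (k < n2)%N -> (pk k < t.+1)%N.
  by move=> kn; rewrite -gltT; exact: lt_le_trans (pk2 k kn) (hyT kn).
have start k (i : nat) : y k < gpt T t.+1 i -> (k < n2)%N -> (pk k <= i)%N.
  move=> hi kn; have /andP[h _] := truncn_itv (z0 k kn).
  rewrite /pk -(@ltr_nat R); apply: le_lt_trans h _.
  by rewrite ltr_pdivrMr // [ltRHS]mulrC -ltr_pdivlMr.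
pose p (k : 'I_n2) : 'I_t.+1 := inord (pk k).
have pE (k : 'I_n2) : p k = pk k :> nat by rewrite inordK // pkN.
have ymono (a d : nat) : (a + d.+1 < n2)%N -> y a + eta <= y (a + d.+1)%N.
  elim: d => [|d IH] h; first by rewrite addn1 in h *; exact: hyS.
  have h' : (a + d.+1 < n2)%N by apply: ltn_trans h; rewrite ltn_add2l.
  apply: le_trans (IH h') _; rewrite [(a + d.+2)%N]addnS in h *.
  by apply: le_trans (hyS h); rewrite lerDl ltW.
have pmono (i k : 'I_n2) : (i < k)%N -> (p i < p k)%N.
  move=> ik; rewrite !pE -gle; apply: lt_trans (pk2 i (ltn_ord i)) _.
  apply: le_lt_trans (pk1 k (ltn_ord k)).
  by have := ymono i (k - i.+1)%N; rewrite addnS -addSn subnKC // ltn_ord => /(_ isT).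
pose v : 'I_t.+1 -> R := smp T f0.
have vsign (k : nat) (i : 'I_t.+1) : (k < n2)%N -> (pk k <= i)%N -> gpt T t.+1 i < y k + eta ->
    (0 < v i) = (0 < f0 (y k)).
  move=> kn ki hi; apply: same_sign; apply: hyc => //; apply: ltW.
  by apply: lt_le_trans (pk1 k kn) _; rewrite leNgt gle -leqNgt.
have [L [Lsign Lrun Lnc Lform]] := kinetic_courant v.
have psign (k : 'I_n2) : (0 < v (p k)) = (0 < f0 (y k)).
  by apply: vsign => //; rewrite pE // pk2.
have Lalt (i k : 'I_n2) : k = i.+1 :> nat -> (L (p i)).1 != (L (p k)).1.
  move=> ki; rewrite !Lsign !psign ki; apply: opposite_sign; apply: hya.
  by rewrite -ki.
have [r rinj] := many_classes (ltn0Sn q) Lnc pmono Lalt.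
(* [f0] keeps its sign on the interval, so [Lrun] carries the label from each grid point to the
   next. *)
have cell (k : 'I_n2) (i : 'I_t.+1) : (pk k <= i)%N -> gpt T t.+1 i < y k + eta -> L i = L (p k).
  move=> ki hi; have : i = (pk k + (i - pk k))%N :> nat by rewrite subnKC.
  move: (i - pk k)%N => d; elim: d i {ki} hi => [|d IH] i hi ei.
    by congr L; apply: val_inj; rewrite /= pE ei addn0.
  have dN : (pk k + d < t.+1)%N by apply: leq_ltn_trans (ltn_ord i); rewrite ei addnS.
  pose i' : 'I_t.+1 := inord (pk k + d).
  have ei' : i' = (pk k + d)%N :> nat by rewrite inordK.
  have hi' : gpt T t.+1 i' < y k + eta by apply: lt_trans hi; rewrite gle ei' ei addnS.
  have Si : ordS i' = i.
    by apply: val_inj; rewrite /= ei' -addnS -ei modn_small.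
  rewrite -(IH i' hi' ei') -Si; apply/esym; apply: Lrun; rewrite Si.
  have l1 : (pk k <= i')%N by rewrite ei' leq_addr.
  have l2 : (pk k <= i)%N by rewrite ei leq_addr.
  by rewrite (vsign _ _ (ltn_ord k) l1 hi') (vsign _ _ (ltn_ord k) l2 hi).
pose lab s := L (p (r s)).
pose ind s (i : 'I_t.+1) : R := (L i == lab s)%:R.
(* The first column forces the coefficient of the class [ord0] to be zero; the others express
   orthogonality to [w]. *)
pose A : 'M[R]_(q.+2, j.+1) := \matrix_(s, l)
  if unlift ord0 l is Some l' then gip (w l') (fun i => ind s i * v i) else (s == ord0)%:R.
have [c [[s1 cs1] c1 cA]] := null_combination A (jq : (j.+1 < q.+2)%N).
pose a x : R := \sum_(s < q.+2) c s * (x == lab s)%:R.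
have alab s : a (lab s) = c s.
  rewrite /a (bigD1 s) //= eqxx mulr1 big1 ?addr0 // => s' ss'.
  rewrite (_ : (lab s == lab s') = false) ?mulr0 //.
  by apply: contraNF ss' => /eqP /rinj ->.
have a1 x : `|a x| <= 1.
  case: (pickP (fun s => x == lab s)) => [s /eqP ->|h]; first by rewrite alab.
  by rewrite /a big1 ?normr0 // => s _; rewrite h mulr0.
have c0 : c ord0 = 0.
  have := cA ord0; rewrite (bigD1 ord0) //= mxE unlift_none eqxx mulr1 big1 ?addr0 // => s s0.
  by rewrite mxE unlift_none (negbTE s0) mulr0.
pose F i := a (L i) * v i.
exists F, (fun i => a (L i) ^+ 2), (r ord0), (r s1); split.
- move=> i; have h := a1 (L i); split.
  + exact: sqr_ge0.
  + by rewrite -real_normK ?num_real // exprn_ile1.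
  + by rewrite /F /v /smp; ring.
  + by rewrite /F normrM ler_piMl.
- exact: Lform.
- move=> l; have := cA (lift ord0 l) => h; rewrite -[RHS]h.
  transitivity (\sum_(s < q.+2) c s * gip (w l) (fun i => ind s i * v i)); last first.
    by apply: eq_bigr => s _; rewrite mxE liftK.
  have e (n : nat) (G : 'I_n -> 'I_t.+1 -> R) (d : 'I_n -> R) :
      gip (w l) (fun i => \sum_(s < n) d s * G s i) = \sum_(s < n) d s * gip (w l) (G s).
    transitivity (t.+1%:R^-1 * \sum_(i < t.+1) \sum_(s < n) w l i * (d s * G s i)).
      by congr (_ * _); apply: eq_bigr => i _; rewrite mulr_sumr.
    rewrite exchange_big mulr_sumr; apply: eq_bigr => s _ /=; rewrite /gip /mean.
    by rewrite !mulr_sumr; apply: eq_bigr => i _; ring.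
  rewrite -e; apply: eq_gip => // i; rewrite /F /a mulr_suml.
  by apply: eq_bigr => s _; rewrite mulrA.
- move=> i h1 h2; rewrite /F (cell (r ord0) i) ?alab ?c0 ?mul0r //.
  by apply: start.
- move=> i h1 h2; rewrite /F (cell (r s1) i) ?alab ?cs1 ?mul1r //.
  by apply: start.
Qed.

End GridTest.

(** * Passage from the grid to the nodal bound *)

Section Courant.
Variables (R : realType) (T alpha : R) (V : R -> R).
Hypotheses (T0 : 0 < T) (al0 : 0 < alpha) (al2 : alpha < 2).
Hypotheses (sV : smooth V) (pV : forall x, V (x + T) = V x).

Let UV : UA T V. Proof. by have [C [h _ _ _]] := smooth_tail T0 sV pV. Qed.

Lemma uniform_eta (n : nat) (P : nat -> R -> Prop) :
  (forall k e e', P k e -> e' <= e -> P k e') ->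
  (forall k, (k < n)%N -> exists2 e, 0 < e & P k e) ->
  exists2 e, 0 < e & forall k, (k < n)%N -> P k e.
Proof.
move=> mono; elim: n => [|n IH] h; first by exists 1.
have [k kn|e e0 he] := IH; first by apply: h; exact: ltnW.
have [e' e'0 he'] := h n (ltnSn n).
exists (Num.min e e'); first by rewrite lt_min e0.
move=> k; rewrite ltnS leq_eqVlt => /orP[/eqP ->|kn].
  by apply: mono he' _; rewrite ge_min lexx orbT.
by apply: mono (he k kn) _; rewrite ge_min lexx.
Qed.

Lemma sign_interval (f : R -> R) (x : R) : continuous f -> f x != 0 -> exists2 e, 0 < e &
  forall z, x <= z -> z < x + e -> 0 < f z * f x.
Proof.
move=> cf fx.
have /cvgrPdist_lt/(_ `|f x|) : f z @[z --> x] --> f x by exact: cf.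
rewrite normr_gt0 fx => /(_ isT) [e /= e0 he]; exists e => // z xz zx.
have := he z; rewrite /ball_ /= distrC ger0_norm ?subr_ge0 // ltrBlDl => /(_ zx).
case: (ltgtP (f x) 0) fx => // h _; first rewrite (ltr0_norm h).
  by rewrite ltr_norml => /andP[h1 h2]; rewrite nmulr_lgt0 //; lra.
by rewrite (gtr0_norm h) ltr_norml => /andP[h1 h2]; rewrite pmulr_lgt0 //; lra.
Qed.

Definition orthogonal_family lam (j : nat) (v : 'I_j -> R -> R) (nl : 'I_j -> R) : Prop :=
  [/\ forall l, nice T alpha V (nl l) (v l), forall l, nl l < lam,
      forall l, exists x, v l x != 0 & forall l l', l != l' -> ip T (v l) (v l') = 0].

(** The sizes are bounded by [q], so a largest family exists; a further orthogonal eigenfunction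
    below [lam] could be scaled and added to it. *)
Lemma maximal_family lam q :
  (forall j (v : 'I_j -> R -> R) nl, orthogonal_family lam v nl -> (j <= q)%N) ->
  exists j (v : 'I_j -> R -> R) nl, [/\ orthogonal_family lam v nl,
    forall l, lam <= nl l + ip T (v l) (v l) &
    forall u nu, nice T alpha V nu u -> nu < lam -> (forall l, ip T (v l) u = 0) -> forall x, u x = 0].
Proof.
move=> hq.
pose P j := `[< exists (v : 'I_j -> R -> R) nl, orthogonal_family lam v nl /\
   forall l, lam <= nl l + ip T (v l) (v l) >].
have P0 : exists j, P j.
  exists 0%N; apply/asboolP; exists (fun _ _ => 0), (fun=> 0); split; last by case.
  by split; case.
have Pq j : P j -> (j <= q)%N by move=> /asboolP[v [nl [h _]]]; exact: hq h.
case: (ex_maxnP P0 Pq) => j /asboolP[v [nl [hf hl]]] jmax.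
exists j, v, nl; split => // u nu nu_u nulam ou x; apply/eqP/negPn/negP => ux.
have [nv ll vn0 ov] := hf.
have uu := nice_UA nu_u; have iu := ip_pos T0 uu ux.
(* As [c >= 1], the square norm of [c * u] is at least [c * ip T u u], which exceeds [lam - nu]; so
   the penalty lifts the new eigenvalue to [lam]. *)
pose c := 1 + (lam - nu) / ip T u u.
have c1 : 1 <= c by rewrite lerDl; apply: divr_ge0; [rewrite subr_ge0|]; exact: ltW.
pose v' i := if unlift ord_max i is Some l then v l else fun x => c * u x.
pose nl' i := if unlift ord_max i is Some l then nl l else nu.
have uv l := nice_UA (nv l).
suff : P j.+1 by move=> /jmax; rewrite ltnn.
have v'm : v' ord_max = fun x => c * u x by rewrite /v' unlift_none.
have v'l l : v' (lift ord_max l) = v l by rewrite /v' liftK.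
have n'm : nl' ord_max = nu by rewrite /nl' unlift_none.
have n'l l : nl' (lift ord_max l) = nl l by rewrite /nl' liftK.
apply/asboolP; exists v', nl'; split; first split.
- move=> i; case: (unliftP ord_max i) => [l ->|->]; first by rewrite v'l n'l.
  by rewrite v'm n'm; exact: nice_scale.
- by move=> i; case: (unliftP ord_max i) => [l ->|->]; rewrite ?n'l ?n'm.
- move=> i; case: (unliftP ord_max i) => [l ->|->]; first by rewrite v'l.
  by rewrite v'm; exists x; rewrite mulf_neq0 // gt_eqF // (lt_le_trans ltr01).
- have ouc l : ip T (fun x => c * u x) (v l) = 0 by rewrite ipZl // [ip T u _]ipC ou mulr0.
  move=> i i'; case: (unliftP ord_max i) => [l ->|->]; case: (unliftP ord_max i') => [l' ->|->].
  + rewrite !v'l => h; apply: ov; by apply: contraNneq h => ->.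
  + by move=> _; rewrite v'l v'm ipC ouc.
  + by move=> _; rewrite v'l v'm ouc.
  + by rewrite eqxx.
- move=> i; case: (unliftP ord_max i) => [l ->|->]; first by rewrite v'l n'l.
  rewrite v'm n'm ipZl //; last exact: UAZ. rewrite ipC ipZl // mulrA -lerBlDl.
  have h : lam - nu <= c * ip T u u by rewrite /c mulrDl divfK ?gt_eqF // mul1r lerDr ltW.
  apply: le_trans h _; rewrite -mulrA ler_peMl // mulr_ge0 ?(ltW iu) //.
  exact: le_trans c1.
Qed.

Lemma near_small_step eta : 0 < eta -> \forall t \near \oo, T / t.+1%:R < eta.
Proof.
move=> e0; have h : T / t.+1%:R @[t --> \oo] --> (0 : R).
  rewrite -(mulr0 T); apply: cvgM; first exact: cvg_cst. exact: cvg_harmonic.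
by apply: (cvgr_lt _ h).
Qed.

(* If [f0] had too many sign changes, a combination of its nodal pieces orthogonal to the
   lower eigenfunctions would be, in the limit, an eigenfunction vanishing on an interval. *)
Lemma nodal_bound q lam f0 : nice T alpha V lam f0 ->
  (forall j (v : 'I_j -> R -> R) nl, orthogonal_family lam v nl -> (j <= q)%N) ->
  ~ changes_sign_times T f0 (2 * q).+1.
Proof.
move=> nf0 hq [y [hy [hymono [hyn hys]]]].
have uf0 := nice_UA nf0; have cf0 := UA_continuous uf0.
have [j [v [nl [[nv ll vn0 ov] lv vmax]]]] := maximal_family hq.
have jq : (j <= q)%N by apply: (hq _ v nl); split.
have uv l := nice_UA (nv l); have dv l := nice_decay (nv l).
have n2E : q.+1.*2 = (2 * q).+2 by rewrite doubleS -mul2n.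
have [la hla] := approximating_exists T0 al0 al2.
have [U [hU Uoo]] := ultraFilterLemma (@eventually_filter).
have [nuN [Bn [nB nlam cn low]]] := lower_bound T0 al0 al2 sV pV hla uv dv Uoo nv ov lv vmax.
have alt k : (k.+1 < q.+1.*2)%N -> f0 (y k) * f0 (y k.+1) < 0.
  rewrite n2E ltnS => kn; have s := hys k kn.
  rewrite [f0 (y k)]numEsg [f0 (y k.+1)]numEsg s mulrACA mulNr -expr2.
  have h1 : f0 (y k) != 0 by apply: hyn; exact: ltnW.
  have h2 : f0 (y k.+1) != 0 by exact: hyn.
  by rewrite sqr_sg h2 mulN1r oppr_lt0 mulr_gt0 ?normr_gt0.
(* Intervals are taken to the right of the points, because the first point may be [0] while the last
   is strictly below [T]. *)
have [eta eta0 heta] : exists2 eta, 0 < eta & forall k, (k < q.+1.*2)%N ->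
   [/\ y k + eta <= T, (k.+1 < q.+1.*2)%N -> y k + eta <= y k.+1 &
     forall x, y k <= x -> x < y k + eta -> 0 < f0 x * f0 (y k)].
  apply: uniform_eta => [k e e' [h1 h2 h3] ee|k kn].
    split; [apply: le_trans h1; exact: lerD|move=> h; apply: le_trans (h2 h); exact: lerD|].
    by move=> x xy xe; apply: h3 => //; apply: lt_le_trans xe _; exact: lerD.
  have kn' := kn; rewrite n2E ltnS in kn'.
  have [e e0 he] := sign_interval cf0 (hyn k kn').
  have [_ yT] := hy k kn'.
  pose d := if (k.+1 < q.+1.*2)%N then y k.+1 - y k else 1.
  have d0 : 0 < d.
    rewrite /d; case: ifP => // h; rewrite subr_gt0; apply: hymono.
    by rewrite n2E ltnS in h.
  exists (Num.min e (Num.min (T - y k) d)); first by rewrite !lt_min e0 subr_gt0 yT d0.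
  split.
  - by rewrite addrC -lerBrDr !ge_min lexx orbT.
  - by move=> h; rewrite addrC -lerBrDr /d h !ge_min lexx !orbT.
  - move=> x xy xe; apply: he => //; apply: lt_le_trans xe _.
    by rewrite lerD2l ge_min lexx.
have hyc k x : (k < q.+1.*2)%N -> y k <= x -> x < y k + eta -> 0 < f0 x * f0 (y k).
  by move=> kn; have [_ _] := heta k kn; exact.
have hy0 k : (k < q.+1.*2)%N -> 0 <= y k by rewrite n2E ltnS => kn; case: (hy k kn).
have hyT k : (k < q.+1.*2)%N -> y k + eta <= T by move=> kn; have [] := heta k kn.
have hyS k : (k.+1 < q.+1.*2)%N -> y k + eta <= y k.+1.
  by move=> kn; have [_ h _] := heta k (ltnW kn); exact: h.
have [Bf [Bf0 hBf]] := UA_bounded uf0.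
pose vt t : 'I_t.+1 -> R := smp T f0.
(* Grids too coarse for [eta] receive the zero function; the bound by [Bf] must hold for every
   [t]. *)
pose good t (d : ('I_t.+1 -> R) * ('I_t.+1 -> R) * ('I_q.+1.*2 * 'I_q.+1.*2)) : Prop :=
  (forall i, `|d.1.1 i| <= Bf) /\ (T / t.+1%:R < eta ->
  [/\ forall i, [/\ 0 <= d.1.2 i, d.1.2 i <= 1 & d.1.1 i * d.1.1 i = d.1.2 i * (vt t i * vt t i)],
      kinetic T alpha la d.1.1 d.1.1 <= mean (fun i => mult (tau T alpha la t) (vt t) i * (d.1.2 i * vt t i)),
      forall l, gip (smp T (v l)) d.1.1 = 0,
      forall i : 'I_t.+1, y d.2.1 < gpt T t.+1 i -> gpt T t.+1 i < y d.2.1 + eta -> d.1.1 i = 0 &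
      forall i : 'I_t.+1, y d.2.2 < gpt T t.+1 i -> gpt T t.+1 i < y d.2.2 + eta -> d.1.1 i = vt t i]).
have hgood t : exists d, good t d.
  have [te|te] := ltP (T / t.+1%:R) eta; last first.
    exists ((fun=> 0, fun=> 0), (ord0, ord0)); split; first by move=> i; rewrite normr0.
    by rewrite ltNge te.
  have [F [b [k0 [k1 [h1 h2 h3 h4 h5]]]]] := grid_test T0 hla hy0 hyT hyS hyc alt eta0 (fun l => smp T (v l)) te jq.
  exists ((F, b), (k0, k1)); split => [i|_].
    by have [_ _ _ h] := h1 i; apply: le_trans h (hBf _).
  by split => // i; have [? ? ? _] := h1 i.
pose d t := projT1 (cid (hgood t)).
have hd t : good t (d t) by rewrite /d; case: cid.
pose F t := (d t).1.1; pose b t := (d t).1.2.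
have FB t i : `|F t i| <= Bf by exact: (hd t).1.
have FB2 t : gip (F t) (F t) <= Bf * Bf.
  by apply: le_trans (ler_norm _) _; apply: mean_bound => // i; rewrite normrM ler_pM.
have small := near_small_step eta0.
have evU (P : nat -> Prop) : (\forall t \near \oo, P t) -> \forall t \near U, P t by move=> h; exact: Uoo.
(* The intervals chosen by [grid_test] depend on [t], but there are finitely many, so along [U] they
   are fixed. *)
have [k0 hk0] := ultra_const (fun t => (d t).2.1).
have [k1 hk1] := ultra_const (fun t => (d t).2.2).
have [C0 hC0] := nice_decay nf0.
have ur := UA_residual UV lam uf0.
have im := nice_image T0 UV nf0.
(* Courant's inequality bounds the kinetic part of [F t] by pairing the grid operator on [f0] with
   [b t * vt t]. By consistency that operator is [lam - V] up to [e2], and [F t] feels no penalty;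
   so the form exceeds [lam * gip (F t) (F t)] by at most [e / 2], and [nuN] tends to [lam]. *)
have a0 : form T alpha V la v (F t) (F t) - nuN t * gip (F t) (F t) @[t --> U] --> (0 : R).
  apply/cvgr0Pnorm_le => e e0.
  have B1 : 0 < Bf * Bf + 1 by rewrite ltr_wpDl ?mulr_ge0.
  have B2 : 0 < Bf + 1 by rewrite ltr_wpDl.
  have e1 : 0 < e / 2 / (Bf * Bf + 1) by rewrite !divr_gt0.
  have e2 : 0 < e / 2 / (Bf + 1) by rewrite !divr_gt0.
  have cons := evU _ (consistency T0 al0 al2 hla uf0 ur hC0 im e2).
  have nearlam : \forall t \near U, lam - e / 2 / (Bf * Bf + 1) <= nuN t.
    by apply: (cvgr_ge _ cn); rewrite ltrBlDr ltrDl.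
  apply: filterS3 cons nearlam (evU _ small) => t hc hn hs.
  have [h1 h2 h3 _ _] := (hd t).2 hs; rewrite -/(F t) -/(b t) in h1 h2 h3.
  rewrite ger0_norm; last by rewrite subr_ge0.
  have f1 : form T alpha V la v (F t) (F t) = kinetic T alpha la (F t) (F t) + gip (fun i => smp T V i * F t i) (F t).
    by rewrite /form big1 ?addr0 // => l _; rewrite h3 mul0r.
  have f2 : gip (fun i => smp T V i * F t i) (F t) = mean (fun i => V (gpt T t.+1 i) * (b t i * (vt t i * vt t i))).
    by apply: eq_mean => i; have [_ _ <-] := h1 i; rewrite /smp; ring.
  have f3 : gip (F t) (F t) = mean (fun i => b t i * (vt t i * vt t i)).
    by apply: eq_mean => i; have [_ _ <-] := h1 i.
  have f4 : mean (fun i => mult (tau T alpha la t) (vt t) i * (b t i * vt t i)) <=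
      mean (fun i => lam * (b t i * (vt t i * vt t i)) + (-1) * (V (gpt T t.+1 i) * (b t i * (vt t i * vt t i)))
         + e / 2 / (Bf + 1) * Bf).
    apply: mean_le => i; have [b0 b1 _] := h1 i; have := hc i.
    set m := mult _ _ _; rewrite /smp /residual => hm.
    have e3 : m * (b t i * vt t i) - (lam * (b t i * (vt t i * vt t i)) + (-1) * (V (gpt T t.+1 i) * (b t i * (vt t i * vt t i))))
        = (m - (lam * f0 (gpt T t.+1 i) - V (gpt T t.+1 i) * f0 (gpt T t.+1 i))) * (b t i * vt t i).
      by rewrite /vt /smp; ring.
    rewrite addrC -lerBlDr e3; apply: le_trans (ler_norm _) _; rewrite normrM ler_pM //.
    by rewrite normrM (ger0_norm b0) -[leRHS]mul1r ler_pM //; exact: hBf.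
  rewrite !meanD !meanZ mean_cst // -f3 -f2 in f4.
  rewrite f1 lerBlDr.
  have g0 := gip_ge0 (F t); have gB := FB2 t.
  have t1 : e / 2 / (Bf + 1) * Bf <= e / 2.
    rewrite -mulrA ler_piMr ?divr_ge0 ?(ltW e0) // mulrC ler_pdivrMr // mul1r lerDl //.
  have t2 : (lam - nuN t) * gip (F t) (F t) <= e / 2.
    apply: (@le_trans _ _ (e / 2 / (Bf * Bf + 1) * (Bf * Bf))).
      apply: ler_pM => //; first by rewrite subr_ge0.
      by rewrite lerBlDr addrC -lerBlDr.
    by rewrite -[leLHS]mulrA ler_piMr ?divr_ge0 ?(ltW e0) // mulrC ler_pdivrMr // mul1r lerDl.
  have := le_trans h2 f4; move: t1 t2; rewrite mulN1r mulrBl.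
  move: (kinetic _ _ _ _ _) (gip (fun i => _ * F t i) _) (nuN t * _) (lam * _) (e / 2 / (Bf + 1) * Bf) => K G N L E; lra.
have [f [uf df cf ef]] := limit_equation T0 al0 sV pV hla uv dv Uoo FB2 nB cn low a0.
have orth l : ip T (v l) f = 0.
  rewrite ipC -(ulimE (cf _ (uv l))); apply: ulimE.
  have h0 : (fun=> 0) t @[t --> U] --> (0 : R) by exact: cvg_cst.
  apply: cvg_trans h0; apply: near_eq_cvg.
  apply: filterS (evU _ small) => t hs; have [_ _ h3 _ _] := (hd t).2 hs.
  by rewrite gipC h3.
have nf : nice T alpha V lam f.
  split => // k p; rewrite -ef big1 ?addr0 // => l _; by rewrite orth mul0r.
have f_zero : forall x, y k0 < x -> x < y k0 + eta -> f x = 0.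
  apply: (localize T0 uf cf FB (hy0 _ (ltn_ord k0)) (hyT _ (ltn_ord k0))).
  apply: filterS2 hk0 (evU _ small) => t hk hs i; have [_ _ _ h4 _] := (hd t).2 hs.
  by rewrite -hk; exact: h4.
(* On this interval the coefficient is [1], so the difference of [F t] and the samples of [f0]
   vanishes there. *)
have f_f0 : forall x, y k1 < x -> x < y k1 + eta -> f x - f0 x = 0.
  have uff : UA T (fun x => f x - f0 x).
    by apply: UA_ext (UAD uf (UAZ (-1) uf0)) _ => x; rewrite mulN1r.
  apply: (@localize _ T U hU T0 (fun t i => F t i - vt t i) _ (Bf + Bf) _ _ uff _ _
    (hy0 _ (ltn_ord k1)) (hyT _ (ltn_ord k1))).
  - move=> g ug.
    have h2 := riemann_ultra T0 Uoo (UAM uf0 ug).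
    have h3 := cvgB (cf g ug) h2.
    have e1 : ip T (fun x => f x - f0 x) g = ip T f g - ip T f0 g.
      rewrite -mulN1r -ipZl // -ipDl //; last exact: UAZ.
      by apply: eq_ip => // x; rewrite mulN1r.
    rewrite e1 (_ : (fun t => _) = (fun t => gip (F t) (smp T g) - mean (@smp R T t.+1 (fun x => f0 x * g x)))).
      by apply: cvgB => //; exact: cf.
    apply/funext => t; rewrite /gip -mulN1r -meanZ -meanD; apply: eq_mean => i.
    by rewrite /vt /smp; ring.
  - move=> t i; apply: le_trans (ler_normB _ _) _; apply: lerD => //; exact: hBf.
  - apply: filterS2 hk1 (evU _ small) => t hk hs i; have [_ _ _ _ h5] := (hd t).2 hs.
    by move=> i1 i2; rewrite /F h5 ?hk // subrr.
have [C hC] := df.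
have r0 : 0 < eta / 2 by rewrite divr_gt0.
have z := unique_continuation al0 al2 T0 uf (UA_residual UV lam uf) hC (nice_image T0 UV nf) r0
  (z := y k0 + eta / 2).
have z0 : forall x, f x = 0.
  apply: z => x; rewrite ltr_norml => /andP[x1 x2].
  have fx : f x = 0 by apply: f_zero; lra.
  by rewrite /residual fx !mulr0 subrr.
(* The limit is zero everywhere, hence so is [f0] on the interval of [k1], where its sign is
   strict. *)
have := f_f0 (y k1 + eta / 2); rewrite z0 sub0r => h.
have := hyc k1 (y k1 + eta / 2) (ltn_ord k1); have /eqP : - f0 (y k1 + eta / 2) = 0 by apply: h; lra.
by rewrite oppr_eq0 => /eqP ->; rewrite mul0r ltxx => g; have : false by apply: g; lra.
Qed.

End Courant.

(** * Counting lower eigenfunctions *)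

Section Enumeration.
Variables (R : realType) (T alpha : R) (V : R -> R) (lam : nat -> R).
Hypotheses (T0 : 0 < T) (al0 : 0 < alpha) (al2 : alpha < 2).
Hypotheses (sV : smooth V) (pV : forall x, V (x + T) = V x).
Hypothesis hE : eigenvalue_enumeration alpha T V lam.

Let UV : UA T V. Proof. by have [C [h _ _ _]] := smooth_tail T0 sV pV. Qed.

Lemma lam_mono a b : (1 <= a)%N -> (a <= b)%N -> lam a <= lam b.
Proof.
have [h _] := hE; move=> a1 /subnKC <-; elim: (b - a)%N => [|d IH]; first by rewrite addn0.
by apply: le_trans IH _; rewrite addnS; apply: h; rewrite (leq_trans a1) // leq_addr.
Qed.

Lemma nice_index nu f x : nice T alpha V nu f -> f x != 0 -> exists2 k, (1 <= k)%N & lam k = nu.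
Proof.
move=> nf fx; have [_ [h _]] := hE; apply/h; exists f; exact: nice_eigenfunction fx.
Qed.

(** All signs in [[0, T)] are compared with that of one nonzero value; the point [T] is covered by
    periodicity. *)
Lemma constant_sign f : UA T f -> ~ changes_sign_times T f 1 -> (exists x, f x != 0) ->
  exists2 s : R, `|s| = 1 & forall x, per_int T x -> 0 <= s * f x.
Proof.
move=> uf hs [x0 fx0].
have pf := UA_periodic T0 uf.
have [x1 /andP[x10 x1T] fx1] : exists2 x1, 0 <= x1 < T & f x1 != 0.
  apply: contrapT => h; move: fx0; rewrite (periodic_zero T0 pf) ?eqxx // => x.
  rewrite /per_int /= in_itv /= => /andP[x00]; rewrite le_eqVlt => /orP[/eqP ->|xT].
    apply/eqP/negPn/negP => fT; apply: h; exists 0; first by rewrite lexx.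
    by rewrite -(pf 0) add0r.
  by apply/eqP/negPn/negP => fx; apply: h; exists x => //; rewrite x00.
have same a b : 0 <= a -> a < b -> b < T -> f a != 0 -> f b != 0 -> 0 < f a * f b.
  move=> a0 ab bT fa fb; rewrite ltNge; apply/negP => le0; apply: hs.
  exists (fun k => if k == 0%N then a else b); split; last split; last split.
  - by case=> [|k] _ /=; split; rewrite ?(lt_trans ab) // (le_trans a0) // ltW.
  - by case.
  - by case.
  - case=> [|//] _ /=; move: le0; case: (ltgtP (f a) 0) fa => // ha _; case: (ltgtP (f b) 0) fb => // hb _ h.
    + by move: h; rewrite leNgt nmulr_rgt0 // hb.
    + by rewrite ltr0_sg ?gtr0_sg.
    + by rewrite gtr0_sg ?ltr0_sg // opprK.
    + by move: h; rewrite leNgt mulr_gt0.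
have same1 z : 0 <= z -> z < T -> 0 <= f x1 * f z.
  move=> z0 zT; have [->|fz] := eqVneq (f z) 0; first by rewrite mulr0.
  by case: (ltgtP z x1) => [h|h|->]; [rewrite mulrC| |rewrite -expr2 sqr_ge0]; rewrite ?ltW // same.
exists (Num.sg (f x1)); first by rewrite normr_sg fx1.
have sgE z : 0 <= f x1 * f z -> 0 <= Num.sg (f x1) * f z.
  have p : 0 < `|f x1| by rewrite normr_gt0.
  by move=> h; rewrite -(pmulr_rge0 _ p) mulrA [`|_| * _]mulrC -numEsg.
move=> z; rewrite /per_int /= in_itv /= => /andP[z0]; rewrite le_eqVlt => /orP[/eqP ->|zT].
  by rewrite -[T]add0r pf; apply: sgE; exact: same1.
by apply: sgE; exact: same1.
Qed.

(** No eigenvalue lies below, so [nodal_bound] with [q = 0] gives both functions a constant sign. If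
    they were orthogonal, their product would vanish, so [g] would be zero on an interval where [f]
    is not, against unique continuation. *)
Lemma lowest_simple f g : nice T alpha V (lam 1) f -> nice T alpha V (lam 1) g ->
  (exists x, f x != 0) -> (exists x, g x != 0) -> ip T f g != 0.
Proof.
move=> nf ng f0 g0; apply/eqP => fg.
have uf := nice_UA nf; have ug := nice_UA ng.
have low j (v : 'I_j -> R -> R) nl : orthogonal_family T alpha V (lam 1) v nl -> (j <= 0)%N.
  case: j v nl => // j v nl [nv ll vn _]; have [x vx] := vn ord0.
  have [k k1 kl] := nice_index (nv ord0) vx.
  by have := ll ord0; rewrite -kl ltNge (lam_mono _ k1).
have sf := nodal_bound T0 al0 al2 sV pV nf low; have sg := nodal_bound T0 al0 al2 sV pV ng low.
have [s s1 hs] := constant_sign uf sf f0; have [s' s'1 hs'] := constant_sign ug sg g0.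
have usf := UAZ s uf; have usg := UAZ s' ug.
have prod0 x : 0 < x < T -> (s * f x) * (s' * g x) = 0.
  apply: (product_zero T0 (g := fun x => (s * f x) * (s' * g x))).
  - by apply: UA_wc; exact: UAM.
  - by move=> z hz; rewrite mulr_ge0 ?hs ?hs'.
  - by rewrite -/(ip T _ _) ipZl // ipC ipZl // ipC fg !mulr0.
have sn : s != 0 by rewrite -normr_gt0 s1. have s'n : s' != 0 by rewrite -normr_gt0 s'1.
have fg0 x : 0 < x < T -> f x != 0 -> g x = 0.
  move=> hx fx; have /eqP := prod0 x hx; rewrite !mulf_eq0 (negbTE sn) (negbTE fx) (negbTE s'n) /=.
  by move/eqP.
have [x [x0 xT fx]] : exists x, [/\ 0 <= x, x < T & f x != 0].
  have [z fz] := f0; apply: contrapT => h; move: fz.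
  rewrite (periodic_zero T0 (UA_periodic T0 uf)) ?eqxx // => x.
  rewrite /per_int /= in_itv /= => /andP[x00]; rewrite le_eqVlt => /orP[/eqP ->|xT].
    apply/eqP/negPn/negP => fT; apply: h; exists 0; split => //.
    by rewrite -(UA_periodic T0 uf 0) add0r.
  by apply/eqP/negPn/negP => fx; apply: h; exists x.
have [e e0 he] := sign_interval (UA_continuous uf) fx.
pose d := Num.min e (T - x).
have d0 : 0 < d by rewrite lt_min e0 subr_gt0.
have de : d <= e by rewrite ge_min lexx.
have dT : d <= T - x by rewrite ge_min lexx orbT.
have gz z : x < z -> z < x + d -> g z = 0.
  move=> xz zd; apply: fg0; first by apply/andP; split; lra.
  have : 0 < f z * f x by apply: he; lra.
  by apply: contraTneq => ->; rewrite mul0r ltxx.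
have [C hC] := nice_decay ng.
have r0 : 0 < d / 2 by rewrite divr_gt0.
have z := unique_continuation al0 al2 T0 ug (UA_residual UV (lam 1) ug) hC (nice_image T0 UV ng) r0 (z := x + d / 2).
have [y] := g0; rewrite z ?eqxx // => w; rewrite ltr_norml => /andP[w1 w2].
have gw : g w = 0 by apply: gz; lra.
by rewrite /residual gw !mulr0 subrr.
Qed.

(** Pairing a vanishing combination with each member isolates its coefficient, the square norm being
    positive. *)
Lemma indep_orthogonal nu (m : nat) (fs : 'I_m -> R -> R) : (forall i, nice T alpha V nu (fs i)) ->
  (forall i, exists x, fs i x != 0) -> (forall i i', i != i' -> ip T (fs i) (fs i') = 0) ->
  indep_eigenfunctions alpha T V nu m.
Proof.
move=> nf f0 of_; exists fs; split => [i|c hc i].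
  by have [x fx] := f0 i; exact: nice_eigenfunction (nf i) fx.
have ui k := nice_UA (nf k); have uci k := UAZ (c k) (ui k).
have us := UA_sum_ord uci.
have z := UA_ae_zero T0 us hc.
have [x fx] := f0 i; have p := ip_pos T0 (ui i) fx.
have : ip T (fun x => \sum_(k < m) c k * fs k x) (fs i) = 0.
  by rewrite /ip (@eq_itg _ _ _ (fun=> 0)) ?itg_cst // => w _; rewrite z mul0r.
rewrite (@ip_suml _ _ T0 _ (fun k x => c k * fs k x)) // (bigD1 i) //= ipZl // big1 ?addr0.
  by move=> /eqP; rewrite mulf_eq0 (gt_eqF p) orbF => /eqP.
by move=> k ki; rewrite ipZl // of_ // mulr0.
Qed.

Lemma indep_sub nu m m' : (m <= m')%N -> indep_eigenfunctions alpha T V nu m' ->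
  indep_eigenfunctions alpha T V nu m.
Proof.
move=> mm [fs [h1 h2]]; exists (fun i => fs (widen_ord mm i)); split => // c hc.
pose c' (i : 'I_m') : R := if insub (i : nat) is Some k then c k else 0.
have c'w i : c' (widen_ord mm i) = c i by rewrite /c' insubT /= ?ltn_ord // => h; congr c; apply: val_inj.
have c'0 : forall i, c' i = 0; last by move=> i; rewrite -c'w c'0.
apply: h2; move: hc; apply: filterS; first exact: (ae_filter_ringOfSetsType (@lebesgue_measure R)).
move=> x h hx; rewrite -[RHS](h hx) (bigID (fun i : 'I_m' => (i < m)%N)) /= [X in _ + X]big1 ?addr0.
  rewrite (big_ord_narrow mm).
  by apply: eq_bigr => i _; rewrite c'w.
by move=> i im; rewrite /c' insubF ?mul0r //; exact: negbTE.
Qed.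

(* The index block of [lam 1] may start at [0], so that its multiplicity would exceed the
   number of its indices by one; simplicity of the lowest eigenvalue rules this out. *)
Lemma family_card n j (v : 'I_j -> R -> R) nl : (1 <= n)%N ->
  orthogonal_family T alpha V (lam n) v nl -> (j <= n - 1)%N.
Proof.
move=> n1 [nv ll vn ov]; have [_ [_ h3]] := hE.
have /choice[kf hkf] x : exists k, is_eigenvalue alpha T V x -> (1 <= k)%N /\ lam k = x.
  have [hx|hx] := pselect (is_eigenvalue alpha T V x); last by exists 0%N.
  by have [_ [h _]] := hE; have [k k1 kx] := (h x).1 hx; exists k.
have /choice[mi hmi] k : exists mi : nat * nat, (1 <= k)%N -> eig_multiplicity alpha T V (lam k) mi.1 /\
    forall j, (1 <= j)%N -> (lam j = lam k <-> (mi.2 <= j < mi.2 + mi.1)%N).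
  have [k1|k0] := leqP 1 k; last by exists (0, 0)%N.
  by have [m [i h]] := h3 k k1; exists (m, i).
pose mm l := (mi (kf (nl l))).1; pose ii l := (mi (kf (nl l))).2.
have ev l : is_eigenvalue alpha T V (nl l).
  by exists (v l); have [x vx] := vn l; exact: nice_eigenfunction (nv l) vx.
have k1 l : (1 <= kf (nl l))%N by have [] := hkf _ (ev l).
have kl l : lam (kf (nl l)) = nl l by have [] := hkf _ (ev l).
have mult l : eig_multiplicity alpha T V (nl l) (mm l) by have [h _] := hmi _ (k1 l); rewrite kl in h.
have idx l a : (1 <= a)%N -> (lam a = nl l <-> (ii l <= a < ii l + mm l)%N).
  by have [_ h] := hmi _ (k1 l); rewrite kl in h; exact: h.
pose S (l : 'I_j) := [set l' : 'I_j | (l' < l)%N & nl l' == nl l]%SET.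
(* An index at which the eigenvalue of [v l] is listed: the start of its block plus the rank of [l]
   among the earlier members with this eigenvalue. The [maxn 1] treats a block that formally starts
   at [0]. *)
pose e l := (maxn 1 (ii l) + #|S l|)%N.
(* The members up to [l] with this eigenvalue are orthogonal, hence independent, so their number
   does not exceed the multiplicity. *)
have cntm l : (#|S l| < mm l)%N.
  rewrite ltnNge; apply/negP => h; have [_] := mult l; apply.
  pose A := (l |: S l)%SET.
  have cA : #|A| = #|S l|.+1 by rewrite cardsU1 inE ltnn.
  have hA : ((mm l).+1 <= #|A|)%N by rewrite cA ltnS.
  apply: (indep_sub hA).
  pose fs (i : 'I_#|A|) := v (enum_val i).
  have nA l' : l' \in A -> nl l' = nl l by rewrite !inE => /orP[/eqP ->|/andP[_ /eqP]].
  apply: (@indep_orthogonal _ _ fs) => [i|i|i i' ii'].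
  - by rewrite -(nA (enum_val i)) ?enum_valP //; exact: nv.
  - exact: vn.
  - by apply: ov; apply: contraNneq ii' => /enum_val_inj ->.
have lame l : lam (e l) = nl l.
  have e1 : (1 <= e l)%N by rewrite /e (leq_trans (leq_maxl 1 (ii l))) // leq_addr.
  apply/(idx l) => //; rewrite /e; have c := cntm l.
  have [i0|i0] := posnP (ii l); last first.
    by rewrite (maxn_idPr i0) leq_addr ltn_add2l.
  have kk := (idx l _ (k1 l)).1 (kl l); rewrite i0 in kk.
  have m2 : (1 < mm l)%N by have := k1 l; move: kk; lia.
  have l1 : lam 1 = nl l by apply/(idx l) => //; rewrite i0.
  have -> : #|S l| = 0%N.
    apply/eqP; rewrite cards_eq0; apply/eqP/setP => l'; rewrite !inE.
    apply/negP => /andP[ll' /eqP nll].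
    have n1' : nice T alpha V (lam 1) (v l') by rewrite l1 -nll; exact: nv.
    have n2' : nice T alpha V (lam 1) (v l) by rewrite l1; exact: nv.
    have := lowest_simple n1' n2' (vn l') (vn l).
    by rewrite ov ?eqxx // neq_ltn ll'.
  by rewrite i0 maxn0 addn0.
have en l : (e l < n)%N.
  rewrite ltnNge; apply/negP => ne; have := lam_mono n1 ne.
  by rewrite lame leNgt ll.
have e1 l : (1 <= e l)%N by rewrite /e (leq_trans (leq_maxl 1 (ii l))) // leq_addr.
(* Equal indices have equal eigenvalues, hence the same block, and within a block the ranks differ.
   So the family injects into the indices from [1] to [n - 1]. *)
have einj : injective e.
  have key (l l' : 'I_j) : (l < l')%N -> e l != e l'.
    move=> lt; apply/eqP => ee; have nn : nl l = nl l' by rewrite -!lame ee.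
    have : (#|S l| < #|S l'|)%N.
      apply: proper_card; apply/properP; split.
        by apply/fintype.subsetP => x; rewrite !inE nn => /andP[xl ->]; rewrite (ltn_trans xl lt).
      by exists l; rewrite !inE ?ltnn // lt nn eqxx.
    by move: ee; rewrite /e /ii nn => /addnI ->; rewrite ltnn.
  move=> l l' ee; apply: val_inj; case: (ltngtP l l') => // /key; rewrite ee eqxx //.
have en' l : (e l - 1 < n - 1)%N by have := en l; have := e1 l; lia.
have := @leq_card _ _ (fun l => Ordinal (en' l)) _; rewrite !card_ord; apply.
move=> l l' /(congr1 val) /= h; apply: einj; have := e1 l; have := e1 l'; move: h; lia.
Qed.

End Enumeration.

Theorem theorem4p3 (R : realType) (alpha T : R) (V : R -> R)
    (lam : nat -> R) (n : nat) (phi : R -> R) :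
  0 < alpha -> alpha < 2 -> 0 < T ->
  smooth V -> (exists M : R, forall x, `|V x| <= M) ->
  (forall x, V (x + T) = V x) ->
  eigenvalue_enumeration alpha T V lam ->
  (1 <= n)%N ->
  (* phi is associated with lam_n, n being the lowest index of this eigenvalue *)
  (forall k, (1 <= k < n)%N -> lam k < lam n) ->
  Hper (alpha / 2) T phi -> {within `[0, T], continuous phi} ->
  is_eigenfunction alpha T V (lam n) phi ->
  ~ changes_sign_times T phi (2 * (n - 1)).+1.
Proof.
move=> al0 al2 T0 sV _ pV hE n1 _ _ wphi ephi [x [hx [xmono [xn xs]]]].
have [f nf phif] := eigenfunction_nice T0 al0 sV pV wphi ephi.
(* [f] is known to agree with [phi] on [[0, T]], where all the points [x k] lie. *)
have e k : (k <= (2 * (n - 1)).+1)%N -> phi (x k) = f (x k).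
  by move=> /hx[x0 xT]; apply: phif; rewrite /per_int /= in_itv /= x0 ltW.
apply: (nodal_bound T0 al0 al2 sV pV nf (fun j v nl => family_card T0 al0 al2 sV pV hE n1)).
exists x; split => //; split => //; split => k hk.
  by rewrite -e //; exact: xn.
by rewrite -!e ?(ltnW hk) //; exact: xs.
Qed.
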